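(* Let $p+q=1$, $0<\tau:=p/q<1$, $n\ge1$, and define for $x\in\mathbb{W}_n^-$ $$F_n(x)=\exp\Big[\int_0^\infty \mathrm{d}u\Big(\prod_{j=1}^n\tau^{\theta(x_j-u)}-1\Big)\Big].$$ Then for all $x\in\mathbb{W}_n^-$ and $t>0$, $$\mathbb{E}_x\big(F_n(x(t))\big)=\tau^{n(n-1)/2}\int_{\mathcal{C}_1}\!\mathrm{d}z_1\cdots\int_{\mathcal{C}_n}\!\mathrm{d}z_n\prod_{j=1}^n\frac{1}{z_j}\cdot\frac{\tau-1}{z_j+(1-\tau)}\,\mathrm{e}^{x_jz_j+\frac12 tz_j^2}\prod_{1\le A<B\le n}\frac{z_B-z_A}{z_B-\tau z_A},$$ where $\mathcal{C}_j=\{a_j+\mathrm{i}\varphi:\varphi\in\mathbb{R}\}$ (oriented upward) with $-(1-\tau)<a_1<\dots<a_n<0$ and $\tau a_j<a_{j+1}$, and each contour integral includes the factor $1/(2\pi\mathrm{i})$.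
   Context: $\theta(u)=1$ for $u>0$, $\theta(u)=0$ for $u\le0$. $\mathbb{W}_n^-=\{x\in\mathbb{R}^n:x_n\le\dots\le x_1\}$. $x(t)\in\mathbb{W}_n^-$ is the process solving $x_j(t)=x_j+B_j(t)+p\Lambda^{(j,j+1)}(t)-q\Lambda^{(j-1,j)}(t)$, $j=1,\dots,n$, with independent standard Brownian motions $B_j$, $\Lambda^{(j,j+1)}(t)=L^{x_j-x_{j+1}}(t,0)$ the right-sided local time at $0$ of $x_j-x_{j+1}$ on $[0,t]$, and $\Lambda^{(0,1)}=\Lambda^{(n,n+1)}=0$; $\mathbb{E}_x$ is expectation for this process started at $x$. (Interpretation: $F_n(x)=\mathbb{E}_{\mathrm{poi}}\prod_j\tau^{N(x_j)}$ for a Poisson process of intensity 1 on $[0,\infty)$, and $\mathbb{E}_x(F_n(x(t)))$ is, by duality, $\mathbb{E}\prod_j\tau^{N(x_j,t)}$ for point-interacting Brownian motions started from that Poisson process, $N(u,t)$ being the number of particles in $(-\infty,u]$ at time $t$.) *)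

(* Defs.v *)
From HB Require Import structures.
From mathcomp Require Import all_boot all_order all_algebra.
From mathcomp Require Import all_classical all_reals all_analysis.
From mathcomp Require Import complex.
Set Implicit Arguments. Unset Strict Implicit. Unset Printing Implicit Defensive.
Import Order.TTheory GRing.Theory Num.Theory.
Import numFieldNormedType.Exports.
Local Open Scope classical_set_scope.
Local Open Scope ring_scope.
Local Open Scope complex_scope.

Section Defs.
Variable R : realType.

(* Weyl chamber W_n^- = {x : x_{n} <= ... <= x_1}; vectors are nat-indexed,  *)
(* only the entries 0,...,n-1 (= particles 1,...,n) matter.                  *)
Definition weyl_minus (n : nat) (x : nat -> R) : Prop :=
  forall j, (j.+1 < n)%N -> x j.+1 <= x j.

Definition theta (v : R) : nat := if 0 < v then 1%N else 0%N.

Definition Fn (tau : R) (n : nat) (x : nat -> R) : R :=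
  expR (Rintegral lebesgue_measure `[0, +oo[%classic
          (fun u => \prod_(j < n) tau ^+ theta (x j - u) - 1)).

Definition right_local_time_at0 (y : R -> R) (t L : R) : Prop :=
  (e^-1 * Rintegral lebesgue_measure `[0, t]%classic
      (fun s => \1_(`[0, e[%classic) (y s) : R)) @[e --> 0^'+] --> L.

Definition indep_std_BMs {d} {Omega : measurableType d}
    (P : probability Omega R) (n : nat) (B : nat -> R -> Omega -> R) : Prop :=
  [/\ (forall j t, (j < n)%N -> 0 <= t -> measurable_fun setT (B j t)),
      {ae P, forall w, forall j, (j < n)%N ->
          B j 0 w = 0 /\ {within `[0, +oo[%classic, continuous (B j ^~ w)}} &
      forall (k : nat) (ts : nat -> R) (A : nat -> nat -> set R),
        ts 0%N = 0 -> (forall i, (i < k)%N -> ts i < ts i.+1) ->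
        (forall i j, measurable (A i j)) ->
        P [set w | forall i j, (i < k)%N -> (j < n)%N ->
                     A i j (B j (ts i.+1) w - B j (ts i) w)]
        = (\prod_(i < k) \prod_(j < n)
             fine (normal_prob 0 (Num.sqrt (ts i.+1 - ts i)) (A i j)))%:E].

(* (X, L) solves, for the Brownian motions B, the system
     x_j(t) = x_j + B_j(t) + p Lam^{(j,j+1)}(t) - q Lam^{(j-1,j)}(t)
   (0-based: L k = Lam^{(k+1,k+2)} is the right local time at 0 of
   X_k - X_{k+1}; Lam^{(0,1)} = Lam^{(n,n+1)} = 0), with X(t) in W_n^-,
   almost surely for all t >= 0. *)
Definition solves_system {d} {Omega : measurableType d}
    (P : probability Omega R) (n : nat) (p q : R) (x : nat -> R)
    (B X L : nat -> R -> Omega -> R) : Prop :=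
  (forall j t, (j < n)%N -> 0 <= t -> measurable_fun setT (X j t)) /\
  {ae P, forall w,
    (forall j, (j < n)%N -> {within `[0, +oo[%classic, continuous (X j ^~ w)})
    /\ forall t, 0 <= t ->
      [/\ weyl_minus n (fun j => X j t w),
          (forall k, (k.+1 < n)%N ->
             right_local_time_at0 (fun s => X k s w - X k.+1 s w) t (L k t w)) &
          (forall j, (j < n)%N ->
             X j t w = x j + B j t w
                       + p * (if (j.+1 < n)%N then L j t w else 0)
                       - q * (if j is j'.+1 then L j' t w else 0))]}.

Definition cexp (w : R[i]) : R[i] :=
  (expR (complex.Re w))%:C * ((cos (complex.Im w))%:C + 'i * (sin (complex.Im w))%:C).

Definition cint (g : R -> R[i]) : R[i] :=
  (Rintegral lebesgue_measure setT (fun phi => complex.Re (g phi)))%:C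
  + 'i * (Rintegral lebesgue_measure setT (fun phi => complex.Im (g phi)))%:C.

(* (1/(2 pi i)) int_{a + i R, upward} h(z) dz,  z = a + i phi, dz = i dphi *)
Definition vline_int (a : R) (h : R[i] -> R[i]) : R[i] :=
  ((2%:R * pi)%:C * 'i)^-1 * cint (fun phi => h (a%:C + 'i * phi%:C) * 'i).

Fixpoint contour_iter (m : nat) (a : nat -> R) (h : (nat -> R[i]) -> R[i])
    : R[i] :=
  match m with
  | 0%N => h (fun _ => 0)
  | m'.+1 => vline_int (a 0%N) (fun z =>
       contour_iter m' (fun k => a k.+1)
         (fun w => h (fun k => if k is k'.+1 then w k' else z)))
  end.

Definition integrand (n : nat) (tau t : R) (x : nat -> R) (z : nat -> R[i])
    : R[i] :=
  (\prod_(j < n) ((z j)^-1 * ((tau - 1)%:C / (z j + (1 - tau)%:C))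
                  * cexp ((x j)%:C * z j + (2^-1 * t)%:C * z j ^+ 2)))
  * \prod_(B < n) \prod_(A < n | (A < B)%N)
        ((z B - z A) / (z B - tau%:C * z A)).

End Defs.

(* Main.v *)
(* Write U(s,x) for the right-hand side at time s, and put c = 1 - tau.

   Contours are never moved by Cauchy's theorem: two contour integrals with the same exponential transform in x
   stay equal when affine factors (limits of difference quotients in x) and inverses of affine factors (Laplace
   integrals) are inserted.  Only the explicit one-dimensional integral of a Gaussian over a simple pole is needed.

   Initial value.  Shifting the contours of the variables with x_j >= 0 to real part of order -s^(-1/2) picks up the
   residues at -c tau^j and leaves an O(s^(1/2)) error; the variables with x_j <= 0 are treated in the same way after
   the reflection z -> -z, which exchanges tau and 1/tau.  On the Weyl chamber this gives
   U(s,x) -> prod_j exp(-c tau^j max(x_j,0)) = F_n(x), uniformly bounded for small s.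

   Evolution.  U(s,.) averaged over a centred Gaussian vector of variance h is U(s+h,.), and the derivative of U(s,.) in
   the direction p e_k - q e_(k+1) vanishes where x_k = x_(k+1), because the factor p z_k - q z_(k+1) makes the integrand
   antisymmetric under z_k <-> z_(k+1).  Consider the Euler scheme which adds the Brownian increment and then resolves each
   overlap of size l along l (p e_k - q e_(k+1)).  Its expectation of U(delta,.) differs from U(delta+t,x) by at
   most the expected sum of l^2 with exponential weights.

   Pathwise, the pushes of the scheme are dominated by the local times and converge to them along the dyadic grids, by a
   maximum principle with barrier (k+1)/(q-p); Doob's inequality supplies an integrable majorant.  Hence
   E U(delta,x(t)) = U(delta+t,x), and delta -> 0 gives the theorem. *)
From HB Require Import structures.
From mathcomp Require Import all_boot all_order all_algebra.
From mathcomp Require Import all_classical all_reals all_analysis.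
From mathcomp Require Import measurable_realfun complex.
From mathcomp Require Import ring lra zify.
Require Import Defs.
Set Implicit Arguments. Unset Strict Implicit. Unset Printing Implicit Defensive.
Import Order.TTheory GRing.Theory Num.Theory.
Import numFieldNormedType.Exports.
Local Open Scope classical_set_scope.
Local Open Scope ring_scope.
Local Open Scope complex_scope.

(** Every change of contour starts from one fact: without poles, the integral of Gaussians times
    exponentials does not depend on the abscissae. Its value is a product of heat kernels, even in
    each variable and symmetric under permutations. Inserting the rational factors afterwards gives
    the reflection z -> -z and the exchange of neighbouring variables.

    The sign of x_j decides the direction of the shift: exp(x_j z_j) stays bounded to the left for
    x_j >= 0 and to the right for x_j <= 0. To the left lie the poles -c tau^j, to the right the
    pole 0 of 1/z_j, which the reflection turns into the pole to be crossed.

    Besides the equation itself, the local times enter only as functions which start at 0, are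
    nondecreasing, and are constant while the gap stays away from 0. The error of the scheme
    vanishes because the sum of l^2 is at most (max l)(sum l): max l tends to 0 with the mesh, while
    sum l is bounded by the maximum of the Brownian paths on every grid. The time delta > 0 is kept
    until the end because the regularity estimates for U(s,.) are uniform only for s bounded
    below. *)

Notation Rez := complex.Re.
Notation Imz := complex.Im.
Notation cn := Normc.normc.

(** * Complex-valued integrals *)

Section ComplexBasics.
Variable R : realType.
Implicit Types (z w : R[i]) (x y r : R).

Lemma RezD z w : Rez (z + w) = Rez z + Rez w. Proof. by case: z; case: w. Qed.
Lemma ImzD z w : Imz (z + w) = Imz z + Imz w. Proof. by case: z; case: w. Qed.
Lemma RezN z : Rez (- z) = - Rez z. Proof. by case: z. Qed.
Lemma ImzN z : Imz (- z) = - Imz z. Proof. by case: z. Qed.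
Lemma RezB z w : Rez (z - w) = Rez z - Rez w. Proof. by rewrite RezD RezN. Qed.
Lemma ImzB z w : Imz (z - w) = Imz z - Imz w. Proof. by rewrite ImzD ImzN. Qed.
Lemma RezM z w : Rez (z * w) = Rez z * Rez w - Imz z * Imz w.
Proof. by case: z; case: w. Qed.
Lemma ImzM z w : Imz (z * w) = Rez z * Imz w + Imz z * Rez w.
Proof. by case: z; case: w. Qed.
Lemma RezC x : Rez x%:C = x. Proof. by []. Qed.
Lemma ImzC x : Imz x%:C = 0. Proof. by []. Qed.
Lemma Rez0 : Rez (0 : R[i]) = 0. Proof. by []. Qed.
Lemma Imz0 : Imz (0 : R[i]) = 0. Proof. by []. Qed.
Lemma Rez1 : Rez (1 : R[i]) = 1. Proof. by []. Qed.
Lemma Imz1 : Imz (1 : R[i]) = 0. Proof. by []. Qed.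
Lemma RezCM x z : Rez (x%:C * z) = x * Rez z.
Proof. by rewrite RezM /= mul0r subr0. Qed.
Lemma ImzCM x z : Imz (x%:C * z) = x * Imz z.
Proof. by rewrite ImzM /= mul0r addr0. Qed.
Lemma RezMi x : Rez ('i * x%:C) = 0. Proof. by rewrite RezM /= mul0r mulr0 subrr. Qed.
Lemma ImzMi x : Imz ('i * x%:C) = x.
Proof. by rewrite ImzM /= mul0r mul1r add0r. Qed.
Definition complexRI := (RezD, ImzD, RezN, ImzN, RezM, ImzM, RezC, ImzC, Rez0, Imz0, Rez1, Imz1).

Lemma complex_ext z w : Rez z = Rez w -> Imz z = Imz w -> z = w.
Proof. by case: z => a b; case: w => c d /= -> ->. Qed.

Lemma cn_ReIm z : cn z = Num.sqrt (Rez z ^+ 2 + Imz z ^+ 2).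
Proof. by case: z. Qed.
Lemma cn_ge0 z : 0 <= cn z. Proof. by rewrite cn_ReIm sqrtr_ge0. Qed.
Lemma cnM z w : cn (z * w) = cn z * cn w. Proof. exact: Normc.normcM. Qed.
Lemma cnV z : cn z^-1 = (cn z)^-1. Proof. exact: Normc.normcV. Qed.
Lemma cnD z w : cn (z + w) <= cn z + cn w. Proof. exact: le_normcD. Qed.
Lemma cnN z : cn (- z) = cn z. Proof. exact: normcN. Qed.
Lemma cn0 : cn (0 : R[i]) = 0. Proof. exact: Normc.normc0. Qed.
Lemma cn1 : cn (1 : R[i]) = 1. Proof. exact: Normc.normc1. Qed.
Lemma cnR x : cn x%:C = `|x|.
Proof. by rewrite cn_ReIm /= expr0n /= addr0 sqrtr_sqr. Qed.
Lemma cn_sqr z : cn z ^+ 2 = Rez z ^+ 2 + Imz z ^+ 2.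
Proof. by rewrite cn_ReIm sqr_sqrtr // addr_ge0 // sqr_ge0. Qed.
Lemma Rez_le_cn z : `|Rez z| <= cn z.
Proof.
by rewrite cn_ReIm -sqrtr_sqr ler_wsqrtr // lerDl sqr_ge0.
Qed.
Lemma Imz_le_cn z : `|Imz z| <= cn z.
Proof.
by rewrite cn_ReIm -sqrtr_sqr ler_wsqrtr // lerDr sqr_ge0.
Qed.
Lemma cn_le_ReIm z : cn z <= `|Rez z| + `|Imz z|.
Proof.
rewrite -(@ler_pXn2r _ 2) ?nnegrE ?cn_ge0 ?addr_ge0 //.
rewrite cn_sqr sqrrD !real_normK ?num_real // lerD2r lerDl mulrn_wge0 //.
Qed.
Lemma cn_eq0 z : cn z = 0 -> z = 0. Proof. exact: Normc.eq0_normc. Qed.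
Lemma cn_gt0 z : z != 0 -> 0 < cn z.
Proof. by move=> z0; rewrite lt0r cn_ge0 andbT; apply: contraNneq z0 => /cn_eq0 ->. Qed.
Lemma cnX z n : cn (z ^+ n) = cn z ^+ n.
Proof. by elim: n => [|n IH]; rewrite ?expr0 ?cn1 // !exprS cnM IH. Qed.
Lemma cn_prod I (s : seq I) (P : pred I) (F : I -> R[i]) :
  cn (\prod_(i <- s | P i) F i) = \prod_(i <- s | P i) cn (F i).
Proof. by elim/big_rec2 : _ => [|i x y _ <-]; [exact: cn1|exact: cnM]. Qed.
Lemma cn_sum I (s : seq I) (P : pred I) (F : I -> R[i]) :
  cn (\sum_(i <- s | P i) F i) <= \sum_(i <- s | P i) cn (F i).
Proof.
elim/big_rec2 : _ => [|i x y _ h]; first by rewrite cn0.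
by rewrite (le_trans (cnD _ _)) // lerD2l.
Qed.

Lemma Re_gt0_neq0 z : 0 < Rez z -> z != 0.
Proof. by move=> h; apply: contraTneq h => ->; rewrite ltxx. Qed.
Lemma Re_lt0_neq0 z : Rez z < 0 -> z != 0.
Proof. by move=> h; apply: contraTneq h => ->; rewrite ltxx. Qed.

Lemma RezV z : Rez z^-1 = Rez z / (Rez z ^+ 2 + Imz z ^+ 2).
Proof. by case: z. Qed.
Lemma ImzV z : Imz z^-1 = - Imz z / (Rez z ^+ 2 + Imz z ^+ 2).
Proof. by rewrite mulNr; case: z. Qed.

Lemma RezX2 z : Rez (z ^+ 2) = Rez z ^+ 2 - Imz z ^+ 2.
Proof. by rewrite expr2 RezM !expr2. Qed.
Lemma ImzX2 z : Imz (z ^+ 2) = 2 * (Rez z * Imz z).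
Proof. rewrite expr2 ImzM; ring. Qed.

Lemma Rez_sum I (s : seq I) (P : pred I) (F : I -> R[i]) :
  Rez (\sum_(i <- s | P i) F i) = \sum_(i <- s | P i) Rez (F i).
Proof. by elim/big_rec2 : _ => [//|i x y _ <-]; exact: RezD. Qed.
Lemma cexpE z : cexp z = Complex (expR (Rez z) * cos (Imz z)) (expR (Rez z) * sin (Imz z)).
Proof.
by rewrite /cexp; case: z => a b /=; apply: complex_ext; rewrite /= !(mul0r, mulr0, mul1r, addr0, add0r, subr0, sub0r, oppr0).
Qed.
Lemma Rez_cexp z : Rez (cexp z) = expR (Rez z) * cos (Imz z). Proof. by rewrite cexpE. Qed.
Lemma Imz_cexp z : Imz (cexp z) = expR (Rez z) * sin (Imz z). Proof. by rewrite cexpE. Qed.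
Lemma cexpD z w : cexp (z + w) = cexp z * cexp w.
Proof.
apply: complex_ext; rewrite !(Rez_cexp, Imz_cexp, complexRI) expRD ?cosD ?sinD; ring.
Qed.
Lemma cexp0 : cexp (0 : R[i]) = 1.
Proof. by apply: complex_ext; rewrite ?Rez_cexp ?Imz_cexp /= ?expR0 ?cos0 ?sin0 ?mulr1 ?mulr0. Qed.
Lemma cexpR x : cexp x%:C = (expR x)%:C.
Proof. by apply: complex_ext; rewrite ?Rez_cexp ?Imz_cexp /= ?cos0 ?sin0 ?mulr1 ?mulr0. Qed.
Lemma cn_cexp z : cn (cexp z) = expR (Rez z).
Proof.
rewrite cn_ReIm Rez_cexp Imz_cexp !exprMn -mulrDr cos2Dsin2 mulr1 sqrtr_sqr.
by rewrite ger0_norm // expR_ge0.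
Qed.
Lemma cexp_sum I (s : seq I) (P : pred I) (F : I -> R[i]) :
  cexp (\sum_(i <- s | P i) F i) = \prod_(i <- s | P i) cexp (F i).
Proof. by elim/big_rec2 : _ => [|i x y _ <-]; [exact: cexp0|exact: cexpD]. Qed.
Lemma norm_expRB1 x : `|expR x - 1| <= `|x| * Num.max 1 (expR x).
Proof.
have [x0|x0] := leP 0 x.
  rewrite ger0_norm ?subr_ge0 -?expR0 ?ler_expR // expR0 ger0_norm //.
  have e1 : 1 <= expR x by rewrite -expR0 ler_expR.
  rewrite max_r //.
  have := expR_ge1Dx (- x); rewrite expRN => h.
  have e0 := expR_gt0 x.
  have : (1 - x) * expR x <= 1 by rewrite -ler_pdivlMr // div1r.
  nra.
have e1 : expR x <= 1 by rewrite -expR0 ler_expR ltW.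
rewrite ler0_norm ?subr_le0 // (ltr0_norm x0) max_l //.
by have := expR_ge1Dx x; lra.
Qed.

Lemma norm_expRB1B x : `|expR x - 1 - x| <= x ^+ 2 * Num.max 1 (expR x).
Proof.
have e0 := expR_gt0 x; have h1 := expR_ge1Dx x.
rewrite ger0_norm; last by lra.
have := expR_ge1Dx (- x); rewrite expRN => h.
have h2 : (1 - x) * expR x <= 1 by rewrite -ler_pdivlMr // div1r.
have [x0|x0] := leP 0 x.
  have e1 : 1 <= expR x by rewrite -expR0 ler_expR.
  rewrite max_r // expr2; nra.
have e1 : expR x <= 1 by rewrite -expR0 ler_expR ltW.
rewrite max_l // mulr1 expr2; nra.
Qed.

Lemma norm_sin_le x : `|sin x| <= `|x|.
Proof.
have ds y : is_derive y 1 (@sin R) (cos y) by exact: is_derive_sin.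
have H (a b : R) : a <= b -> `|sin b - sin a| <= b - a.
  move=> ab; have [c _ ->] := @MVT_segment R sin cos a b ab (fun y _ => ds y)
    (continuous_subspaceT (@continuous_sin R)).
  by rewrite normrM (@ger0_norm _ (b - a)) ?subr_ge0 // ler_piMl ?subr_ge0 // cos_max.
have [x0|x0] := leP 0 x.
  by have := H _ _ x0; rewrite sin0 !subr0 (ger0_norm x0).
have := H _ _ (ltW x0); rewrite sin0 !sub0r normrN => h.
by rewrite (ltr0_norm x0).
Qed.

Lemma norm_cosB1_le x : `|cos x - 1| <= x ^+ 2.
Proof.
have -> : cos x = 1 - sin (x / 2) ^+ 2 *+ 2.
  rewrite {1}(_ : x = (x / 2) *+ 2) ?cos_mulr2n ?cos2sin2; last by rewrite -mulr_natr mulfVK.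
  ring.
rewrite addrC addKr normrN ger0_norm; last by rewrite mulrn_wge0 // sqr_ge0.
have : `|sin (x / 2)| ^+ 2 <= `|x / 2| ^+ 2.
  by rewrite ler_pXn2r ?nnegrE ?norm_sin_le.
rewrite !real_normK ?num_real // exprMn => h.
have {h} : sin (x / 2) ^+ 2 <= x ^+ 2 * 4^-1.
  by rewrite (_ : 4^-1 = 2^-1 ^+ 2 :> R) // exprVn; congr (_^-1); ring.
have := sqr_ge0 x; set u := x ^+ 2; set v := sin _ ^+ 2; rewrite -mulr_natr; lra.
Qed.

Lemma norm_cosB1_le1 x : `|cos x - 1| <= `|x|.
Proof.
have ds y : is_derive y 1 (@cos R) (- sin y) by exact: is_derive_cos.
have H (a b : R) : a <= b -> `|cos b - cos a| <= b - a.
  move=> ab; have [c _ ->] := @MVT_segment R cos (fun y => - sin y) a b ab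
    (fun y _ => ds y) (continuous_subspaceT (@continuous_cos R)).
  by rewrite normrM normrN (@ger0_norm _ (b - a)) ?subr_ge0 // ler_piMl ?subr_ge0 // sin_max.
have [x0|x0] := leP 0 x.
  by have := H _ _ x0; rewrite cos0 !subr0 (ger0_norm x0).
have := H _ _ (ltW x0); rewrite cos0 !sub0r distrC => h.
by rewrite (ltr0_norm x0).
Qed.

Lemma norm_sinBid_le x : `|sin x - x| <= x ^+ 2.
Proof.
have ds y : is_derive y 1 (@sin R) (cos y) by exact: is_derive_sin.
have H (a b : R) : a <= b -> (forall c, c \in `[a, b] -> `|c| <= `|x|) ->
    `|sin b - sin a - (b - a)| <= `|x| * (b - a).
  move=> ab hc; have [c cab ->] := @MVT_segment R sin cos a b ab (fun y _ => ds y)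
    (continuous_subspaceT (@continuous_sin R)).
  rewrite -{2}(mul1r (b - a)) -mulrBl normrM (@ger0_norm _ (b - a)) ?subr_ge0 //.
  by rewrite ler_wpM2r ?subr_ge0 // (le_trans (norm_cosB1_le1 _)) // hc.
rewrite -real_normK ?num_real // expr2.
have [x0|x0] := leP 0 x.
  have := H _ _ x0; rewrite sin0 !subr0 (ger0_norm x0); apply => c.
  by rewrite in_itv /= => /andP[c0 c1]; rewrite ger0_norm.
have := H _ _ (ltW x0); rewrite sin0 !sub0r opprK (ltr0_norm x0) -normrN opprD !opprK; apply => c.
by rewrite in_itv /= => /andP[c0 c1]; rewrite ler0_norm // lerN2.
Qed.

(** The bound is global in [z], since [z] will run over whole vertical lines; only [Rez z], which
    stays bounded there, enters exponentially. *)
Lemma cn_cexpB1 z :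
  cn (cexp z - 1) <= 4 * cn z * Num.max 1 (expR (Rez z)).
Proof.
apply: le_trans (cn_le_ReIm _) _.
rewrite RezB ImzB Rez_cexp Imz_cexp Rez1 Imz1 subr0.
set a := Rez z; set b := Imz z; set m := Num.max _ _.
have e0 := expR_gt0 a.
have m1 : expR a <= m by rewrite le_max lexx orbT.
have ha : `|a| <= cn z by exact: Rez_le_cn.
have hb : `|b| <= cn z by exact: Imz_le_cn.
have m0 : 0 <= m by rewrite (le_trans _ m1) // ltW.
have A1 : `|expR a * cos b - 1| <= 2 * cn z * m.
  have -> : expR a * cos b - 1 = (expR a - 1) + expR a * (cos b - 1) by ring.
  apply: le_trans (ler_normD _ _) _; rewrite normrM (ger0_norm (ltW e0)).
  have H1 := norm_expRB1 a; have H2 := norm_cosB1_le1 b.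
  have : `|a| * m <= cn z * m by rewrite ler_wpM2r.
  have : expR a * `|cos b - 1| <= m * cn z.
    by rewrite ler_pM // ?(ltW e0) // (le_trans H2).
  rewrite -/m in H1; lra.
have A2 : `|expR a * sin b| <= 1 * cn z * m.
  rewrite normrM (ger0_norm (ltW e0)) mul1r mulrC.
  by rewrite ler_pM // ?(ltW e0) // (le_trans (norm_sin_le _)).
have : 0 <= cn z * m by rewrite mulr_ge0 // cn_ge0.
lra.
Qed.

Lemma cn_cexpB1B z :
  cn (cexp z - 1 - z) <= 4 * cn z ^+ 2 * Num.max 1 (expR (Rez z)).
Proof.
apply: le_trans (cn_le_ReIm _) _.
rewrite !RezB !ImzB Rez_cexp Imz_cexp Rez1 Imz1 subr0.
set a := Rez z; set b := Imz z; set m := Num.max _ _.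
have e0 := expR_gt0 a.
have m1 : expR a <= m by rewrite le_max lexx orbT.
have m2 : 1 <= m by rewrite le_max lexx.
have ha : `|a| <= cn z by exact: Rez_le_cn.
have hb : `|b| <= cn z by exact: Imz_le_cn.
have m0 : 0 <= m by rewrite (le_trans _ m2).
have c0 := cn_ge0 z.
have ab : a ^+ 2 + b ^+ 2 = cn z ^+ 2 by rewrite cn_sqr.
have a2 : 0 <= a ^+ 2 by exact: sqr_ge0.
have b2 : 0 <= b ^+ 2 by exact: sqr_ge0.
have H1 := norm_expRB1 a; have H2 := norm_cosB1_le b.
have H3 := norm_expRB1B a; have H4 := norm_sinBid_le b; have H5 := norm_sin_le b.
have A1 : `|expR a * cos b - 1 - a| <= cn z ^+ 2 * m.
  have -> : expR a * cos b - 1 - a = (expR a - 1 - a) + expR a * (cos b - 1) by ring.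
  apply: le_trans (ler_normD _ _) _; rewrite normrM (ger0_norm (ltW e0)).
  have : expR a * `|cos b - 1| <= m * b ^+ 2.
    by rewrite ler_pM // ?(ltW e0).
  rewrite -ab -/m in H3 *; lra.
have A2 : `|expR a * sin b - b| <= 2 * cn z ^+ 2 * m.
  have -> : expR a * sin b - b = (expR a - 1) * sin b + (sin b - b) by ring.
  apply: le_trans (ler_normD _ _) _; rewrite normrM.
  have B1 : `|expR a - 1| * `|sin b| <= (cn z * m) * cn z.
    rewrite ler_pM // ?(le_trans H5) // (le_trans H1) // ler_wpM2r //.
  have B2 : b ^+ 2 <= cn z ^+ 2 * m.
    by rewrite -ab; nra.
  have -> : 2 * cn z ^+ 2 * m = (cn z * m) * cn z + cn z ^+ 2 * m by ring.
  by rewrite lerD // (le_trans H4).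
have : 0 <= cn z ^+ 2 * m by rewrite mulr_ge0 // exprn_ge0.
lra.
Qed.
End ComplexBasics.

Section ComplexMeasurable.
Context {d} {T : measurableType d} {R : realType}.
Implicit Types (f g : T -> R[i]).

Definition cmeas f :=
  measurable_fun setT (fun x => Rez (f x)) /\ measurable_fun setT (fun x => Imz (f x)).

Lemma cmeas_cst (c : R[i]) : cmeas (fun=> c).
Proof. by split; exact: measurable_cst. Qed.

Lemma cmeas_real (h : T -> R) : measurable_fun setT h -> cmeas (fun x => (h x)%:C).
Proof. by move=> mh; split => //=; exact: measurable_cst. Qed.

Lemma cmeasD f g : cmeas f -> cmeas g -> cmeas (fun x => f x + g x).
Proof.
move=> [f1 f2] [g1 g2]; split.
  by under eq_fun do rewrite RezD; exact: measurable_funD.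
by under eq_fun do rewrite ImzD; exact: measurable_funD.
Qed.

Lemma cmeasN f : cmeas f -> cmeas (fun x => - f x).
Proof.
move=> [f1 f2]; split.
  by under eq_fun do rewrite RezN; exact: measurable_funN.
by under eq_fun do rewrite ImzN; exact: measurable_funN.
Qed.

Lemma cmeasB f g : cmeas f -> cmeas g -> cmeas (fun x => f x - g x).
Proof. by move=> mf mg; apply: cmeasD => //; exact: cmeasN. Qed.

Lemma cmeasM f g : cmeas f -> cmeas g -> cmeas (fun x => f x * g x).
Proof.
move=> [f1 f2] [g1 g2]; split.
  by under eq_fun do rewrite RezM; apply: measurable_funB; exact: measurable_funM.
by under eq_fun do rewrite ImzM; apply: measurable_funD; exact: measurable_funM.
Qed.

Lemma cmeas_prod (I : Type) (s : seq I) (P : pred I) (F : I -> T -> R[i]) :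
  (forall i, P i -> cmeas (F i)) -> cmeas (fun x => \prod_(i <- s | P i) F i x).
Proof.
move=> mF; elim: s => [|i s IH].
  by under eq_fun do rewrite big_nil; exact: cmeas_cst.
under eq_fun do rewrite big_cons.
have [Pi|//] := boolP (P i); by apply: cmeasM => //; exact: mF.
Qed.

Lemma cmeas_sum (I : Type) (s : seq I) (P : pred I) (F : I -> T -> R[i]) :
  (forall i, P i -> cmeas (F i)) -> cmeas (fun x => \sum_(i <- s | P i) F i x).
Proof.
move=> mF; elim: s => [|i s IH].
  by under eq_fun do rewrite big_nil; exact: cmeas_cst.
under eq_fun do rewrite big_cons.
have [Pi|//] := boolP (P i); by apply: cmeasD => //; exact: mF.
Qed.

Lemma cmeasX f n : cmeas f -> cmeas (fun x => f x ^+ n).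
Proof.
move=> mf; elim: n => [|n IH].
  by under eq_fun do rewrite expr0; exact: cmeas_cst.
by under eq_fun do rewrite exprS; exact: cmeasM.
Qed.

Lemma cmeas_cn f : cmeas f -> measurable_fun setT (fun x => cn (f x)).
Proof.
move=> [f1 f2]; under eq_fun do rewrite cn_ReIm.
apply: (measurableT_comp (continuous_measurable_fun (@sqrt_continuous R))).
by apply: measurable_funD; exact: measurable_funX.
Qed.

Lemma measurable_fun_invr_gt0 (h : T -> R) :
  measurable_fun setT h -> (forall x, 0 < h x) -> measurable_fun setT (fun x => (h x)^-1).
Proof.
move=> mh h0.
rewrite (_ : (fun x => _) = (fun x => expR (- ln (h x)))); last first.
  by apply/funext => x; rewrite expRN lnK // posrE.
apply: measurableT_comp; first exact: measurable_expR.
apply: measurable_funN; apply: measurableT_comp => //; exact: measurable_ln.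
Qed.

Lemma cmeasV f : cmeas f -> (forall x, f x != 0) -> cmeas (fun x => (f x)^-1).
Proof.
move=> [f1 f2] f0.
have m2 : measurable_fun setT (fun x => (Rez (f x) ^+ 2 + Imz (f x) ^+ 2)^-1).
  apply: measurable_fun_invr_gt0.
    by apply: measurable_funD; exact: measurable_funX.
  by move=> x; rewrite -cn_sqr exprn_gt0 // cn_gt0.
split.
  by under eq_fun do rewrite RezV; exact: measurable_funM.
under eq_fun do rewrite ImzV.
by apply: measurable_funM => //; exact: measurable_funN.
Qed.

Lemma cmeas_cexp f : cmeas f -> cmeas (fun x => cexp (f x)).
Proof.
move=> [f1 f2]; split.
  under eq_fun do rewrite Rez_cexp.
  apply: measurable_funM; first exact: measurableT_comp.
  exact: (measurableT_comp (continuous_measurable_fun (@continuous_cos R))).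
under eq_fun do rewrite Imz_cexp.
apply: measurable_funM; first exact: measurableT_comp.
exact: (measurableT_comp (continuous_measurable_fun (@continuous_sin R))).
Qed.

End ComplexMeasurable.

Lemma cmeas_comp {d1 d2} {T1 : measurableType d1} {T2 : measurableType d2} {R : realType}
    (f : T2 -> R[i]) (h : T1 -> T2) :
  cmeas f -> measurable_fun setT h -> cmeas (fun x => f (h x)).
Proof.
by move=> [f1 f2] mh; split; [exact: (measurableT_comp f1 mh)|exact: (measurableT_comp f2 mh)].
Qed.

Section ComplexIntegral.
Context {d} {T : measurableType d} {R : realType} (mu : {measure set T -> \bar R}).
Implicit Types (f g : T -> R[i]) (V W : T -> R).

Definition cintg f : R[i] :=
  Complex (Rintegral mu setT (fun x => Rez (f x))) (Rintegral mu setT (fun x => Imz (f x))).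

Lemma Rez_cintg f : Rez (cintg f) = Rintegral mu setT (fun x => Rez (f x)).
Proof. by []. Qed.
Lemma Imz_cintg f : Imz (cintg f) = Rintegral mu setT (fun x => Imz (f x)).
Proof. by []. Qed.

Definition rintegrable W := mu.-integrable setT (EFin \o W).

Definition cintegrable f := cmeas f /\ rintegrable (fun x => cn (f x)).

Lemma eq_cintg f g : f =1 g -> cintg f = cintg g.
Proof. by move=> /funext ->. Qed.

Lemma rintegrable_le W V : measurable_fun setT V -> (forall x, `|V x| <= W x) ->
  rintegrable W -> rintegrable V.
Proof.
move=> mV VW iW; apply: le_integrable iW => //; first exact/measurable_EFinP.
by move=> x _ /=; rewrite lee_fin (le_trans (VW x)) // ler_norm.
Qed.

Lemma rintegrableZ (c : R) W : rintegrable W -> rintegrable (fun x => c * W x).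
Proof. by move=> h; have := integrableZl measurableT c h; exact: eq_integrable. Qed.

Lemma rintegrableD V W : rintegrable V -> rintegrable W -> rintegrable (fun x => V x + W x).
Proof. by move=> h k; have := integrableD measurableT h k; exact: eq_integrable. Qed.

Lemma cintegrable_le W f : cmeas f -> (forall x, cn (f x) <= W x) -> rintegrable W ->
  cintegrable f.
Proof.
move=> mf fW iW; split => //; apply: rintegrable_le iW; first exact: cmeas_cn.
by move=> x; rewrite ger0_norm ?cn_ge0.
Qed.

Lemma cintegrable_Re f : cintegrable f -> rintegrable (fun x => Rez (f x)).
Proof. by move=> [[m1 m2] i]; apply: rintegrable_le i => // x; exact: Rez_le_cn. Qed.
Lemma cintegrable_Im f : cintegrable f -> rintegrable (fun x => Imz (f x)).
Proof. by move=> [[m1 m2] i]; apply: rintegrable_le i => // x; exact: Imz_le_cn. Qed.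

Lemma cintegrableD f g : cintegrable f -> cintegrable g -> cintegrable (fun x => f x + g x).
Proof.
move=> [mf jf] [mg jg]; apply: (@cintegrable_le (fun x => cn (f x) + cn (g x))).
- exact: cmeasD.
- by move=> x; exact: cnD.
- exact: rintegrableD.
Qed.

Lemma cintegrableZ (c : R[i]) f : cintegrable f -> cintegrable (fun x => c * f x).
Proof.
move=> [mf jf]; apply: (@cintegrable_le (fun x => cn c * cn (f x))).
- by apply: cmeasM => //; exact: cmeas_cst.
- by move=> x; rewrite cnM.
- exact: rintegrableZ.
Qed.

Lemma cintgD f g : cintegrable f -> cintegrable g ->
  cintg (fun x => f x + g x) = cintg f + cintg g.
Proof.
move=> jf jg; apply: complex_ext => /=.
  under [LHS]eq_Rintegral do rewrite RezD.
  by rewrite RintegralD //; exact: cintegrable_Re.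
under [LHS]eq_Rintegral do rewrite ImzD.
by rewrite RintegralD //; exact: cintegrable_Im.
Qed.

Lemma cintgZ (c : R[i]) f : cintegrable f -> cintg (fun x => c * f x) = c * cintg f.
Proof.
move=> jf; have [i1 i2] := (cintegrable_Re jf, cintegrable_Im jf).
have z1 a V : rintegrable V -> Rintegral mu setT (fun x => a * V x) = a * Rintegral mu setT V.
  by move=> iV; rewrite RintegralZl.
apply: complex_ext; rewrite ?RezM ?ImzM /=.
  under [LHS]eq_Rintegral do rewrite RezM.
  by rewrite RintegralB ?z1 //; exact: rintegrableZ.
under [LHS]eq_Rintegral do rewrite ImzM.
by rewrite RintegralD ?z1 //; exact: rintegrableZ.
Qed.

Lemma cintg0 : cintg (fun=> 0) = 0.
Proof. by apply: complex_ext => /=; rewrite Rintegral_cst // mul0r. Qed.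

Lemma cintgN f : cintegrable f -> cintg (fun x => - f x) = - cintg f.
Proof.
by move=> jf; rewrite -mulN1r -cintgZ //; apply: eq_cintg => x; rewrite mulN1r.
Qed.

Lemma cintegrableN f : cintegrable f -> cintegrable (fun x => - f x).
Proof.
move=> [mf jf]; split; first exact: cmeasN.
by under eq_fun do rewrite cnN.
Qed.

Lemma cintgB f g : cintegrable f -> cintegrable g ->
  cintg (fun x => f x - g x) = cintg f - cintg g.
Proof. by move=> jf jg; rewrite cintgD ?cintgN //; exact: cintegrableN. Qed.

Lemma cintegrableB f g : cintegrable f -> cintegrable g -> cintegrable (fun x => f x - g x).
Proof. by move=> jf jg; apply: cintegrableD => //; exact: cintegrableN. Qed.

Lemma cintegrable0 : cintegrable (fun=> 0).
Proof.
split; first exact: cmeas_cst.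
by rewrite /rintegrable; under eq_fun do rewrite cn0; exact: integrable0.
Qed.

Lemma cintegrable_sum (I : Type) (s : seq I) (F : I -> T -> R[i]) :
  (forall i, cintegrable (F i)) -> cintegrable (fun x => \sum_(i <- s) F i x).
Proof.
move=> jF; elim: s => [|i s IH].
  by under eq_fun do rewrite big_nil; exact: cintegrable0.
by under eq_fun do rewrite big_cons; exact: cintegrableD.
Qed.

Lemma cintg_sum (I : Type) (s : seq I) (F : I -> T -> R[i]) :
  (forall i, cintegrable (F i)) ->
  cintg (fun x => \sum_(i <- s) F i x) = \sum_(i <- s) cintg (F i).
Proof.
move=> jF; elim: s => [|i s IH].
  by under eq_fun do rewrite big_nil; rewrite big_nil cintg0.
under eq_fun do rewrite big_cons.
by rewrite big_cons cintgD ?IH //; exact: cintegrable_sum.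
Qed.

(** The factor 2 comes from estimating the real and imaginary parts separately; the later bounds
    only need some constant. *)
Lemma cn_cintg W f : (forall x, cn (f x) <= W x) -> cmeas f -> rintegrable W ->
  cn (cintg f) <= 2 * Rintegral mu setT W.
Proof.
move=> fW mf iW; have jf := cintegrable_le mf fW iW.
apply: le_trans (cn_le_ReIm _) _; rewrite mulr2n mulrDl mul1r /=.
have H (h : T -> R) : rintegrable h -> (forall x, `|h x| <= cn (f x)) ->
    `|Rintegral mu setT h| <= Rintegral mu setT W.
  move=> ih hc; apply: le_trans (le_normr_Rintegral _ ih) _ => //.
  apply: le_Rintegral => //; first exact: integrable_norm.
  by move=> x _; rewrite (le_trans (hc x)).
apply: lerD; apply: H => //.
- exact: cintegrable_Re.
- by move=> x; exact: Rez_le_cn.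
- exact: cintegrable_Im.
- by move=> x; exact: Imz_le_cn.
Qed.

Lemma rint_dominated (h : nat -> T -> R) (h0 : T -> R) W :
  (forall n, measurable_fun setT (h n)) -> measurable_fun setT h0 ->
  (forall x, h ^~ x @ \oo --> h0 x) -> rintegrable W ->
  (forall n x, `|h n x| <= W x) ->
  (fun n => Rintegral mu setT (h n)) @ \oo --> Rintegral mu setT h0.
Proof.
move=> mh mh0 hc iW hW.
have H1 n : measurable_fun setT (EFin \o h n) by exact/measurable_EFinP.
have H2 : measurable_fun setT (EFin \o h0) by exact/measurable_EFinP.
have H3 : {ae mu, forall x, setT x -> (EFin \o h n) x @[n --> \oo] --> (EFin \o h0) x}.
  by apply: aeW => x _; apply: cvg_EFin; [exact: nearW|exact: hc].
have H4 : {ae mu, forall x n, setT x -> (`|(EFin \o h n) x| <= (EFin \o W) x)%E}.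
  by apply: aeW => x n _; rewrite lee_fin.
have [i0 _ H] := dominated_convergence measurableT H1 H2 H3 iW H4.
apply: fine_cvg; rewrite fineK //; exact: integrable_fin_num.
Qed.

Definition ccvg (z : nat -> R[i]) (l : R[i]) := (fun n => cn (z n - l)) @ \oo --> 0.

Lemma ccvg_Re z l : ccvg z l -> (fun n => Rez (z n)) @ \oo --> Rez l.
Proof.
move=> H; apply/cvgrPdist_le => e e0; move/cvgrPdist_le: H => /(_ e e0).
apply: filterS => n; rewrite sub0r normrN ger0_norm ?cn_ge0 // => h.
by rewrite distrC -RezB (le_trans (Rez_le_cn _)).
Qed.

Lemma ccvg_Im z l : ccvg z l -> (fun n => Imz (z n)) @ \oo --> Imz l.
Proof.
move=> H; apply/cvgrPdist_le => e e0; move/cvgrPdist_le: H => /(_ e e0).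
apply: filterS => n; rewrite sub0r normrN ger0_norm ?cn_ge0 // => h.
by rewrite distrC -ImzB (le_trans (Imz_le_cn _)).
Qed.

Lemma ccvg_ReIm z l : (fun n => Rez (z n)) @ \oo --> Rez l ->
  (fun n => Imz (z n)) @ \oo --> Imz l -> ccvg z l.
Proof.
move=> H1 H2; apply/cvgrPdist_le => e e0.
have e2 : 0 < e / 2 by rewrite divr_gt0.
move/cvgrPdist_le: H1 => /(_ _ e2) h1; move/cvgrPdist_le: H2 => /(_ _ e2) h2.
near=> n; rewrite sub0r normrN ger0_norm ?cn_ge0 // (le_trans (cn_le_ReIm _)) //.
rewrite RezB ImzB distrC [X in _ + X]distrC (splitr e) lerD //; by near: n.
Unshelve. all: by end_near. Qed.

Lemma cintg_dominated (f : nat -> T -> R[i]) f0 W :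
  (forall n, cmeas (f n)) -> cmeas f0 ->
  (forall x, ccvg (f ^~ x) (f0 x)) -> rintegrable W ->
  (forall n x, cn (f n x) <= W x) ->
  ccvg (fun n => cintg (f n)) (cintg f0).
Proof.
move=> mf [m1 m2] fc iW fW; apply: ccvg_ReIm => /=.
  apply: rint_dominated iW _ => //.
  - by move=> n; case: (mf n).
  - by move=> x; exact: ccvg_Re (fc x).
  - by move=> n x; rewrite (le_trans (Rez_le_cn _)).
apply: rint_dominated iW _ => //.
- by move=> n; case: (mf n).
- by move=> x; exact: ccvg_Im (fc x).
- by move=> n x; rewrite (le_trans (Imz_le_cn _)).
Qed.

Lemma ccvg_cst0 (z : nat -> R[i]) l : (forall n, z n = 0) -> ccvg z l -> l = 0.
Proof.
move=> z0; rewrite /ccvg; under eq_fun do rewrite z0 sub0r cnN.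
move=> H; apply: cn_eq0; have := cvg_lim (@Rhausdorff R) H; rewrite (lim_cst (@Rhausdorff R)) //; apply.
Qed.

End ComplexIntegral.

Section ComplexFubini.
Context {d1 d2} {T1 : measurableType d1} {T2 : measurableType d2} {R : realType}.
Variables (m1 : {sigma_finite_measure set T1 -> \bar R})
  (m2 : {sigma_finite_measure set T2 -> \bar R}).

(** [Rintegral] replaces an infinite inner integral by 0. This does not increase the absolute value,
    and the inner integral is finite almost everywhere, so iterated real integrals behave like the
    extended ones. *)
Lemma integrable_fubini_Rintegral (f : T1 * T2 -> R) : rintegrable (m1 \x m2)%E f ->
  rintegrable m1 (fun x => Rintegral m2 setT (fun y => f (x, y))).
Proof.
move=> jf; have H := integrable_fubini_F jf.
have mF := measurable_fubini_F jf.
apply: (le_integrable measurableT _ _ H).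
  apply/measurable_EFinP; apply: measurableT_comp mF; exact: fine_measurable.
move=> x _ /=; rewrite /Rintegral /fubini_F.
by case: (integral _ _ _) => [r| |] //=; rewrite ?normr0 // leey.
Qed.

Lemma Rintegral_fubini1 (f : T1 * T2 -> R) : rintegrable (m1 \x m2)%E f ->
  Rintegral m1 setT (fun x => Rintegral m2 setT (fun y => f (x, y))) =
  Rintegral (m1 \x m2)%E setT f.
Proof.
move=> jf; rewrite /Rintegral; congr fine.
rewrite -integral12_prod_meas1 //; apply: ae_eq_integral => //.
- apply/measurable_EFinP; apply: measurableT_comp; first exact: fine_measurable.
  exact: (measurable_fubini_F jf).
- exact: (measurable_fubini_F jf).
- have := ae_integrable1 jf; apply: filterS => x ix _ /=.
  by rewrite fineK //; exact: integrable_fin_num.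
Qed.

Lemma Rintegral_fubini2 (f : T1 * T2 -> R) : rintegrable (m1 \x m2)%E f ->
  Rintegral m2 setT (fun y => Rintegral m1 setT (fun x => f (x, y))) =
  Rintegral (m1 \x m2)%E setT f.
Proof.
move=> jf; rewrite /Rintegral; congr fine.
rewrite -integral21_prod_meas1 //; apply: ae_eq_integral => //.
- apply/measurable_EFinP; apply: measurableT_comp; first exact: fine_measurable.
  exact: (measurable_fubini_G jf).
- exact: (measurable_fubini_G jf).
- have := ae_integrable2 jf; apply: filterS => x ix _ /=.
  by rewrite fineK //; exact: integrable_fin_num.
Qed.

Lemma cintg_fubini1 (f : T1 * T2 -> R[i]) : cintegrable (m1 \x m2)%E f ->
  cintg m1 (fun x => cintg m2 (fun y => f (x, y))) = cintg (m1 \x m2)%E f.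
Proof.
move=> jf; apply: complex_ext => /=.
  exact: Rintegral_fubini1 (cintegrable_Re jf).
exact: Rintegral_fubini1 (cintegrable_Im jf).
Qed.

Lemma cintg_fubini2 (f : T1 * T2 -> R[i]) : cintegrable (m1 \x m2)%E f ->
  cintg m2 (fun y => cintg m1 (fun x => f (x, y))) = cintg (m1 \x m2)%E f.
Proof.
move=> jf; apply: complex_ext => /=.
  exact: Rintegral_fubini2 (cintegrable_Re jf).
exact: Rintegral_fubini2 (cintegrable_Im jf).
Qed.

Lemma cmeas_fubini1 (f : T1 * T2 -> R[i]) : cintegrable (m1 \x m2)%E f ->
  cmeas (fun x => cintg m2 (fun y => f (x, y))).
Proof.
move=> jf; split => /=.
  have := integrable_fubini_Rintegral (cintegrable_Re jf).
  by move=> /measurable_int /measurable_EFinP.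
have := integrable_fubini_Rintegral (cintegrable_Im jf).
by move=> /measurable_int /measurable_EFinP.
Qed.

Lemma integrable_fubini_Rintegral2 (f : T1 * T2 -> R) : rintegrable (m1 \x m2)%E f ->
  rintegrable m2 (fun y => Rintegral m1 setT (fun x => f (x, y))).
Proof.
move=> jf; have mG := measurable_fubini_G jf.
have mf : measurable_fun setT f.
  by apply/measurable_EFinP; exact: (measurable_int (m1 \x m2)%E jf).
apply/integrableP; split.
  by apply/measurable_EFinP; apply: measurableT_comp mG; exact: fine_measurable.
apply: (@le_lt_trans _ _ (\int[m2]_y \int[m1]_x `|(f (x, y))%:E|)%E).
  apply: ge0_le_integral => //.
  - apply: measurableT_comp => //; apply/measurable_EFinP.
    by apply: measurableT_comp mG; exact: fine_measurable.
  - apply: (measurable_fun_fubini_tonelli_G (fun xy => `|(f xy)%:E|%E)) => //.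
    by apply: measurableT_comp => //; exact/measurable_EFinP.
  - move=> y _ /=; rewrite /Rintegral.
    apply: (@le_trans _ _ `|\int[m1]_x (f (x, y))%:E|%E).
      by case: (integral _ _ _) => [r| |] //=; rewrite ?normr0 // leey.
    apply: le_abse_integral => //; apply/measurable_EFinP.
    exact: measurable_fun_pair1.
have := (integrable21ltyP m1 m2 (f := EFin \o f) (proj2 (measurable_EFinP _ _) mf)).1 jf.
by [].
Qed.

Lemma cintegrable_fubini2 (f : T1 * T2 -> R[i]) : cintegrable (m1 \x m2)%E f ->
  cintegrable m2 (fun y => cintg m1 (fun x => f (x, y))).
Proof.
move=> jf; have j1 := integrable_fubini_Rintegral2 (cintegrable_Re jf).
have j2 := integrable_fubini_Rintegral2 (cintegrable_Im jf).
apply: (cintegrable_le (mu := m2) (W := fun y =>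
  `|Rintegral m1 setT (fun x => Rez (f (x, y)))| + `|Rintegral m1 setT (fun x => Imz (f (x, y)))|)).
- split => /=.
    by exact/measurable_EFinP/(measurable_int _ j1).
  by exact/measurable_EFinP/(measurable_int _ j2).
- by move=> x; exact: cn_le_ReIm.
- by apply: rintegrableD; exact: integrable_norm.
Qed.

Lemma rintegrable_prod (f : T1 -> R) (g : T2 -> R) : rintegrable m1 f -> rintegrable m2 g ->
  rintegrable (m1 \x m2)%E (fun xy => f xy.1 * g xy.2).
Proof.
move=> jf jg.
have mf : measurable_fun setT f by exact/measurable_EFinP/(measurable_int _ jf).
have mg : measurable_fun setT g by exact/measurable_EFinP/(measurable_int _ jg).
apply/integrable12ltyP.
  apply/measurable_EFinP; apply: measurable_funM.
    by apply: measurableT_comp => //; exact: measurable_fst.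
  by apply: measurableT_comp => //; exact: measurable_snd.
have -> : (\int[m1]_x \int[m2]_y `|(f x * g y)%R%:E| =
  \int[m1]_x (`|(f x)%:E| * \int[m2]_y `|(g y)%:E|))%E.
  apply: eq_integral => x _.
  rewrite -ge0_integralZl //.
    by apply: eq_integral => y _ /=; rewrite normrM EFinM.
  by apply: measurableT_comp => //; exact/measurable_EFinP.
rewrite ge0_integralZr //; last 2 first.
- by apply: measurableT_comp => //; exact/measurable_EFinP.
- by apply: integral_ge0 => y _; rewrite abse_ge0.
case/integrableP: jf => _ jf; case/integrableP: jg => _ jg.
rewrite lte_mul_pinfty //; first by apply: integral_ge0 => x _; exact: abse_ge0.
by rewrite ge0_fin_numE //; apply: integral_ge0 => x _; exact: abse_ge0.
Qed.

Lemma Rintegral_prod (f : T1 -> R) (g : T2 -> R) : rintegrable m1 f -> rintegrable m2 g ->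
  Rintegral (m1 \x m2)%E setT (fun xy => f xy.1 * g xy.2) =
  Rintegral m1 setT f * Rintegral m2 setT g.
Proof.
move=> jf jg; rewrite -Rintegral_fubini1; last exact: rintegrable_prod.
under eq_Rintegral do rewrite /= RintegralZl //.
by rewrite RintegralZr.
Qed.

Lemma cintegrable_prod (f : T1 -> R[i]) (g : T2 -> R[i]) :
  cintegrable m1 f -> cintegrable m2 g ->
  cintegrable (m1 \x m2)%E (fun xy => f xy.1 * g xy.2).
Proof.
move=> [mf jf] [mg jg]; split.
  apply: cmeasM; first exact: cmeas_comp mf measurable_fst.
  exact: cmeas_comp mg measurable_snd.
under eq_fun do rewrite cnM.
exact: rintegrable_prod jf jg.
Qed.

Lemma cintg_prod (f : T1 -> R[i]) (g : T2 -> R[i]) :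
  cintegrable m1 f -> cintegrable m2 g ->
  cintg (m1 \x m2)%E (fun xy => f xy.1 * g xy.2) = cintg m1 f * cintg m2 g.
Proof.
move=> jf jg; rewrite -cintg_fubini1; last exact: cintegrable_prod.
under eq_cintg do rewrite /= cintgZ // mulrC.
by rewrite cintgZ // mulrC.
Qed.

End ComplexFubini.

(** * Gaussian Fourier transform *)

Section GaussianIntegrals.
Variable R : realType.
Local Notation leb := (@lebesgue_measure R).
Implicit Types (x y z a k : R).

Lemma measurable_RM (f : R -> R) :
  measurable_fun setT f -> measurable_fun (setT : set (measurableTypeR R)) f.
Proof. by []. Qed.

Definition gk k y : R := expR (- (k * y ^+ 2)).

Lemma gk_ge0 k y : 0 <= gk k y. Proof. exact: expR_ge0. Qed.

Lemma measurable_gk k : measurable_fun setT (gk k).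
Proof.
apply: measurableT_comp => //; apply: measurable_funN; by apply: measurable_funM.
Qed.

(** Completing the square gives mean [a / (2 * k)] and variance [1 / (2 * k)]. Integrability and
    total mass are then those of the normal density. *)
Lemma gk_shift_normal k a y : 0 < k ->
  gk k y * expR (a * y) =
  (expR (a ^+ 2 / (4 * k)) * Num.sqrt (pi / k)) * normal_pdf (a / (2 * k)) (Num.sqrt (2 * k)^-1) y.
Proof.
move=> k0; have k20 : 0 < (2 * k)^-1 by rewrite invr_gt0 mulr_gt0.
rewrite normal_pdfE; last by rewrite gt_eqF // sqrtr_gt0.
rewrite /normal_peak /normal_fun sqr_sqrtr ?(ltW k20) //.
rewrite (_ : (2 * k)^-1 * pi *+ 2 = pi / k); last first.
  by rewrite -mulr_natr invfM; field; rewrite gt_eqF.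
rewrite mulrA -(mulrA (expR _)) divff ?mulr1; last first.
  by rewrite gt_eqF // sqrtr_gt0 divr_gt0 // pi_gt0.
rewrite /gk -!expRD; congr expR; rewrite -mulr_natr.
by field; rewrite gt_eqF.
Qed.

Lemma rintegrable_gk_exp k a : 0 < k -> rintegrable leb (fun y => gk k y * expR (a * y)).
Proof.
move=> k0; rewrite /rintegrable.
under eq_fun do rewrite (gk_shift_normal _ _ k0).
exact: rintegrableZ (integrable_normal_pdf _ _).
Qed.

Lemma Rintegral_gk_exp k a : 0 < k ->
  Rintegral leb setT (fun y => gk k y * expR (a * y)) =
  expR (a ^+ 2 / (4 * k)) * Num.sqrt (pi / k).
Proof.
move=> k0; under eq_Rintegral do rewrite (gk_shift_normal _ _ k0).
rewrite RintegralZl //; last exact: integrable_normal_pdf.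
by rewrite /Rintegral integral_normal_pdf mulr1.
Qed.

Lemma rintegrable_gk k : 0 < k -> rintegrable leb (gk k).
Proof.
move=> /(rintegrable_gk_exp 0); rewrite /rintegrable.
by under eq_fun do rewrite mul0r expR0 mulr1.
Qed.

Lemma Rintegral_gk k : 0 < k -> Rintegral leb setT (gk k) = Num.sqrt (pi / k).
Proof.
move=> /(Rintegral_gk_exp 0); rewrite expr0n mul0r expR0 mul1r => <-.
by apply: eq_Rintegral => y _; rewrite mul0r expR0 mulr1.
Qed.

Lemma lin_le_quad (c e y : R) : 0 < e -> c * `|y| <= c ^+ 2 / (4 * e) + e * y ^+ 2.
Proof.
move=> e0; rewrite -(real_normK (num_real y)).
have : 0 <= e * (`|y| - c / (2 * e)) ^+ 2 by rewrite mulr_ge0 ?sqr_ge0 // ltW.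
have -> : e * (`|y| - c / (2 * e)) ^+ 2 = e * `|y| ^+ 2 - c * `|y| + c ^+ 2 / (4 * e).
  by field; rewrite gt_eqF.
lra.
Qed.

(** Half of the Gaussian exponent absorbs the other factors, after [(1 + |y|)^m <= exp(m |y|)]. *)
Lemma poly_gk_le k (m : nat) (c : R) : 0 < k ->
  exists C : R, 0 < C /\ forall y : R, (1 + `|y|) ^+ m * expR (c * `|y|) * gk k y <= C * gk (k / 2) y.
Proof.
move=> k0; pose b := m%:R + c; exists (expR (b ^+ 2 / (4 * (k / 2)))); split.
  exact: expR_gt0.
move=> y; have h1 : (1 + `|y|) ^+ m <= expR (m%:R * `|y|).
  by rewrite expRM_natl lerXn2r ?nnegrE ?expR_ge0 ?addr_ge0 ?expR_ge1Dx.
apply: (@le_trans _ _ (expR (m%:R * `|y|) * expR (c * `|y|) * gk k y)).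
  by rewrite ler_wpM2r ?gk_ge0 // ler_wpM2r ?expR_ge0.
rewrite /gk -!expRD ler_expR -mulrDl -/b.
have := @lin_le_quad b (k / 2) y; rewrite divr_gt0 // => /(_ isT); lra.
Qed.

Lemma rintegrable_poly_gk k (m : nat) (c : R) : 0 < k ->
  rintegrable leb (fun y => (1 + `|y|) ^+ m * expR (c * `|y|) * gk k y).
Proof.
move=> k0; have [C [C0 H]] := poly_gk_le m c k0.
have HH := (@rintegrable_le _ _ _ leb (fun y => C * gk (k / 2) y) (fun y => (1 + `|y|) ^+ m * expR (c * `|y|) * gk k y)).
  apply: HH.
- apply: measurable_funM; last exact: measurable_gk.
  apply: measurable_funM.
    by apply: measurable_funX; apply: measurable_funD => //; exact: measurableT_comp.
  by apply: measurableT_comp => //; apply: measurable_funM => //; exact: measurableT_comp.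
- move=> y; rewrite ger0_norm //; apply: mulr_ge0; last exact: gk_ge0.
  by apply: mulr_ge0; [rewrite exprn_ge0 // addr_ge0|exact: expR_ge0].
- by apply: rintegrableZ; apply: rintegrable_gk; rewrite divr_gt0.
Qed.

Lemma Rintegral_deriv_eq0 (F f : R -> R) :
  (forall x, is_derive x 1 F (f x)) -> continuous f -> rintegrable leb f ->
  (fun n : nat => F n%:R) @ \oo --> (0 : R) -> (fun n : nat => F (- n%:R)) @ \oo --> (0 : R) ->
  Rintegral leb setT f = 0.
Proof.
move=> dF cf jf F1 F2.
have cF : continuous F by move=> x; apply: differentiable_continuous; apply/derivable1_diffP.
have H n : Rintegral leb `[- n.+1%:R, n.+1%:R] f = F n.+1%:R - F (- n.+1%:R).
  have h : - n.+1%:R < n.+1%:R :> R by rewrite -subr_gt0 opprK addr_gt0 // ltr0n.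
  rewrite /Rintegral (@continuous_FTC2 _ f F) //.
  - exact: continuous_subspaceT.
  - split => //; [apply: cvg_at_right_filter|apply: cvg_at_left_filter]; exact: cF.
  - by move=> x _; rewrite derive1E derive_val.
have L1 : (fun n : nat => Rintegral leb `[- n.+1%:R, n.+1%:R] f) @ \oo --> (0 : R).
  under eq_fun do rewrite H.
  rewrite -(subr0 0); apply: cvgB.
    by have := F1; rewrite -cvg_shiftS.
  by have := F2; rewrite -cvg_shiftS.
have L2 : (fun n : nat => Rintegral leb `[- n.+1%:R, n.+1%:R] f) @ \oo -->
    Rintegral leb setT f.
  under eq_fun do rewrite Rintegral_mkcond.
  apply: (rint_dominated (mu := leb) (W := fun x => `|f x|)).
  - move=> n; apply: measurable_RM; apply: (iffLR (measurable_restrictT _ _)) => //.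
    by apply: measurable_funTS; exact: continuous_measurable_fun.
  - exact: continuous_measurable_fun.
  - move=> x; apply/cvgrPdist_le => e e0.
    near=> n; rewrite patchE mem_set ?subrr ?normr0 ?(ltW e0) //=.
    rewrite in_itv /= -ler_norml; near: n.
    exists `|Num.ceil `|x| |%N => // n /= hn.
    apply: (le_trans (ceil_ge _)); rewrite -[X in X <= _]ger0_norm; last first.
      by apply: le_trans (ceil_ge _).
    rewrite -intr_norm -natr_absz ler_nat; exact: leq_trans hn _.
  - exact: (integrable_norm jf).
  - by move=> n x; rewrite patchE; case: ifP => // _; rewrite normr0.
by rewrite -(cvg_lim (@Rhausdorff R) L1) -(cvg_lim (@Rhausdorff R) L2).
Unshelve. all: by end_near. Qed.

Lemma derive_fourier (w : R -> R) (b : R) :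
  rintegrable leb (fun y => (1 + `|y|) * w y) -> (forall y, 0 <= w y) ->
  measurable_fun setT w ->
  is_derive b 1 (fun b => Rintegral leb setT (fun y => w y * cos (b * y)))
    (- Rintegral leb setT (fun y => y * w y * sin (b * y))) /\
  is_derive b 1 (fun b => Rintegral leb setT (fun y => w y * sin (b * y)))
    (Rintegral leb setT (fun y => y * w y * cos (b * y))).
Proof.
move=> jw w0 mw.
have mcos c : measurable_fun setT (fun y : R => cos (c * y)).
  apply: (measurableT_comp (continuous_measurable_fun (@continuous_cos R))).
  exact: measurable_funM.
have msin c : measurable_fun setT (fun y : R => sin (c * y)).
  apply: (measurableT_comp (continuous_measurable_fun (@continuous_sin R))).
  exact: measurable_funM.
have Ib : `]b - 1, b + 1[%classic b by rewrite /= in_itv /=; lra.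
have le1 y r : `|r| <= 1 -> `|w y * r| <= (1 + `|y|) * w y.
  move=> r1; rewrite normrM (ger0_norm (w0 y)) mulrC ler_wpM2r //.
  by rewrite (le_trans r1) // lerDl.
have le2 y r : `|r| <= 1 -> `|y * w y * r| <= (1 + `|y|) * w y.
  move=> r1; rewrite !normrM (ger0_norm (w0 y)) -[leRHS]mulr1.
  by apply: ler_pM => //; [exact: mulr_ge0|rewrite ler_wpM2r // lerDr].
have jc c : rintegrable leb (fun y => w y * cos (c * y)).
  apply: (rintegrable_le (mu := leb) (V := fun y => w y * cos (c * y)) _ _ jw); first by apply: measurable_RM; exact: measurable_funM.
  by move=> y; apply: le1; exact: cos_max.
have js c : rintegrable leb (fun y => w y * sin (c * y)).
  apply: (rintegrable_le (mu := leb) (V := fun y => w y * sin (c * y)) _ _ jw); first by apply: measurable_RM; exact: measurable_funM.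
  by move=> y; apply: le1; exact: sin_max.
have dlin (y c : R) : is_derive c 1 (fun c : R => c * y) y.
  by apply: is_derive_eq; rewrite ?scaler0 ?add0r ?addr0 /GRing.scale /= mulr1.
have dc (y c : R) : is_derive c 1 (fun c => w y * cos (c * y)) (- (y * w y * sin (c * y))).
  apply: is_derive_eq; rewrite /GRing.scale /=; ring.
have ds (y c : R) : is_derive c 1 (fun c => w y * sin (c * y)) (y * w y * cos (c * y)).
  apply: is_derive_eq; rewrite /GRing.scale /=; ring.
split.
  have H1 (c y : R) : `]b - 1, b + 1[%classic c -> setT y ->
      derivable (fun c : R => w y * cos (c * y)) c 1 by move=> _ _; have [] := dc y c.
  have E (c y : R) : partial1of2 (fun c y : R => w y * cos (c * y)) c y = - (y * w y * sin (c * y)).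
    by rewrite partial1of2E; have [] := dc y c.
  have H2 (c y : R) : `]b - 1, b + 1[%classic c -> setT y ->
    `|partial1of2 (fun c y : R => w y * cos (c * y)) c y| <= (1 + `|y|) * w y.
    by move=> _ _; rewrite E normrN; apply: le2; exact: sin_max.
  have H0 y : 0 <= (1 + `|y|) * w y by rewrite mulr_ge0 // addr_ge0.
  apply: DeriveDef.
    exact: (derivable_under_integral measurableT Ib (fun c _ => jc c) H1 H0 jw H2).
  rewrite -derive1E (differentiation_under_integral measurableT Ib (fun c _ => jc c) H1 H0 jw H2).
  under eq_Rintegral do rewrite E -mulN1r.
  rewrite RintegralZl ?mulN1r //.
  apply: (rintegrable_le (mu := leb) (V := fun y => y * w y * sin (b * y)) _ _ jw).
    apply: measurable_RM; by apply: measurable_funM => //; exact: measurable_funM.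
  by move=> y; apply: le2; exact: sin_max.
have H1 (c y : R) : `]b - 1, b + 1[%classic c -> setT y ->
    derivable (fun c : R => w y * sin (c * y)) c 1 by move=> _ _; have [] := ds y c.
have E (c y : R) : partial1of2 (fun c y : R => w y * sin (c * y)) c y = y * w y * cos (c * y).
  by rewrite partial1of2E; have [] := ds y c.
have H2 (c y : R) : `]b - 1, b + 1[%classic c -> setT y ->
  `|partial1of2 (fun c y : R => w y * sin (c * y)) c y| <= (1 + `|y|) * w y.
  by move=> _ _; rewrite E; apply: le2; exact: cos_max.
have H0 y : 0 <= (1 + `|y|) * w y by rewrite mulr_ge0 // addr_ge0.
apply: DeriveDef.
  exact: (derivable_under_integral measurableT Ib (fun c _ => js c) H1 H0 jw H2).
rewrite -derive1E (differentiation_under_integral measurableT Ib (fun c _ => js c) H1 H0 jw H2).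
by under eq_Rintegral do rewrite E.
Qed.

(** For fixed [a = Re z] the integral is [U b + i V b] with [b = Im z]. Differentiation under the
    integral produces the first moments [U1] and [V1], integration by parts expresses these through
    [U] and [V], and the resulting linear system in [b] is solved from its known value at
    [b = 0]. *)
Lemma cintg_gk_cexp k (z : R[i]) : 0 < k ->
  cintg leb (fun y => (gk k y)%:C * cexp (z * y%:C)) =
  (Num.sqrt (pi / k))%:C * cexp (z ^+ 2 * ((4 * k)^-1)%:C).
Proof.
move=> k0; pose a := Rez z; pose w y := gk k y * expR (a * y).
have kne : k != 0 by rewrite gt_eqF.
have w0 y : 0 <= w y by rewrite mulr_ge0 // expR_ge0.
have mw : measurable_fun setT w.
  apply: measurable_funM; first exact: measurable_gk.
  by apply: measurableT_comp => //; exact: measurable_funM.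
have jw : rintegrable leb (fun y => (1 + `|y|) * w y).
  apply: (rintegrable_le (mu := leb) (V := fun y => (1 + `|y|) * w y) _ _
    (rintegrable_poly_gk 1 `|a| k0)).
    apply: measurable_RM; apply: measurable_funM => //.
    by apply: measurable_funD => //; exact: measurableT_comp.
  move=> y; rewrite ger0_norm; last by rewrite mulr_ge0 // addr_ge0.
  rewrite expr1 -mulrA.
  rewrite ler_wpM2l ?addr_ge0 // /w mulrC ler_wpM2r ?gk_ge0 // ler_expR.
  by rewrite -normrM ler_norm.
pose U b := Rintegral leb setT (fun y => w y * cos (b * y)).
pose V b := Rintegral leb setT (fun y => w y * sin (b * y)).
pose U1 b := Rintegral leb setT (fun y => y * w y * cos (b * y)).
pose V1 b := Rintegral leb setT (fun y => y * w y * sin (b * y)).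
have dU (b : R) : is_derive b 1 U (- V1 b) by have [] := derive_fourier b jw w0 mw.
have dV (b : R) : is_derive b 1 V (U1 b) by have [] := derive_fourier b jw w0 mw.
have mcos c : measurable_fun setT (fun y : R => cos (c * y)).
  apply: (measurableT_comp (continuous_measurable_fun (@continuous_cos R))).
  exact: measurable_funM.
have msin c : measurable_fun setT (fun y : R => sin (c * y)).
  apply: (measurableT_comp (continuous_measurable_fun (@continuous_sin R))).
  exact: measurable_funM.
have J0 (h : R -> R) : measurable_fun setT h -> (forall y, `|h y| <= 1) ->
    rintegrable leb (fun y => w y * h y).
  move=> mh h1; apply: (rintegrable_le (mu := leb) (V := fun y => w y * h y) _ _ jw).
    by apply: measurable_RM; exact: measurable_funM.
  move=> y; rewrite normrM (ger0_norm (w0 y)) mulrC ler_wpM2r //.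
  by rewrite (le_trans (h1 y)) // lerDl.
have J1 (h : R -> R) : measurable_fun setT h -> (forall y, `|h y| <= 1) ->
    rintegrable leb (fun y => y * w y * h y).
  move=> mh h1; apply: (rintegrable_le (mu := leb) (V := fun y => y * w y * h y) _ _ jw).
    by apply: measurable_RM; apply: measurable_funM => //; exact: measurable_funM.
  move=> y; rewrite normrM (normrM y (w y)) (ger0_norm (w0 y)) -[leRHS]mulr1.
  by apply: ler_pM => //; [exact: mulr_ge0|rewrite ler_wpM2r // lerDr].
have lim0 (h : R -> R) (e : R) : `|e| = 1 -> (forall y, `|h y| <= 1) ->
    (fun n : nat => w (e * n%:R) * h (e * n%:R)) @ \oo --> (0 : R).
  move=> e1 h1; have [C [C0 HC]] := poly_gk_le 1 `|a| k0.
  have L : (fun n : nat => C * expR (- (k / 2 * n%:R))) @ \oo --> (0 : R).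
    rewrite -(mulr0 C); apply: cvgM; first exact: cvg_cst.
    have k2 : 0 < k / 2 by rewrite divr_gt0.
    rewrite (_ : (fun n => _) = (fun n : nat => expR (- (k / 2)) ^+ n)); last first.
      by apply/funext => n; rewrite -expRM_natr mulNr.
    apply: cvg_expr; rewrite ger0_norm ?expR_ge0 // expR_lt1; lra.
  apply: (@squeeze_cvgr _ _ _ _ (fun n : nat => - (C * expR (- (k / 2 * n%:R))))
    (fun n : nat => C * expR (- (k / 2 * n%:R)))) => //; last first.
    by rewrite -oppr0; apply: cvgN.
  apply: nearW => n; rewrite -ler_norml normrM (ger0_norm (w0 _)).
  rewrite -[leRHS]mulr1; apply: ler_pM => //.
  have := HC (e * n%:R); rewrite normrM e1 mul1r normr_nat expr1 => HC1.
  apply: (@le_trans _ _ (C * gk (k / 2) (e * n%:R))).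
    apply: le_trans HC1; rewrite /w -mulrA -[leLHS]mul1r.
    apply: ler_pM => //; first by rewrite mulr_ge0 // expR_ge0.
      by rewrite lerDl.
    rewrite mulrC ler_wpM2r ?gk_ge0 // ler_expR.
    by rewrite (le_trans (ler_norm _)) // normrM normrM e1 mul1r normr_nat.
  rewrite ler_wpM2l ?(ltW C0) // /gk ler_expR lerN2 ler_wpM2l ?divr_ge0 ?(ltW k0) //.
  rewrite exprMn -[e ^+ 2]real_normK ?num_real // e1 expr1n mul1r expr2.
  by rewrite -natrM ler_nat; case: n {HC1} => // n; rewrite leq_pmulr.
have dw (y : R) : is_derive y 1 w ((a - 2 * k * y) * w y).
  rewrite /w /gk; apply: is_derive_eq; rewrite /GRing.scale /=; ring.
have cw : continuous w.
  by move=> y; apply: differentiable_continuous; apply/derivable1_diffP.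
have ccos c : continuous (fun y : R => cos (c * y)).
  move=> y; apply: (cvg_comp (fun y => c * y) cos); last exact: continuous_cos.
  by apply: cvgM; [exact: cvg_cst|exact: cvg_id].
have csin c : continuous (fun y : R => sin (c * y)).
  move=> y; apply: (cvg_comp (fun y => c * y) sin); last exact: continuous_sin.
  by apply: cvgM; [exact: cvg_cst|exact: cvg_id].
have lin c (A B D : R -> R) : rintegrable leb A -> rintegrable leb B -> rintegrable leb D ->
  forall u v, Rintegral leb setT (fun y => c * A y + u * B y + v * D y) =
   c * Rintegral leb setT A + u * Rintegral leb setT B + v * Rintegral leb setT D.
  move=> jA jB jD u v.
  rewrite (RintegralD (mu := leb)) ?(RintegralD (mu := leb)) ?(RintegralZl (mu := leb)) //;
    try exact: rintegrableZ.
  by apply: rintegrableD; exact: rintegrableZ.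
have jlin c (A B D : R -> R) : rintegrable leb A -> rintegrable leb B -> rintegrable leb D ->
  forall u v, rintegrable leb (fun y => c * A y + u * B y + v * D y).
  by move=> jA jB jD u v; do 2?[apply: rintegrableD]; exact: rintegrableZ.
have cid : continuous (fun y : R => y) by move=> y; exact: cvg_id.
(* Integration by parts: the derivatives of [w y * cos (b * y)] and, below, of [w y * sin (b * y)]
   have integral 0 over the line. *)
have IB1 (b : R) : - (2 * k) * U1 b + a * U b + (- b) * V b = 0.
  rewrite -lin; [|exact: J1 (mcos b) (fun _ => cos_max _)
   |exact: J0 (mcos b) (fun _ => cos_max _)|exact: J0 (msin b) (fun _ => sin_max _)].
  apply: (@Rintegral_deriv_eq0 (fun y => w y * cos (b * y))).
  - by move=> y; apply: is_derive_eq; rewrite /GRing.scale /=; ring.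
  - move=> y; apply: cvgD; [apply: cvgD|]; (apply: cvgM; [exact: cvg_cst|]).
    + by apply: cvgM; [apply: cvgM; [exact: cid|exact: cw]|exact: ccos].
    + by apply: cvgM; [exact: cw|exact: ccos].
    + by apply: cvgM; [exact: cw|exact: csin].
  - apply: jlin; [exact: J1 (mcos b) (fun _ => cos_max _)
   |exact: J0 (mcos b) (fun _ => cos_max _)|exact: J0 (msin b) (fun _ => sin_max _)].
  - have := @lim0 (fun y => cos (b * y)) 1 (normr1 _) (fun _ => cos_max _).
    by under eq_fun do rewrite mul1r.
  - have := @lim0 (fun y => cos (b * y)) (-1) (normrN1 _) (fun _ => cos_max _).
    by under eq_fun do rewrite mulN1r.
have IB2 (b : R) : - (2 * k) * V1 b + a * V b + b * U b = 0.
  rewrite -lin; [|exact: J1 (msin b) (fun _ => sin_max _)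
   |exact: J0 (msin b) (fun _ => sin_max _)|exact: J0 (mcos b) (fun _ => cos_max _)].
  apply: (@Rintegral_deriv_eq0 (fun y => w y * sin (b * y))).
  - by move=> y; apply: is_derive_eq; rewrite /GRing.scale /=; ring.
  - move=> y; apply: cvgD; [apply: cvgD|]; (apply: cvgM; [exact: cvg_cst|]).
    + by apply: cvgM; [apply: cvgM; [exact: cid|exact: cw]|exact: csin].
    + by apply: cvgM; [exact: cw|exact: csin].
    + by apply: cvgM; [exact: cw|exact: ccos].
  - apply: jlin; [exact: J1 (msin b) (fun _ => sin_max _)
   |exact: J0 (msin b) (fun _ => sin_max _)|exact: J0 (mcos b) (fun _ => cos_max _)].
  - have := @lim0 (fun y => sin (b * y)) 1 (normr1 _) (fun _ => sin_max _).
    by under eq_fun do rewrite mul1r.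
  - have := @lim0 (fun y => sin (b * y)) (-1) (normrN1 _) (fun _ => sin_max _).
    by under eq_fun do rewrite mulN1r.
have EU1 (b : R) : U1 b = (a * U b - b * V b) / (2 * k).
  by apply: (canRL (mulfK _)); [rewrite mulf_neq0|have := IB1 b; lra].
have EV1 (b : R) : V1 b = (a * V b + b * U b) / (2 * k).
  by apply: (canRL (mulfK _)); [rewrite mulf_neq0|have := IB2 b; lra].
(* (U + i V) exp(- z^2/(4k)) has zero derivative in the imaginary part b of z. *)
pose e (b : R) := expR (b ^+ 2 / (4 * k)); pose g (b : R) := a * b / (2 * k).
pose P b := e b * (U b * cos (g b) + V b * sin (g b)).
pose Q b := e b * (V b * cos (g b) - U b * sin (g b)).
have dP (b : R) : is_derive b 1 P 0.
  have := dU b; have := dV b; rewrite EU1 EV1 => h1 h2.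
  rewrite /P /e /g; apply: is_derive_eq; rewrite /GRing.scale /=; field; exact: kne.
have dQ (b : R) : is_derive b 1 Q 0.
  have := dU b; have := dV b; rewrite EU1 EV1 => h1 h2.
  rewrite /Q /e /g; apply: is_derive_eq; rewrite /GRing.scale /=; field; exact: kne.
have P0 (b : R) : P b = expR (a ^+ 2 / (4 * k)) * Num.sqrt (pi / k).
  rewrite (is_derive_0_is_cst b 0 dP) /P /e /g !(mulr0, mul0r, expr0n, expR0, cos0, sin0, mulr1, mul1r, addr0) /=.
  rewrite -Rintegral_gk_exp // /U.
  by apply: eq_Rintegral => y _; rewrite mul0r cos0 mulr1.
have Q0 (b : R) : Q b = 0.
  rewrite (is_derive_0_is_cst b 0 dQ) /Q /e /g !(mulr0, mul0r, cos0, sin0, mulr1, subr0).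
  rewrite /V (_ : (fun y => _) = (fun=> 0)); last by apply/funext => y; rewrite mul0r sin0 mulr0.
  by rewrite Rintegral_cst // mul0r mulr0.
have cUV : cintg leb (fun y => (gk k y)%:C * cexp (z * y%:C)) = Complex (U (Imz z)) (V (Imz z)).
  apply: complex_ext; rewrite ?Rez_cintg ?Imz_cintg.
  transitivity (U (Imz z)) => //; apply: eq_Rintegral => y _.
    by rewrite RezCM Rez_cexp RezM ImzM /= !mulr0 subr0 add0r mulrA.
  transitivity (V (Imz z)) => //; apply: eq_Rintegral => y _.
  by rewrite ImzCM Imz_cexp RezM ImzM /= !mulr0 subr0 add0r mulrA.
rewrite cUV; set b := Imz z.
have e0 : e b != 0 by rewrite gt_eqF // expR_gt0.
have := P0 b; have := Q0 b; rewrite /P /Q => hQ hP.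
have cs : cos (g b) ^+ 2 + sin (g b) ^+ 2 = 1 by exact: cos2Dsin2.
have hQ' : V b * cos (g b) - U b * sin (g b) = 0.
  by apply: (mulfI e0); rewrite hQ mulr0.
have hP' : U b * cos (g b) + V b * sin (g b) =
    (e b)^-1 * (expR (a ^+ 2 / (4 * k)) * Num.sqrt (pi / k)).
  by rewrite -hP mulKf.
have EE : (e b)^-1 * expR (a ^+ 2 / (4 * k)) = expR (Rez (z ^+ 2 * ((4 * k)^-1)%:C)).
  rewrite /e -expRN -expRD; congr expR; rewrite RezM /= mulr0 subr0 RezX2 -/a -/b; ring.
have GE : Imz (z ^+ 2 * ((4 * k)^-1)%:C) = g b.
  by rewrite ImzM /= mulr0 add0r ImzX2 -/a -/b /g; field.
apply: complex_ext; rewrite ?RezCM ?ImzCM ?Rez_cexp ?Imz_cexp GE -EE /=.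
  transitivity ((U b * cos (g b) + V b * sin (g b)) * cos (g b) - (V b * cos (g b) - U b * sin (g b)) * sin (g b)).
    by rewrite -[LHS]mulr1 -cs; ring.
  by rewrite hP' hQ'; ring.
transitivity ((U b * cos (g b) + V b * sin (g b)) * sin (g b) + (V b * cos (g b) - U b * sin (g b)) * cos (g b)).
  by rewrite -[LHS]mulr1 -cs; ring.
by rewrite hP' hQ'; ring.
Qed.

End GaussianIntegrals.

(** * Contour integrals as integrals over a product space *)

Section ProductSigmaFinite.
Context {d1 d2} {T1 : measurableType d1} {T2 : measurableType d2} {R : realType}.
Variables (m1 : {sigma_finite_measure set T1 -> \bar R})
  (m2 : {sigma_finite_measure set T2 -> \bar R}).

(** The product measure with its sigma-finiteness attached, so that the product with a further
    factor can be formed. *)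
Definition prod_measure : set (T1 * T2) -> \bar R := (m1 \x m2)%E.

HB.instance Definition _ := Measure.copy prod_measure (m1 \x m2)%E.

Lemma prod_measure_sigma_finite : sigma_finite setT prod_measure.
Proof.
have /sigma_finiteP[F [TF ndF Foo]] := sigma_finiteT m1.
have /sigma_finiteP[G [TG ndG Goo]] := sigma_finiteT m2.
exists (fun k => F k `*` G k).
  rewrite -setXTT TF TG predeqE => -[x y]; split.
    move=> [/= [n _ Fnx] [k _ Gky]]; exists (maxn n k) => //; split.
    - by move: x Fnx; exact/subsetPset/ndF/leq_maxl.
    - by move: y Gky; exact/subsetPset/ndG/leq_maxr.
  by move=> [n _ []/= ? ?]; split; exists n.
move=> k; have [? ?] := Foo k; have [? ?] := Goo k.
split; first exact: measurableX.
by rewrite /prod_measure product_measure1E// lte_mul_pinfty// ge0_fin_numE.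
Qed.

HB.instance Definition _ := Measure_isSigmaFinite.Build _ _ _ prod_measure
  prod_measure_sigma_finite.

Definition prodm : {sigma_finite_measure set (T1 * T2)%type -> \bar R} := prod_measure.

End ProductSigmaFinite.

Definition diracm (R : realType) : {sigma_finite_measure set unit -> \bar R} := dirac tt.

Section IteratedProduct.
Context {dT} {T : measurableType dT} {R : realType}.

(** A dependent pair, because the display of the product space changes with [n]. The first
    coordinate is split off at each level, as in [contour_iter]. *)
Fixpoint pws (n : nat) : {d & measurableType d} :=
  match n with
  | 0 => existT _ _ (unit : measurableType _)
  | n'.+1 => existT _ _ ((T * projT2 (pws n'))%type : measurableType _)
  end.
Definition pw n := projT2 (pws n).

Variable m : {sigma_finite_measure set T -> \bar R}.

Fixpoint pwm (n : nat) : {sigma_finite_measure set (pw n) -> \bar R} :=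
  match n return {sigma_finite_measure set (pw n) -> \bar R} with
  | 0 => diracm R
  | n'.+1 => prodm m (pwm n')
  end.

(* Coordinates beyond [n] take the junk value [point], which is [0] for real coordinates. *)
Fixpoint coord (n : nat) : pw n -> nat -> T :=
  match n return pw n -> nat -> T with
  | 0 => fun _ _ => point
  | n'.+1 => fun t j => if j is j'.+1 then coord t.2 j' else t.1
  end.

Lemma measurable_coord n j : measurable_fun setT (fun t : pw n => coord t j).
Proof.
elim: n j => [|n IH] j /=; first exact: measurable_cst.
case: j => [|j]; first exact: measurable_fst.
exact: measurableT_comp (IH j) measurable_snd.
Qed.

Lemma Rintegral_unit (f : unit -> R) :
  Rintegral (pwm 0) setT f = f tt.
Proof. by rewrite /Rintegral [X in fine X]integral_dirac // diracE in_setT mul1e. Qed.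

Lemma rintegrable_unit (f : unit -> R) : rintegrable (pwm 0) f.
Proof.
apply/integrableP; split.
  by move=> _ Y mY; exact: I.
by rewrite integral_dirac //= diracE in_setT mul1e ltry.
Qed.

Lemma cintg_unit (f : unit -> R[i]) : cintg (pwm 0) f = f tt.
Proof. by apply: complex_ext; rewrite ?Rez_cintg ?Imz_cintg Rintegral_unit. Qed.

Lemma rintegrable_pw n (W : nat -> T -> R) :
  (forall j, (j < n)%N -> rintegrable m (W j)) ->
  rintegrable (pwm n) (fun t => \prod_(j < n) W j (coord t j)).
Proof.
elim: n W => [|n IH] W jW; first exact: rintegrable_unit.
have := @rintegrable_prod _ _ _ _ _ m (pwm n) _ _ (jW 0%N isT) (IH (fun j => W j.+1) (fun j => jW j.+1)).
congr (rintegrable _ _); apply/funext => -[x t] /=.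
by rewrite big_ord_recl.
Qed.

Lemma Rintegral_pw n (W : nat -> T -> R) :
  (forall j, (j < n)%N -> rintegrable m (W j)) ->
  Rintegral (pwm n) setT (fun t => \prod_(j < n) W j (coord t j)) =
  \prod_(j < n) Rintegral m setT (W j).
Proof.
elim: n W => [|n IH] W jW; first by rewrite Rintegral_unit !big_ord0.
rewrite big_ord_recl -(IH (fun j => W j.+1)); last by move=> j; exact: (jW j.+1).
rewrite -(@Rintegral_prod _ _ _ _ _ m (pwm n)); last 2 first.
- exact: jW.
- by apply: (@rintegrable_pw n (fun j => W j.+1)) => j; exact: (jW j.+1).
by congr (Rintegral _ _ _); apply/funext => -[x t] /=; rewrite big_ord_recl.
Qed.

Lemma cintegrable_pw n (W : nat -> T -> R[i]) :
  (forall j, (j < n)%N -> cintegrable m (W j)) ->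
  cintegrable (pwm n) (fun t => \prod_(j < n) W j (coord t j)).
Proof.
elim: n W => [|n IH] W jW.
  split; last exact: rintegrable_unit.
  by split; move=> _ Y mY; exact: I.
have := @cintegrable_prod _ _ _ _ _ m (pwm n) _ _ (jW 0%N isT) (IH (fun j => W j.+1) (fun j => jW j.+1)).
congr (cintegrable _ _); apply/funext => -[x t] /=.
by rewrite big_ord_recl.
Qed.

Lemma cintg_pw n (W : nat -> T -> R[i]) :
  (forall j, (j < n)%N -> cintegrable m (W j)) ->
  cintg (pwm n) (fun t => \prod_(j < n) W j (coord t j)) =
  \prod_(j < n) cintg m (W j).
Proof.
elim: n W => [|n IH] W jW; first by rewrite cintg_unit !big_ord0.
rewrite big_ord_recl -(IH (fun j => W j.+1)); last by move=> j; exact: (jW j.+1).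
rewrite -(@cintg_prod _ _ _ _ _ m (pwm n)); last 2 first.
- exact: jW.
- by apply: (@cintegrable_pw n (fun j => W j.+1)) => j; exact: (jW j.+1).
by congr (cintg _ _); apply/funext => -[x t] /=; rewrite big_ord_recl.
Qed.

End IteratedProduct.
Arguments pw {dT} T n.

Section ContourIterate.
Variable R : realType.
Local Notation leb := [the {sigma_finite_measure set (measurableTypeR R) -> \bar R} of @lebesgue_measure R].

Definition RT n := pw (measurableTypeR R) n.
Definition lebn n : {sigma_finite_measure set (RT n) -> \bar R} := pwm leb n.

(** The value 0 beyond [n] agrees with the base case of [contour_iter], where [h] is applied to the
    zero sequence. *)
Definition zline (n : nat) (a f : nat -> R) : nat -> R[i] :=
  fun j => if (j < n)%N then (a j)%:C + 'i * (f j)%:C else 0.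

Definition zc n (a : nat -> R) (t : RT n) : nat -> R[i] := zline n a (coord t).

Lemma cmeas_zc n a j : cmeas (fun t : RT n => zc a t j).
Proof.
rewrite /zc /zline; case: ltnP => _; last exact: cmeas_cst.
apply: cmeasD; first exact: cmeas_cst.
apply: cmeasM; first exact: cmeas_cst.
by apply: cmeas_real; exact: (measurable_coord (T := measurableTypeR R)).
Qed.

Definition cons_seq (z : R[i]) (w : nat -> R[i]) : nat -> R[i] :=
  fun k => if k is k'.+1 then w k' else z.

Lemma zline_cons n a f :
  zline n.+1 a f = cons_seq ((a 0%N)%:C + 'i * (f 0%N)%:C)
    (zline n (fun k => a k.+1) (fun k => f k.+1)).
Proof. by apply/funext => -[|j]. Qed.

Lemma vline_intE a (h : R[i] -> R[i]) :
  cintegrable leb (fun phi : measurableTypeR R => h (a%:C + 'i * phi%:C)) ->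
  vline_int a h = ((2 * pi)^-1)%:C * cintg leb (fun phi => h (a%:C + 'i * phi%:C)).
Proof.
move=> jh; rewrite /vline_int.
have -> (g : R -> R[i]) : cint g = cintg leb g.
  by apply: complex_ext; rewrite /cint ?RezD ?ImzD ?RezMi ?ImzMi ?RezC ?ImzC ?addr0 ?add0r.
rewrite (_ : cintg leb _ = 'i * cintg leb (fun phi => h (a%:C + 'i * phi%:C))); last first.
  by rewrite -cintgZ //; apply: eq_cintg => phi; rewrite mulrC.
rewrite mulrA; congr (_ * _).
have i0 : ('i : R[i]) != 0 by rewrite eq_complex /= oner_eq0 andbF.
have p0 : ((2 * pi)%:C : R[i]) != 0.
  by rewrite eq_complex /= negb_and mulf_neq0 // ?gt_eqF ?pi_gt0 // pnatr_eq0.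
by rewrite invfM -mulrA mulVf // mulr1 fmorphV.
Qed.

(** Induction on the number of variables: once the first is fixed at [phi], its weight [W 0 phi]
    goes into the constant [C], so the product bound reproduces itself and provides the majorant for
    Fubini. *)
Lemma contour_iterE n a (h : (nat -> R[i]) -> R[i]) (C : R) (W : nat -> R -> R) :
  0 <= C -> (forall j r, 0 <= W j r) ->
  (forall j, (j < n)%N -> rintegrable leb (W j)) ->
  cmeas (fun t : RT n => h (zc a t)) ->
  (forall f, cn (h (zline n a f)) <= C * \prod_(j < n) W j (f j)) ->
  contour_iter n a h = (((2 * pi)^-1)%:C) ^+ n * cintg (lebn n) (fun t => h (zc a t)).
Proof.
elim: n a h C W => [|n IH] a h C W C0 W0 jW mh bh.
  by rewrite expr0 mul1r [RHS](@cintg_unit _ (measurableTypeR R) R leb).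
rewrite [LHS]/=.
have bp f : 0 <= \prod_(j < n) W j.+1 (f j) by apply: prodr_ge0.
pose h1 (z : R[i]) := h \o cons_seq z.
pose z0 (phi : measurableTypeR R) := (a 0%N)%:C + 'i * phi%:C : R[i].
pose F (xt : measurableTypeR R * RT n) := h1 (z0 xt.1) (zc (fun k => a k.+1) xt.2).
have FE : (fun t : RT n.+1 => h (zc a t)) = F.
  by apply/funext => -[x t]; rewrite /zc zline_cons.
have mF : cmeas F by rewrite -FE.
have bF x f : cn (h1 (z0 x) (zline n (fun k => a k.+1) f)) <=
    C * W 0%N x * \prod_(j < n) W j.+1 (f j).
  have := bh (fun k => if k is k'.+1 then f k' else x).
  by rewrite zline_cons big_ord_recl mulrA.
have jp : rintegrable (lebn n) (fun t => \prod_(j < n) W j.+1 (coord t j)).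
  exact: (@rintegrable_pw _ _ _ leb n (fun j => W j.+1) (fun j => jW j.+1)).
have jF : cintegrable (leb \x lebn n)%E F.
  apply: (cintegrable_le (mu := (leb \x lebn n)%E) (W := fun xt => C * (W 0%N xt.1 * \prod_(j < n) W j.+1 (coord xt.2 j)))) => //.
    by move=> [x t]; rewrite mulrA; exact: bF.
  apply: rintegrableZ; exact: (rintegrable_prod (jW 0%N isT) jp).
have E phi : contour_iter n (fun k => a k.+1) (h1 (z0 phi)) =
    (((2 * pi)^-1)%:C) ^+ n * cintg (lebn n) (fun t => F (phi, t)).
  apply: (IH _ _ (C * W 0%N phi) (fun j => W j.+1)) => //.
  - exact: mulr_ge0.
  - by move=> j; exact: (jW j.+1).
  - apply: (cmeas_comp (h := fun t : RT n => (phi, t)) mF).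
    by apply: measurable_fun_pair => //; exact: measurable_cst.
have jc : cintegrable leb (fun phi => cintg (lebn n) (fun t => F (phi, t))).
  apply: (cintegrable_le (mu := leb) (W := fun phi => (2 * C *
    Rintegral (lebn n) setT (fun t => \prod_(j < n) W j.+1 (coord t j))) * W 0%N phi)).
  - exact: cmeas_fubini1 jF.
  - move=> phi.
    apply: le_trans (cn_cintg (mu := lebn n) (W := fun t => (C * W 0%N phi) * \prod_(j < n) W j.+1 (coord t j)) _ _ _) _.
    + by move=> t; exact: bF.
    + apply: (cmeas_comp (h := fun t : RT n => (phi, t)) mF).
      by apply: measurable_fun_pair => //; exact: measurable_cst.
    + exact: rintegrableZ.
    + by rewrite (RintegralZl (mu := lebn n)) // le_eqVlt; apply/orP; left; apply/eqP; ring.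
  - by apply: rintegrableZ; exact: jW.
have EE : (fun phi : measurableTypeR R => contour_iter n (fun k => a k.+1) (h1 (z0 phi))) =
    (fun phi => (((2 * pi)^-1)%:C) ^+ n * cintg (lebn n) (fun t => F (phi, t))).
  by apply/funext => phi; exact: E.
rewrite vline_intE; last by move: (cintegrableZ ((((2 * pi)^-1)%:C) ^+ n) jc); rewrite -EE.
transitivity (((2 * pi)^-1)%:C * cintg leb
    (fun phi => (((2 * pi)^-1)%:C) ^+ n * cintg (lebn n) (fun t => F (phi, t)))).
  by rewrite -EE.
by rewrite cintgZ // mulrA -exprS FE -(cintg_fubini1 jF).
Qed.

End ContourIterate.

(** * Transfer of identities between contours *)

Section LaplaceInverse.
Variable R : realType.
Local Notation leb := [the {sigma_finite_measure set (measurableTypeR R) -> \bar R} of @lebesgue_measure R].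

(** Its integral over [r] is [l^-1] when [Re l > 0]; this is how inverses of affine factors are
    produced. *)
Definition Epos (l : R[i]) (r : R) : R[i] := if 0 <= r then cexp (- (r%:C * l)) else 0.

Definition hexp (k : R) (r : R) : R := if 0 <= r then expR (- (k * r)) else 0.

Lemma EposE l r : Epos l r = (if 0 <= r then 1 else 0)%:C * cexp (- (r%:C * l)).
Proof. by rewrite /Epos; case: ifP => _; rewrite ?mul1r ?mul0r. Qed.

Lemma measurable_pos_if : measurable_fun setT (fun r : R => if 0 <= r then 1 else 0 : R).
Proof.
apply: measurable_fun_if => //; apply: measurable_fun_ler => //.
Qed.

Lemma cn_Epos l k r : k <= Rez l -> cn (Epos l r) <= hexp k r.
Proof.
rewrite /Epos /hexp; case: ifP => [r0|_] kl; last by rewrite cn0.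
by rewrite cn_cexp RezN RezCM ler_expR lerN2 (mulrC k) ler_wpM2l.
Qed.

Lemma measurable_hexp k : measurable_fun setT (hexp k).
Proof.
apply: measurable_fun_if => //; first exact: measurable_fun_ler.
apply: measurable_funTS; apply: measurableT_comp => //; apply: measurable_funN.
exact: measurable_funM.
Qed.

Lemma rintegrable_hexp k : 0 < k -> rintegrable leb (hexp k).
Proof.
move=> k0; apply/integrableP; split.
  by apply/measurable_EFinP; apply: measurable_RM; exact: measurable_hexp.
have -> : (\int[leb]_x `|(EFin \o hexp k) x| =
    \int[leb]_(x in `[0%R, +oo[) (expR (- (k * x)))%:E)%E.
  rewrite [RHS]integral_mkcond; apply: eq_integral => x _ /=.
  rewrite /patch /hexp; case: ifP => [x0|/negbT x0].
    by rewrite mem_set /= ?in_itv /= ?x0 // ger0_norm ?expR_ge0.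
  by rewrite memNset ?normr0 //= in_itv /= andbT; exact/negP.
have dF (x : R) : is_derive x 1 (fun x : R => - (expR (- (k * x)) / k)) (expR (- (k * x))).
  by apply: is_derive_eq; rewrite /GRing.scale /=; field; rewrite gt_eqF.
rewrite (@ge0_continuous_FTC2y R (fun x => expR (- (k * x))) (fun x => - (expR (- (k * x)) / k)) 0 0).
- by rewrite EFinN /= ltry.
- by move=> x _; exact: expR_ge0.
- apply: continuous_in_subspaceT => x _.
  apply: (cvg_comp (fun x => - (k * x)) expR); last exact: continuous_expR.
  by apply: cvgN; apply: cvgM; [exact: cvg_cst|exact: cvg_id].
- rewrite -oppr0; apply: cvgN; rewrite -(mul0r k^-1); apply: cvgM; last exact: cvg_cst.
  apply: (cvg_comp (fun x : R => k * x) (fun x => expR (- x))); last exact: cvgr_expR.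
  by apply/gt0_cvgMry => //; exact: cvg_id.
- by move=> x _; have [] := dF x.
- have cF : continuous (fun x : R => - (expR (- (k * x)) / k)).
    by move=> x; apply: differentiable_continuous; apply/derivable1_diffP; have [] := dF x.
  exact: cvg_at_right_filter (cF 0).
- by move=> x _; rewrite derive1E; have [] := dF x.
Qed.

Lemma Rintegral_deriv_pos (F f : R -> R) :
  (forall x : R, is_derive x 1 F (f x)) -> continuous f ->
  rintegrable leb (fun x => if 0 <= x then f x else 0) ->
  (fun n : nat => F n%:R) @ \oo --> (0 : R) ->
  Rintegral leb setT (fun x => if 0 <= x then f x else 0) = - F 0.
Proof.
move=> dF cf jf F1.
have cF : continuous F.
  by move=> x; apply: differentiable_continuous; apply/derivable1_diffP; have [] := dF x.
have mf : measurable_fun setT (fun x : R => if 0 <= x then f x else 0).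
  apply: measurable_fun_if => //; first exact: measurable_fun_ler.
  by apply: measurable_funTS; exact: continuous_measurable_fun.
have H n : Rintegral leb `[0, n.+1%:R] (fun x => if 0 <= x then f x else 0) = F n.+1%:R - F 0.
  have h : 0 < n.+1%:R :> R by rewrite ltr0n.
  transitivity (Rintegral leb `[0, n.+1%:R] f).
    by apply: eq_Rintegral => x; rewrite inE /= in_itv /= => /andP[-> _].
  rewrite /Rintegral (@continuous_FTC2 _ f F) //.
  - exact: continuous_subspaceT.
  - split => //; [apply: cvg_at_right_filter|apply: cvg_at_left_filter]; exact: cF.
  - by move=> x _; rewrite derive1E; have [] := dF x.
have L1 : (fun n : nat => Rintegral leb `[0, n.+1%:R] (fun x => if 0 <= x then f x else 0)) @ \oo --> - F 0.
  under eq_fun do rewrite H.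
  have L0 : (fun n : nat => F n.+1%:R) @ \oo --> (0 : R).
    by have := F1; rewrite -cvg_shiftS.
  by have := cvgB L0 (cvg_cst (F 0)); rewrite sub0r; apply.
have L2 : (fun n : nat => Rintegral leb `[0, n.+1%:R] (fun x => if 0 <= x then f x else 0)) @ \oo -->
    Rintegral leb setT (fun x => if 0 <= x then f x else 0).
  under eq_fun do rewrite Rintegral_mkcond.
  apply: (rint_dominated (mu := leb) (W := fun x => `|if 0 <= x then f x else 0|)).
  - move=> n; apply: measurable_RM; apply: (iffLR (measurable_restrictT _ _)) => //.
    exact: measurable_funTS.
  - exact: measurable_RM.
  - move=> x; apply/cvgrPdist_le => e e0.
    have [x0|x0] := leP 0 x; last first.
      apply: nearW => n; rewrite patchE.
      by case: (x \in _) => /=; rewrite ?(lt_geF x0) subrr normr0 (ltW e0).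
    near=> n; rewrite patchE mem_set ?x0 ?subrr ?normr0 ?(ltW e0) //=.
    rewrite in_itv /= x0 /=; apply: (le_trans (ler_norm _)); near: n.
    exists `|Num.ceil `|x| |%N => // n /= hn.
    apply: (le_trans (ceil_ge _)); rewrite -[X in X <= _]ger0_norm; last first.
      by apply: le_trans (ceil_ge _).
    rewrite -intr_norm -natr_absz ler_nat; exact: leq_trans hn _.
  - exact: (integrable_norm jf).
  - by move=> n x; rewrite patchE; case: ifP => // _; rewrite normr0.
by rewrite -(cvg_lim (@Rhausdorff R) L1) -(cvg_lim (@Rhausdorff R) L2).
Unshelve. all: by end_near. Qed.

Lemma cmeas_Epos l : cmeas (Epos l).
Proof.
rewrite (_ : Epos l = fun r => (if 0 <= r then 1 else 0)%:C * cexp (- (r%:C * l))); last first.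
  by apply/funext => r; exact: EposE.
apply: cmeasM; first exact: cmeas_real measurable_pos_if.
apply: cmeas_cexp; apply: cmeasN; apply: cmeasM; last exact: cmeas_cst.
exact: cmeas_real.
Qed.

Lemma cintegrable_Epos l : 0 < Rez l -> cintegrable leb (Epos l).
Proof.
move=> l0; apply: (cintegrable_le (mu := leb) (W := hexp (Rez l))).
- by have [h1 h2] := cmeas_Epos l; split; apply: measurable_RM.
- by move=> r; exact: cn_Epos.
- exact: rintegrable_hexp.
Qed.

Lemma cintg_Epos l : 0 < Rez l -> cintg leb (Epos l) = l^-1.
Proof.
case: l => a b /= a0; pose D := a ^+ 2 + b ^+ 2.
have D0 : D != 0 by rewrite gt_eqF // ltr_pwDl ?exprn_gt0 // sqr_ge0.
have j := @cintegrable_Epos (Complex a b) a0.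
have ER r : Rez (Epos (Complex a b) r) = if 0 <= r then expR (- (a * r)) * cos (b * r) else 0.
  rewrite /Epos; case: ifP => // _; rewrite Rez_cexp RezN RezCM ImzN ImzCM cosN /=.
  by rewrite (mulrC r a) (mulrC r b).
have EI r : Imz (Epos (Complex a b) r) = if 0 <= r then - (expR (- (a * r)) * sin (b * r)) else 0.
  rewrite /Epos; case: ifP => // _; rewrite Imz_cexp RezN RezCM ImzN ImzCM sinN /=.
  by rewrite (mulrC r a) (mulrC r b) mulrN.
have cv : (fun n : nat => expR (- (a * n%:R))) @ \oo --> (0 : R).
  rewrite (_ : (fun n => _) = (fun n : nat => expR (- a) ^+ n)); last first.
    by apply/funext => n; rewrite -expRM_natr mulNr.
  by apply: cvg_expr; rewrite ger0_norm ?expR_ge0 // expR_lt1 oppr_lt0.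
have cv2 (h : R -> R) (M : R) : (forall r, `|h r| <= M) ->
    (fun n : nat => expR (- (a * n%:R)) * h n%:R) @ \oo --> (0 : R).
  move=> hM; have L : (fun n : nat => expR (- (a * n%:R)) * M) @ \oo --> (0 : R).
    by rewrite -(mul0r M); apply: cvgM => //; exact: cvg_cst.
  apply: (@squeeze_cvgr _ _ _ _ (fun n : nat => - (expR (- (a * n%:R)) * M))
    (fun n : nat => expR (- (a * n%:R)) * M)) => //; last by rewrite -oppr0; apply: cvgN.
  apply: nearW => n; rewrite -ler_norml normrM ger0_norm ?expR_ge0 //.
  by rewrite ler_wpM2l ?expR_ge0.
have bd (u v : R) r : `|u * cos (b * r) + v * sin (b * r)| <= `|u| + `|v|.
  rewrite (le_trans (ler_normD _ _)) // !normrM lerD // ler_piMr // ?cos_max ?sin_max //.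
have ce : continuous (fun r : R => expR (- (a * r))).
  move=> y; apply: (cvg_comp (fun x => - (a * x)) expR); last exact: continuous_expR.
  by apply: cvgN; apply: cvgM; [exact: cvg_cst|exact: cvg_id].
apply: complex_ext.
  rewrite Rez_cintg (_ : (fun x => _) = (fun r => if 0 <= r then expR (- (a * r)) * cos (b * r) else 0)); last by apply/funext => r; exact: ER.
  pose F (r : R) := expR (- (a * r)) * ((- a / D) * cos (b * r) + (b / D) * sin (b * r)).
  transitivity (- F 0); [apply: Rintegral_deriv_pos|].
  - move=> x; rewrite /F; apply: is_derive_eq; rewrite /GRing.scale /=; rewrite /D; field.
    exact: D0.
  - move=> y; apply: cvgM; first exact: ce.
    apply: (cvg_comp (fun y => b * y) cos); last exact: continuous_cos.
    by apply: cvgM; [exact: cvg_cst|exact: cvg_id].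
  - by have := cintegrable_Re j; congr (rintegrable _ _); apply/funext => r; exact: ER.
  - exact: (cv2 (fun r => (- a / D) * cos (b * r) + (b / D) * sin (b * r)) _ (bd _ _)).
  - by rewrite /F !mulr0 oppr0 expR0 cos0 sin0 mulr0 mulr1 addr0 mul1r RezV /= mulNr opprK.
rewrite Imz_cintg (_ : (fun x => _) = (fun r => if 0 <= r then - (expR (- (a * r)) * sin (b * r)) else 0)); last by apply/funext => r; exact: EI.
pose F (r : R) := expR (- (a * r)) * ((b / D) * cos (b * r) + (a / D) * sin (b * r)).
transitivity (- F 0); [apply: Rintegral_deriv_pos|].
- move=> x; rewrite /F; apply: is_derive_eq; rewrite /GRing.scale /=; rewrite /D; field.
  exact: D0.
- move=> y; apply: cvgN; apply: cvgM; first exact: ce.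
  apply: (cvg_comp (fun y => b * y) sin); last exact: continuous_sin.
  by apply: cvgM; [exact: cvg_cst|exact: cvg_id].
- by have := cintegrable_Im j; congr (rintegrable _ _); apply/funext => r; exact: EI.
- exact: (cv2 (fun r => (b / D) * cos (b * r) + (a / D) * sin (b * r)) _ (bd _ _)).
- by rewrite /F !mulr0 oppr0 expR0 cos0 sin0 mulr0 mulr1 addr0 mul1r ImzV /= mulNr.
Qed.

End LaplaceInverse.

Section Transfer.
Variables (R : realType) (n : nat).
Local Notation leb := [the {sigma_finite_measure set (measurableTypeR R) -> \bar R} of @lebesgue_measure R].

Definition dotz (v : nat -> R) (z : nat -> R[i]) : R[i] := \sum_(j < n) (v j)%:C * z j.
Definition nrm (z : nat -> R[i]) : R := 1 + \sum_(j < n) cn (z j).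

Lemma nrm_ge1 z : 1 <= nrm z.
Proof. by rewrite lerDl sumr_ge0 // => j _; exact: cn_ge0. Qed.

Lemma nrm_ge0 z : 0 <= nrm z.
Proof. exact: le_trans ler01 (nrm_ge1 z). Qed.

Lemma dotzD v w z : dotz (fun j => v j + w j) z = dotz v z + dotz w z.
Proof. by rewrite -big_split; apply: eq_bigr => j _; rewrite rmorphD mulrDl. Qed.

Lemma dotzZ r v z : dotz (fun j => r * v j) z = r%:C * dotz v z.
Proof. by rewrite mulr_sumr; apply: eq_bigr => j _; rewrite rmorphM mulrA. Qed.

Lemma cn_dotz v z : cn (dotz v z) <= (\sum_(j < n) `|v j|) * nrm z.
Proof.
apply: le_trans (cn_sum _ _ _) _; rewrite mulr_suml; apply: ler_sum => j _.
rewrite cnM cnR ler_wpM2l // /nrm (bigD1 j) //= addrCA lerDl addr_ge0 //.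
by apply: sumr_ge0 => i _; exact: cn_ge0.
Qed.

Lemma Rez_dotz v z : Rez (dotz v z) = \sum_(j < n) v j * Rez (z j).
Proof. by rewrite Rez_sum; apply: eq_bigr => j _; rewrite RezCM. Qed.

(* Contains the integrand without its Gaussian factors. *)
Inductive tcl (D : (nat -> R[i]) -> Prop) : ((nat -> R[i]) -> R[i]) -> Prop :=
| tcl1 : tcl D (fun=> 1)
| tcl_lin v c h : tcl D h -> tcl D (fun z => (dotz v z + c) * h z)
| tcl_inv v c h k : 0 < k -> (forall z, D z -> k <= Rez (dotz v z + c)) -> tcl D h ->
    tcl D (fun z => (dotz v z + c)^-1 * h z).

Lemma tclM D h1 h2 : tcl D h1 -> tcl D h2 -> tcl D (fun z => h1 z * h2 z).
Proof.
move=> t1 t2; elim: t1 => [|v c h _ IH|v c h k k0 Hk _ IH].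
- by under eq_fun do rewrite mul1r.
- by under eq_fun do rewrite -mulrA; exact: tcl_lin.
- by under eq_fun do rewrite -mulrA; exact: tcl_inv Hk IH.
Qed.

Lemma tcl_prod D (I : Type) (s : seq I) (P : pred I) (F : I -> (nat -> R[i]) -> R[i]) :
  (forall i, P i -> tcl D (F i)) -> tcl D (fun z => \prod_(i <- s | P i) F i z).
Proof.
move=> tF; elim: s => [|i s IH].
  by under eq_fun do rewrite big_nil; exact: tcl1.
under eq_fun do rewrite big_cons.
by have [Pi|//] := boolP (P i); apply: tclM => //; exact: tF.
Qed.

Lemma tcl_bound D h : tcl D h ->
  exists C m, 0 <= C /\ forall z, D z -> cn (h z) <= C * nrm z ^+ m.
Proof.
elim=> [|v c h' _ [C [m [C0 H]]]|v c h' k k0 Hk _ [C [m [C0 H]]]].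
- by exists 1, 0%N; split => // z _; rewrite cn1 mul1r expr0.
- exists (((\sum_(j < n) `|v j|) + cn c) * C), m.+1; split.
    by rewrite mulr_ge0 // addr_ge0 ?cn_ge0 // sumr_ge0.
  move=> z Dz; rewrite cnM exprS mulrACA ler_pM ?cn_ge0 ?H //.
  rewrite (le_trans (cnD _ _)) // mulrDl lerD ?cn_dotz //.
  by rewrite ler_peMr ?cn_ge0 // nrm_ge1.
- exists (k^-1 * C), m; split; first by rewrite mulr_ge0 // invr_ge0 ltW.
  move=> z Dz; rewrite cnM -mulrA ler_pM ?cn_ge0 ?H // cnV.
  have h1 := Hk z Dz; have h2 := Rez_le_cn (dotz v z + c).
  have h3 : k <= cn (dotz v z + c) by rewrite (le_trans h1) // (le_trans _ h2) // ler_norm.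
  by rewrite lef_pV2 // posrE (lt_le_trans k0).
Qed.

Context {dT} {T : measurableType dT} (mu : {sigma_finite_measure set T -> \bar R}).

Lemma cmeas_dotz v (Z : T -> nat -> R[i]) : (forall j, (j < n)%N -> cmeas (fun t => Z t j)) ->
  cmeas (fun t => dotz v (Z t)).
Proof.
move=> mZ; apply: cmeas_sum => j _; apply: cmeasM; first exact: cmeas_cst.
exact: mZ.
Qed.

Lemma measurable_nrm (Z : T -> nat -> R[i]) : (forall j, (j < n)%N -> cmeas (fun t => Z t j)) ->
  measurable_fun setT (fun t => nrm (Z t)).
Proof.
move=> mZ; apply: measurable_funD => //.
by apply: measurable_sum => j; apply: cmeas_cn; exact: mZ.
Qed.

Lemma tcl_meas D h (Z : T -> nat -> R[i]) : tcl D h -> (forall t, D (Z t)) ->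
  (forall j, (j < n)%N -> cmeas (fun t => Z t j)) -> cmeas (fun t => h (Z t)).
Proof.
move=> th DZ mZ; elim: th => [|v c h' _ IH|v c h' k k0 Hk _ IH]; first exact: cmeas_cst.
  by apply: cmeasM => //; apply: cmeasD; [exact: cmeas_dotz|exact: cmeas_cst].
apply: cmeasM => //; apply: cmeasV; first by apply: cmeasD; [exact: cmeas_dotz|exact: cmeas_cst].
by move=> t; apply: Re_gt0_neq0; rewrite (lt_le_trans k0) // Hk.
Qed.

(** Several families of contours [Z i] with decaying weights [w i], parametrized by one measure
    space. Signs and numerical factors are kept in [w], so that an identity between contour
    integrals is the vanishing of one sum. *)
Variables (k : nat) (w : 'I_k -> T -> R[i]) (Z : 'I_k -> T -> nat -> R[i]) (K : R).
Hypothesis mw : forall i, cmeas (w i).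
Hypothesis mZ : forall i j, (j < n)%N -> cmeas (fun t => Z i t j).
Hypothesis ReZ : forall i t j, (j < n)%N -> `|Rez (Z i t j)| <= K.
Hypothesis jw : forall i m, rintegrable mu (fun t => cn (w i t) * nrm (Z i t) ^+ m).

Lemma Re_dotz_bound v i t : `|Rez (dotz v (Z i t))| <= K * \sum_(j < n) `|v j|.
Proof.
rewrite Rez_dotz (le_trans (ler_norm_sum _ _ _)) // mulr_sumr; apply: ler_sum => j _.
by rewrite normrM mulrC ler_wpM2r // ReZ.
Qed.

Lemma transfer_integrable D h x i : tcl D h -> (forall t, D (Z i t)) ->
  cintegrable mu (fun t => w i t * h (Z i t) * cexp (dotz x (Z i t))).
Proof.
move=> th DZ; have [C [m [C0 H]]] := tcl_bound th.
apply: (cintegrable_le (mu := mu) (W := fun t =>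
  (C * expR (K * \sum_(j < n) `|x j|)) * (cn (w i t) * nrm (Z i t) ^+ m))).
- apply: cmeasM; first by apply: cmeasM => //; exact: tcl_meas th DZ (mZ i).
  by apply: cmeas_cexp; exact: cmeas_dotz (mZ i).
- move=> t; rewrite cnM cn_cexp cnM.
  have -> : C * expR (K * \sum_(j < n) `|x j|) * (cn (w i t) * nrm (Z i t) ^+ m) =
    cn (w i t) * (C * nrm (Z i t) ^+ m) * expR (K * \sum_(j < n) `|x j|) by ring.
  apply: ler_pM; rewrite ?mulr_ge0 ?cn_ge0 ?expR_ge0 //.
    by rewrite ler_wpM2l ?cn_ge0 ?H.
  by rewrite ler_expR (le_trans (ler_norm _)) // Re_dotz_bound.
- exact: rintegrableZ.
Qed.

Hypothesis H0 : forall x, \sum_(i < k) cintg mu (fun t => w i t * cexp (dotz x (Z i t))) = 0.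

Lemma ccvg_sum (f : 'I_k -> nat -> R[i]) (l : 'I_k -> R[i]) : (forall i, ccvg (f i) (l i)) ->
  ccvg (fun m => \sum_(i < k) f i m) (\sum_(i < k) l i).
Proof.
move=> fl; elim: (index_enum _) => [|i s IH].
  rewrite big_nil /ccvg; under eq_fun do rewrite big_nil subr0 cn0; exact: cvg_cst.
rewrite big_cons; under eq_fun do rewrite big_cons.
apply: ccvg_ReIm.
  rewrite RezD; under eq_fun do rewrite RezD.
  by apply: cvgD; apply: ccvg_Re.
rewrite ImzD; under eq_fun do rewrite ImzD.
by apply: cvgD; apply: ccvg_Im.
Qed.

(* Differentiate along [v] for an affine factor; integrate [expR (- r l)] over [r >= 0] for the inverse of [l]. *)
Theorem transfer D h x : tcl D h -> (forall i t, D (Z i t)) ->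
  \sum_(i < k) cintg mu (fun t => w i t * h (Z i t) * cexp (dotz x (Z i t))) = 0.
Proof.
move=> th DZ; elim: th x => [|v c h' th' IH|v c h' e e0 He th' IH] x.
- rewrite -[RHS](H0 x); apply: eq_bigr => i _; apply: eq_cintg => t.
  by rewrite mulr1.
(* The difference quotient of [cexp (dotz (x + e v) z)] at [e = 0] brings down the factor
   [dotz v z]; steps [e <= 1] keep it dominated by a constant times [nrm z]. *)
- pose ep (m : nat) : R := m.+1%:R^-1.
  have ep0 m : 0 < ep m by rewrite invr_gt0.
  have ep1 m : ep m <= 1 by rewrite invf_le1 // ler1n.
  have epc (m : nat) : ((ep m)%:C : R[i]) != 0.
    by rewrite eq_complex /= gt_eqF.
  pose g i t := w i t * h' (Z i t) * cexp (dotz x (Z i t)).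
  pose f i m t := g i t * ((cexp ((ep m)%:C * dotz v (Z i t)) - 1) / (ep m)%:C).
  have jg i : cintegrable mu (g i) by exact: transfer_integrable th' (DZ i).
  have fE i m t : f i m t = ((ep m)%:C)^-1 *
      (w i t * h' (Z i t) * cexp (dotz (fun j => x j + ep m * v j) (Z i t)) - g i t).
    by rewrite /f /g dotzD dotzZ cexpD; ring.
  have Sf m : \sum_(i < k) cintg mu (f i m) = 0.
    rewrite (eq_bigr (fun i => ((ep m)%:C)^-1 * (cintg mu (fun t => w i t * h' (Z i t) *
       cexp (dotz (fun j => x j + ep m * v j) (Z i t))) - cintg mu (g i)))).
      rewrite -mulr_sumr sumrB IH [X in _ - X](_ : _ = 0) ?subr0 ?mulr0 //.
      exact: (IH x).
    move=> i _; rewrite -cintgB; [|exact: transfer_integrable th' (DZ i)|exact: jg].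
    rewrite -cintgZ; last by apply: cintegrableB; [exact: transfer_integrable th' (DZ i)|exact: jg].
    by apply: eq_cintg => t; exact: fE.
  have [C [m0 [C0 HC]]] := tcl_bound th'.
  pose S := \sum_(j < n) `|v j|.
  have S0 : 0 <= S by exact: sumr_ge0.
  have bd i t : cn (g i t) <= cn (w i t) * (C * nrm (Z i t) ^+ m0) * expR (K * \sum_(j < n) `|x j|).
    rewrite /g cnM cn_cexp cnM; apply: ler_pM; rewrite ?mulr_ge0 ?cn_ge0 ?expR_ge0 //.
      by rewrite ler_wpM2l ?cn_ge0 ?HC.
    by rewrite ler_expR (le_trans (ler_norm _)) // Re_dotz_bound.
  have bm i t m : Num.max 1 (expR (Rez ((ep m)%:C * dotz v (Z i t)))) <= expR (K * S).
    have hb := Re_dotz_bound v i t; rewrite -/S in hb.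
    have KS : 0 <= K * S by exact: le_trans hb.
    rewrite ge_max; apply/andP; split; first by rewrite -expR0 ler_expR.
    rewrite ler_expR RezCM (le_trans (ler_norm _)) // normrM (ger0_norm (ltW (ep0 m))).
    by rewrite (le_trans _ hb) // ler_piMl.
  have L i : ccvg (fun m => cintg mu (f i m)) (cintg mu (fun t => g i t * dotz v (Z i t))).
    apply: (cintg_dominated (mu := mu) (W := fun t =>
      (4 * S * expR (K * S) * C * expR (K * \sum_(j < n) `|x j|)) *
       (cn (w i t) * nrm (Z i t) ^+ m0.+1))).
    + move=> m; apply: cmeasM; first by case: (jg i).
      apply: cmeasM; last exact: cmeas_cst.
      apply: cmeasB; last exact: cmeas_cst.
      apply: cmeas_cexp; apply: cmeasM; first exact: cmeas_cst.
      exact: cmeas_dotz (mZ i).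
    + by apply: cmeasM; [case: (jg i)|exact: cmeas_dotz (mZ i)].
    + move=> t; pose u := dotz v (Z i t).
      have B m : cn (f i m t - g i t * u) <= cn (g i t) * (4 * cn u ^+ 2 * expR (K * S)) * ep m.
        have -> : f i m t - g i t * u =
          g i t * ((cexp ((ep m)%:C * u) - 1 - (ep m)%:C * u) / (ep m)%:C).
          by rewrite /f -/u; field; exact: epc.
        rewrite cnM [X in _ * X]cnM cnV cnR (ger0_norm (ltW (ep0 m))) -[X in _ <= X]mulrA ler_wpM2l ?cn_ge0 //.
        have h1 := cn_cexpB1B ((ep m)%:C * u).
        have h2 : cn (cexp ((ep m)%:C * u) - 1 - (ep m)%:C * u) <=
            4 * (cn u ^+ 2 * (expR (K * S) * ep m)) * ep m.
          apply: (le_trans h1); rewrite cnM cnR (ger0_norm (ltW (ep0 m))) exprMn.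
          have -> : 4 * (cn u ^+ 2 * (expR (K * S) * ep m)) * ep m =
            (4 * (ep m ^+ 2 * cn u ^+ 2)) * expR (K * S) by ring.
          by rewrite ler_wpM2l ?bm //; apply: mulr_ge0 => //; apply: mulr_ge0; exact: sqr_ge0.
        rewrite ler_pdivrMr ?ep0 // (le_trans h2) // le_eqVlt; apply/orP; left; apply/eqP; ring.
      have epL : (fun m => cn (g i t) * (4 * cn u ^+ 2 * expR (K * S)) * ep m) @ \oo --> (0 : R).
        rewrite -(mulr0 (cn (g i t) * (4 * cn u ^+ 2 * expR (K * S)))).
        by apply: cvgM; [exact: cvg_cst|exact: cvg_harmonic].
      apply: (@squeeze_cvgr _ _ _ _ (fun=> 0) _ _ _ _ _ epL); last exact: cvg_cst.
      by apply: nearW => m; rewrite cn_ge0 B.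
    + exact: rintegrableZ.
    + move=> m t; rewrite cnM.
      have h1 := cn_cexpB1 ((ep m)%:C * dotz v (Z i t)).
      have h2 : cn ((cexp ((ep m)%:C * dotz v (Z i t)) - 1) / (ep m)%:C) <=
          4 * (S * nrm (Z i t)) * expR (K * S).
        rewrite cnM cnV cnR (ger0_norm (ltW (ep0 m))) ler_pdivrMr ?ep0 //.
        apply: (le_trans h1); rewrite cnM cnR (ger0_norm (ltW (ep0 m))).
        have -> : 4 * (S * nrm (Z i t)) * expR (K * S) * ep m =
           4 * (ep m * (S * nrm (Z i t))) * expR (K * S) by ring.
        apply: ler_pM => //.
        * by apply: mulr_ge0 => //; apply: mulr_ge0; rewrite ?cn_ge0 ?(ltW (ep0 m)).
        * by rewrite ler_wpM2l // ler_wpM2l ?(ltW (ep0 m)) // cn_dotz.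
      apply: (le_trans (ler_pM _ _ (bd i t) h2)); rewrite ?cn_ge0 //.
      by rewrite exprS le_eqVlt; apply/orP; left; apply/eqP; ring.
  have SL : \sum_(i < k) cintg mu (fun t => g i t * dotz v (Z i t)) = 0.
    exact: (ccvg_cst0 Sf (ccvg_sum L)).
  rewrite (eq_bigr (fun i => cintg mu (fun t => g i t * dotz v (Z i t)) + c * cintg mu (g i))).
    by rewrite big_split /= -mulr_sumr SL add0r [X in _ * X](_ : _ = 0) ?mulr0 //; exact: (IH x).
  move=> i _; rewrite -cintgZ // -cintgD.
  + by apply: eq_cintg => t; rewrite /g; ring.
  + have := transfer_integrable x (tcl_lin v 0 th') (DZ i); congr (cintegrable _ _).
    by apply/funext => t; rewrite /g addr0; ring.
  + exact: cintegrableZ.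
- have [C [m0 [C0 HC]]] := tcl_bound th'.
  pose g i t := w i t * h' (Z i t) * cexp (dotz x (Z i t)).
  have jg i : cintegrable mu (g i) by exact: transfer_integrable th' (DZ i).
  pose G i (tr : T * measurableTypeR R) := g i tr.1 * Epos (dotz v (Z i tr.1) + c) tr.2.
  have jG i : cintegrable (mu \x leb)%E (G i).
    apply: (cintegrable_le (mu := (mu \x leb)%E) (W := fun tr => cn (g i tr.1) * hexp e tr.2)).
    + apply: cmeasM; first by apply: (cmeas_comp (f := g i)); [case: (jg i)|exact: measurable_fst].
      rewrite (_ : (fun tr => _) = (fun tr : T * measurableTypeR R =>
         (if 0 <= tr.2 then 1 else 0)%:C * cexp (- (tr.2%:C * (dotz v (Z i tr.1) + c))))); last first.
        by apply/funext => tr; exact: EposE.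
      have m2 : measurable_fun setT (fun tr : T * measurableTypeR R => tr.2 : R) by exact: measurable_snd.
      apply: cmeasM.
        by apply: cmeas_real; exact: (measurableT_comp (@measurable_pos_if R) m2).
      apply: cmeas_cexp; apply: cmeasN; apply: cmeasM; first exact: cmeas_real.
      apply: cmeasD; last exact: cmeas_cst.
      apply: (cmeas_comp (f := fun t => dotz v (Z i t))); last exact: measurable_fst.
      exact: cmeas_dotz (mZ i).
    + move=> [t r]; rewrite cnM ler_wpM2l ?cn_ge0 //.
      by apply: cn_Epos; exact: He.
    + exact: (rintegrable_prod (proj2 (jg i)) (rintegrable_hexp e0)).
  have E i : cintg mu (fun t => w i t * ((dotz v (Z i t) + c)^-1 * h' (Z i t)) * cexp (dotz x (Z i t))) =
      cintg leb (fun r => cintg mu (fun t => G i (t, r))).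
    rewrite cintg_fubini2 // -cintg_fubini1 //; apply: eq_cintg => t.
    have l0 : 0 < Rez (dotz v (Z i t) + c) by rewrite (lt_le_trans e0) // He.
    by rewrite /G /= cintgZ ?cintg_Epos //; [rewrite /g; ring|exact: cintegrable_Epos].
  rewrite (eq_bigr _ (fun i _ => E i)) -cintg_sum; last first.
    by move=> i; exact: cintegrable_fubini2 (jG i).
  rewrite (_ : (fun r => _) = fun=> 0) ?cintg0 //; apply/funext => r.
  rewrite /G /=; have [r0|r0] := leP 0 r; last first.
    rewrite big1 // => i _; rewrite /Epos leNgt r0 /= -[RHS](cintg0 mu).
    by apply: eq_cintg => t; rewrite mulr0.
  (* At level [r] the factor [cexp (- r (dotz v z + c))] only shifts [x] to [x - r v], up to a
     constant, so the induction hypothesis gives 0 for each [r]. *)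
  rewrite (eq_bigr (fun i => cexp (- (r%:C * c)) * cintg mu (fun t => w i t * h' (Z i t) *
     cexp (dotz (fun j => x j + (- r) * v j) (Z i t))))).
    by rewrite -mulr_sumr IH mulr0.
  move=> i _; rewrite -cintgZ; last exact: transfer_integrable th' (DZ i).
  apply: eq_cintg => t; rewrite /g /Epos r0 dotzD dotzZ mulrDr opprD !cexpD rmorphN mulNr; ring.
Qed.

End Transfer.

(** * Crossing a pole *)

Section GaussianLine.
Variable R : realType.
Local Notation leb := [the {sigma_finite_measure set (measurableTypeR R) -> \bar R} of @lebesgue_measure R].

Lemma rintegrable_opp (f : R -> R) : rintegrable leb f -> rintegrable leb (fun y => f (- y)).
Proof.
move=> jf; have mf : measurable_fun [set: measurableTypeR R] f.
  by apply/measurable_EFinP; exact: measurable_int jf.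
have mo : measurable_fun [set: measurableTypeR R] (-%R : _ -> measurableTypeR R) by exact: measurable_funN.
apply/integrableP; split; first by apply/measurable_EFinP; exact: measurableT_comp mf mo.
have /integrableP[_] := jf; congr (_ < _)%E.
transitivity (\int[pushforward leb (-%R : _ -> measurableTypeR R)]_x `|(f x)%:E|)%E.
  by apply: eq_measure_integral => //= A mA AS; exact/esym/lebesgue_measureN.
rewrite ge0_integral_pushforward //=.
by apply/measurable_EFinP; exact: measurableT_comp.
Qed.

Lemma Rintegral_opp (f : R -> R) : rintegrable leb f ->
  Rintegral leb setT (fun y => f (- y)) = Rintegral leb setT f.
Proof.
move=> jf; have mf : measurable_fun [set: measurableTypeR R] f.
  by apply/measurable_EFinP; exact: measurable_int jf.
have mo : measurable_fun [set: measurableTypeR R] (-%R : _ -> measurableTypeR R) by exact: measurable_funN.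
have jo := rintegrable_opp jf.
rewrite /Rintegral; congr fine; apply/esym.
transitivity (\int[pushforward leb (-%R : _ -> measurableTypeR R)]_x (f x)%:E)%E.
  by apply: eq_measure_integral => //= A mA AS; exact/esym/lebesgue_measureN.
by rewrite (integral_pushforward mo (f := EFin \o f)) //; exact/measurable_EFinP.
Qed.

Lemma cintegrable_opp (f : R -> R[i]) : cintegrable leb f -> cintegrable leb (fun y => f (- y)).
Proof.
move=> [mf jf]; split; last exact: (rintegrable_opp jf).
have mo : measurable_fun [set: measurableTypeR R] (-%R : _ -> measurableTypeR R) by exact: measurable_funN.
exact: cmeas_comp mf mo.
Qed.

Lemma cintg_opp (f : R -> R[i]) : cintegrable leb f ->
  cintg leb (fun y => f (- y)) = cintg leb f.
Proof.
move=> jf; apply: complex_ext; rewrite ?Rez_cintg ?Imz_cintg.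
  exact: (Rintegral_opp (cintegrable_Re jf)).
exact: (Rintegral_opp (cintegrable_Im jf)).
Qed.

Lemma CM (x y : R) : (x * y)%:C = x%:C * y%:C.
Proof. exact: rmorphM. Qed.

Lemma CD (x y : R) : (x + y)%:C = x%:C + y%:C.
Proof. exact: rmorphD. Qed.

Lemma CN (x : R) : (- x)%:C = - x%:C.
Proof. exact: rmorphN. Qed.

Lemma iCC (x y : R) : 'i * x%:C * y%:C = 'i * (x * y)%:C.
Proof. by rewrite CM mulrA. Qed.

Definition zl (a : R) (y : measurableTypeR R) : R[i] := a%:C + 'i * y%:C.

Lemma Rez_zl a y : Rez (zl a y) = a.
Proof. by rewrite /zl RezD RezMi addr0. Qed.

Lemma Imz_zl a y : Imz (zl a y) = y.
Proof. by rewrite /zl ImzD ImzMi ImzC add0r. Qed.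

Lemma cmeas_zl a : cmeas (zl a).
Proof.
split; first by under eq_fun do rewrite Rez_zl; exact: measurable_cst.
by under eq_fun do rewrite Imz_zl; exact: measurable_id.
Qed.

Definition gss (s : R) (z : R[i]) : R[i] := cexp ((2^-1 * s)%:C * z ^+ 2).

Lemma cmeas_gss (s a : R) : cmeas (fun y => gss s (zl a y)).
Proof.
apply: cmeas_cexp; apply: cmeasM; first exact: cmeas_cst.
by apply: cmeasX; exact: cmeas_zl.
Qed.

Lemma cn_gss (s a : R) (y : R) : cn (gss s (zl a y)) = expR (2^-1 * s * a ^+ 2) * gk (2^-1 * s) y.
Proof.
rewrite /gss cn_cexp RezCM RezX2 Rez_zl Imz_zl /gk -expRD; congr expR; ring.
Qed.

(** [2 pi] times the heat kernel at time [s]. *)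
Definition vgauss (s x : R) : R := Num.sqrt (pi / (2^-1 * s)) * expR (- (x ^+ 2 / (2 * s))).

(** The abscissa [a] has disappeared from the value, because the integrand has no pole. This is the
    source of all contour changes. *)
Lemma cintg_gss (s a x : R) : 0 < s ->
  cintg leb (fun y => gss s (zl a y) * cexp (x%:C * zl a y)) = (vgauss s x)%:C.
Proof.
move=> s0.
have E (y : R) : gss s (zl a y) * cexp (x%:C * zl a y) =
    (expR (2^-1 * s * a ^+ 2 + x * a))%:C *
    ((gk (2^-1 * s) y)%:C * cexp (('i * (s * a + x)%:C) * y%:C)).
  rewrite /gss -!cexpR -!cexpD iCC; congr cexp; apply: complex_ext.
    rewrite 3!RezD !RezCM RezX2 Rez_zl Imz_zl RezMi !RezC; ring.
  rewrite 3!ImzD ImzMi (ImzCM _ (zl a y ^+ 2)) (ImzCM x) ImzX2 Rez_zl Imz_zl.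
  by rewrite !ImzC; field.
rewrite (eq_cintg leb E) cintgZ; last first.
  apply: (cintegrable_le (mu := leb) (W := gk (2^-1 * s))).
  - apply: cmeasM; first by apply: cmeas_real; apply: measurable_RM; exact: measurable_gk.
    apply: cmeas_cexp; apply: cmeasM; first exact: cmeas_cst.
    exact: cmeas_real.
  - move=> y; rewrite cnM cn_cexp cnR ger0_norm ?gk_ge0 // iCC RezMi expR0 mulr1 //.
  - by apply: rintegrable_gk; rewrite mulr_gt0.
rewrite cintg_gk_cexp ?mulr_gt0 // /vgauss mulrCA CM; congr (_ * _).
rewrite -cexpR -cexpD -cexpR; congr cexp; rewrite exprMn sqrCi.
apply: complex_ext.
  rewrite mulN1r mulNr -rmorphXn -rmorphM RezD RezN !RezC; field; exact: lt0r_neq0.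
by rewrite mulN1r mulNr -rmorphXn -rmorphM ImzD ImzN !ImzC; ring.
Qed.

Lemma cn_gss_exp (s a x : R) (y : R) :
  cn (gss s (zl a y) * cexp (x%:C * zl a y)) = expR (2^-1 * s * a ^+ 2 + x * a) * gk (2^-1 * s) y.
Proof. by rewrite cnM cn_gss cn_cexp RezCM Rez_zl expRD mulrAC. Qed.

Lemma cmeas_gss_exp (s a x : R) : cmeas (fun y => gss s (zl a y) * cexp (x%:C * zl a y)).
Proof.
apply: cmeasM; first exact: cmeas_gss.
by apply: cmeas_cexp; apply: cmeasM; [exact: cmeas_cst|exact: cmeas_zl].
Qed.

(** Since [Re (z + c) > 0] on the line, [(z + c)^-1] is the Laplace integral of [exp (- r (z + c))];
    Fubini leaves Gaussian integrals with [x] replaced by [x - r]. *)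
Lemma pole_right (s a c x : R) : 0 < s -> - c < a ->
  cintg leb (fun y => (zl a y + c%:C)^-1 * (gss s (zl a y) * cexp (x%:C * zl a y))) =
  (Rintegral leb setT (fun r => if 0 <= r then expR (- (r * c)) * vgauss s (x - r) else 0))%:C.
Proof.
move=> s0 ca; have l0 y : Rez (zl a y + c%:C) = a + c by rewrite RezD Rez_zl RezC.
have ac0 : 0 < a + c by rewrite -ltrBlDr sub0r.
pose f (t : measurableTypeR R * measurableTypeR R) :=
  Epos (zl a t.1 + c%:C) t.2 * (gss s (zl a t.1) * cexp (x%:C * zl a t.1)).
pose W (y : measurableTypeR R) := expR (2^-1 * s * a ^+ 2 + x * a) * gk (2^-1 * s) y.
have jW : rintegrable leb W.
  by apply: rintegrableZ; apply: rintegrable_gk; rewrite mulr_gt0.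
have jf : cintegrable (leb \x leb)%E f.
  apply: (cintegrable_le (mu := (leb \x leb)%E) (W := fun t => W t.1 * hexp (a + c) t.2)).
  - rewrite /f; under eq_fun do rewrite EposE; apply: cmeasM; last first.
      exact: (cmeas_comp (cmeas_gss_exp s a x) measurable_fst).
    apply: cmeasM.
      have m2 : measurable_fun setT (fun tr : measurableTypeR R * measurableTypeR R => tr.2 : R) by exact: measurable_snd.
      by apply: cmeas_real; exact: (measurableT_comp (@measurable_pos_if R) m2).
    apply: cmeas_cexp; apply: cmeasN; apply: cmeasM.
      by apply: cmeas_real; exact: measurable_snd.
    by apply: cmeasD; [exact: (cmeas_comp (cmeas_zl a) measurable_fst)|exact: cmeas_cst].
  - move=> [y r]; rewrite /f cnM cn_gss_exp mulrC ler_wpM2l //.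
      by rewrite mulr_ge0 ?expR_ge0 // gk_ge0.
    by apply: cn_Epos; rewrite l0.
  - exact: (rintegrable_prod jW (rintegrable_hexp ac0)).
transitivity (cintg leb (fun y => cintg leb (fun r => f (y, r)))).
  apply: eq_cintg => y; rewrite /f /=.
  under eq_cintg do rewrite mulrC.
  rewrite cintgZ; last by apply: cintegrable_Epos; rewrite l0.
  by rewrite cintg_Epos ?l0 // mulrC.
rewrite (cintg_fubini1 jf) -(cintg_fubini2 jf).
have E r : cintg leb (fun y => f (y, r)) =
    (if 0 <= r then expR (- (r * c)) * vgauss s (x - r) else 0)%:C.
  rewrite /f /= /Epos; case: ifP => r0; last first.
    by under eq_cintg do rewrite mul0r; rewrite cintg0.
  transitivity (cintg leb (fun y : measurableTypeR R => (expR (- (r * c)))%:C *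
      (gss s (zl a y) * cexp ((x - r)%:C * zl a y)))).
    apply: eq_cintg => y; move: (gss s (zl a y)) => g; rewrite -cexpR.
    rewrite [LHS]mulrCA [RHS]mulrCA -!cexpD; congr (_ * cexp _).
    by rewrite CN CM CD CN; ring.
  rewrite cintgZ ?cintg_gss // ?CM //.
  apply: (cintegrable_le (mu := leb) (W := fun y => expR (2^-1 * s * a ^+ 2 + (x - r) * a) * gk (2^-1 * s) y)).
  - exact: cmeas_gss_exp.
  - by move=> y; rewrite cn_gss_exp.
  - by apply: rintegrableZ; apply: rintegrable_gk; rewrite mulr_gt0.
rewrite (eq_cintg leb E); apply: complex_ext; rewrite ?Rez_cintg ?Imz_cintg //=.
by rewrite /Rintegral integral0.
Qed.

Lemma vgaussN (s x : R) : vgauss s (- x) = vgauss s x.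
Proof. by rewrite /vgauss sqrrN. Qed.

Lemma vgauss_exp (s c x : R) r : 0 < s -> expR (- (r * c)) * vgauss s (x - r) =
  vgauss s x * (gk (2 * s)^-1 r * expR ((x / s - c) * r)).
Proof.
move=> s0; rewrite /vgauss /gk mulrCA -!mulrA -!expRD; congr (_ * expR _); field.
exact: lt0r_neq0.
Qed.

(** The reflection [z -> - z] brings the line to the right of the pole of [(z - c)^-1], which is the
    case of [pole_right]. *)
Lemma pole_left (s b c x : R) : 0 < s -> b < - c ->
  cintg leb (fun y => (zl b y + c%:C)^-1 * (gss s (zl b y) * cexp (x%:C * zl b y))) =
  - (Rintegral leb setT (fun r => if 0 <= r then expR (r * c) * vgauss s (x + r) else 0))%:C.
Proof.
move=> s0 bc.
have bc0 : 0 < - (b + c) by rewrite oppr_gt0 -ltrBrDr sub0r.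
pose F y := (zl b y + c%:C)^-1 * (gss s (zl b y) * cexp (x%:C * zl b y)).
have l0 y : zl b y + c%:C != 0 by apply: Re_lt0_neq0; rewrite RezD Rez_zl RezC -oppr_gt0.
have jF : cintegrable leb F.
  apply: (cintegrable_le (mu := leb) (W := fun y => (- (b + c))^-1 *
     (expR (2^-1 * s * b ^+ 2 + x * b) * gk (2^-1 * s) y))).
  - apply: cmeasM; last exact: cmeas_gss_exp.
    by apply: cmeasV => //; apply: cmeasD; [exact: cmeas_zl|exact: cmeas_cst].
  - move=> y; rewrite /F cnM cn_gss_exp ler_wpM2r ?mulr_ge0 ?expR_ge0 ?gk_ge0 // cnV.
    rewrite lef_pV2 ?posrE ?cn_gt0 //; apply: le_trans (Rez_le_cn _).
    by rewrite RezD Rez_zl RezC -normrN ler_norm.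
  - by do 2 apply: rintegrableZ; apply: rintegrable_gk; rewrite mulr_gt0.
rewrite -/F -(cintg_opp jF).
have zN y : zl b (- y) = - zl (- b) y by rewrite /zl !CN mulrN opprD opprK.
have EF y : F (- y) = - ((zl (- b) y + (- c)%:C)^-1 *
    (gss s (zl (- b) y) * cexp ((- x)%:C * zl (- b) y))).
  rewrite /F zN /gss sqrrN mulrN -mulNr -CN -mulNr; congr (_ * _).
  by rewrite -[RHS]invrN CN opprB addrC.
have cb : - - c < - b by rewrite ltrN2.
transitivity (- cintg leb (fun y => (zl (- b) y + (- c)%:C)^-1 *
    (gss s (zl (- b) y) * cexp ((- x)%:C * zl (- b) y)))).
  rewrite -cintgN.
    by apply: eq_cintg => y; exact: EF.
  have := cintegrableN (cintegrable_opp jF); congr (cintegrable _ _).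
  by apply/funext => y /=; rewrite EF opprK.
rewrite (pole_right (- x) s0 cb); apply: (congr1 (fun v => - (real_complex R v))).
apply: eq_Rintegral => r _; case: ifP => // _.
by rewrite mulrN opprK -opprD vgaussN.
Qed.

(** The two half-line integrals fit together to the integral over all real [r] of one Gaussian,
    whose value is [2 pi] times the residue. *)
Lemma pole_crossing (s a b c x : R) : 0 < s -> b < - c -> - c < a ->
  cintg leb (fun y => (zl a y + c%:C)^-1 * (gss s (zl a y) * cexp (x%:C * zl a y))) -
  cintg leb (fun y => (zl b y + c%:C)^-1 * (gss s (zl b y) * cexp (x%:C * zl b y))) =
  (2 * pi * expR (2^-1 * s * c ^+ 2 - c * x))%:C.
Proof.
move=> s0 bc ca; rewrite pole_right // pole_left // opprK -CD; congr (_%:C).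
pose f (r : R) := expR (- (r * c)) * vgauss s (x - r).
have k0 : 0 < (2 * s)^-1 by rewrite invr_gt0 mulr_gt0.
have fE : f = fun r => vgauss s x * (gk (2 * s)^-1 r * expR ((x / s - c) * r)).
  by apply/funext => r; exact: vgauss_exp.
have jf : rintegrable leb f.
  by rewrite fE; apply: rintegrableZ; exact: rintegrable_gk_exp.
have mf : measurable_fun [set: measurableTypeR R] f.
  by apply/measurable_EFinP; exact: measurable_int jf.
transitivity (Rintegral leb setT f); last first.
  rewrite fE RintegralZl //; last exact: rintegrable_gk_exp.
  rewrite (Rintegral_gk_exp (x / s - c) k0) /vgauss.
  rewrite (_ : forall A e1 e2 B : R, A * e1 * (e2 * B) = A * B * (e1 * e2)); last by move=> *; ring.
  rewrite -expRD -sqrtrM; last first.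
    by rewrite divr_ge0 ?pi_ge0 // mulr_ge0 // ltW.
  rewrite (_ : _ * (pi / _) = (2 * pi) ^+ 2); last by field; exact: lt0r_neq0.
  rewrite sqrtr_sqr ger0_norm ?mulr_ge0 ?pi_ge0 //; congr (_ * expR _).
  by field; exact: lt0r_neq0.
have jD (D : set (measurableTypeR R)) : measurable D -> leb.-integrable D (EFin \o f).
  by move=> mD; apply: integrableS jf.
have -> : Rintegral leb setT f = Rintegral leb `]-oo, 0[ f + Rintegral leb `[0, +oo[ f.
  rewrite -Rintegral_setU //.
  - congr (Rintegral _ _ _); apply/seteqP; split => // r _.
    by case: (ltP r 0) => r0; [left|right]; rewrite /= in_itv /= ?r0.
  - by apply: jD; exact: measurableU.
  - apply/disj_setPS => r [] /=; rewrite !in_itv /= andbT => h1 h2.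
    by move: (lt_le_trans h1 h2); rewrite ltxx.
rewrite addrC; congr (_ + _); last first.
  rewrite [RHS]Rintegral_mkcond; apply: eq_Rintegral => r _.
  by rewrite patchE mem_setE in_itv /= andbT.
rewrite Rintegral_itv_bndo_bndc; last exact: jD.
have jg : rintegrable leb (fun r => if r <= 0 then f r else 0).
  have mI : measurable (`]-oo, 0]%classic : set (measurableTypeR R)) by exact: measurable_itv.
  have /(integrable_mkcond _ mI) := jD _ mI.
  congr (leb.-integrable setT _); apply/funext => r.
  by rewrite patchE mem_setE in_itv /=; case: ifP.
rewrite [RHS]Rintegral_mkcond.
transitivity (Rintegral leb setT (fun r => if r <= 0 then f r else 0)); last first.
  by apply: eq_Rintegral => r _; rewrite patchE mem_setE in_itv /=.
rewrite -(Rintegral_opp jg); apply: eq_Rintegral => r _.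
by rewrite oppr_le0 /f mulNr opprK opprK.
Qed.
End GaussianLine.

(** * One variable crossing its pole in the presence of further factors *)

Section OneBody.
Variable R : realType.
Local Notation leb := [the {sigma_finite_measure set (measurableTypeR R) -> \bar R} of @lebesgue_measure R].

Definition strip (lo hi : R) (z : nat -> R[i]) : Prop := lo <= Rez (z 0%N) <= hi.

(* The class [tcl] in one variable, on the strip [lo <= Rez z <= hi]. *)
Definition sc (lo hi : R) (h : R[i] -> R[i]) : Prop :=
  tcl 1 (strip lo hi) (fun z => h (z 0%N)).

Lemma sc_ext lo hi h1 h2 : h1 =1 h2 -> sc lo hi h1 -> sc lo hi h2.
Proof. by move=> /funext ->. Qed.

Lemma scM lo hi h1 h2 : sc lo hi h1 -> sc lo hi h2 -> sc lo hi (fun w => h1 w * h2 w).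
Proof. exact: tclM. Qed.

Lemma sc_prod lo hi (I : Type) (r : seq I) (P : pred I) (F : I -> R[i] -> R[i]) :
  (forall i, P i -> sc lo hi (F i)) -> sc lo hi (fun w => \prod_(i <- r | P i) F i w).
Proof. by move=> H; apply: (@tcl_prod _ _ _ I r P (fun i z => F i (z 0%N))). Qed.

Lemma dotz1 (v : nat -> R) z : dotz 1 v z = (v 0%N)%:C * z 0%N.
Proof. by rewrite /dotz big_ord1. Qed.

Lemma sc_lin lo hi (u : R) (c : R[i]) : sc lo hi (fun w => u%:C * w + c).
Proof.
have := tcl_lin (n := 1) (fun=> u) c (tcl1 1 (strip lo hi)).
by congr tcl; apply/funext => z; rewrite mulr1 dotz1.
Qed.

Lemma sc_inv lo hi (u : R) (c : R[i]) k : 0 < k ->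
  (forall w, lo <= Rez w <= hi -> k <= Rez (u%:C * w + c)) ->
  sc lo hi (fun w => (u%:C * w + c)^-1).
Proof.
move=> k0 H; have H' z : strip lo hi z -> k <= Rez (dotz 1 (fun=> u) z + c).
  by move=> zs; rewrite dotz1; exact: H.
have := tcl_inv k0 H' (tcl1 1 (strip lo hi)).
by congr tcl; apply/funext => z; rewrite mulr1 dotz1.
Qed.

Lemma sc_bound lo hi h : sc lo hi h ->
  exists C m, 0 <= C /\ forall w, lo <= Rez w <= hi -> cn (h w) <= C * (1 + cn w) ^+ m.
Proof.
move=> /tcl_bound [C [m [C0 H]]]; exists C, m; split => // w wl.
by have := H (fun=> w) wl; rewrite /nrm big_ord1.
Qed.

Lemma sc_meas d (T : measurableType d) lo hi h (f : T -> R[i]) : sc lo hi h ->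
  (forall t, lo <= Rez (f t) <= hi) -> cmeas f -> cmeas (fun t => h (f t)).
Proof.
by move=> hs fb mf; apply: (tcl_meas (Z := fun t _ => f t) hs) => // t; exact: fb.
Qed.

Lemma cn_zl_le (a : R) (y : R) : 1 + cn (zl a y) <= (1 + `|a|) * (1 + `|y|).
Proof.
have := cn_le_ReIm (zl a y); rewrite Rez_zl Imz_zl.
have := mulr_ge0 (normr_ge0 a) (normr_ge0 y); lra.
Qed.

Lemma rintegrable_gss_poly (s a : R) m : 0 < s ->
  rintegrable leb (fun y => cn (gss s (zl a y)) * (1 + cn (zl a y)) ^+ m).
Proof.
move=> s0; have k0 : 0 < 2^-1 * s by rewrite mulr_gt0.
apply: (rintegrable_le (mu := leb) (W := fun y => expR (2^-1 * s * a ^+ 2) * (1 + `|a|) ^+ m *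
   ((1 + `|y|) ^+ m * expR (0 * `|y|) * gk (2^-1 * s) y))).
- apply: measurable_funM; first by apply: cmeas_cn; exact: cmeas_gss.
  apply: measurable_funX; apply: measurable_funD => //; apply: cmeas_cn; exact: cmeas_zl.
- move=> y; rewrite ger0_norm ?mulr_ge0 ?exprn_ge0 ?addr_ge0 ?cn_ge0 //.
  rewrite cn_gss mul0r expR0 mulr1.
  rewrite (_ : forall e A B g : R, e * A ^+ m * (B ^+ m * g) = e * g * (A * B) ^+ m); last first.
    by move=> *; rewrite exprMn; ring.
  rewrite ler_wpM2l ?mulr_ge0 ?expR_ge0 ?gk_ge0 //.
  by rewrite lerXn2r ?nnegrE ?mulr_ge0 ?addr_ge0 ?cn_ge0 // cn_zl_le.
- by apply: rintegrableZ; exact: rintegrable_poly_gk.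
Qed.

(** [transfer] with three contours: the lines at [a] and [b], and the constant contour at the pole
    [- c]. For a pure exponential the relation is [pole_crossing]; the factor [h] is then inserted
    into all three terms. *)
Lemma left1 (s a b c x : R) (h : R[i] -> R[i]) : 0 < s -> b < - c -> - c < a -> sc b a h ->
  cintg leb (fun y => (zl a y + c%:C)^-1 * (h (zl a y) * (gss s (zl a y) * cexp (x%:C * zl a y)))) =
  cintg leb (fun y => (zl b y + c%:C)^-1 * (h (zl b y) * (gss s (zl b y) * cexp (x%:C * zl b y)))) +
  h (- c)%:C * (2 * pi * expR (2^-1 * s * c ^+ 2 - c * x))%:C.
Proof.
move=> s0 bc ca hs.
pose p0 (a : R) (y : measurableTypeR R) := (zl a y + c%:C)^-1 * gss s (zl a y).
(* The residue has to be an integral over the same space as the other two terms: a constant contour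
   with weight [K * gk 1], normalized by the Gaussian mass [sqrt pi]. *)
pose K := 2 * pi * expR (2^-1 * s * c ^+ 2) / Num.sqrt pi.
pose w (i : 'I_3) (y : measurableTypeR R) : R[i] := match val i with
  | 0%N => p0 a y | 1%N => - p0 b y | _ => - (K * gk 1 y)%:C end.
pose Z (i : 'I_3) (y : measurableTypeR R) (j : nat) : R[i] := match val i with
  | 0%N => zl a y | 1%N => zl b y | _ => (- c)%:C end.
pose p3 (y : measurableTypeR R) : R[i] := (K * gk 1 y)%:C.
have mgk : cmeas p3.
  apply: cmeas_real; apply: measurable_funM => //.
  by apply: measurable_RM; exact: measurable_gk.
have mp d : (forall y, zl d y + c%:C != 0) -> cmeas (p0 d).
  move=> d0; apply: cmeasM; last exact: cmeas_gss.
  by apply: cmeasV => //; apply: cmeasD; [exact: cmeas_zl|exact: cmeas_cst].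
have da y : zl a y + c%:C != 0.
  by apply: Re_gt0_neq0; rewrite RezD Rez_zl RezC -ltrBlDr sub0r.
have db y : zl b y + c%:C != 0.
  by apply: Re_lt0_neq0; rewrite RezD Rez_zl RezC -ltrBrDr sub0r.
have cnp d y : d + c != 0 -> cn (p0 d y) <= `|d + c|^-1 * cn (gss s (zl d y)).
  move=> d0; rewrite /p0 cnM cnV ler_wpM2r ?cn_ge0 // lef_pV2 ?posrE ?normr_gt0 //.
    by apply: le_trans (Rez_le_cn _); rewrite RezD Rez_zl RezC.
  apply: cn_gt0; apply/eqP => /(congr1 (@Rez R)); rewrite RezD Rez_zl RezC => /eqP.
  by rewrite (negbTE d0).
have jp d m : (forall y, zl d y + c%:C != 0) -> d + c != 0 ->
    rintegrable leb (fun y => cn (p0 d y) * (1 + cn (zl d y)) ^+ m).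
  move=> d0 d1; apply: (rintegrable_le (mu := leb)
    (W := fun y => `|d + c|^-1 * (cn (gss s (zl d y)) * (1 + cn (zl d y)) ^+ m))).
  - apply: measurable_funM; first by apply: cmeas_cn; exact: mp.
    by apply: measurable_funX; apply: measurable_funD => //; apply: cmeas_cn; exact: cmeas_zl.
  - move=> y; rewrite ger0_norm ?mulr_ge0 ?exprn_ge0 ?addr_ge0 ?cn_ge0 //.
    by rewrite mulrA ler_wpM2r ?exprn_ge0 ?addr_ge0 ?cn_ge0 // cnp.
  - by apply: rintegrableZ; exact: rintegrable_gss_poly.
have ac0 : a + c != 0 by rewrite gt_eqF // -ltrBlDr sub0r.
have bc0 : b + c != 0 by rewrite lt_eqF // -ltrBrDr sub0r.
have K0 : 0 <= K by rewrite !mulr_ge0 ?invr_ge0 ?sqrtr_ge0 ?expR_ge0 ?pi_ge0.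
have IK (u : R[i]) : cintg leb (fun y => - p3 y * u) =
    - (2 * pi * expR (2^-1 * s * c ^+ 2))%:C * u.
  transitivity (cintg leb (fun y => - u * ((gk 1 y)%:C * K%:C))).
    by apply: eq_cintg => y; rewrite /p3 CM; ring.
  transitivity (- u * K%:C * (cintg leb (fun y => (gk 1 y)%:C * cexp (0 * y%:C)))).
    rewrite -cintgZ; first by apply: eq_cintg => y; rewrite mul0r cexp0 mulr1; ring.
    apply: (cintegrable_le (mu := leb) (W := gk 1)).
    - apply: cmeasM; first by apply: cmeas_real; apply: measurable_RM; exact: measurable_gk.
      by under eq_fun do rewrite mul0r; exact: cmeas_cst.
    - by move=> y; rewrite mul0r cexp0 mulr1 cnR ger0_norm ?gk_ge0.
    - exact: rintegrable_gk.
  rewrite cintg_gk_cexp // expr0n /= mul0r cexp0 mulr1 divr1 -mulrA -CM.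
  rewrite /K divfK ?gt_eqF ?sqrtr_gt0 ?pi_gt0 //; ring.
have S f : cintegrable leb (fun y => p0 b y * f (zl b y)) ->
    \sum_(i < 3) cintg leb (fun y => w i y * f (Z i y 0%N)) =
    cintg leb (fun y => p0 a y * f (zl a y)) - cintg leb (fun y => p0 b y * f (zl b y))
    - f (- c)%:C * (2 * pi * expR (2^-1 * s * c ^+ 2))%:C.
  move=> jf; rewrite !big_ord_recl big_ord0 /w /Z /= addr0 addrA; congr (_ + _ + _).
    by rewrite -cintgN //; apply: eq_cintg => y; rewrite mulNr.
  by have := IK (f (- c)%:C); rewrite /p3 => ->; rewrite mulNr mulrC.
have ba : b <= a by rewrite ltW // (lt_trans bc ca).
have ZD i y : strip b a (Z i y).
  case: i => -[|[|i]] Hi.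
  - by suff : b <= Rez (zl a y) <= a by []; rewrite Rez_zl ba lexx.
  - by suff : b <= Rez (zl b y) <= a by []; rewrite Rez_zl ba lexx.
  - by suff : b <= - c <= a by []; rewrite !ltW.
have mw i : cmeas (w i).
  rewrite /w; case: i => -[|[|i]] Hi /=; [exact: mp|apply: cmeasN; exact: mp|].
  by apply: cmeasN; exact: mgk.
have mZ i j : (j < 1)%N -> cmeas (fun y => Z i y j).
  by move=> _; rewrite /Z; case: i => -[|[|i]] Hi /=; [exact: cmeas_zl|exact: cmeas_zl|exact: cmeas_cst].
have ReZ i y j : (j < 1)%N -> `|Rez (Z i y j)| <= `|a| + `|b|.
  move=> j0; have := ZD i y; rewrite /strip (_ : Z i y 0%N = Z i y j); last by case: j j0.
  move=> /andP[h1 h2]; have := ler_norm a; have := ler_norm (- b); rewrite normrN.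
  have := normr_ge0 a; have := normr_ge0 b; rewrite ler_norml; lra.
have jw i m : rintegrable leb (fun y => cn (w i y) * nrm 1 (Z i y) ^+ m).
  case: i => -[|[|i]] Hi.
  - by have := jp a m da ac0; congr rintegrable; apply/funext => y; rewrite /nrm big_ord1.
  - by have := jp b m db bc0; congr rintegrable; apply/funext => y; rewrite /nrm big_ord1 -[cn (p0 b y)]cnN.
  - apply: (rintegrable_le (mu := leb) (W := fun y => (1 + `|c|) ^+ m * (K * gk 1 y))).
    + apply: measurable_funM; last first.
        by apply: measurable_funX; apply: measurable_nrm => j j1; exact: mZ.
      by apply: cmeas_cn; apply: (cmeasN mgk).
    + move=> y; rewrite /nrm big_ord1 (_ : w _ _ = - p3 y) // (_ : Z _ _ _ = (- c)%:C) // cnN !cnR normrN normrM normr_id [`|_ ^+ m|]ger0_norm ?exprn_ge0 ?addr_ge0 //.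
      by have g0 := mulr_ge0 K0 (gk_ge0 1 y); rewrite (ger0_norm g0) mulrC.
    + by do 2 apply: rintegrableZ; exact: rintegrable_gk.
have TI := @transfer_integrable R 1 _ _ leb 3 w Z (`|a| + `|b|) mw mZ ReZ jw (strip b a).
have H0 (x' : nat -> R) : \sum_(i < 3) cintg leb (fun y => w i y * cexp (dotz 1 x' (Z i y))) = 0.
  under eq_bigr do under eq_cintg do rewrite dotz1.
  rewrite (S (fun z => cexp ((x' 0%N)%:C * z))); last first.
    have := TI (fun=> 1) x' (Ordinal (isT : (1 < 3)%N)) (tcl1 _ _) (ZD _).
    have -> : (fun y => w (Ordinal (isT : (1 < 3)%N)) y * 1 * cexp (dotz 1 x' (Z (Ordinal (isT : (1 < 3)%N)) y))) =
      fun y => - (p0 b y * cexp ((x' 0%N)%:C * zl b y)).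
      by apply/funext => y; rewrite mulr1 dotz1 /w /Z /= mulNr.
    by move=> /cintegrableN; congr cintegrable; apply/funext => y; rewrite opprK.
  apply/eqP; rewrite subr_eq0; apply/eqP.
  transitivity ((2 * pi * expR (2^-1 * s * c ^+ 2 - c * x' 0%N))%:C).
    by rewrite -(pole_crossing (x' 0%N) s0 bc ca); congr (_ - _); apply: eq_cintg => y; rewrite /p0 -mulrA.
  by rewrite -CM cexpR -CM; congr (real_complex R _); rewrite [RHS]mulrC -[RHS]mulrA -expRD; congr (_ * expR _); ring.
have := @transfer R 1 _ _ leb 3 w Z _ mw mZ ReZ jw H0 (strip b a) (fun z => h (z 0%N)) (fun=> x) hs ZD.
under eq_bigr do under eq_cintg do rewrite dotz1 -mulrA.
rewrite (S (fun z => h z * cexp (x%:C * z))); last first.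
  have := TI (fun z => h (z 0%N)) (fun=> x) (Ordinal (isT : (1 < 3)%N)) hs (ZD _).
  have -> : (fun y => w (Ordinal (isT : (1 < 3)%N)) y * h (Z (Ordinal (isT : (1 < 3)%N)) y 0%N) *
       cexp (dotz 1 (fun=> x) (Z (Ordinal (isT : (1 < 3)%N)) y))) =
    fun y => - (p0 b y * (h (zl b y) * cexp (x%:C * zl b y))).
    by apply/funext => y; rewrite dotz1 -mulrA /w /Z /= mulNr.
  by move=> /cintegrableN; congr cintegrable; apply/funext => y; rewrite opprK.
have G d : cintg leb (fun y => p0 d y * (h (zl d y) * cexp (x%:C * zl d y))) =
  cintg leb (fun y => (zl d y + c%:C)^-1 * (h (zl d y) * (gss s (zl d y) * cexp (x%:C * zl d y)))).
  by apply: eq_cintg => y; rewrite /p0 -mulrA; congr (_ * _); rewrite mulrCA.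
rewrite !G => /eqP; rewrite subr_eq0 subr_eq addrC => /eqP ->; congr (_ + _).
rewrite -[LHS]mulrA; congr (_ * _).
by rewrite -CM cexpR -CM; congr (real_complex R _); rewrite [LHS]mulrC -[LHS]mulrA -expRD; congr (_ * expR _); ring.
Qed.
End OneBody.

Arguments Normc.normc : simpl never.
Arguments complex.Re : simpl never.
Arguments complex.Im : simpl never.
Arguments cexp : simpl never.
Arguments zl : simpl never.
Arguments gss : simpl never.

(** * Gaussian functionals of several variables and permutations of their contours *)

Section GaussianFunctional.
Variable R : realType.
Local Notation leb := [the {sigma_finite_measure set (measurableTypeR R) -> \bar R} of @lebesgue_measure R].

Definition gx n (s : R) (x : nat -> R) (z : nat -> R[i]) : R[i] :=
  \prod_(j < n) (gss s (z j) * cexp ((x j)%:C * z j)).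

Definition gint n (s : R) (x : nat -> R) (a : nat -> R) (H : (nat -> R[i]) -> R[i]) : R[i] :=
  cintg (lebn R n) (fun t => gx n s x (zc a t) * H (zc a t)).

(** Polynomial growth along the contours [a]. The bound is a product over the variables, the form
    that gives integrability over the product space. *)
Definition pbd n (a : nat -> R) (H : (nat -> R[i]) -> R[i]) : Prop :=
  cmeas (fun t : RT R n => H (zc a t)) /\
  exists C m, 0 <= C /\ forall f : nat -> R,
    cn (H (zline n a f)) <= C * \prod_(j < n) (1 + cn (zl (a j) (f j))) ^+ m.

Lemma zline_zl n (a f : nat -> R) j : (j < n)%N -> zline n a f j = zl (a j) (f j).
Proof. by rewrite /zline => ->. Qed.

Lemma zc_zl n (a : nat -> R) (t : RT R n) j : (j < n)%N -> zc a t j = zl (a j) (coord t j).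
Proof. exact: zline_zl. Qed.

Lemma prod_1cn_ge1 n (a f : nat -> R) m : 1 <= \prod_(j < n) (1 + cn (zl (a j) (f j))) ^+ m.
Proof.
apply: (big_ind (fun u => 1 <= u)) => //; first by move=> u v u1 v1; rewrite mulr_ege1.
by move=> i _; rewrite exprn_ege1 // lerDl cn_ge0.
Qed.

Lemma pbd_cst n a c : pbd n a (fun=> c).
Proof.
split; first exact: cmeas_cst.
exists (cn c), 0%N; split; first exact: cn_ge0.
by move=> f; rewrite big1 ?mulr1 // => i _; rewrite expr0.
Qed.

Lemma pbdM n a H1 H2 : pbd n a H1 -> pbd n a H2 -> pbd n a (fun z => H1 z * H2 z).
Proof.
move=> [m1 [C1 [e1 [C10 h1]]]] [m2 [C2 [e2 [C20 h2]]]]; split; first exact: cmeasM.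
exists (C1 * C2), (e1 + e2)%N; split; first exact: mulr_ge0.
move=> f; rewrite cnM; under eq_bigr do rewrite exprD.
by rewrite big_split /= mulrACA ler_pM ?cn_ge0.
Qed.

Lemma pbd_prod n a (I : Type) (r : seq I) (P : pred I) (F : I -> (nat -> R[i]) -> R[i]) :
  (forall i, P i -> pbd n a (F i)) -> pbd n a (fun z => \prod_(i <- r | P i) F i z).
Proof.
move=> HF; elim: r => [|i r IH].
  by have := pbd_cst n a 1; congr pbd; apply/funext => z; rewrite big_nil.
case Pi: (P i).
  by have := pbdM (HF i Pi) IH; congr pbd; apply/funext => z; rewrite big_cons Pi.
by move: IH; congr pbd; apply/funext => z; rewrite big_cons Pi.
Qed.

Lemma pbd_ext n a H1 H2 : H1 =1 H2 -> pbd n a H1 -> pbd n a H2.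
Proof. by move=> /funext ->. Qed.

Lemma pbd_lin n a (u v : R) (c : R[i]) j k : (j < n)%N -> (k < n)%N ->
  pbd n a (fun z => u%:C * z j + v%:C * z k + c).
Proof.
move=> jn kn; split.
  apply: cmeasD; [apply: cmeasD|].
  - by apply: cmeasM; [exact: cmeas_cst|exact: cmeas_zc].
  - by apply: cmeasM; [exact: cmeas_cst|exact: cmeas_zc].
  - exact: cmeas_cst.
exists (`|u| + `|v| + cn c), 1%N; split; first by rewrite !addr_ge0 ?cn_ge0.
move=> f; have B i : (i < n)%N -> cn (zline n a f i) <= \prod_(j < n) (1 + cn (zl (a j) (f j))) ^+ 1.
  move=> ni; rewrite zline_zl // (bigD1 (Ordinal ni)) //= expr1.
  apply: (@le_trans _ _ (1 + cn (zl (a i) (f i)))); first by rewrite lerDr.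
  rewrite ler_peMr ?addr_ge0 ?cn_ge0 //.
  apply: (big_ind (fun u => 1 <= u)) => //; first by move=> u' v' u1 v1; rewrite mulr_ege1.
  by move=> l _; rewrite exprn_ege1 // lerDl cn_ge0.
apply: (le_trans (cnD _ _)); rewrite !mulrDl lerD //; last first.
  by rewrite ler_peMr ?cn_ge0 // prod_1cn_ge1.
by apply: (le_trans (cnD _ _)); rewrite lerD // cnM cnR ler_wpM2l // B.
Qed.

Lemma pbd_inv n a (l : (nat -> R[i]) -> R[i]) (r : R) : r != 0 ->
  (forall f, Rez (l (zline n a f)) = r) -> pbd n a l -> pbd n a (fun z => (l z)^-1).
Proof.
move=> r0 lr [ml _].
have l0 f : l (zline n a f) != 0.
  by apply: contra_neq r0 => h; rewrite -(lr f) h.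
split; first by apply: cmeasV => // t; exact: l0.
exists `|r|^-1, 0%N; split; first by rewrite invr_ge0.
move=> f; rewrite big1 ?mulr1 => [|i _]; last by rewrite expr0.
rewrite cnV lef_pV2 ?posrE ?normr_gt0 ?cn_gt0 //.
by rewrite -(lr f) Rez_le_cn.
Qed.

Lemma pbd_sc n a lo hi h j : sc lo hi h -> (j < n)%N -> lo <= a j <= hi ->
  pbd n a (fun z => h (z j)).
Proof.
move=> hs jn aj; split.
  apply: (sc_meas hs); last exact: cmeas_zc.
  by move=> t; rewrite zc_zl // Rez_zl.
have [C [m [C0 H]]] := sc_bound hs; exists C, m; split => // f.
rewrite zline_zl //; have := H (zl (a j) (f j)); rewrite Rez_zl => /(_ aj) h1.
apply: (le_trans h1); rewrite ler_wpM2l //.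
rewrite (bigD1 (Ordinal jn)) //= ler_peMr ?exprn_ge0 ?addr_ge0 ?cn_ge0 //.
apply: (big_ind (fun u => 1 <= u)) => //; first by move=> u' v' u1 v1; rewrite mulr_ege1.
by move=> l _; rewrite exprn_ege1 // lerDl cn_ge0.
Qed.

Definition gW (s : R) (x a : nat -> R) m j (y : R) : R :=
  expR (x j * a j) * (cn (gss s (zl (a j) y)) * (1 + cn (zl (a j) y)) ^+ m).

Lemma gW_ge0 s x a m j y : 0 <= gW s x a m j y.
Proof. by rewrite /gW !mulr_ge0 ?expR_ge0 ?cn_ge0 ?exprn_ge0 ?addr_ge0 ?cn_ge0. Qed.

Lemma rintegrable_gW s x a m j : 0 < s -> rintegrable leb (gW s x a m j).
Proof. by move=> s0; apply: rintegrableZ; exact: rintegrable_gss_poly. Qed.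

Lemma cmeas_gx n s x a : cmeas (fun t : RT R n => gx n s x (zc a t)).
Proof.
apply: cmeas_prod => j _; apply: cmeasM; apply: cmeas_cexp; apply: cmeasM;
  rewrite ?cmeas_cst //; try exact: cmeas_cst; last exact: cmeas_zc.
by apply: cmeasX; exact: cmeas_zc.
Qed.

Lemma pbd_bound n s x a H : pbd n a H -> exists C m, 0 <= C /\ forall f,
  cn (gx n s x (zline n a f) * H (zline n a f)) <= C * \prod_(j < n) gW s x a m j (f j).
Proof.
move=> [_ [C [m [C0 h]]]]; exists C, m; split => // f.
rewrite cnM /gx cn_prod; under [X in _ <= _ * X]eq_bigr do rewrite /gW mulrA.
rewrite [X in _ <= _ * X]big_split /= [leRHS]mulrCA ler_pM ?cn_ge0 ?prodr_ge0 //.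
  by move=> i _; exact: cn_ge0.
apply: ler_prod => i _; rewrite cn_ge0 /= zline_zl // cnM cn_cexp RezCM Rez_zl mulrC //.
Qed.

Lemma gint_integrable n s x a H : 0 < s -> pbd n a H ->
  cintegrable (lebn R n) (fun t => gx n s x (zc a t) * H (zc a t)).
Proof.
move=> s0 Hp; have [C [m [C0 h]]] := pbd_bound s x Hp.
apply: (cintegrable_le (mu := lebn R n) (W := fun t => C * \prod_(j < n) gW s x a m j (coord t j))).
- by apply: cmeasM; [exact: cmeas_gx|case: Hp].
- by move=> t; exact: h.
- apply: rintegrableZ; apply: (rintegrable_pw (m := leb)) => j _; exact: rintegrable_gW.
Qed.

Lemma contour_gint n s x a H : 0 < s -> pbd n a H ->
  contour_iter n a (fun z => gx n s x z * H z) = (((2 * pi)^-1)%:C) ^+ n * gint n s x a H.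
Proof.
move=> s0 Hp; have [C [m [C0 h]]] := pbd_bound s x Hp.
apply: (contour_iterE (W := gW s x a m) C0) => //.
- by move=> j r; exact: gW_ge0.
- by move=> j _; exact: rintegrable_gW.
- by apply: cmeasM; [exact: cmeas_gx|case: Hp].
Qed.

(** The two instances are an adjacent transposition and the reversal of the order. *)
Definition involn n (f : nat -> nat) := forall j, (j < n)%N -> (f j < n)%N /\ f (f j) = j.

Lemma big_involn (T : Type) (idx : T) (op : Monoid.com_law idx) n f (F : nat -> T) : involn n f ->
  \big[op/idx]_(j < n) F (f j) = \big[op/idx]_(j < n) F j.
Proof.
move=> fi; pose g (i : 'I_n) := Ordinal (proj1 (fi i (ltn_ord i))).
rewrite [RHS](reindex g) //; exists g => i _; apply: val_inj;
  exact: (proj2 (fi i (ltn_ord i))).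
Qed.

Lemma gx_dotz n s x z : gx n s x z = (\prod_(j < n) gss s (z j)) * cexp (dotz n x z).
Proof. by rewrite /gx big_split /= /dotz cexp_sum. Qed.

Lemma nrm_le_prod n (z : nat -> R[i]) : nrm n z <= \prod_(j < n) (1 + cn (z j)).
Proof.
rewrite /nrm; elim: n => [|n IH]; first by rewrite !big_ord0 addr0.
rewrite !big_ord_recr /= addrA.
have h0 : 0 <= \sum_(j < n) cn (z j) by apply: sumr_ge0 => i _; exact: cn_ge0.
apply: (@le_trans _ _ ((1 + \sum_(j < n) cn (z j)) * (1 + cn (z n)))); last first.
  by rewrite ler_wpM2r // addr_ge0 ?cn_ge0.
have := mulr_ge0 h0 (cn_ge0 (z n)); lra.
Qed.

Lemma cmeas_pgss n s (a : nat -> R) : cmeas (fun t : RT R n => \prod_(j < n) gss s (zc a t j)).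
Proof.
apply: cmeas_prod => j _; apply: cmeas_cexp; apply: cmeasM; first exact: cmeas_cst.
by apply: cmeasX; exact: cmeas_zc.
Qed.

Lemma rintegrable_pgss n s (a : nat -> R) m : 0 < s ->
  rintegrable (lebn R n) (fun t => cn (\prod_(j < n) gss s (zc a t j)) * nrm n (zc a t) ^+ m).
Proof.
move=> s0; apply: (rintegrable_le (mu := lebn R n)
  (W := fun t => \prod_(j < n) gW s (fun=> 0) a m j (coord t j))).
- apply: measurable_funM; first by apply: cmeas_cn; exact: cmeas_pgss.
  by apply: measurable_funX; apply: measurable_nrm => j _; exact: cmeas_zc.
- move=> t; rewrite ger0_norm ?mulr_ge0 ?cn_ge0 ?exprn_ge0 ?nrm_ge0 //.
  rewrite cn_prod /gW; under [leRHS]eq_bigr do rewrite mul0r expR0 mul1r.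
  rewrite big_split /= ler_pM ?prodr_ge0 ?exprn_ge0 ?nrm_ge0 //.
  + by move=> i _; exact: cn_ge0.
  + by apply: ler_prod => i _; rewrite cn_ge0 /= zc_zl.
  + rewrite prodrXl lerXn2r ?nnegrE ?nrm_ge0 ?prodr_ge0 // => [i _|].
      by rewrite addr_ge0 ?cn_ge0.
    apply: (le_trans (nrm_le_prod _ _)); apply: ler_prod => i _.
    by rewrite addr_ge0 ?cn_ge0 //= zc_zl.
- apply: (rintegrable_pw (m := leb)) => j _; exact: rintegrable_gW.
Qed.

Lemma gint1 n s x (a : nat -> R) : 0 < s ->
  cintg (lebn R n) (fun t => gx n s x (zc a t)) = \prod_(j < n) (vgauss s (x j))%:C.
Proof.
move=> s0; transitivity (cintg (lebn R n) (fun t => \prod_(j < n)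
  (fun j y => gss s (zl (a j) y) * cexp ((x j)%:C * zl (a j) y)) j (coord t j))).
  by apply: eq_cintg => t; apply: eq_bigr => i _; rewrite zc_zl.
rewrite (cintg_pw (m := leb)
  (W := fun j y => gss s (zl (a j) y) * cexp ((x j)%:C * zl (a j) y))) => [|j _].
  by apply: eq_bigr => j _; rewrite cintg_gss.
apply: (cintegrable_le (mu := leb) (W := fun y => expR (2^-1 * s * (a j) ^+ 2 + x j * a j) * gk (2^-1 * s) y)).
- exact: cmeas_gss_exp.
- by move=> y; rewrite cn_gss_exp.
- by apply: rintegrableZ; apply: rintegrable_gk; rewrite mulr_gt0.
Qed.

(** For pure exponentials both sides equal the product of the [vgauss s (x j)], which is even in
    each [x j] and symmetric; this is the identity fed into [transfer]. It is used with [eps = 1]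
    and an adjacent transposition, and with [eps = -1] and the reversal of the order. *)
Lemma perm_transfer n (f : nat -> nat) (eps : R) (a a2 : nat -> R) (s : R) x D h :
  0 < s -> eps ^+ 2 = 1 -> involn n f -> tcl n D h ->
  (forall t : RT R n, D (zc a t)) ->
  (forall t : RT R n, D (fun j => eps%:C * zc a2 t (f j))) ->
  gint n s x a h = cintg (lebn R n) (fun t => gx n s x (fun j => eps%:C * zc a2 t (f j)) *
    h (fun j => eps%:C * zc a2 t (f j))).
Proof.
move=> s0 e2 fi hD D1 D2.
have eC2 : eps%:C ^+ 2 = 1 :> R[i] by rewrite -rmorphXn e2.
pose Z2 (t : RT R n) (j : nat) : R[i] := eps%:C * zc a2 t (f j).
pose Z (i : 'I_2) (t : RT R n) : nat -> R[i] := if val i is 0%N then zc a t else Z2 t.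
pose P2 (t : RT R n) : R[i] := \prod_(j < n) gss s (zc a2 t j).
pose w (i : 'I_2) (t : RT R n) : R[i] :=
  if val i is 0%N then \prod_(j < n) gss s (zc a t j) else - P2 t.
have P2E t : \prod_(j < n) gss s (Z2 t j) = P2 t.
  rewrite /P2 -(big_involn _ (fun j => gss s (zc a2 t j)) fi); apply: eq_bigr => j _.
  by rewrite /gss /Z2 exprMn eC2 mul1r.
have absE : `|eps| = 1.
  by apply/eqP; rewrite -(@eqrXn2 _ 2) // -normrX e2 normr1 expr1n.
have N2 t : nrm n (Z2 t) = nrm n (zc a2 t).
  rewrite /nrm; congr (_ + _); rewrite -(big_involn _ (fun j => cn (zc a2 t j)) fi).
  by apply: eq_bigr => j _; rewrite /Z2 cnM cnR absE mul1r.
have mw i : cmeas (w i).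
  by case: i => -[|i] Hi; [exact: cmeas_pgss|apply: cmeasN; exact: cmeas_pgss].
have mZ i j : (j < n)%N -> cmeas (fun t => Z i t j).
  move=> _; case: i => -[|i] Hi; first exact: cmeas_zc.
  by apply: cmeasM; [exact: cmeas_cst|exact: cmeas_zc].
have ReZ i t j : (j < n)%N -> `|Rez (Z i t j)| <= \sum_(k < n) `|a k| + \sum_(k < n) `|a2 k|.
  have B (b : nat -> R) k : (k < n)%N -> `|b k| <= \sum_(k < n) `|b k|.
    by move=> kn; rewrite (bigD1 (Ordinal kn)) //= lerDl sumr_ge0.
  have S (b : nat -> R) : 0 <= \sum_(k < n) `|b k| by rewrite sumr_ge0.
  move=> jn; case: i => -[|i] Hi.
    by rewrite /Z /= zc_zl // Rez_zl (le_trans (B a j jn)) // lerDl.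
  have [fj _] := fi j jn.
  by rewrite /Z /= /Z2 RezCM zc_zl // Rez_zl normrM absE mul1r (le_trans (B a2 _ fj)) // lerDr.
have jw i m : rintegrable (lebn R n) (fun t => cn (w i t) * nrm n (Z i t) ^+ m).
  case: i => -[|i] Hi; first exact: rintegrable_pgss.
  have := @rintegrable_pgss n s a2 m s0; congr rintegrable; apply/funext => t.
  by rewrite /Z /w /= cnN N2.
have ZD i t : D (Z i t) by case: i => -[|i] Hi; [exact: D1|exact: D2].
have H0 (x' : nat -> R) : \sum_(i < 2) cintg (lebn R n) (fun t => w i t * cexp (dotz n x' (Z i t))) = 0.
  rewrite !big_ord_recl big_ord0 addr0.
  have -> : cintg (lebn R n) (fun t => w ord0 t * cexp (dotz n x' (Z ord0 t))) =
      \prod_(j < n) (vgauss s (x' j))%:C.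
    by rewrite -(@gint1 n s x' a s0); apply: eq_cintg => t; rewrite gx_dotz.
  have E : (fun t : RT R n => w (lift ord0 ord0) t * cexp (dotz n x' (Z (lift ord0 ord0) t))) =
      (fun t : RT R n => - gx n s (fun j => eps * x' (f j)) (zc a2 t)).
    apply/funext => t; rewrite gx_dotz /w /Z /= mulNr; congr (- (_ * cexp _)).
    rewrite /dotz -(big_involn _ (fun j => (eps * x' (f j))%:C * zc a2 t j) fi).
    apply: eq_bigr => j _; have [_ ->] := fi j (ltn_ord j).
    by rewrite /Z2 CM mulrA [_ * eps%:C]mulrC.
  rewrite E cintgN; last first.
    have := gint_integrable (fun j => eps * x' (f j)) s0 (pbd_cst n a2 1).
    by congr cintegrable; apply/funext => t; rewrite mulr1.
  rewrite gint1 //; apply/eqP; rewrite subr_eq0; apply/eqP.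
  rewrite -(big_involn _ (fun j => (vgauss s (x' j))%:C) fi); apply: eq_bigr => j _.
  by rewrite /vgauss exprMn e2 mul1r.
have TI i : cintegrable (lebn R n) (fun t => w i t * h (Z i t) * cexp (dotz n x (Z i t))).
  exact: (transfer_integrable mw mZ ReZ jw x hD (ZD i)).
have := transfer mw mZ ReZ jw H0 x hD ZD.
rewrite !big_ord_recl big_ord0 addr0.
have -> : cintg (lebn R n) (fun t => w ord0 t * h (Z ord0 t) * cexp (dotz n x (Z ord0 t))) =
    gint n s x a h.
  by apply: eq_cintg => t; rewrite gx_dotz mulrAC.
have E : (fun t : RT R n => w (lift ord0 ord0) t * h (Z (lift ord0 ord0) t) *
      cexp (dotz n x (Z (lift ord0 ord0) t))) =
    (fun t : RT R n => - (gx n s x (Z2 t) * h (Z2 t))).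
  by apply/funext => t; rewrite gx_dotz P2E /w /Z /= mulrAC !mulNr.
rewrite E cintgN; last first.
  have := TI (lift ord0 ord0); rewrite E => /cintegrableN; congr cintegrable.
  by apply/funext => t; rewrite opprK.
by move=> /eqP; rewrite subr_eq0 => /eqP.
Qed.
End GaussianFunctional.

(** * The first of several variables crosses its pole *)

Section LeftStep.
Variable R : realType.
Local Notation leb := [the {sigma_finite_measure set (measurableTypeR R) -> \bar R} of @lebesgue_measure R].

Definition pairf (th : R) n (z : nat -> R[i]) : R[i] :=
  \prod_(B < n) \prod_(A < n | (A < B)%N) ((z B - z A) / (z B - th%:C * z A)).

(* The integrand without Gaussian factors: [G z] stands for [(tau - 1) / z], and the pole [- c] moves to [- (th * c)] each time
   a residue is taken. *)
Definition hg (th : R) (G : R[i] -> R[i]) (c : R) n (z : nat -> R[i]) : R[i] :=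
  (\prod_(j < n) (G (z j) * (z j + c%:C)^-1)) * pairf th n z.

(* The factor left in the other variables when one variable is frozen at [zeta]. *)
Definition rho (th : R) (zeta z : R[i]) : R[i] := (z - zeta) / (z - th%:C * zeta).

Definition headset (b : R) (a : nat -> R) : nat -> R := fun k => if k is k'.+1 then a k else b.

Definition IQ (th s : R) n (a x : nat -> R) G c : R[i] := gint n s x a (hg th G c n).

Lemma gx_cons n s x z0 (w : nat -> R[i]) : gx n.+1 s x (cons_seq z0 w) =
  gss s z0 * cexp ((x 0%N)%:C * z0) * gx n s (fun k => x k.+1) w.
Proof. by rewrite /gx big_ord_recl. Qed.

Lemma pairf_cons th n z0 (w : nat -> R[i]) : pairf th n.+1 (cons_seq z0 w) =
  (\prod_(B < n) rho th z0 (w B)) * pairf th n w.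
Proof.
rewrite /pairf big_ord_recl big_pred0 // mul1r -big_split; apply: eq_bigr => B _ /=.
by rewrite big_mkcond big_ord_recl /= -big_mkcond.
Qed.

Lemma hg_cons th G c n z0 (w : nat -> R[i]) : hg th G c n.+1 (cons_seq z0 w) =
  G z0 * (z0 + c%:C)^-1 * ((\prod_(B < n) rho th z0 (w B)) * hg th G c n w).
Proof. by rewrite /hg pairf_cons big_ord_recl /= -!mulrA; congr (_ * (_ * _)); rewrite mulrCA. Qed.

Lemma hg_rho th G c n z0 (w : nat -> R[i]) :
  (\prod_(B < n) rho th z0 (w B)) * hg th G c n w = hg th (fun z => G z * rho th z0 z) c n w.
Proof.
rewrite /hg mulrA -big_split /=; congr (_ * _); apply: eq_bigr => j _.
by rewrite mulrA; congr (_ * _); rewrite mulrC.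
Qed.

Lemma zc_cons n (a : nat -> R) (t : RT R n.+1) :
  zc a t = cons_seq (zl (a 0%N) t.1) (zc (n := n) (fun k => a k.+1) t.2).
Proof. by rewrite /zc zline_cons. Qed.

Lemma pbd_hg th G c n (a : nat -> R) lo hi : sc lo hi G ->
  (forall j, (j < n)%N -> lo <= a j <= hi) ->
  (forall j, (j < n)%N -> a j + c != 0) ->
  (forall A B, (A < B)%N -> (B < n)%N -> th * a A < a B) -> pbd n a (hg th G c n).
Proof.
move=> hG al ac aAB; apply: pbdM.
  apply: pbd_prod => j _; apply: pbdM; first exact: (pbd_sc hG (ltn_ord j) (al j (ltn_ord j))).
  apply: (pbd_inv (ac j (ltn_ord j))).
    by move=> f; rewrite zline_zl // RezD Rez_zl RezC.
  apply: pbd_ext (pbd_lin a 1 0 c%:C (ltn_ord j) (ltn_ord j)).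
  by move=> z; rewrite mul1r mul0r addr0.
apply: pbd_prod => B _; apply: pbd_prod => A AB; apply: pbdM.
  apply: pbd_ext (pbd_lin a 1 (-1) 0 (ltn_ord B) (ltn_ord A)).
  by move=> z; rewrite mul1r CN mulN1r addr0.
apply: (@pbd_inv _ _ _ _ (a B - th * a A)).
- by rewrite subr_eq0 gt_eqF // aAB.
- by move=> f; rewrite !zline_zl // RezB RezCM !Rez_zl.
- apply: pbd_ext (pbd_lin a 1 (- th) 0 (ltn_ord B) (ltn_ord A)).
  by move=> z; rewrite mul1r CN mulNr addr0.
Qed.

Lemma sc_cst lo hi (c : R[i]) : sc lo hi (fun=> c).
Proof. by apply: sc_ext (sc_lin lo hi 0 c) => w; rewrite mul0r add0r. Qed.

(** As a function of the variable to be moved, the cross factor has its pole at [w / th], to the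
    right of the strip. A shift to the left therefore meets only the explicit pole [- c]. *)
Lemma sc_rho_l th lo hi (w : R[i]) : 0 < th -> th * hi < Rez w ->
  sc lo hi (fun z => rho th z w).
Proof.
move=> t0 tw; apply: scM.
  by apply: sc_ext (sc_lin lo hi (-1) w) => z; rewrite CN mulN1r addrC.
have k0 : 0 < Rez w - th * hi by rewrite subr_gt0.
apply: (sc_ext (h1 := fun z => ((- th)%:C * z + w)^-1)).
  by move=> z; rewrite CN mulNr addrC.
apply: (sc_inv k0) => z /andP[_ zh].
by rewrite RezD RezCM mulNr [leRHS]addrC lerD2l lerN2 ler_pM2l.
Qed.

Lemma tcl_sub n (D D' : (nat -> R[i]) -> Prop) h : (forall z, D' z -> D z) -> tcl n D h -> tcl n D' h.
Proof.
move=> DD; elim => [|v c h' _ IH|v c h' k k0 H _ IH]; first exact: tcl1.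
  exact: tcl_lin.
by apply: (tcl_inv k0) => // z /DD; exact: H.
Qed.

Lemma sc_sub (lo hi lo' hi' : R) h : lo <= lo' -> hi' <= hi -> sc lo hi h -> sc lo' hi' h.
Proof.
move=> l u; apply: tcl_sub => z /andP[h1 h2]; rewrite /strip.
by rewrite (le_trans l h1) (le_trans h2 u).
Qed.

Lemma hg_residue th G c n (w : nat -> R[i]) : (forall j, (j < n)%N -> w j + c%:C != 0) ->
  (\prod_(B < n) rho th (- c)%:C (w B)) * hg th G c n w = hg th G (th * c) n w.
Proof.
move=> wc; rewrite /hg mulrA -big_split /=; congr (_ * _); apply: eq_bigr => j _.
rewrite /rho CN mulrN !opprK -CM mulrACA -mulrA mulrC -!mulrA; congr (_ * _).
by rewrite mulVf ?mulr1 // wc.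
Qed.

(* At the residue [z_0 = - c] the cross factors [(z_B + c) / (z_B + th c)] turn the poles [- c] of the other variables into
   [- (th c)]. *)
Lemma left_step (th s : R) n (a x : nat -> R) G c b lo hi : 0 < s -> 0 < th -> sc lo hi G ->
  lo <= b -> b < - c -> (forall j, (j < n.+1)%N -> - c < a j) ->
  (forall j, (j < n.+1)%N -> lo <= a j <= hi) ->
  (forall A B, (A < B)%N -> (B < n.+1)%N -> th * a A < a B) ->
  (forall j, (j < n)%N -> - (th * c) < a j.+1) ->
  IQ th s n.+1 a x G c = IQ th s n.+1 (headset b a) x G c +
   G (- c)%:C * (2 * pi * expR (2^-1 * s * c ^+ 2 - c * x 0%N))%:C *
     IQ th s n (fun k => a k.+1) (fun k => x k.+1) G (th * c).
Proof.
move=> s0 t0 hG lob bc ca al aAB tca.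
have cb0 : b < a 0%N by apply: lt_trans bc (ca _ _).
have pa : pbd n.+1 a (hg th G c n.+1).
  by apply: (pbd_hg hG) => // j jn; rewrite gt_eqF // -ltrBlDr sub0r ca.
have pb : pbd n.+1 (headset b a) (hg th G c n.+1).
  apply: (pbd_hg hG).
  - move=> [|j] jn /=; last exact: al.
    by have /andP[_ h] := al 0%N isT; rewrite lob (le_trans (ltW cb0) h).
  - move=> [|j] jn /=; first by rewrite lt_eqF // -ltrBrDr sub0r.
    by rewrite gt_eqF // -ltrBlDr sub0r ca.
  - move=> [|A] [|B] //= AB Bn; last exact: aAB.
    by apply: lt_trans (aAB 0%N B.+1 isT Bn); rewrite ltr_pM2l.
have pr : pbd n (fun k => a k.+1) (hg th G (th * c) n).
  apply: (pbd_hg hG) => [j jn|j jn|A B AB Bn]; [exact: al| |exact: aAB].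
  by rewrite gt_eqF // -ltrBlDr sub0r tca.
pose x' k := x k.+1; pose a' k := a k.+1.
pose rest w := gx n s x' w * hg th G c n w.
pose h (w : nat -> R[i]) z := G z * (\prod_(B < n) rho th z (w B)) * rest w.
pose F d (t : measurableTypeR R * RT R n) :=
  (zl d t.1 + c%:C)^-1 * (h (zc a' t.2) (zl d t.1) * (gss s (zl d t.1) * cexp ((x 0%N)%:C * zl d t.1))).
have FE (d : nat -> R) : (forall k, d k.+1 = a k.+1) ->
    (fun t : RT R n.+1 => gx n.+1 s x (zc d t) * hg th G c n.+1 (zc d t)) = F (d 0%N).
  move=> da; apply/funext => t; rewrite zc_cons gx_cons hg_cons.
  have -> : (fun k => d k.+1) = a' by apply/funext => k; exact: da.
  rewrite /F /h /rest /x'.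
  move: (\prod_(B < n) _) (hg _ _ _ _ _) (gx _ _ _ _) (gss _ _) (cexp _) (G _) (_^-1).
  by move=> *; ring.
have IE (d : nat -> R) : (forall k, d k.+1 = a k.+1) -> pbd n.+1 d (hg th G c n.+1) ->
    IQ th s n.+1 d x G c = cintg (lebn R n) (fun w => cintg leb (fun y => F (d 0%N) (y, w))) /\
    cintegrable (lebn R n) (fun w => cintg leb (fun y => F (d 0%N) (y, w))).
  move=> da pd; have := gint_integrable x s0 pd; rewrite (FE d da) => jF.
  split; last exact: (cintegrable_fubini2 (m1 := leb) (m2 := lebn R n) jF).
  by rewrite (cintg_fubini2 (m1 := leb) (m2 := lebn R n) jF) /IQ /gint (FE d da).
have [-> ja] := IE a (fun=> erefl) pa.
have [-> jb] := IE (headset b a) (fun=> erefl) pb.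
(* For fixed values of the other variables this is [left1]; their cross factors with the moving
   variable are part of [h]. *)
have inner w : cintg leb (fun y => F (a 0%N) (y, w)) = cintg leb (fun y => F b (y, w)) +
   G (- c)%:C * (2 * pi * expR (2^-1 * s * c ^+ 2 - c * x 0%N))%:C *
     (gx n s x' (zc a' w) * hg th G (th * c) n (zc a' w)).
  have hs : sc b (a 0%N) (h (zc a' w)).
    apply: scM; last exact: sc_cst.
    apply: scM; first by apply: (sc_sub _ _ hG) => //; have /andP[] := al 0%N isT.
    apply: sc_prod => B _; apply: sc_rho_l => //.
    by rewrite (zc_zl _ _ (ltn_ord B)) Rez_zl; exact: (aAB 0%N B.+1 isT (ltn_ord B)).
  rewrite [LHS](left1 (x 0%N) s0 bc (ca 0%N isT) hs); congr (_ + _).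
  rewrite /h /rest -(@hg_residue th G c); last first.
    by move=> j jn; apply: Re_gt0_neq0; rewrite RezD zc_zl // Rez_zl RezC -ltrBlDr sub0r ca.
  move: (\prod_(B < n) _) (hg _ _ _ _ _) (gx _ _ _ _) (G _) ((_ * expR _)%:C).
  by move=> *; ring.
under eq_cintg do rewrite inner.
rewrite cintgD //; last by apply: cintegrableZ; exact: (gint_integrable x' s0 pr).
by rewrite cintgZ //; exact: (gint_integrable x' s0 pr).
Qed.

(** With the first variable fixed, the remaining integral is again of the form [IQ], with [rho]
    absorbed into [G]. A bound [C1] uniform in the fixed variable leaves one Gaussian integral. *)
Lemma far_bound (th s : R) n (a x : nat -> R) G c lo lo1 hi (W : R -> R) (C1 : R) :
  0 < s -> sc lo hi G -> lo <= lo1 -> (forall j, (j < n)%N -> lo1 <= a j.+1) -> (forall j, (j < n.+1)%N -> lo <= a j <= hi) ->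
  (forall j, (j < n.+1)%N -> a j + c != 0) ->
  (forall A B, (A < B)%N -> (B < n.+1)%N -> th * a A < a B) ->
  (forall y, sc lo1 hi (rho th (zl (a 0%N) y))) ->
  (forall y, cn (IQ th s n (fun k => a k.+1) (fun k => x k.+1)
      (fun z => G z * rho th (zl (a 0%N) y) z) c) <= C1) ->
  rintegrable leb W -> 
  (forall y, cn (gss s (zl (a 0%N) y) * cexp ((x 0%N)%:C * zl (a 0%N) y) *
     (G (zl (a 0%N) y) * (zl (a 0%N) y + c%:C)^-1)) <= W y) ->
  cn (IQ th s n.+1 a x G c) <= 2 * (Rintegral leb setT W * C1).
Proof.
move=> s0 hG l1 al1 al ac aAB hrho hC jW hW.
have pa : pbd n.+1 a (hg th G c n.+1) by exact: (pbd_hg hG).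
have jF := gint_integrable x s0 pa.
have E y : cintg (lebn R n) (fun w => gx n.+1 s x (zc a ((y, w) : RT R n.+1)) * hg th G c n.+1 (zc a ((y, w) : RT R n.+1))) =
   gss s (zl (a 0%N) y) * cexp ((x 0%N)%:C * zl (a 0%N) y) *
     (G (zl (a 0%N) y) * (zl (a 0%N) y + c%:C)^-1) *
   IQ th s n (fun k => a k.+1) (fun k => x k.+1) (fun z => G z * rho th (zl (a 0%N) y) z) c.
  rewrite /IQ /gint -cintgZ; last first.
    apply: (gint_integrable _ s0); apply: (pbd_hg (scM (sc_sub l1 (lexx _) hG) (hrho y))) => [j jn|j jn|A B AB Bn].
    - by rewrite al1 //=; have /andP[] := al j.+1 jn.
    - exact: ac.
    - exact: aAB.
  apply: eq_cintg => w; rewrite zc_cons /= gx_cons hg_cons hg_rho.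
  move: (hg _ _ _ _ _) (gx _ _ _ _) (gss _ _) (cexp _) (G _) (_^-1).
  by move=> *; ring.
have m1 := cmeas_fubini1 (m1 := leb) (m2 := lebn R n) jF.
rewrite {1}/IQ /gint -(cintg_fubini1 (m1 := leb) (m2 := lebn R n) jF) -RintegralZr //.
apply: (cn_cintg (mu := leb)) => //.
- move=> y; rewrite E cnM ler_pM ?cn_ge0 //; exact: hW.
- by under eq_fun do rewrite mulrC; exact: (rintegrableZ (mu := leb) C1 jW).
Qed.
End LeftStep.

(** * The limit of small time *)

Section FarLines.
Variable R : realType.
Local Notation leb := [the {sigma_finite_measure set (measurableTypeR R) -> \bar R} of @lebesgue_measure R].

(** [ka = s^(-1/2)] is the width of the Gaussian along the vertical line: in the variable [y / ka]
    all moments are of order 1, and the substitution contributes the factor [ka]. *)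
Lemma gauss_scale (e : nat) : exists Ce : R, 0 <= Ce /\ forall s ka : R, 0 < ka -> s * ka ^+ 2 = 1 ->
  rintegrable leb (fun y => (1 + `|y| / ka) ^+ e * gk (2^-1 * s) y) /\
  Rintegral leb setT (fun y => (1 + `|y| / ka) ^+ e * gk (2^-1 * s) y) <= Ce * ka.
Proof.
have [C [C0 hC]] := @poly_gk_le R (2^-1) e 0 ltac:(by []).
exists (C * Num.sqrt (pi * 4)); split; first by rewrite mulr_ge0 ?sqrtr_ge0 // ltW.
move=> s ka k0 sk.
have s0 : 0 < s by rewrite -(pmulr_lgt0 _ (exprn_gt0 2 k0)) sk.
have k0' : ka != 0 by exact: lt0r_neq0.
have sE : s = (ka ^+ 2)^-1.
  by rewrite -[LHS]mulr1 -(mulfV (expf_neq0 2 k0')) mulrA sk mul1r.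
have B (y : R) : (1 + `|y| / ka) ^+ e * gk (2^-1 * s) y <= C * gk (s / 4) y.
  have := hC (y / ka); rewrite mul0r expR0 mulr1 normrM normfV (gtr0_norm k0).
  rewrite /gk expr_div_n (_ : 2^-1 * (y ^+ 2 / ka ^+ 2) = 2^-1 * s * y ^+ 2); last first.
    by rewrite sE; field.
  rewrite (_ : 2^-1 / 2 * (y ^+ 2 / ka ^+ 2) = s / 4 * y ^+ 2) //.
  by rewrite sE; field; rewrite k0'.
have j4 : rintegrable leb (fun y => C * gk (s / 4) y).
  by apply: rintegrableZ; apply: rintegrable_gk; rewrite divr_gt0.
have P0 (y : R) : 0 <= (1 + `|y| / ka) ^+ e * gk (2^-1 * s) y.
  by rewrite mulr_ge0 ?gk_ge0 // exprn_ge0 // addr_ge0 // divr_ge0 // ltW.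
have j1 : rintegrable leb (fun y => (1 + `|y| / ka) ^+ e * gk (2^-1 * s) y).
  apply: (rintegrable_le (mu := leb) _ _ j4) => [|y]; last by rewrite ger0_norm.
  apply: measurable_funM; last by apply: measurable_RM; exact: measurable_gk.
  apply: measurable_funX; apply: measurable_funD => //; apply: measurable_funM => //.
split => //.
apply: (@le_trans _ _ (Rintegral leb setT (fun y => C * gk (s / 4) y))).
  apply: le_Rintegral => //.
rewrite RintegralZl //; last by apply: rintegrable_gk; rewrite divr_gt0.
rewrite Rintegral_gk ?divr_gt0 // -mulrA ler_wpM2l ?(ltW C0) //.
rewrite (_ : pi / (s / 4) = pi * 4 * ka ^+ 2).
  by rewrite sqrtrM ?mulr_ge0 ?pi_ge0 // sqrtr_sqr gtr0_norm.
by rewrite sE; field; rewrite k0'.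
Qed.

Lemma rho_bound (th : R) (zeta w : R[i]) (L : R) : 0 < th -> 0 < L ->
  L <= Rez (w - th%:C * zeta) -> cn (rho th zeta w) <= th^-1 + (1 + th^-1) * (cn w / L).
Proof.
move=> t0 L0 hL; have w0 : w - th%:C * zeta != 0 by apply: Re_gt0_neq0; exact: lt_le_trans hL.
have tC : th%:C != 0 :> R[i] by apply: Re_gt0_neq0.
have -> : rho th zeta w = (th^-1)%:C + (1 - th^-1)%:C * (w / (w - th%:C * zeta)).
  rewrite /rho CD CN; rewrite (_ : (th^-1)%:C = (th%:C)^-1); last by rewrite rmorphV // unitfE gt_eqF.
  by field; rewrite tC w0.
have ti0 : 0 <= th^-1 by rewrite invr_ge0 ltW.
apply: (le_trans (cnD _ _)); rewrite cnR ger0_norm // lerD2l cnM cnR ler_pM ?cn_ge0 //.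
  by rewrite (le_trans (ler_normB _ _)) // normr1 ger0_norm.
rewrite cnM cnV ler_wpM2l ?cn_ge0 // lef_pV2 ?posrE ?cn_gt0 //.
apply: (le_trans hL); apply: le_trans (Rez_le_cn _); exact: ler_norm.
Qed.
End FarLines.

(** * Far lines and residues: the induction over the variables *)

Section Bounding.
Variable R : realType.
Local Notation leb := [the {sigma_finite_measure set (measurableTypeR R) -> \bar R} of @lebesgue_measure R].
Variables (th c0 r b0 hi : R) (D Kx : nat).
(** [ct] covers the two uses: [th = tau < 1], and, after reflection, [th = 1 / tau] with
    [c0 = 0]. *)
Hypotheses (t0 : 0 < th) (c00 : 0 <= c0) (ct : forall k, c0 * th ^+ k <= c0).
Hypotheses (r0 : 0 < r) (r1 : r <= 2^-1) (rt : 2 * r <= th) (b00 : 0 < b0).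

(* With [ka = s^(-1/2)], the [d]-th frozen variable lies on the line [Re z = - lam ka d]; the ratio [r < th] between
   consecutive lines keeps them away from the poles of the cross factors. *)
Definition lam (ka : R) (d : nat) : R := b0 * r ^+ d * ka.

(** The last condition keeps all far lines at distance at least 1 to the left of every pole
    [- (c0 th^k)]. *)
Definition scal (ka s : R) := [/\ 1 <= ka, s * ka ^+ 2 = 1 & c0 + 1 <= lam ka D].

(** What the estimates need of [G]: no singularity between the far line and the contours,
    boundedness at the points where residues are taken, and size [1 / ka] on the far lines. The last
    is the decay of the factor [1 / z]; with the pole factor, again of order [1 / ka], and a
    Gaussian integral of order [ka], a far contribution is of order [1 / ka]. *)
Definition adm (ka : R) (e : nat) (M : R) (G : R[i] -> R[i]) (d : nat) :=
  [/\ sc (- lam ka d) hi G, forall k, (k <= Kx)%N -> cn (G (- (c0 * th ^+ k))%:C) <= M &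
    forall k (y : R), (d <= k <= D)%N -> cn (G (zl (- lam ka k) y)) <= M * ka^-1 * (1 + `|y| / ka) ^+ e].

(** [k] counts the residues already taken. The third condition is demanded for all [i <= j] so that
    it survives both operations on the first variable: dropping it with [k] unchanged, and dropping
    it with [k] raised by one. *)
Definition lin n k (a : nat -> R) :=
  [/\ forall A B, (A < B)%N -> (B < n)%N -> th * a A < a B,
      forall j, (j < n)%N -> a j <= hi &
      forall j i, (i <= j)%N -> (j < n)%N -> - (c0 * th ^+ (k + i)) < a j].

Definition rho_cst : R := th^-1 + (1 + th^-1) * (c0 + 2 / th * (1 + (b0 * r ^+ D)^-1)).

Lemma ct0 k : 0 <= c0 * th ^+ k.
Proof. by rewrite mulr_ge0 // exprn_ge0 // ltW. Qed.

Lemma lam_le ka d d' : 0 < ka -> (d <= d')%N -> lam ka d' <= lam ka d.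
Proof.
move=> k0 dd; rewrite /lam ler_pM2r // ler_pM2l //.
rewrite -(subnK dd) exprD ler_piMl ?exprn_ge0 ?(ltW r0) // exprn_ile1 ?(ltW r0) //.
by apply: (le_trans r1); rewrite invf_le1 // ler1n.
Qed.

Lemma lam_S ka d : 0 < ka -> 2 * lam ka d.+1 <= th * lam ka d.
Proof.
move=> k0; rewrite /lam exprS (_ : 2 * _ = 2 * r * (b0 * r ^+ d * ka)); last by ring.
by rewrite ler_wpM2r // !mulr_ge0 ?exprn_ge0 // ltW.
Qed.

Lemma scal_gt0 ka s : scal ka s -> [/\ 0 < ka, 0 < s & s <= 1].
Proof.
move=> [k1 sk _]; have k0 : 0 < ka by exact: lt_le_trans k1.
have s0 : 0 < s by rewrite -(pmulr_lgt0 _ (exprn_gt0 2 k0)) sk.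
split => //; rewrite -sk ler_peMr ?(ltW s0) //.
by rewrite exprn_ege1.
Qed.

Lemma scal_lam ka s d : scal ka s -> (d <= D)%N -> c0 + 1 <= lam ka d.
Proof.
move=> sk dD; have [k0 _ _] := scal_gt0 sk; case: sk => _ _ h.
exact: le_trans h (lam_le k0 dD).
Qed.

Lemma rho_cst_ge0 : 0 <= rho_cst.
Proof.
have ti : 0 <= th^-1 by rewrite invr_ge0 ltW.
have : 0 <= (b0 * r ^+ D)^-1 by rewrite invr_ge0 mulr_ge0 ?exprn_ge0 // ltW.
move=> h; rewrite /rho_cst addr_ge0 // mulr_ge0 ?addr_ge0 // mulr_ge0 ?addr_ge0 //.
by rewrite mulr_ge0.
Qed.

(** As a function of a remaining variable, the cross factor has its pole at [th zeta], of real part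
    [- th lam_d <= - 2 lam_(d+1)]. The choice of [r] thus puts it beyond the next far line. *)
Lemma sc_rho_r ka s d (y : R) : scal ka s -> (d < D)%N ->
  sc (- lam ka d.+1) hi (rho th (zl (- lam ka d) y)).
Proof.
move=> sk dD; have [k0 _ _] := scal_gt0 sk.
have l1 := scal_lam sk dD; have l2 := lam_S d k0.
apply: scM.
  by apply: sc_ext (sc_lin _ _ 1 (- zl (- lam ka d) y)) => z; rewrite mul1r.
apply: (sc_ext (h1 := fun z => (1%:C * z + (- (th%:C * zl (- lam ka d) y)))^-1)).
  by move=> z; rewrite mul1r.
apply: (@sc_inv R _ _ _ _ 1) => // z /andP[zl0 _].
apply: (@le_trans _ _ (- lam ka d.+1 + th * lam ka d)).
  have c1 : 1 <= lam ka d.+1 by apply: le_trans l1; rewrite lerDr.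
  by rewrite addrC lerBrDr (le_trans _ l2) // mulr_natl mulr2n lerD2r.
by rewrite RezB !RezCM Rez_zl mul1r mulrN opprK lerD2r.
Qed.

(** Freezing a variable costs one degree of growth and the factor [rho_cst], wherever on its far
    line the variable sits. *)
Lemma adm_rho ka s e M G d (y : R) : scal ka s -> (d < D)%N -> adm ka e M G d ->
  adm ka e.+1 (M * rho_cst) (fun z => G z * rho th (zl (- lam ka d) y) z) d.+1.
Proof.
move=> sk dD [h1 h2 h3]; have [k0 _ _] := scal_gt0 sk.
have ti : 0 <= th^-1 by rewrite invr_ge0 ltW.
have bi : 0 < b0 * r ^+ D by rewrite mulr_gt0 // exprn_gt0.
have l1 := scal_lam sk dD; have l2 := lam_S d k0.
have M0 : 0 <= M by apply: le_trans (h2 0%N (leq0n _)); exact: cn_ge0.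
have bi' : 0 <= (b0 * r ^+ D)^-1 by rewrite invr_ge0 ltW.
have tb : 0 <= 2 / th * (1 + (b0 * r ^+ D)^-1) by rewrite !mulr_ge0 // addr_ge0.
split.
- apply: scM; last exact: sc_rho_r sk dD.
  by apply: sc_sub h1 => //; rewrite lerN2 lam_le.
- move=> k kK; rewrite cnM ler_pM ?cn_ge0 //; first exact: h2.
  have ck := ct k; have ck0 := ct0 k.
  apply: (le_trans (@rho_bound _ th _ _ 1 t0 ltr01 _)).
    rewrite RezB RezCM Rez_zl RezC; lra.
  rewrite divr1 cnR normrN ger0_norm // /rho_cst lerD2l ler_wpM2l ?addr_ge0 //; lra.
- move=> k y' /andP[dk kD]; have := h3 k y'; rewrite kD (ltnW dk) => /(_ isT) h.
  rewrite cnM exprS (_ : M * _ / ka * _ = M / ka * (1 + `|y'| / ka) ^+ e * (rho_cst * (1 + `|y'| / ka))); last by ring.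
  rewrite ler_pM ?cn_ge0 //.
  have lk := lam_le k0 dk.
  have ld : 0 < lam ka d by rewrite /lam !mulr_gt0 // exprn_gt0.
  have L0 : 0 < th / 2 * lam ka d by rewrite mulr_gt0 // divr_gt0.
  apply: (le_trans (@rho_bound _ th _ _ (th / 2 * lam ka d) t0 L0 _)).
    rewrite RezB RezCM !Rez_zl; lra.
  have y0 : 0 <= `|y'| / ka by rewrite divr_ge0 // ltW.
  rewrite /rho_cst [leRHS]mulrDl lerD //.
    by rewrite ler_peMr // lerDl.
  rewrite -[leRHS]mulrA ler_wpM2l ?addr_ge0 //.
  apply: (@le_trans _ _ (2 / th * (1 + (b0 * r ^+ D)^-1) * (1 + `|y'| / ka))); last first.
    by rewrite ler_wpM2r ?addr_ge0 // lerDr.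
  rewrite ler_pdivrMr //.
  apply: (le_trans (cn_le_ReIm _)); rewrite Rez_zl Imz_zl normrN.
  have lk0 : 0 <= lam ka k by rewrite /lam !mulr_ge0 ?exprn_ge0 // ltW.
  rewrite (ger0_norm lk0).
  have dd := lam_le k0 (ltnW dk).
  have -> : 2 / th * (1 + (b0 * r ^+ D)^-1) * (1 + `|y'| / ka) * (th / 2 * lam ka d) =
     lam ka d * (1 + (b0 * r ^+ D)^-1) * (1 + `|y'| / ka).
    by field; rewrite ?(lt0r_neq0 t0) ?(lt0r_neq0 k0) ?(lt0r_neq0 b00) ?expf_neq0 ?(lt0r_neq0 r0).
  have lD : b0 * r ^+ D * ka <= lam ka d by apply: lam_le => //; exact: ltnW.
  have : `|y'| <= lam ka d * (b0 * r ^+ D)^-1 * (`|y'| / ka).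
    rewrite (_ : _ * (_ / _) = `|y'| * (lam ka d / (b0 * r ^+ D * ka))); last first.
      by field; rewrite ?(lt0r_neq0 t0) ?(lt0r_neq0 k0) ?(lt0r_neq0 b00) ?expf_neq0 ?(lt0r_neq0 r0).
    by rewrite ler_peMr // ler_pdivlMr ?mul1r // mulr_gt0.
  have := mulr_ge0 (ltW ld) bi'; have := mulr_ge0 (ltW ld) y0; lra.
Qed.

(** The induction is run for an abstract class of functions [G] stable under [rho]. The reflected
    problem takes [adm] itself; the original one must also control [G] on the side towards which the
    remaining variables will be reflected. *)
Variable Cl : R -> nat -> (R[i] -> R[i]) -> Prop.
Hypothesis Cl_adm : forall d, (d <= D)%N -> exists (M : R) (e : nat), 0 <= M /\
  forall ka s G, scal ka s -> Cl ka d G -> adm ka e M G d.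
Hypothesis Cl_rho : forall ka s d G y, scal ka s -> (d < D)%N -> Cl ka d G ->
  Cl ka d.+1 (fun z => G z * rho th (zl (- lam ka d) y) z).

Lemma far_le d : (d < D)%N -> exists K : R, 0 <= K /\ forall n k (C2 ka s : R) (a x : nat -> R) G,
  scal ka s -> Cl ka d G -> lin n.+1 k a -> 0 <= x 0%N ->
  (forall y, cn (IQ th s n (fun j => a j.+1) (fun j => x j.+1)
     (fun z => G z * rho th (zl (- lam ka d) y) z) (c0 * th ^+ k)) <= C2) ->
  cn (IQ th s n.+1 (headset (- lam ka d) a) x G (c0 * th ^+ k)) <= K * C2 * ka^-1.
Proof.
move=> dD; have [M [e [M0 hM]]] := Cl_adm (ltnW dD).
have [Ce [Ce0 hCe]] := gauss_scale R e.
have bd0 : 0 < b0 * r ^+ d by rewrite mulr_gt0 // exprn_gt0.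
pose K := expR (2^-1 * (b0 * r ^+ d) ^+ 2) * M * ((c0 + 1) / (b0 * r ^+ d)).
have c1 : 0 < c0 + 1 by rewrite ltr_wpDl.
have K0 : 0 <= K.
  apply: mulr_ge0; first by apply: mulr_ge0 => //; exact: expR_ge0.
  by apply: divr_ge0; exact: ltW.
exists (2 * (K * Ce)); split; first by apply: mulr_ge0 => //; exact: mulr_ge0.
move=> n k C2 ka s a x G sk hG [l1 l2 l3] x0 hC2.
have [k0 s0 s1] := scal_gt0 sk; have [g1 g2 g3] := hM ka s G sk hG.
have [jW hW] := hCe s ka k0 (let: And3 _ h _ := sk in h).
have lc := scal_lam sk (ltnW dD); have lc' := scal_lam sk dD.
have ck := ct k; have ck0 := ct0 k.
have la := lam_S d k0; have lb := lam_le k0 (leqnSn d).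
have aj j : (j < n.+1)%N -> - c0 < a j.
  by move=> jn; apply: le_lt_trans (l3 j 0%N (leq0n j) jn); rewrite lerN2.
have C20 : 0 <= C2 by apply: le_trans (hC2 0); exact: cn_ge0.
apply: le_trans (@far_bound _ th s n _ x G _ (- lam ka d) (- lam ka d.+1) hi
  (fun y => K * ka^-1 ^+ 2 * ((1 + `|y| / ka) ^+ e * gk (2^-1 * s) y)) C2 s0 g1 _ _ _ _ _ _ hC2 _ _) _.
- by rewrite lerN2.
- move=> j jn; apply: ltW; apply: le_lt_trans (aj j.+1 jn); lra.
- move=> [|j] jn /=.
    rewrite lexx /=; apply: le_trans (l2 0%N isT); apply: ltW; apply: le_lt_trans (aj 0%N isT); lra.
  rewrite l2 // andbT; apply: ltW; apply: le_lt_trans (aj j.+1 jn); lra.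
- move=> [|j] jn /=; first by rewrite lt_eqF //; lra.
  rewrite gt_eqF // -ltrBlDr sub0r; have := l3 j.+1 0%N isT jn; by rewrite addn0.
- move=> [|A] [|B] //= AB Bn; last exact: l1.
  by apply: le_lt_trans (aj B.+1 Bn); lra.
- by move=> y; exact: sc_rho_r sk dD.
- exact: (rintegrableZ (mu := leb) _ jW).
- move=> y /=; rewrite cnM cn_gss_exp cnM cnV.
  (* [x 0 >= 0] makes the linear exponent nonpositive on a line to the left, and [s ka^2 = 1] bounds
     the quadratic one. *)
  have E1 : expR (2^-1 * s * (- lam ka d) ^+ 2 + x 0%N * - lam ka d) <= expR (2^-1 * (b0 * r ^+ d) ^+ 2).
    rewrite ler_expR sqrrN /lam exprMn.
    have -> : 2^-1 * s * ((b0 * r ^+ d) ^+ 2 * ka ^+ 2) = 2^-1 * (b0 * r ^+ d) ^+ 2 * (s * ka ^+ 2) by ring.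
    case: sk => _ -> _; rewrite mulr1 gerDl mulrN oppr_le0 mulr_ge0 // mulr_ge0 // ltW //.
  have E2 : (cn (zl (- lam ka d) y + (c0 * th ^+ k)%:C))^-1 <= (c0 + 1) / (b0 * r ^+ d) * ka^-1.
    have h0 : 0 < lam ka d by apply: lt_le_trans lc.
    rewrite -mulrA -invfM -[X in _ <= _ / X]/(lam ka d) -[leRHS]invf_div.
    rewrite lef_pV2 ?posrE ?divr_gt0 //; last first.
      apply: cn_gt0; apply: Re_lt0_neq0; rewrite RezD Rez_zl RezC; lra.
    apply: le_trans (Rez_le_cn _); rewrite RezD Rez_zl RezC ler0_norm; last by lra.
    rewrite ler_pdivrMr //; have := ler_wpM2r (ltW c1) ck; have := ler_wpM2l c00 lc; lra.
  have h := g3 d y; rewrite leqnn (ltnW dD) in h; have {}h := h isT.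
  have -> : K * ka^-1 ^+ 2 * ((1 + `|y| / ka) ^+ e * gk (2^-1 * s) y) =
    expR (2^-1 * (b0 * r ^+ d) ^+ 2) * gk (2^-1 * s) y * (M * ka^-1 * (1 + `|y| / ka) ^+ e *
     ((c0 + 1) / (b0 * r ^+ d) * ka^-1)) by rewrite /K; ring.
  apply: ler_pM; rewrite ?mulr_ge0 ?expR_ge0 ?gk_ge0 ?cn_ge0 ?invr_ge0 ?cn_ge0 //.
    by rewrite ler_wpM2r ?gk_ge0.
  by apply: ler_pM; rewrite ?cn_ge0 ?invr_ge0 ?cn_ge0.
- rewrite RintegralZl //.
  have : K * ka^-1 ^+ 2 * Rintegral leb setT (fun y => (1 + `|y| / ka) ^+ e * gk (2^-1 * s) y) <= K * Ce * ka^-1.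
    apply: (@le_trans _ _ (K * ka^-1 ^+ 2 * (Ce * ka))).
      by rewrite ler_wpM2l // mulr_ge0 // exprn_ge0 // invr_ge0 ltW.
    by rewrite le_eqVlt; apply/orP; left; apply/eqP; field; exact: lt0r_neq0.
  move=> h; rewrite (_ : 2 * (K * Ce) * C2 / ka = 2 * ((K * Ce / ka) * C2)); last by rewrite !mulrA mulrAC.
  by rewrite ler_wpM2l // ler_wpM2r.
Qed.

(** The last [N'] variables are left alone by the induction, and [Q] is what is known about them:
    [N' = 0] in the reflected problem, while in the original one they are the variables with
    nonpositive coordinates. *)
Variables (N' : nat) (Q : (nat -> R) -> (nat -> R) -> Prop).
Hypothesis HB : forall d k, (d <= D)%N -> (k <= Kx)%N -> exists C : R, 0 <= C /\ forall ka s (a x : nat -> R) G,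
  scal ka s -> Cl ka d G -> lin N' k a -> Q a x -> cn (IQ th s N' a x G (c0 * th ^+ k)) <= C.

Lemma lin_shift n k a : lin n.+1 k a -> lin n k (fun j => a j.+1).
Proof.
move=> [l1 l2 l3]; split.
- by move=> A B AB Bn; exact: l1.
- by move=> j jn; exact: l2.
- by move=> j i ij jn; apply: l3 => //; exact: leqW.
Qed.

Lemma lin_shiftS n k a : lin n.+1 k a -> lin n k.+1 (fun j => a j.+1).
Proof.
move=> [l1 l2 l3]; split.
- by move=> A B AB Bn; exact: l1.
- by move=> j jn; exact: l2.
- by move=> j i ij jn; rewrite addSnnS; exact: l3.
Qed.

(** The residue of variable [j] when [k + j] residues have been taken before it, with the factor
    [2 pi] of the unnormalized integral. *)
Definition resid (s : R) (x : nat -> R) (G : R[i] -> R[i]) k j : R[i] :=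
  G (- (c0 * th ^+ (k + j)))%:C *
  (2 * pi * expR (2^-1 * s * (c0 * th ^+ (k + j)) ^+ 2 - c0 * th ^+ (k + j) * x j))%:C.

Lemma cl_step n d k ka s (a x : nat -> R) G : scal ka s -> (d < D)%N -> Cl ka d G -> lin n.+1 k a ->
  IQ th s n.+1 a x G (c0 * th ^+ k) =
  IQ th s n.+1 (headset (- lam ka d) a) x G (c0 * th ^+ k) +
  resid s x G k 0 * IQ th s n (fun j => a j.+1) (fun j => x j.+1) G (c0 * th ^+ k.+1).
Proof.
move=> sk dD hG [l1 l2 l3]; have [k0 s0 s1] := scal_gt0 sk.
have [M [e [M0 hM]]] := Cl_adm (ltnW dD); have [g1 _ _] := hM ka s G sk hG.
have lc := scal_lam sk (ltnW dD); have ck := ct k.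
have cl : - lam ka d < - (c0 * th ^+ k) by rewrite ltrN2; lra.
have ak j : (j < n.+1)%N -> - (c0 * th ^+ k) < a j.
  by move=> jn; have := l3 j 0%N (leq0n j) jn; rewrite addn0.
have al j : (j < n.+1)%N -> - lam ka d <= a j <= hi.
  by move=> jn; rewrite l2 // andbT ltW // (lt_trans cl) // ak.
have at1 j : (j < n)%N -> - (th * (c0 * th ^+ k)) < a j.+1.
  by move=> jn; rewrite mulrCA -exprS; have := l3 j.+1 1%N isT jn; rewrite addn1.
rewrite (left_step x s0 t0 g1 (lexx _) cl ak al l1 at1).
by rewrite /resid addn0 (mulrCA th) -exprS.
Qed.

Lemma resid_bound d k : (d <= D)%N -> (k <= Kx)%N -> exists C : R, 0 <= C /\ forall ka s (x : nat -> R) G,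
  scal ka s -> Cl ka d G -> 0 <= x 0%N -> cn (resid s x G k 0) <= C.
Proof.
move=> dD kK; have [M [e [M0 hM]]] := Cl_adm dD.
exists (M * (2 * pi * expR (2^-1 * (c0 * th ^+ k) ^+ 2))); split.
  by rewrite !mulr_ge0 ?expR_ge0 ?pi_ge0.
move=> ka s x G sk hG x0; have [k0 s0 s1] := scal_gt0 sk.
have [_ g2 _] := hM ka s G sk hG.
rewrite /resid addn0 cnM ler_pM ?cn_ge0 //; first exact: g2.
rewrite cnR ger0_norm ?mulr_ge0 ?expR_ge0 ?pi_ge0 //.
rewrite ler_wpM2l ?mulr_ge0 ?pi_ge0 // ler_expR.
apply: (@le_trans _ _ (2^-1 * s * (c0 * th ^+ k) ^+ 2)).
  by rewrite gerDl oppr_le0 mulr_ge0 // ct0.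
by rewrite ler_wpM2r ?sqr_ge0 // ler_piMr.
Qed.

(** Each of the first [m] variables either goes to a far line, which raises [d], or leaves a
    residue, which raises [k]; hence the budgets [D] and [Kx]. *)
Lemma cl_bound m : forall d k, (d + m <= D)%N -> (k + m <= Kx)%N -> exists C : R, 0 <= C /\
  forall ka s (a x : nat -> R) G, scal ka s -> Cl ka d G -> lin (m + N') k a ->
  (forall j, (j < m)%N -> 0 <= x j) -> Q (fun j => a (m + j)%N) (fun j => x (m + j)%N) ->
  cn (IQ th s (m + N') a x G (c0 * th ^+ k)) <= C.
Proof.
elim: m => [|m IH] d k dm km.
  rewrite !addn0 in dm km; have [C [C0 hC]] := HB dm km; exists C; split => // ka s a x G sk hG la _ hQ.
  exact: (hC ka s a x G sk hG la hQ).
have dD : (d < D)%N by apply: leq_trans dm; rewrite addnS ltnS leq_addr.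
have dm' : (d + m <= D)%N by apply: leq_trans dm; rewrite addnS.
have dm1 : (d.+1 + m <= D)%N by rewrite addSnnS.
have km' : (k + m <= Kx)%N by apply: leq_trans km; rewrite addnS.
have km1 : (k.+1 + m <= Kx)%N by rewrite addSnnS.
have kK : (k <= Kx)%N by apply: leq_trans km; rewrite leq_addr.
have [C1 [C10 h1]] := IH d k.+1 dm' km1; have [C2 [C20 h2]] := IH d.+1 k dm1 km'.
have [K [K0 hK]] := far_le dD; have [Cr [Cr0 hr]] := resid_bound (ltnW dD) kK.
exists (K * C2 + Cr * C1); split; first by rewrite addr_ge0 ?mulr_ge0.
move=> ka s a x G sk hG la x0 hQ; have [k0 s0 s1] := scal_gt0 sk.
rewrite addSn (cl_step x sk dD hG la); apply: (le_trans (cnD _ _)); rewrite lerD //.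
  apply: (@le_trans _ _ (K * C2 * ka^-1)).
    apply: (hK _ _ _ _ _ _ _ _ sk hG la (x0 0%N isT)) => y.
    apply: (h2 ka s _ _ _ sk (Cl_rho y sk dD hG) (lin_shift la)) => //.
    by move=> j jm; exact: x0.
  rewrite ler_piMr ?mulr_ge0 // invf_le1 //; by case: sk.
rewrite cnM ler_pM ?cn_ge0 //; first exact: (hr ka s x G sk hG (x0 0%N isT)).
apply: (h1 ka s _ _ _ sk hG (lin_shiftS la)) => //.
by move=> j jm; exact: x0.
Qed.

(** A single variable on a far line already costs [1 / ka] by [far_le], the rest being bounded by
    [cl_bound]. Only the term in which all variables leave residues survives. *)
Lemma cl_approx m : forall d k, (d + m <= D)%N -> (k + m <= Kx)%N -> exists C : R, 0 <= C /\
  forall ka s (a x : nat -> R) G, scal ka s -> Cl ka d G -> lin (m + N') k a ->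
  (forall j, (j < m)%N -> 0 <= x j) -> Q (fun j => a (m + j)%N) (fun j => x (m + j)%N) ->
  cn (IQ th s (m + N') a x G (c0 * th ^+ k) - (\prod_(j < m) resid s x G k j) *
    IQ th s N' (fun j => a (m + j)%N) (fun j => x (m + j)%N) G (c0 * th ^+ (k + m))) <= C * ka^-1.
Proof.
elim: m => [|m IH] d k dm km.
  exists 0; split => // ka s a x G sk hG la _ hQ.
  by rewrite big_ord0 mul1r addn0 subrr cn0 mul0r.
have dD : (d < D)%N by apply: leq_trans dm; rewrite addnS ltnS leq_addr.
have dm' : (d + m <= D)%N by apply: leq_trans dm; rewrite addnS.
have dm1 : (d.+1 + m <= D)%N by rewrite addSnnS.
have km' : (k + m <= Kx)%N by apply: leq_trans km; rewrite addnS.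
have km1 : (k.+1 + m <= Kx)%N by rewrite addSnnS.
have kK : (k <= Kx)%N by apply: leq_trans km; rewrite leq_addr.
have [C1 [C10 h1]] := IH d k.+1 dm' km1; have [C2 [C20 h2]] := cl_bound dm1 km'.
have [K [K0 hK]] := far_le dD; have [Cr [Cr0 hr]] := resid_bound (ltnW dD) kK.
exists (K * C2 + Cr * C1); split; first by rewrite addr_ge0 ?mulr_ge0.
move=> ka s a x G sk hG la x0 hQ; have [k0 s0 s1] := scal_gt0 sk.
rewrite addSn (cl_step x sk dD hG la) big_ord_recl.
have -> : \prod_(i < m) resid s x G k (lift ord0 i) =
    \prod_(i < m) resid s (fun j => x j.+1) G k.+1 i.
  by apply: eq_bigr => i _; rewrite /resid /= addSnnS.
rewrite -addrA -[resid s x G k ord0 * _ * _]mulrA -mulrBr.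
rewrite mulrDl; apply: (le_trans (cnD _ _)); rewrite lerD //.
  apply: (hK _ _ _ _ _ _ _ _ sk hG la (x0 0%N isT)) => y.
  apply: (h2 ka s _ _ _ sk (Cl_rho y sk dD hG) (lin_shift la)) => //.
  by move=> j jm; exact: x0.
rewrite cnM -mulrA ler_pM ?cn_ge0 //; first exact: (hr ka s x G sk hG (x0 0%N isT)).
rewrite -addSnnS; apply: (h1 ka s _ _ _ sk hG (lin_shiftS la)) => //.
by move=> j jm; exact: x0.
Qed.
End Bounding.

Section NoTail.
Variable R : realType.
Variables (th c0 r b0 hi : R) (D Kx : nat).
Hypotheses (t0 : 0 < th) (c00 : 0 <= c0) (ct : forall k, c0 * th ^+ k <= c0).
Hypotheses (r0 : 0 < r) (r1 : r <= 2^-1) (rt : 2 * r <= th) (b00 : 0 < b0).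

Lemma IQ0 th' s (a x : nat -> R) G c : IQ th' s 0 a x G c = 1.
Proof.
by rewrite /IQ /gint /lebn cintg_unit /gx /hg /pairf !big_ord0 !mulr1.
Qed.

Lemma adm_approx N e (M : R) : (N <= D)%N -> (N <= Kx)%N -> 0 <= M -> exists C : R, 0 <= C /\
  forall ka s (a x : nat -> R) G, scal c0 r b0 D ka s -> adm th c0 r b0 hi D Kx ka e M G 0 ->
  lin th c0 hi N 0 a -> (forall j, (j < N)%N -> 0 <= x j) ->
  cn (IQ th s N a x G c0) <= C /\
  cn (IQ th s N a x G c0 - \prod_(j < N) resid th c0 s x G 0 j) <= C * ka^-1.
Proof.
move=> ND NK M0.
pose m1 := rho_cst th c0 r b0 D.
have m10 : 0 <= m1 by exact: rho_cst_ge0.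
(* Degree and constant grow with the number [d] of frozen variables, at the rate given by
   [adm_rho]. *)
pose Cl ka d G := adm th c0 r b0 hi D Kx ka (e + d)%N (M * m1 ^+ d) G d.
have Cl_adm d : (d <= D)%N -> exists (M : R) (e : nat), 0 <= M /\
  forall ka s G, scal c0 r b0 D ka s -> Cl ka d G -> adm th c0 r b0 hi D Kx ka e M G d.
  by move=> dD; exists (M * m1 ^+ d), (e + d)%N; split => //; rewrite mulr_ge0 // exprn_ge0.
have Cl_rho ka s d G y : scal c0 r b0 D ka s -> (d < D)%N -> Cl ka d G ->
    Cl ka d.+1 (fun z => G z * rho th (zl (- lam r b0 ka d) y) z).
  move=> sk dD hG; rewrite /Cl addnS exprSr mulrA.
  exact: (adm_rho t0 c00 ct r0 r1 rt b00 y sk dD hG).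
have HB d k : (d <= D)%N -> (k <= Kx)%N -> exists C : R, 0 <= C /\
    forall ka s (a x : nat -> R) G,
    scal c0 r b0 D ka s -> Cl ka d G -> lin th c0 hi 0 k a -> True -> cn (IQ th s 0 a x G (c0 * th ^+ k)) <= C.
  by move=> _ _; exists 1; split => // ka s a x G _ _ _ _; rewrite IQ0 cn1.
have [C1 [C10 h1]] := cl_bound t0 c00 ct r0 r1 rt b00 Cl_adm Cl_rho (Q := fun _ _ => True) HB
  (m := N) (d := 0%N) (k := 0%N) ND NK.
have [C2 [C20 h2]] := cl_approx t0 c00 ct r0 r1 rt b00 Cl_adm Cl_rho (Q := fun _ _ => True) HB
  (m := N) (d := 0%N) (k := 0%N) ND NK.
exists (C1 + C2); split; first exact: addr_ge0.
move=> ka s a x G sk hG la x0.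
have hG' : Cl ka 0 G by rewrite /Cl addn0 expr0 mulr1.
have k0 : 0 < ka by case: sk => k1 _ _; exact: lt_le_trans k1.
rewrite -[N in lin _ _ _ N _ _]addn0 in la.
have := h1 ka s a x G sk hG' la x0 I; have := h2 ka s a x G sk hG' la x0 I.
rewrite IQ0 mulr1 addn0 expr0 mulr1 => H2 H1; split; first by apply: le_trans H1 _; rewrite lerDl.
by apply: le_trans H2 _; rewrite ler_wpM2r ?invr_ge0 ?(ltW k0) // lerDr.
Qed.
End NoTail.

(** * Reflection of the contours with reversal of the order *)

Section Reversal.
Variable R : realType.
Local Notation leb := [the {sigma_finite_measure set (measurableTypeR R) -> \bar R} of @lebesgue_measure R].

Lemma dotz_delta n (u : R) j (z : nat -> R[i]) : (j < n)%N ->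
  dotz n (fun i => if i == j then u else 0) z = u%:C * z j.
Proof.
move=> jn; rewrite /dotz (bigD1 (Ordinal jn)) //= eqxx big1 ?addr0 // => i ij.
rewrite ifF ?mul0r //; apply: contraNF ij => /eqP ij; apply/eqP; exact: val_inj.
Qed.

Lemma dotz2 n (u v : R) j k (z : nat -> R[i]) : (j < n)%N -> (k < n)%N ->
  dotz n (fun i => (if i == j then u else 0) + (if i == k then v else 0)) z = u%:C * z j + v%:C * z k.
Proof. by move=> jn kn; rewrite dotzD !dotz_delta. Qed.

Lemma tcl_lin2 n (D : (nat -> R[i]) -> Prop) (u v : R) (c : R[i]) j k : (j < n)%N -> (k < n)%N ->
  tcl n D (fun z => u%:C * z j + v%:C * z k + c).
Proof.
move=> jn kn; have := tcl_lin (fun i => (if i == j then u else 0) + (if i == k then v else 0)) c (tcl1 n D).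
by congr tcl; apply/funext => z; rewrite mulr1 dotz2.
Qed.

Lemma tcl_inv2 n (D : (nat -> R[i]) -> Prop) (u v : R) (c : R[i]) j k (e : R) : (j < n)%N -> (k < n)%N ->
  0 < e -> (forall z, D z -> e <= Rez (u%:C * z j + v%:C * z k + c)) ->
  tcl n D (fun z => (u%:C * z j + v%:C * z k + c)^-1).
Proof.
move=> jn kn e0 H.
have H' z : D z -> e <= Rez (dotz n (fun i => (if i == j then u else 0) + (if i == k then v else 0)) z + c).
  by move=> Dz; rewrite dotz2 //; exact: H.
have := tcl_inv e0 H' (tcl1 n D).
by congr tcl; apply/funext => z; rewrite mulr1 dotz2.
Qed.

Lemma tcl_sc n (D : (nat -> R[i]) -> Prop) lo hi h j : sc lo hi h -> (j < n)%N ->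
  (forall z, D z -> lo <= Rez (z j) <= hi) -> tcl n D (fun z => h (z j)).
Proof.
move=> hs jn Dj.
have : forall F, tcl 1 (strip lo hi) F -> tcl n D (fun z => F (fun=> z j)).
  move=> F; elim => [|v c h' _ IH|v c h' k k0 H _ IH]; first exact: tcl1.
    have := tcl_lin (fun i => if i == j then v 0%N else 0) c IH.
    by congr tcl; apply/funext => z; rewrite dotz_delta // dotz1.
  have H' z : D z -> k <= Rez (dotz n (fun i => if i == j then v 0%N else 0) z + c).
    by move=> Dz; rewrite dotz_delta // -(dotz1 v (fun=> z j)); apply: H; exact: Dj.
  have := tcl_inv k0 H' IH.
  by congr tcl; apply/funext => z; rewrite dotz_delta // dotz1.
by move=> /(_ _ hs).
Qed.

Lemma tcl_hg (th : R) G (c : R) n (a : nat -> R) lo hi :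
  sc lo hi G -> (forall j, (j < n)%N -> lo <= a j <= hi) ->
  (forall j, (j < n)%N -> - c < a j) ->
  (forall A B, (A < B)%N -> (B < n)%N -> th * a A < a B) ->
  tcl n (fun z => forall j, (j < n)%N -> Rez (z j) = a j) (hg th G c n).
Proof.
move=> hG al ac aAB; apply: tclM.
  apply: tcl_prod => j _; apply: tclM.
    by apply: (tcl_sc hG (ltn_ord j)) => z Dz; rewrite Dz // al.
  have e0 : 0 < a j + c by rewrite -ltrBlDr sub0r ac.
  have := @tcl_inv2 n (fun z => forall j, (j < n)%N -> Rez (z j) = a j) 1 0 c%:C j j _ (ltn_ord j) (ltn_ord j) e0.
  have -> : (fun z : nat -> R[i] => (1%:C * z j + 0%:C * z j + c%:C)^-1) = (fun z => (z j + c%:C)^-1).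
    by apply/funext => z; rewrite mul1r mul0r addr0.
  by apply => z Dz; rewrite mul1r mul0r addr0 RezD RezC Dz.
apply: tcl_prod => B _; apply: tcl_prod => A AB; apply: tclM.
  have := tcl_lin2 (fun z => forall j, (j < n)%N -> Rez (z j) = a j) 1 (-1) 0 (ltn_ord B) (ltn_ord A).
  by congr tcl; apply/funext => z; rewrite mul1r CN mulN1r addr0.
have e0 : 0 < a B - th * a A by rewrite subr_gt0 aAB.
have := @tcl_inv2 n (fun z => forall j, (j < n)%N -> Rez (z j) = a j) 1 (- th) 0 B A _ (ltn_ord B) (ltn_ord A) e0.
have -> : (fun z : nat -> R[i] => (1%:C * z B + (- th)%:C * z A + 0)^-1) = (fun z => (z B - th%:C * z A)^-1).
  by apply/funext => z; rewrite mul1r CN mulNr addr0.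
by apply => z Dz; rewrite mul1r addr0 CN mulNr RezB RezCM !Dz.
Qed.

Definition revn (N j : nat) := (N - j.+1)%N.

Lemma involn_rev N : involn N (revn N).
Proof. by move=> j jN; rewrite /revn; split; lia. Qed.

Lemma N1C : (- 1)%:C = - 1 :> R[i].
Proof. exact: rmorphN1. Qed.

(** Reversal together with the change of sign maps each pair [A < B] to another such pair, and every
    denominator gives up one factor [th]. The constant counts the pairs. *)
Lemma pairf_rev (th : R) N (w : nat -> R[i]) : th != 0 ->
  pairf th N (fun j => (- 1)%:C * w (revn N j)) =
  (\prod_(B < N) (th^-1) ^+ B)%:C * pairf th^-1 N w.
Proof.
move=> t0; have tC : th%:C != 0 :> R[i].
  by apply: contra_neq t0 => h; have := congr1 (@complex.Re R) h.
have tV : (th^-1)%:C = (th%:C)^-1 by exact: fmorphV.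
have -> : (\prod_(B < N) (th^-1) ^+ B)%:C = \prod_(B < N) \prod_(A < N | (A < B)%N) (th%:C)^-1.
  rewrite rmorph_prod; apply: eq_bigr => B _; rewrite rmorphXn /= tV.
  by rewrite -(big_ord_widen N (fun=> (th%:C)^-1) (ltnW (ltn_ord B))) prodr_const card_ord.
rewrite /pairf -big_split /=.
have rE j : (j < N)%N -> (revn N j < N)%N by move=> jN; rewrite /revn; lia.
under [RHS]eq_bigr do rewrite -big_split.
rewrite (exchange_big_dep xpredT) //=.
under [RHS]eq_bigr do rewrite big_mkcond.
under eq_bigr do rewrite big_mkcond.
pose F (p q : nat) := (if (q < p)%N then (th%:C)^-1 * ((w p - w q) / (w p - (th^-1)%:C * w q)) else 1).
rewrite -(big_involn _ (fun p => \prod_(q < N) F p q) (@involn_rev N)); apply: eq_bigr => A _.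
rewrite -(big_involn _ (fun q => F (revn N A) q) (@involn_rev N)); apply: eq_bigr => B _.
rewrite /F (_ : (revn N B < revn N A)%N = (A < B)%N); last first.
  by rewrite /revn; have := ltn_ord A; have := ltn_ord B; lia.
case: ifP => // _; rewrite CN !mulN1r tV.
move: (w (revn N A)) (w (revn N B)) => p q.
have -> : - q - th%:C * - p = th%:C * (p - (th%:C)^-1 * q).
  by rewrite mulrBr mulrA mulfV // mul1r mulrN opprK addrC.
by rewrite opprK addrC invfM mulrCA.
Qed.

(** The two poles exchange their roles. The pole of [G] at 0, written [G z = z^-1 * g z], becomes
    the explicit one, now with [c = 0], while the old factor [(z + c)^-1] is absorbed into the new
    [G]. The coordinates change sign, so nonpositive ones become nonnegative. *)
Lemma IQ_rev (th s : R) N (a x : nat -> R) (g G : R[i] -> R[i]) (c lo hi lo' hi' : R) : 0 < s -> 0 < th ->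
  (forall z, G z = z^-1 * g z) -> sc lo hi G -> (forall j, (j < N)%N -> lo <= a j <= hi) ->
  (forall j, (j < N)%N -> - c < a j) ->
  (forall A B, (A < B)%N -> (B < N)%N -> th * a A < a B) ->
  (forall j, (j < N)%N -> a j != 0) -> sc lo' hi' (fun w => (c%:C - w)^-1 * - g (- w)) ->
  (forall j, (j < N)%N -> lo' <= - a j <= hi') ->
  IQ th s N a x G c = (\prod_(B < N) (th^-1) ^+ B)%:C *
   IQ th^-1 s N (fun j => - a (revn N j)) (fun j => - x (revn N j))
     (fun w => (c%:C - w)^-1 * - g (- w)) 0.
Proof.
move=> s0 t0 Gg hG al ac aAB a0 hG' al'.
pose a' j := - a (revn N j); pose x' j := - x (revn N j).
pose D (z : nat -> R[i]) := forall j, (j < N)%N -> Rez (z j) = a j.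
have rN := @involn_rev N.
have D1 (t : RT R N) : D (zc a t) by move=> j jN; rewrite zc_zl // Rez_zl.
have D2 (t : RT R N) : D (fun j => (- 1)%:C * zc a' t (revn N j)).
  move=> j jN; have [h1 h2] := rN j jN.
  by rewrite RezCM zc_zl // Rez_zl /a' h2 mulN1r opprK.
have e2 : (- 1) ^+ 2 = 1 :> R by rewrite sqrrN expr1n.
rewrite {1}/IQ (perm_transfer x s0 e2 rN (tcl_hg hG al ac aAB) D1 D2).
have E t : gx N s x (fun j => (- 1)%:C * zc a' t (revn N j)) *
    hg th G c N (fun j => (- 1)%:C * zc a' t (revn N j)) =
  (\prod_(B < N) (th^-1) ^+ B)%:C * (gx N s x' (zc a' t) *
    hg th^-1 (fun w => (c%:C - w)^-1 * - g (- w)) 0 N (zc a' t)).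
  move: (zc a' t) => w.
  have -> : gx N s x (fun j => (- 1)%:C * w (revn N j)) = gx N s x' w.
    rewrite /gx -(big_involn _ (fun j => gss s (w j) * cexp ((x' j)%:C * w j)) rN).
    apply: eq_bigr => j _; have [h1 h2] := rN j (ltn_ord j).
    by rewrite /x' h2 N1C mulN1r /gss sqrrN CN mulNr mulrN.
  rewrite /hg pairf_rev ?gt_eqF // [X in _ * X = _]mulrCA [LHS]mulrCA; congr (_ * (_ * (_ * _))).
  rewrite -(big_involn _ (fun j => (c%:C - w j)^-1 * - g (- w j) * (w j + 0%:C)^-1) rN).
  apply: eq_bigr => j _; rewrite N1C mulN1r Gg addr0 invrN.
  rewrite [- w _ + _]addrC; move: (g _) ((c%:C - _)^-1) ((w _)^-1) => u v q; ring.
rewrite /IQ /gint -cintgZ; first by apply: eq_cintg => t; exact: E.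
apply: (gint_integrable x' s0); apply: (pbd_hg hG') => [j jN|j jN|A B AB BN].
- by have [h1 _] := rN j jN; exact: al'.
- by have [h1 _] := rN j jN; rewrite addr0 oppr_eq0 a0.
- rewrite mulrN ltrN2 ltr_pdivlMl //; apply: aAB; rewrite /revn; lia.
Qed.
End Reversal.

Lemma revn_ltn N A B : (A < B)%N -> (B < N)%N -> (revn N B < revn N A)%N /\ (revn N A < N)%N.
Proof. by rewrite /revn => h1 h2; split; lia. Qed.

(** * Nonnegative and nonpositive coordinates together *)

Section TwoSided.
Variable R : realType.
Variables (tau hi hi2 : R) (m N : nat).
Hypotheses (tau0 : 0 < tau) (tau1 : tau < 1) (hi0 : hi < 0).
Let c0 := 1 - tau.
Hypothesis h2 : hi2 < c0 * tau ^+ m.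
Let n := (m + N)%N.
Let r := tau / 2.

Lemma c0_gt0 : 0 < c0. Proof. by rewrite /c0 subr_gt0. Qed.
Lemma ct_tau k : c0 * tau ^+ k <= c0.
Proof. by rewrite ler_piMr ?(ltW c0_gt0) // exprn_ile1 // ltW. Qed.
Lemma r_gt0 : 0 < r. Proof. by rewrite divr_gt0. Qed.
Lemma r_le : r <= 2^-1. Proof. by rewrite /r ler_piMl // ltW. Qed.
Lemma r_th : 2 * r <= tau. Proof. by rewrite /r mulrCA mulfV ?mulr1. Qed.
Lemma cm_gt0 k : 0 < c0 * tau ^+ k. Proof. by rewrite mulr_gt0 ?c0_gt0 // exprn_gt0. Qed.
Lemma cm_le k : (k <= m)%N -> c0 * tau ^+ m <= c0 * tau ^+ k.
Proof.
by move=> km; rewrite ler_pM2l ?c0_gt0 // ler_wiXn2l // ltW.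
Qed.

(** These are the far lines of the reflected problem; their ratio can be [1/2] because there
    [th = 1 / tau > 1]. *)
Lemma lam2_le ka s k : scal c0 r 1 n ka s -> (k <= N)%N ->
  [/\ 1 <= lam 2^-1 1 ka k, lam 2^-1 1 ka N <= lam 2^-1 1 ka k & lam 2^-1 1 ka N = 2^-1 ^+ N * ka].
Proof.
move=> sk kN; have [k0 _ _] := scal_gt0 sk; case: sk => _ _.
rewrite /lam !mul1r => h.
have hN : 2^-1 ^+ N * ka <= 2^-1 ^+ k * ka.
  by rewrite ler_pM2r // ler_wiXn2l // invf_le1 // ler1n.
split => //; apply: (le_trans _ hN).
apply: (@le_trans _ _ (r ^+ n * ka)); first by apply: le_trans h; rewrite lerDr ltW // c0_gt0.
rewrite ler_pM2r // /n exprD -[leRHS]mul1r ler_pM ?exprn_ge0 ?(ltW r_gt0) //.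
  by rewrite exprn_ile1 ?(ltW r_gt0) // (le_trans r_le) // invf_le1 // ler1n.
by rewrite lerXn2r ?nnegrE ?(ltW r_gt0) // r_le.
Qed.

(** Control of [g] at 0, the pole of the reflected problem, and on the mirror images of its far
    lines. *)
Definition radm ka (e : nat) (M : R) (g : R[i] -> R[i]) :=
  [/\ sc (- lam 2^-1 1 ka 0) hi2 (fun w => g (- w)), cn (g 0) <= M &
    forall k (y : R), (k <= N)%N -> cn (g (- zl (- lam 2^-1 1 ka k) y)) <= M * (1 + `|y| / ka) ^+ e].

Let rc2 := tau^-1 + (1 + tau^-1) * (1 + (2^-1 ^+ N)^-1).

Lemma rc2_ge0 : 0 <= rc2.
Proof.
have ti : 0 <= tau^-1 by rewrite invr_ge0 ltW.
by rewrite /rc2 addr_ge0 // mulr_ge0 ?addr_ge0 // invr_ge0 exprn_ge0.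
Qed.

Lemma radm_rho ka s e M g d (y : R) : scal c0 r 1 n ka s -> (d < n)%N -> radm ka e M g ->
  radm ka e.+1 (M * rc2) (fun z => g z * rho tau (zl (- lam r 1 ka d) y) z).
Proof.
move=> sk dn [g1 g2 g3]; have [k0 _ _] := scal_gt0 sk.
have ti : 0 <= tau^-1 by rewrite invr_ge0 ltW.
have l1 := scal_lam r_gt0 r_le ltr01 sk dn.
have l2 := lam_S r_gt0 r_th ltr01 d k0.
have h2' : hi2 < c0 by apply: lt_le_trans (ct_tau m).
have M0 : 0 <= M by apply: le_trans g2; exact: cn_ge0.
have [m1 _ _] := lam2_le sk (leq0n N).
have P0 : 0 <= (2^-1 ^+ N)^-1 :> R by rewrite invr_ge0 exprn_ge0.
have rce : tau^-1 <= rc2 by rewrite /rc2 lerDl mulr_ge0 ?addr_ge0.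
split.
- apply: scM => //; apply: scM.
    by apply: sc_ext (sc_lin _ _ (-1) (- zl (- lam r 1 ka d) y)) => z; rewrite N1C mulN1r.
  apply: (sc_ext (h1 := fun z => ((-1)%:C * z + (- (tau%:C * zl (- lam r 1 ka d) y)))^-1)).
    by move=> z; rewrite N1C mulN1r.
  apply: (@sc_inv R _ _ _ _ 1) => // z /andP[_ zh].
  rewrite RezB !RezCM Rez_zl mulN1r mulrN opprK.
  apply: (@le_trans _ _ (- hi2 + tau * lam r 1 ka d)); last by rewrite lerD2r lerN2.
  have := c0_gt0; lra.
- rewrite cnM ler_pM ?cn_ge0 //; apply: le_trans rce.
  have := @rho_bound _ tau (zl (- lam r 1 ka d) y) 0 1 tau0 ltr01.
  rewrite cn0 mul0r mulr0 addr0; apply; rewrite sub0r RezN RezCM Rez_zl.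
  have := c0_gt0; lra.
- move=> k y' kN; have := g3 k y' kN => h.
  rewrite cnM exprS (_ : M * _ * _ = M * (1 + `|y'| / ka) ^+ e * (rc2 * (1 + `|y'| / ka))); last by ring.
  rewrite ler_pM ?cn_ge0 //.
  have [q1 q2 q3] := lam2_le sk kN.
  have L0 : 0 < lam 2^-1 1 ka k by apply: lt_le_trans q1.
  apply: (le_trans (@rho_bound _ tau _ _ (lam 2^-1 1 ka k) tau0 L0 _)).
    rewrite RezB RezN RezCM !Rez_zl; have := c0_gt0; lra.
  have y0 : 0 <= `|y'| / ka by rewrite divr_ge0 // ltW.
  rewrite /rc2 [leRHS]mulrDl lerD //; first by rewrite ler_peMr // lerDl.
  rewrite -[leRHS]mulrA ler_wpM2l ?addr_ge0 //.
  rewrite ler_pdivrMr // cnN; apply: (le_trans (cn_le_ReIm _)); rewrite Rez_zl Imz_zl normrN.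
  rewrite (gtr0_norm L0).
  have : `|y'| <= (2^-1 ^+ N)^-1 * (`|y'| / ka) * lam 2^-1 1 ka k.
    apply: (@le_trans _ _ ((2^-1 ^+ N)^-1 * (`|y'| / ka) * lam 2^-1 1 ka N)).
      by rewrite q3 le_eqVlt; apply/orP; left; apply/eqP; field; rewrite ?(lt0r_neq0 k0) ?expf_neq0.
    exact: (ler_wpM2l (mulr_ge0 P0 y0) q2).
  have := mulr_ge0 y0 (ltW L0); have := mulr_ge0 P0 (ltW L0); lra.
Qed.

Let rc1 := rho_cst tau c0 r 1 n.

(** The first summand bounds [Gmain] at the poles, the second one on the far lines. *)
Let M0 := (1 - tau) / (c0 * tau ^+ m) + (1 - tau) * (r ^+ n)^-1.

(** Both kinds of control at once: the variables to be reflected are reached with a [G] that carries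
    the factors [rho] of the variables frozen before. *)
Definition cls (ka : R) (d : nat) (G : R[i] -> R[i]) := exists g : R[i] -> R[i],
  [/\ forall z, G z = z^-1 * g z,
      adm tau c0 r 1 hi n m ka d (M0 * rc1 ^+ d) G d &
      radm ka d (1 * rc2 ^+ d) g].

Lemma M0_ge0 : 0 <= M0.
Proof.
have c := c0_gt0; apply: addr_ge0; first by apply: divr_ge0; apply: ltW => //; exact: cm_gt0.
by apply: mulr_ge0; [exact: ltW|rewrite invr_ge0 exprn_ge0 // ltW // r_gt0].
Qed.

Lemma cls_adm d : (d <= n)%N -> exists (M : R) (e : nat), 0 <= M /\
  forall ka s G, scal c0 r 1 n ka s -> cls ka d G -> adm tau c0 r 1 hi n m ka e M G d.
Proof.
move=> dn; exists (M0 * rc1 ^+ d), d; split.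
  rewrite mulr_ge0 ?M0_ge0 // exprn_ge0 //.
  by apply: rho_cst_ge0 => //; [exact: ltW c0_gt0|exact: r_gt0].
by move=> ka s G _ [g [_ h _]].
Qed.

Lemma cls_rho ka s d G y : scal c0 r 1 n ka s -> (d < n)%N -> cls ka d G ->
  cls ka d.+1 (fun z => G z * rho tau (zl (- lam r 1 ka d) y) z).
Proof.
move=> sk dn [g [Gg h3 h4]]; exists (fun z => g z * rho tau (zl (- lam r 1 ka d) y) z); split.
- by move=> z; rewrite Gg -mulrA.
- rewrite exprSr mulrA.
  exact: (adm_rho tau0 (ltW c0_gt0) ct_tau r_gt0 r_le r_th ltr01 y sk dn h3).
- by rewrite exprSr mulrA; exact: (radm_rho y sk dn h4).
Qed.

Definition Gmain (z : R[i]) : R[i] := z^-1 * (tau - 1)%:C.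

Lemma cls_main ka s : scal c0 r 1 n ka s -> cls ka 0 Gmain.
Proof.
move=> sk; have [k0 _ _] := scal_gt0 sk; have c := c0_gt0.
have n1 : `|tau - 1| = 1 - tau by rewrite ler0_norm ?opprB // subr_le0 ltW.
have hn1 : 0 <= 1 - tau by exact: ltW.
exists (fun=> (tau - 1)%:C); split => //; rewrite expr0 mulr1; split.
- apply: scM; last exact: sc_cst.
  apply: (sc_ext (h1 := fun z => ((-1)%:C * z + 0)^-1 * (-1)%:C)).
    by move=> z; rewrite N1C mulN1r addr0 invrN mulrN1 opprK.
  apply: scM; last exact: sc_cst.
  apply: (@sc_inv R _ _ _ _ (- hi)) => [|z /andP[_ zh]]; first by rewrite oppr_gt0.
  by rewrite addr0 RezCM mulN1r lerN2.
- move=> k km; rewrite /Gmain cnM cnV !cnR n1 normrN ger0_norm; last exact: ltW (cm_gt0 k).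
  rewrite mulrC; apply: (@le_trans _ _ ((1 - tau) / (c0 * tau ^+ m))).
    by rewrite ler_wpM2l // lef_pV2 ?posrE ?cm_gt0 // cm_le.
  by rewrite lerDl mulr_ge0 // invr_ge0 exprn_ge0 // ltW // r_gt0.
- move=> k y /andP[_ kn]; rewrite /Gmain cnM cnV cnR n1 expr0 mulr1 mulrC.
  have rk : 0 < r ^+ n * ka by rewrite mulr_gt0 // exprn_gt0 // r_gt0.
  have L : r ^+ n * ka <= cn (zl (- lam r 1 ka k) y).
    apply: le_trans (Rez_le_cn _); rewrite Rez_zl normrN ger0_norm; last first.
      by rewrite /lam mul1r mulr_ge0 ?exprn_ge0 // ltW // r_gt0.
    have := lam_le r_gt0 r_le ltr01 k0 kn; by rewrite /lam !mul1r.
  apply: (@le_trans _ _ ((1 - tau) * (r ^+ n * ka)^-1)).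
    by rewrite ler_wpM2l // lef_pV2 ?posrE //; exact: lt_le_trans L.
  rewrite invfM mulrA ler_wpM2r ?invr_ge0 ?(ltW k0) // lerDr.
  by apply: divr_ge0 => //; exact: ltW (cm_gt0 m).
- exact: sc_cst.
- by rewrite cnR n1 gerBl ltW.
- by move=> k y _; rewrite cnR n1 expr0 mulr1 gerBl ltW.
Qed.

Definition tailQ (a x : nat -> R) : Prop :=
  (forall j, (j < N)%N -> x j <= 0) /\ (forall j, (j < N)%N -> - hi2 <= a j).

Definition Grev k (g : R[i] -> R[i]) (w : R[i]) : R[i] := ((c0 * tau ^+ k)%:C - w)^-1 * - g (- w).

Lemma tail_adm ka s d k e M g : scal c0 r 1 n ka s -> (k <= m)%N -> 0 <= M -> radm ka d M g -> (d <= e)%N ->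
  adm tau^-1 0 2^-1 1 hi2 N N ka e ((c0 * tau ^+ m)^-1 * M + (2^-1 ^+ N)^-1 * M) (Grev k g) 0.
Proof.
move=> sk km Mp [g1 g2 g3] de; have [k0 _ _] := scal_gt0 sk.
have cm := cm_gt0 m; have ck := cm_gt0 k; have cmk := cm_le km.
have i1 : 0 <= (c0 * tau ^+ m)^-1 by rewrite invr_ge0 ltW.
have i2 : 0 <= (2^-1 ^+ N)^-1 :> R by rewrite invr_ge0 exprn_ge0.
split.
- apply: scM.
    apply: (sc_ext (h1 := fun z => ((-1)%:C * z + (c0 * tau ^+ k)%:C)^-1)).
      by move=> z; rewrite N1C mulN1r addrC.
    apply: (@sc_inv R _ _ _ _ (c0 * tau ^+ m - hi2)) => [|z /andP[_ zh]]; first by rewrite subr_gt0.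
    by rewrite RezD RezCM RezC mulN1r addrC lerD // lerN2.
  apply: (sc_ext (h1 := fun w => (-1)%:C * g (- w))).
    by move=> z; rewrite N1C mulN1r.
  by apply: scM => //; exact: sc_cst.
- move=> j _; rewrite mul0r oppr0 /Grev (_ : 0%:C = 0 :> R[i]) // subr0 oppr0 cnM cnV cnN cnR (gtr0_norm ck).
  apply: (@le_trans _ _ ((c0 * tau ^+ m)^-1 * M)); last by rewrite lerDl mulr_ge0.
  by rewrite ler_pM ?cn_ge0 ?invr_ge0 ?(ltW ck) // lef_pV2 ?posrE.
- move=> j y /andP[_ jN]; rewrite /Grev cnM cnV cnN.
  have [q1 q2 q3] := lam2_le sk jN.
  have y0 : 0 <= `|y| / ka by rewrite divr_ge0 // ltW.
  have L : 2^-1 ^+ N * ka <= cn ((c0 * tau ^+ k)%:C - zl (- lam 2^-1 1 ka j) y).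
    apply: le_trans (Rez_le_cn _); rewrite RezB RezC Rez_zl opprK -q3 ger0_norm; last first.
      by rewrite addr_ge0 // ?(ltW ck) // (le_trans _ q1).
    by apply: (le_trans q2); rewrite lerDr ltW.
  have hk : 0 < 2^-1 ^+ N * ka by rewrite mulr_gt0 // exprn_gt0.
  apply: (@le_trans _ _ ((2^-1 ^+ N * ka)^-1 * (M * (1 + `|y| / ka) ^+ e))).
    rewrite ler_pM ?cn_ge0 ?invr_ge0 ?cn_ge0 //.
      by rewrite lef_pV2 ?posrE //; exact: lt_le_trans L.
    apply: (le_trans (g3 j y jN)); rewrite ler_wpM2l // ler_weXn2l // lerDl //.
  rewrite invfM !mulrA ler_wpM2r ?exprn_ge0 ?addr_ge0 //.
  rewrite mulrDl [X in X <= _]mulrAC lerDr.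
  by rewrite !mulr_ge0 ?invr_ge0 // ltW.
Qed.

Let Pc : R := \prod_(B < N) (tau^-1) ^+ B.

Lemma scal_rev ka s : scal c0 r 1 n ka s -> scal 0 2^-1 1 N ka s.
Proof.
move=> sk; have [q _ _] := lam2_le sk (leqnn N).
by case: sk => h1 h3 _; split => //; rewrite add0r.
Qed.

(** After reflection [c0 = 0], so all residues are taken at the same point 0, where the exponentials
    equal 1. Hence the limit is a power of one number and does not depend on [x]. *)
Lemma tail_approx d k : (d <= n)%N -> (k <= m)%N -> exists C : R, 0 <= C /\
  forall ka s (a x : nat -> R) G g, scal c0 r 1 n ka s -> (forall z, G z = z^-1 * g z) ->
  adm tau c0 r 1 hi n m ka d (M0 * rc1 ^+ d) G d -> radm ka d (1 * rc2 ^+ d) g ->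
  lin tau c0 hi N k a -> tailQ a x ->
  cn (IQ tau s N a x G (c0 * tau ^+ k)) <= C /\
  cn (IQ tau s N a x G (c0 * tau ^+ k) - Pc%:C * (Grev k g 0 * (2 * pi)%:C) ^+ N) <= C * ka^-1.
Proof.
move=> dn km.
pose M := (c0 * tau ^+ m)^-1 * (1 * rc2 ^+ d) + (2^-1 ^+ N)^-1 * (1 * rc2 ^+ d).
have Mp : 0 <= 1 * rc2 ^+ d by rewrite mul1r exprn_ge0 // rc2_ge0.
have Mge : 0 <= M.
  apply: addr_ge0; apply: mulr_ge0 => //; rewrite invr_ge0; first exact: ltW (cm_gt0 m).
have ti0 : 0 < tau^-1 by rewrite invr_gt0.
have ti1 : 2 * 2^-1 <= tau^-1 by rewrite mulfV // invf_ge1 // ltW.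
have h0 : forall k, 0 * tau^-1 ^+ k <= 0 :> R by move=> j; rewrite mul0r.
have [C [C0 hC]] := @adm_approx R tau^-1 0 2^-1 1 hi2 N N ti0 (lexx 0) h0 ltac:(by rewrite invr_gt0)
   (lexx _) ti1 ltr01 N d M (leqnn _) (leqnn _) Mge.
have Pc0 : 0 <= Pc by rewrite /Pc prodr_ge0 // => i _; rewrite exprn_ge0 // ltW.
exists (Pc * C); split; first exact: mulr_ge0.
move=> ka s a x G g sk Gg hG hg la [x0 ah].
have [k0 s0 s1] := scal_gt0 sk.
have hGr := tail_adm sk km Mp hg (leqnn d).
have [l1 l2 l3] := la.
have [[gs _ _] [gr _ _]] := (hG, hGr).
have lt1 j : (j < N)%N -> - (c0 * tau ^+ k) < a j.
  by move=> jN; have := l3 j 0%N isT jN; rewrite addn0.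
have ac j : (j < N)%N -> - c0 < a j.
  by move=> jN; apply: le_lt_trans (lt1 j jN); rewrite lerN2 ct_tau.
have aneg j : (j < N)%N -> a j < 0 by move=> jN; exact: le_lt_trans (l2 j jN) hi0.
have ld := scal_lam r_gt0 r_le ltr01 sk dn.
have al j : (j < N)%N -> - lam r 1 ka d <= a j <= hi.
  by move=> jN; rewrite l2 // andbT; have := ac j jN; lra.
have [q1 _ _] := lam2_le sk (leq0n N).
have al' j : (j < N)%N -> - lam 2^-1 1 ka 0 <= - a j <= hi2.
  move=> jN; have := aneg j jN; have := ah j jN => h h'; apply/andP; split; lra.
have aN j : (j < N)%N -> a j != 0 by move=> jN; rewrite lt_eqF // aneg.
rewrite (IQ_rev x s0 tau0 Gg gs al lt1 l1 aN gr al') -/Pc.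
pose a' j := - a (revn N j); pose x' j := - x (revn N j).
have rN := @involn_rev N.
have la' : lin tau^-1 0 hi2 N 0 a'.
  split.
  - move=> A B AB BN; rewrite /a' mulrN ltrN2 ltr_pdivlMl //; have [h3 h4] := revn_ltn AB BN; exact: l1.
  - by move=> j jN; rewrite /a'; have [h1 _] := rN j jN; have /andP[] := al' _ h1.
  - by move=> j i _ jN; rewrite mul0r oppr0 oppr_gt0; have [h1 _] := rN j jN; exact: aneg.
have x0' j : (j < N)%N -> 0 <= x' j.
  by move=> jN; rewrite oppr_ge0; have [h1 _] := rN j jN; exact: x0.
have [H1 H2] := hC ka s a' x' (Grev k g) (scal_rev sk) hGr la' x0'.
have E : \prod_(j < N) resid tau^-1 0 s x' (Grev k g) 0 j = (Grev k g 0 * (2 * pi)%:C) ^+ N.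
  rewrite -[in RHS](card_ord N) -prodr_const; apply: eq_bigr => j _.
  by rewrite /resid !mul0r expr0n mulr0 subr0 expR0 mulr1 oppr0.
rewrite E in H2; split.
  by rewrite cnM cnR (ger0_norm Pc0) ler_wpM2l.
by rewrite -mulrBr cnM cnR (ger0_norm Pc0) -mulrA ler_wpM2l.
Qed.

Lemma two_sided : exists C : R, 0 <= C /\
  forall ka s (a x : nat -> R), scal c0 r 1 n ka s -> lin tau c0 hi n 0 a ->
  (forall j, (j < m)%N -> 0 <= x j) -> tailQ (fun j => a (m + j)%N) (fun j => x (m + j)%N) ->
  cn (IQ tau s n a x Gmain c0) <= C /\
  cn (IQ tau s n a x Gmain c0 - (\prod_(j < m) resid tau c0 s x Gmain 0 j) *
    (Pc%:C * (Grev m (fun=> (tau - 1)%:C) 0 * (2 * pi)%:C) ^+ N)) <= C * ka^-1.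
Proof.
have HB d k : (d <= n)%N -> (k <= m)%N -> exists C : R, 0 <= C /\ forall ka s (a x : nat -> R) G,
    scal c0 r 1 n ka s -> cls ka d G -> lin tau c0 hi N k a -> tailQ a x ->
    cn (IQ tau s N a x G (c0 * tau ^+ k)) <= C.
  move=> dn km; have [C [C0 hC]] := tail_approx dn km; exists C; split => //.
  move=> ka s a x G sk [g [Gg hG hg]] la hQ.
  by have [] := hC ka s a x G g sk Gg hG hg la hQ.
have mn : (m <= n)%N by rewrite /n leq_addr.
have [C1 [C10 h1]] := cl_bound tau0 (ltW c0_gt0) ct_tau r_gt0 r_le r_th ltr01 cls_adm cls_rho HB
  (m := m) (d := 0%N) (k := 0%N) mn (leqnn _).
have [C2 [C20 h2']] := cl_approx tau0 (ltW c0_gt0) ct_tau r_gt0 r_le r_th ltr01 cls_adm cls_rho HB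
  (m := m) (d := 0%N) (k := 0%N) mn (leqnn _).
have [C3 [C30 h3]] := tail_approx (leq0n n) (leqnn m).
(* Bound for one residue, uniform in [x] because [x j >= 0] and [s <= 1]. *)
pose K := M0 * (2 * pi * expR (2^-1 * c0 ^+ 2)).
have K0 : 0 <= K by apply: mulr_ge0; [exact: M0_ge0|rewrite !mulr_ge0 ?pi_ge0 ?expR_ge0].
have Km : 0 <= K ^+ m by exact: exprn_ge0.
exists (C1 + C2 + K ^+ m * C3); split.
  by apply: addr_ge0; [exact: addr_ge0|exact: mulr_ge0].
move=> ka s a x sk la x0 hQ; have [k0 s0 s1] := scal_gt0 sk.
have hc := cls_main sk; have [g [Gg gm _]] := hc; have [_ gb _] := gm.
have kV : 0 <= ka^-1 by rewrite invr_ge0 ltW.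
have H1 := h1 ka s a x Gmain sk hc la x0 hQ.
have H2 := h2' ka s a x Gmain sk hc la x0 hQ.
rewrite expr0 mulr1 in H1 H2; rewrite add0n in H2.
split.
  by apply: (le_trans H1); rewrite -addrA lerDl addr_ge0 // mulr_ge0.
set P := \prod_(j < m) _ in H2 *.
have PK : cn P <= K ^+ m.
  rewrite /P cn_prod -[X in _ <= _ ^+ X](card_ord m) -prodr_const; apply: ler_prod => j _.
  rewrite cn_ge0 /= /resid add0n cnM /K.
  have jm := ltn_ord j; have cj := ltW (cm_gt0 j).
  have := gb j (ltnW jm); rewrite expr0 mulr1 => hG.
  apply: ler_pM; rewrite ?cn_ge0 // cnR ger0_norm ?mulr_ge0 ?expR_ge0 ?pi_ge0 //.
  rewrite ler_wpM2l ?mulr_ge0 ?pi_ge0 // ler_expR.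
  apply: (@le_trans _ _ (2^-1 * s * (c0 * tau ^+ j) ^+ 2)).
    by rewrite gerDl oppr_le0 mulr_ge0 // x0.
  rewrite -mulrA ler_wpM2l // -[leRHS]mul1r ler_pM ?sqr_ge0 ?(ltW s0) //.
  by rewrite lerXn2r ?nnegrE ?(ltW c0_gt0) // ct_tau.
have lt : lin tau c0 hi N m (fun j => a (m + j)%N).
  case: la => l1 l2 l3; split.
  - by move=> A B AB BN; apply: l1; rewrite ?ltn_add2l.
  - by move=> j jN; apply: l2; rewrite ltn_add2l.
  - by move=> j i ij jN; have := l3 (m + j)%N (m + i)%N; rewrite leq_add2l ltn_add2l; apply.
have [g0 [Gg0 a0 r0]] := hc.
have [_ H3] : cn (IQ tau s N (fun j => a (m + j)%N) (fun j => x (m + j)%N) Gmain (c0 * tau ^+ m)) <= C3 /\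
  cn (IQ tau s N (fun j => a (m + j)%N) (fun j => x (m + j)%N) Gmain (c0 * tau ^+ m) -
    Pc%:C * (Grev m (fun=> (tau - 1)%:C) 0 * (2 * pi)%:C) ^+ N) <= C3 * ka^-1.
  apply: (h3 ka s _ _ Gmain (fun=> (tau - 1)%:C) sk _ a0 _ lt hQ) => //.
  split; first exact: sc_cst.
  - by rewrite cnR expr0 mulr1 ler0_norm ?opprB ?gerBl ?subr_le0 ltW.
  - by move=> k y _; rewrite cnR !expr0 !mulr1 ler0_norm ?opprB ?gerBl ?subr_le0 ltW.
set I1 := IQ _ _ n _ _ _ _ in H2 *; set I2 := IQ _ _ N _ _ _ _ in H2 H3.
set T := Pc%:C * _ in H3 *.
have -> : I1 - P * T = (I1 - P * I2) + P * (I2 - T) by ring.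
apply: (le_trans (cnD _ _)); rewrite mulrDl lerD //.
  by apply: (le_trans H2); rewrite ler_wpM2r // lerDr.
by rewrite cnM -mulrA ler_pM ?cn_ge0.
Qed.
End TwoSided.

(** * The right-hand side for small time *)

Section InitialValue.
Variable R : realType.
Variables (tau : R) (n : nat) (a : nat -> R).
Hypotheses (tau0 : 0 < tau) (tau1 : tau < 1) (n1 : (1 <= n)%N).
Hypotheses (a0 : - (1 - tau) < a 0%N) (aS : forall j, (j.+1 < n)%N -> a j < a j.+1)
  (an : a n.-1 < 0) (tS : forall j, (j.+1 < n)%N -> tau * a j < a j.+1).

Definition Uf (s : R) (x : nat -> R) : R[i] :=
  (tau ^+ (n * n.-1)./2)%:C * contour_iter n a (integrand n tau s x).

Lemma contour_mono i j : (i <= j)%N -> (j < n)%N -> a i <= a j.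
Proof.
elim: j => [|j IH]; first by rewrite leqn0 => /eqP ->.
rewrite leq_eqVlt => /orP[/eqP -> //|]; rewrite ltnS => ij jn.
by apply: le_trans (IH ij (ltnW jn)) _; exact: ltW (aS jn).
Qed.

Lemma contour_neg j : (j < n)%N -> a j < 0.
Proof.
move=> jn; apply: le_lt_trans an; apply: contour_mono; last by rewrite prednK.
by rewrite -ltnS prednK.
Qed.

(** The conditions [tau a_j < a_(j+1)] propagate the lower bound from [a 0]: contour [j] stays to
    the right of every pole that variable [j] can acquire from the residues of earlier ones. *)
Lemma contour_low j : (j < n)%N -> - ((1 - tau) * tau ^+ j) < a j.
Proof.
elim: j => [|j IH] jn; first by rewrite expr0 mulr1.
have := IH (ltnW jn); have := tS jn => h1 h2.
apply: lt_trans h1; rewrite exprS mulrCA -mulrN ltr_pM2l //.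
Qed.

Lemma contour_tau A B : (A < B)%N -> (B < n)%N -> tau * a A < a B.
Proof.
move=> AB Bn; apply: lt_le_trans (tS (leq_ltn_trans AB Bn)) _.
exact: contour_mono.
Qed.

Lemma contour_lin : lin tau (1 - tau) (a n.-1) n 0 a.
Proof.
split.
- exact: contour_tau.
- by move=> j jn; apply: contour_mono; rewrite ?prednK // -ltnS prednK.
- move=> j i ij jn; apply: lt_le_trans (contour_low (leq_ltn_trans ij jn)) _.
  exact: contour_mono.
Qed.

Lemma integrandE s x z : integrand n tau s x z = gx n s x z * hg tau (Gmain tau) (1 - tau) n z.
Proof.
rewrite /integrand /hg /gx mulrA; congr (_ * _); rewrite -big_split; apply: eq_bigr => j _.
by rewrite cexpD /gss /Gmain /=; move: (cexp _) (cexp _) ((z j)^-1) (_^-1) => p q u v; ring.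
Qed.

Lemma pbd_main : pbd n a (hg tau (Gmain tau) (1 - tau) n).
Proof.
have sG : sc (a 0%N) (a n.-1) (Gmain tau).
  apply: scM; last exact: sc_cst.
  apply: (sc_ext (h1 := fun z => ((-1)%:C * z + 0)^-1 * (-1)%:C)).
    by move=> z; rewrite N1C mulN1r addr0 invrN mulrN1 opprK.
  apply: scM; last exact: sc_cst.
  apply: (@sc_inv R _ _ _ _ (- a n.-1)) => [|z /andP[_ zh]]; first by rewrite oppr_gt0.
  by rewrite addr0 RezCM mulN1r lerN2.
apply: (pbd_hg sG) => [j jn|j jn|A B AB Bn].
- by have [_ h _] := contour_lin; rewrite h // andbT contour_mono.
- have [_ _ h] := contour_lin; have := h j 0%N isT jn.
  by rewrite expr0 mulr1 => h'; rewrite gt_eqF // -ltrBlDr sub0r.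
- exact: contour_tau.
Qed.

Lemma UfE s x : 0 < s ->
  Uf s x = (tau ^+ (n * n.-1)./2 * (2 * pi)^-1 ^+ n)%:C * IQ tau s n a x (Gmain tau) (1 - tau).
Proof.
move=> s0; rewrite /Uf CM -mulrA; congr (_ * _).
rewrite rmorphXn /IQ -(contour_gint x s0 pbd_main); congr contour_iter.
by apply/funext => z; exact: integrandE.
Qed.

(** The residue is kept exactly, with its dependence on [s]; its limit for small [s] is
    [phi_lim]. *)
Definition phi_main (s : R) j (y : R) : R :=
  if 0 <= y then expR (2^-1 * s * ((1 - tau) * tau ^+ j) ^+ 2 - (1 - tau) * tau ^+ j * y) else 1.

Lemma prod_pow N : \prod_(j < N) tau ^+ j = tau ^+ (N * N.-1)./2.
Proof.
rewrite -(big_mkord xpredT (fun j => tau ^+ j)) -bin2 -bin2_sum.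
by elim: N => [|N IH]; rewrite ?big_nil // !big_nat_recr //= IH exprD.
Qed.

(** The prefactor [tau^(n(n-1)/2)] cancels: residue [j] contributes [tau^(-j)], each of the [N]
    reflected variables [tau^(-m)], and the reversal [tau^(-N(N-1)/2)]. *)
Lemma main_value m N s (x : nat -> R) : n = (m + N)%N -> (forall j, (j < m)%N -> 0 <= x j) ->
  (forall j, (m <= j < n)%N -> x j < 0) ->
  (tau ^+ (n * n.-1)./2 * (2 * pi)^-1 ^+ n)%:C * ((\prod_(j < m) resid tau (1 - tau) s x (Gmain tau) 0 j) *
    ((\prod_(B < N) (tau^-1) ^+ B)%:C * (Grev tau m (fun=> (tau - 1)%:C) 0 * (2 * pi)%:C) ^+ N)) =
  (\prod_(j < n) phi_main s j (x j))%:C.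
Proof.
move=> nE xp xn; have t0 : tau != 0 by exact: lt0r_neq0.
have c0 : 1 - tau != 0 by rewrite subr_eq0 gt_eqF.
have p0 : 2 * pi != 0 :> R by rewrite mulf_neq0 // gt_eqF // pi_gt0.
have CV (u : R) : u^-1%:C = (u%:C)^-1 :> R[i] by exact: fmorphV.
have -> : Grev tau m (fun=> (tau - 1)%:C) 0 = (tau^-1 ^+ m)%:C.
  rewrite /Grev subr0 -CV -CN -CM; congr (_%:C); rewrite opprB exprVn; field.
  by rewrite c0 expf_neq0.
have -> : \prod_(j < m) resid tau (1 - tau) s x (Gmain tau) 0 j =
    (\prod_(j < m) (tau^-1 ^+ j * (2 * pi) * phi_main s j (x j)))%:C.
  rewrite rmorph_prod; apply: eq_bigr => j _; rewrite /resid /phi_main xp // add0n /Gmain.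
  rewrite -CV -!CM; congr (_%:C); rewrite !mulrA; congr (_ * _); congr (_ * _); congr (_ * _).
  rewrite exprVn; field; by rewrite c0 expf_neq0.
rewrite -CM -[X in _ * (_ * (_ * X))]rmorphXn -!CM; congr (_%:C).
move: (2 * pi) p0 => p p0; rewrite -prod_pow; subst n; rewrite !big_split_ord /=.
rewrite [X in _ = _ * X]big1 ?mulr1; last first.
  move=> j _; rewrite /phi_main lt_geF // xn // leq_addr /= ltn_add2l; exact: ltn_ord.
have -> : \prod_(j < m) (tau^-1 ^+ j * p * phi_main s j (x j)) =
    (\prod_(j < m) tau ^+ j)^-1 * p ^+ m * \prod_(j < m) phi_main s j (x j).
  rewrite !big_split /= prodr_const card_ord; congr (_ * _ * _).
  by rewrite -prodfV; apply: eq_bigr => j _; rewrite exprVn.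
have -> : \prod_(B < N) tau^-1 ^+ B = (\prod_(B < N) tau ^+ B)^-1.
  by rewrite -prodfV; apply: eq_bigr => j _; rewrite exprVn.
have -> : \prod_(j < N) tau ^+ (m + j) = (tau ^+ m) ^+ N * \prod_(j < N) tau ^+ j.
  under eq_bigr do rewrite exprD; by rewrite big_split /= prodr_const card_ord.
have h1 k : \prod_(j < k) tau ^+ j != 0.
  by apply/prodf_neq0 => j _; rewrite expf_neq0.
move: (h1 m) (h1 N); move: (\prod_(j < m) tau ^+ j) (\prod_(j < N) tau ^+ j) (\prod_(j < m) phi_main _ _ _) => u v w u0 v0.
rewrite !exprMn exprD !exprVn.
have q0 : (tau ^+ m) ^+ N != 0 by rewrite !expf_neq0.
have q1 : p ^+ m != 0 by rewrite expf_neq0.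
have q2 : p ^+ N != 0 by rewrite expf_neq0.
move: ((tau ^+ m) ^+ N) (p ^+ m) (p ^+ N) q0 q1 q2 => y1 y2 y3 q0 q1 q2.
by field; rewrite u0 v0 q0 q1 q2.
Qed.

Lemma weyl_mono (x : nat -> R) i j : weyl_minus n x -> (i <= j)%N -> (j < n)%N -> x j <= x i.
Proof.
move=> wx; elim: j => [|j IH]; first by rewrite leqn0 => /eqP ->.
rewrite leq_eqVlt => /orP[/eqP -> //|]; rewrite ltnS => ij jn.
by apply: le_trans (wx j jn) (IH ij (ltnW jn)).
Qed.

Lemma weyl_split (x : nat -> R) : weyl_minus n x -> exists m, [/\ (m <= n)%N,
  forall j, (j < m)%N -> 0 <= x j & forall j, (m <= j < n)%N -> x j < 0].
Proof.
move=> wx; have ex : exists m, (m == n) || (x m < 0) by exists n; rewrite eqxx.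
case: (ex_minnP ex) => m hm mmin; exists m.
have mn : (m <= n)%N by apply: mmin; rewrite eqxx.
split => // [j jm|j /andP[mj jn]].
  rewrite leNgt; apply/negP => xj; have := mmin j; rewrite xj orbT => /(_ isT).
  by rewrite leqNgt jm.
case/orP: hm => [/eqP mE|xm]; first by move: jn; rewrite ltnNge -mE mj.
by apply: le_lt_trans xm; exact: weyl_mono.
Qed.

Lemma U_initial : exists C k1 : R, [/\ 0 <= C, 1 <= k1 & forall ka s (x : nat -> R),
  k1 <= ka -> s * ka ^+ 2 = 1 -> weyl_minus n x ->
  cn (Uf s x) <= C /\ cn (Uf s x - (\prod_(j < n) phi_main s j (x j))%:C) <= C * ka^-1].
Proof.
have ts m : exists C : R, 0 <= C /\ ((m <= n)%N -> forall ka s (x : nat -> R),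
    scal (1 - tau) (tau / 2) 1 n ka s ->
    (forall j, (j < m)%N -> 0 <= x j) -> (forall j, (m <= j < n)%N -> x j < 0) ->
    cn (Uf s x) <= C /\ cn (Uf s x - (\prod_(j < n) phi_main s j (x j))%:C) <= C * ka^-1).
  have [mn|] := leqP m n; last by exists 0; split => //; rewrite leqNgt => /negP.
  (* The right edge of the reflected strip: [- a m] is the largest reflected abscissa. For [m = n]
     nothing is reflected and 0 serves as a value below the pole. *)
  pose hi2 := if (m < n)%N then - a m else 0.
  have h2 : hi2 < (1 - tau) * tau ^+ m.
    rewrite /hi2; case: ifP => mn'; last by rewrite mulr_gt0 ?exprn_gt0 // subr_gt0.
    by rewrite ltrNl; exact: contour_low.
  have nE : n = (m + (n - m))%N by rewrite subnKC.
  have [C [C0 hC]] := @two_sided R tau (a n.-1) hi2 m (n - m) tau0 tau1 an h2.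
  rewrite -nE in hC.
  pose K := tau ^+ (n * n.-1)./2 * (2 * pi)^-1 ^+ n.
  have K0 : 0 <= K.
    apply: mulr_ge0; first by rewrite exprn_ge0 // ltW.
    by rewrite exprn_ge0 // invr_ge0 mulr_ge0 ?pi_ge0.
  exists (K * C); split => [|_ ka s x sk xp xn]; first exact: mulr_ge0.
  have [k0 s0 s1] := scal_gt0 sk.
  have hQ : tailQ hi2 (n - m) (fun j => a (m + j)%N) (fun j => x (m + j)%N).
    have lt j : (j < n - m)%N -> (m <= m + j < n)%N by rewrite leq_addr ltn_subRL.
    split=> j jN; first by rewrite ltW // xn // lt.
    have /andP[h1 h3] := lt j jN.
    by rewrite /hi2 (leq_ltn_trans h1 h3) opprK contour_mono.
  have [H1 H2] := hC ka s a x sk contour_lin xp hQ.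
  rewrite UfE // -(main_value s nE xp xn) -mulrBr !cnM !cnR (ger0_norm K0).
  by split; [exact: (ler_wpM2l K0 H1)|rewrite -mulrA; exact: (ler_wpM2l K0 H2)].
have [C hC] := choice ts.
have r0 : 0 < (tau / 2) ^+ n by rewrite exprn_gt0 // divr_gt0.
(* The constants depend on the number [m] of nonnegative coordinates, hence on [x]; the sum over [m]
   makes them uniform. *)
exists (\sum_(m < n.+1) C m), (Num.max 1 ((1 - tau + 1) / (tau / 2) ^+ n)).
have C0 m : 0 <= C m by case: (hC m).
split; [exact: sumr_ge0|by rewrite le_max lexx|].
move=> ka s x; rewrite ge_max => /andP[k1 k2] sk wx.
have [m [mn xp xn]] := weyl_split wx.
have sc' : scal (1 - tau) (tau / 2) 1 n ka s.
  by split => //; rewrite /lam mul1r mulrC -ler_pdivrMr.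
have [_ /(_ mn ka s x sc' xp xn)[H1 H2]] := hC m.
have Cm : C m <= \sum_(m < n.+1) C m.
  have mn' : (m < n.+1)%N by rewrite ltnS.
  by rewrite (bigD1 (Ordinal mn')) //= lerDl sumr_ge0.
split; first exact: le_trans H1 Cm.
apply: (le_trans H2); rewrite ler_wpM2r // invr_ge0.
by apply: le_trans k1; exact: ler01.
Qed.
End InitialValue.

(** * Regularity in space and time *)

Section Regularity.
Variable R : realType.
Local Notation leb := [the {sigma_finite_measure set (measurableTypeR R) -> \bar R} of @lebesgue_measure R].
Variables (n : nat) (a : nat -> R).
Hypothesis a1 : forall j, (j < n)%N -> `|a j| <= 1.

(** The l^1 norm; as [|a_j| <= 1], it bounds the real part of the exponent [dotz n x z] on the
    contours. *)
Definition xn (x : nat -> R) : R := \sum_(j < n) `|x j|.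

Lemma xn_ge0 x : 0 <= xn x.
Proof. exact: sumr_ge0. Qed.

Lemma xnD x u : xn (fun j => x j + u j) <= xn x + xn u.
Proof. by rewrite /xn -big_split ler_sum // => j _; exact: ler_normD. Qed.

Lemma dot_le_xn (x : nat -> R) : `|\sum_(j < n) x j * a j| <= xn x.
Proof.
apply: (le_trans (ler_norm_sum _ _ _)); apply: ler_sum => j _.
by rewrite normrM ler_piMr // a1.
Qed.

Lemma gx_shift s (x u : nat -> R) z :
  gx n s (fun j => x j + u j) z = gx n s x z * cexp (dotz n u z).
Proof.
rewrite !gx_dotz -mulrA -cexpD; congr (_ * cexp _).
exact: dotzD.
Qed.

Lemma Rez_dotz_zline (u f : nat -> R) : Rez (dotz n u (zline n a f)) = \sum_(j < n) u j * a j.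
Proof. by rewrite Rez_dotz; apply: eq_bigr => j _; rewrite zline_zl // Rez_zl. Qed.

Lemma gssD (s de : R) z : gss (s + de) z = gss s z * cexp ((2^-1 * de)%:C * z ^+ 2).
Proof. by rewrite /gss -cexpD -mulrDl -CD -mulrDr. Qed.

(** A majorant for all times in [[de, T]]: the decay in the imaginary direction is taken at the
    smallest time, the growth in [a j] at the largest. *)
Definition vmaj (de T : R) m j (y : R) : R :=
  expR (2^-1 * (T - de) * a j ^+ 2) * (cn (gss de (zl (a j) y)) * (1 + cn (zl (a j) y)) ^+ m).

Lemma vmaj_ge0 de T m j y : 0 <= vmaj de T m j y.
Proof.
by rewrite /vmaj mulr_ge0 ?expR_ge0 // mulr_ge0 ?cn_ge0 // exprn_ge0 // addr_ge0 ?cn_ge0.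
Qed.

Lemma rintegrable_vmaj de T m j : 0 < de -> rintegrable leb (vmaj de T m j).
Proof. by move=> d0; apply: rintegrableZ; exact: rintegrable_gss_poly. Qed.

Lemma gx_maj de T s x m (f : nat -> R) : 0 < de -> de <= s <= T ->
  cn (gx n s x (zline n a f)) * \prod_(j < n) (1 + cn (zl (a j) (f j))) ^+ m <=
  expR (xn x) * \prod_(j < n) vmaj de T m j (f j).
Proof.
move=> d0 /andP[ds sT]; rewrite gx_dotz cnM cn_cexp Rez_dotz_zline [X in X * _ <= _]mulrC -mulrA.
rewrite ler_pM ?expR_ge0 ?mulr_ge0 ?cn_ge0 ?prodr_ge0 // => [i _||].
- by rewrite exprn_ge0 // addr_ge0 ?cn_ge0.
- by rewrite ler_expR; apply: le_trans (dot_le_xn x); exact: ler_norm.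
rewrite cn_prod -big_split; apply: ler_prod => j _.
rewrite mulr_ge0 ?cn_ge0 ?exprn_ge0 ?addr_ge0 ?cn_ge0 //= /vmaj mulrA zline_zl //.
rewrite ler_wpM2r ?exprn_ge0 ?addr_ge0 ?cn_ge0 // !cn_gss mulrA -expRD ler_pM ?expR_ge0 ?gk_ge0 //.
  rewrite ler_expR -mulrDl ler_wpM2r ?sqr_ge0 // -mulrDr subrK ler_pM2l //.
by rewrite /gk ler_expR lerN2 ler_wpM2r ?sqr_ge0 // ler_pM2l.
Qed.

(** Here [g] stands for increments of the integrand; growth, Lipschitz, second-order and time
    estimates differ only in the bound they provide for [g]. *)
Lemma gint_le (H : (nat -> R[i]) -> R[i]) de T C m : pbd n a H -> 0 < de -> 0 <= C ->
  forall s x (M : R) (g : (nat -> R[i]) -> R[i]), de <= s <= T -> 0 <= M ->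
  cmeas (fun t : RT R n => g (zc a t)) ->
  (forall f, cn (g (zline n a f)) <= M * cn (gx n s x (zline n a f)) *
     (C * \prod_(j < n) (1 + cn (zl (a j) (f j))) ^+ m)) ->
  cn (cintg (lebn R n) (fun t => g (zc a t))) <=
  2 * C * (\prod_(j < n) Rintegral leb setT (vmaj de T m j)) * (M * expR (xn x)).
Proof.
move=> Hp d0 C0 s x M g sT M0 mg hg.
have jV : rintegrable (lebn R n) (fun t : RT R n => \prod_(j < n) vmaj de T m j (coord t j)).
  by apply: (rintegrable_pw (m := leb)) => j _; exact: rintegrable_vmaj.
have := cn_cintg (mu := lebn R n) (W := fun t => C * (M * expR (xn x)) * \prod_(j < n) vmaj de T m j (coord t j)).
move=> /(_ _ _ mg (rintegrableZ _ jV)); rewrite RintegralZl //.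
rewrite (Rintegral_pw (m := leb) (W := vmaj de T m)); last by move=> j _; exact: rintegrable_vmaj.
move=> h; rewrite (_ : 2 * C * _ * _ = 2 * (C * (M * expR (xn x)) *
   \prod_(j < n) Rintegral leb setT (vmaj de T m j))); last by ring.
apply: h => t; apply: (le_trans (hg _)).
have := gx_maj x m (coord t) d0 sT => h.
rewrite (_ : M * _ * _ = C * M * (cn (gx n s x (zline n a (coord t))) *
   \prod_(j < n) (1 + cn (zl (a j) (coord t j))) ^+ m)); last by ring.
by rewrite (mulrA C) -[leRHS]mulrA ler_wpM2l // mulr_ge0.
Qed.

Lemma prod_1cnX (f : nat -> R) m m' : \prod_(j < n) (1 + cn (zl (a j) (f j))) ^+ m *
  \prod_(j < n) (1 + cn (zl (a j) (f j))) ^+ m' = \prod_(j < n) (1 + cn (zl (a j) (f j))) ^+ (m + m').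
Proof. by rewrite -big_split; apply: eq_bigr => j _; rewrite exprD. Qed.

Lemma cn_dotz_zline (u f : nat -> R) :
  cn (dotz n u (zline n a f)) <= xn u * \prod_(j < n) (1 + cn (zl (a j) (f j))) ^+ 1.
Proof.
apply: (le_trans (cn_dotz _ _ _)); rewrite ler_wpM2l ?xn_ge0 //.
apply: (le_trans (nrm_le_prod _ _)); apply: ler_prod => j _.
by rewrite addr_ge0 ?cn_ge0 //= zline_zl // expr1.
Qed.

Lemma max_expR_dot (u f : nat -> R) : Num.max 1 (expR (Rez (dotz n u (zline n a f)))) <= expR (xn u).
Proof.
rewrite ge_max -{1}(@expR0 R) !ler_expR xn_ge0 Rez_dotz_zline /=.
by apply: le_trans (dot_le_xn u); exact: ler_norm.
Qed.

Lemma cmeas_gxH s x H : pbd n a H -> cmeas (fun t : RT R n => gx n s x (zc a t) * H (zc a t)).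
Proof. by move=> Hp; apply: cmeasM; [exact: cmeas_gx|case: Hp]. Qed.

Lemma cmeas_dotz_zc u : cmeas (fun t : RT R n => dotz n u (zc a t)).
Proof. by apply: cmeas_dotz => j jn; exact: cmeas_zc. Qed.

Lemma gint_growth H de T : pbd n a H -> 0 < de -> exists C : R, 0 <= C /\
  forall s x, de <= s <= T -> cn (gint n s x a H) <= C * expR (xn x).
Proof.
move=> Hp d0; have [_ [C [m [C0 h]]]] := Hp.
exists (2 * C * \prod_(j < n) Rintegral leb setT (vmaj de T m j)); split.
  rewrite !mulr_ge0 // prodr_ge0 // => j _; apply: Rintegral_ge0 => y _; exact: vmaj_ge0.
move=> s x sT; have := gint_le Hp d0 C0 (s := s) (x := x) (M := 1)
  (g := fun z => gx n s x z * H z) sT ler01 (cmeas_gxH s x Hp).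
rewrite mul1r; apply => f; rewrite cnM mul1r ler_wpM2l ?cn_ge0 //; exact: h.
Qed.

Lemma gint_lip H de T : pbd n a H -> 0 < de -> exists C : R, 0 <= C /\
  forall s x u, de <= s <= T ->
  cn (gint n s (fun j => x j + u j) a H - gint n s x a H) <= C * (xn u * expR (xn x + xn u)).
Proof.
move=> Hp d0; have [_ [C [m [C0 h]]]] := Hp.
have C40 : 0 <= 4 * C by exact: mulr_ge0.
exists (2 * (4 * C) * \prod_(j < n) Rintegral leb setT (vmaj de T (m + 1) j)); split.
  rewrite !mulr_ge0 // prodr_ge0 // => j _; apply: Rintegral_ge0 => y _; exact: vmaj_ge0.
move=> s x u sT; have s0 : 0 < s by case/andP: sT => h1 _; exact: lt_le_trans h1.
have M0 : 0 <= xn u * expR (xn u) by rewrite mulr_ge0 ?xn_ge0 ?expR_ge0.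
have := gint_le Hp d0 C40 (s := s) (x := x) (M := xn u * expR (xn u)) (m := (m + 1)%N)
  (g := fun z => gx n s (fun j => x j + u j) z * H z - gx n s x z * H z) sT M0
  (cmeasB (cmeas_gxH s _ Hp) (cmeas_gxH s x Hp)).
rewrite /gint -cintgB; [|exact: gint_integrable|exact: gint_integrable].
rewrite [xn u * _ * _]mulrAC -[xn u * _ * expR _]mulrA -expRD; apply => f.
rewrite gx_shift -mulrBl -{2}[gx n s x _]mulr1 -mulrBr !cnM.
have hb : cn (cexp (dotz n u (zline n a f)) - 1) <=
    4 * (xn u * \prod_(j < n) (1 + cn (zl (a j) (f j))) ^+ 1) * expR (xn u).
  apply: (le_trans (cn_cexpB1 _)); rewrite ler_pM ?mulr_ge0 ?cn_ge0 //.
  - by rewrite ler_pM2l // cn_dotz_zline.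
  - exact: max_expR_dot.
rewrite -prod_1cnX; move: (h f) hb (cn_ge0 (gx n s x (zline n a f))) (cn_ge0 (cexp (dotz n u (zline n a f)) - 1)) (cn_ge0 (H (zline n a f))).
move: (cn (gx _ _ _ _)) (cn (_ - 1)) (cn (H _)) (\prod_(j < n) _) (\prod_(j < n) _) => g e hh P2 P1 h1 h2 g0 e0 hh0.
rewrite (_ : xn u * expR (xn u) * g * _ = g * (4 * (xn u * P2) * expR (xn u)) * (C * P1)); last by ring.
exact: (ler_pM (mulr_ge0 g0 e0) hh0 (ler_wpM2l g0 h2) h1).
Qed.

Lemma pbd_dotz u : pbd n a (dotz n u).
Proof.
split; first exact: cmeas_dotz_zc.
by exists (xn u), 1%N; split; [exact: xn_ge0|move=> f; exact: cn_dotz_zline].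
Qed.

Lemma gint_second H de T : pbd n a H -> 0 < de -> exists C : R, 0 <= C /\
  forall s x u, de <= s <= T ->
  cn (gint n s (fun j => x j + u j) a H - gint n s x a H - gint n s x a (fun z => H z * dotz n u z)) <=
  C * (xn u ^+ 2 * expR (xn x + xn u)).
Proof.
move=> Hp d0; have [_ [C [m [C0 h]]]] := Hp.
have C40 : 0 <= 4 * C by exact: mulr_ge0.
exists (2 * (4 * C) * \prod_(j < n) Rintegral leb setT (vmaj de T (m + 2) j)); split.
  rewrite !mulr_ge0 // prodr_ge0 // => j _; apply: Rintegral_ge0 => y _; exact: vmaj_ge0.
move=> s x u sT; have s0 : 0 < s by case/andP: sT => h1 _; exact: lt_le_trans h1.
have u20 : 0 <= xn u ^+ 2 by exact: sqr_ge0.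
have M0 : 0 <= xn u ^+ 2 * expR (xn u) by rewrite mulr_ge0 ?expR_ge0.
have Hu := pbdM Hp (pbd_dotz u).
have := gint_le Hp d0 C40 (s := s) (x := x) (M := xn u ^+ 2 * expR (xn u)) (m := (m + 2)%N)
  (g := fun z => gx n s (fun j => x j + u j) z * H z - gx n s x z * H z - gx n s x z * (H z * dotz n u z)) sT M0
  (cmeasB (cmeasB (cmeas_gxH s _ Hp) (cmeas_gxH s x Hp)) (cmeas_gxH s x Hu)).
have I1 := gint_integrable (fun j => x j + u j) s0 Hp.
have I2 := gint_integrable x s0 Hp; have I3 := gint_integrable x s0 Hu.
rewrite /gint -(cintgB I1 I2) -(cintgB (cintegrableB I1 I2) I3).
rewrite [xn u ^+ 2 * _ * _]mulrAC -[xn u ^+ 2 * _ * expR _]mulrA -expRD; apply => f.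
rewrite gx_shift (_ : _ - _ - _ = gx n s x (zline n a f) * (cexp (dotz n u (zline n a f)) - 1 - dotz n u (zline n a f)) *
   H (zline n a f)); last by ring.
rewrite !cnM.
have hb : cn (cexp (dotz n u (zline n a f)) - 1 - dotz n u (zline n a f)) <=
    4 * (xn u ^+ 2 * \prod_(j < n) (1 + cn (zl (a j) (f j))) ^+ 2) * expR (xn u).
  apply: (le_trans (cn_cexpB1B _)); rewrite ler_pM ?mulr_ge0 ?cn_ge0 ?exprn_ge0 ?cn_ge0 //.
  - rewrite ler_pM2l // -(prod_1cnX f 1 1) -expr2 -exprMn.
    by rewrite lerXn2r ?nnegrE ?cn_ge0 ?(le_trans (cn_ge0 _) (cn_dotz_zline u f)) // cn_dotz_zline.
  - exact: max_expR_dot.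
rewrite -prod_1cnX; move: (h f) hb (cn_ge0 (gx n s x (zline n a f)))
  (cn_ge0 (cexp (dotz n u (zline n a f)) - 1 - dotz n u (zline n a f))) (cn_ge0 (H (zline n a f))).
move: (cn (gx _ _ _ _)) (cn (_ - 1 - _)) (cn (H _)) (\prod_(j < n) _) (\prod_(j < n) _) => g e hh P2 P1 h1 h2 g0 e0 hh0.
rewrite (_ : xn u ^+ 2 * expR (xn u) * g * _ = g * (4 * (xn u ^+ 2 * P2) * expR (xn u)) * (C * P1)); last by ring.
exact: (ler_pM (mulr_ge0 g0 e0) hh0 (ler_wpM2l g0 h2) h1).
Qed.

Lemma gint_time H s : pbd n a H -> 0 < s -> exists C : R, 0 <= C /\
  forall x de, 0 <= de <= 1 -> cn (gint n (s + de) x a H - gint n s x a H) <= C * (de * expR (xn x)).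
Proof.
move=> Hp s0; have [_ [C [m [C0 h]]]] := Hp.
have C40 : 0 <= 4 * C * expR n%:R by rewrite !mulr_ge0 ?expR_ge0.
exists (2 * (4 * C * expR n%:R) * \prod_(j < n) Rintegral leb setT (vmaj s s (m + 2) j)); split.
  rewrite !mulr_ge0 ?expR_ge0 // prodr_ge0 // => j _; apply: Rintegral_ge0 => y _; exact: vmaj_ge0.
move=> x de /andP[d0 d1].
have sT : s <= s <= s by rewrite lexx.
have sd0 : 0 < s + de by exact: ltr_wpDr.
have := gint_le Hp s0 C40 (s := s) (x := x) (M := de) (m := (m + 2)%N)
  (g := fun z => gx n (s + de) x z * H z - gx n s x z * H z) sT d0
  (cmeasB (cmeas_gxH _ x Hp) (cmeas_gxH s x Hp)).
rewrite /gint -cintgB; [|exact: gint_integrable|exact: gint_integrable].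
apply => f; pose z := zline n a f; rewrite -/z.
pose w : R[i] := (2^-1 * de)%:C * \sum_(j < n) z j ^+ 2.
have -> : gx n (s + de) x z = gx n s x z * cexp w.
  rewrite /gx /w mulr_sumr cexp_sum -big_split; apply: eq_bigr => j _.
  by rewrite gssD; exact: mulrAC.
rewrite -mulrBl -{2}[gx n s x z]mulr1 -mulrBr !cnM.
have P0 e : 0 <= \prod_(j < n) (1 + cn (zl (a j) (f j))) ^+ e.
  by rewrite prodr_ge0 // => j _; rewrite exprn_ge0 // addr_ge0 ?cn_ge0.
have hw : cn w <= de * \prod_(j < n) (1 + cn (zl (a j) (f j))) ^+ 2.
  rewrite /w cnM cnR ger0_norm ?mulr_ge0 // ler_pM ?cn_ge0 ?mulr_ge0 //.
    by rewrite ler_piMl // invf_le1 // ler1n.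
  apply: (@le_trans _ _ (nrm n z ^+ 2)).
    apply: (le_trans (cn_sum _ _ _)).
    apply: (@le_trans _ _ ((\sum_(j < n) cn (z j)) ^+ 2)); last first.
      by rewrite lerXn2r ?nnegrE ?nrm_ge0 ?sumr_ge0 // => [j _|]; rewrite ?cn_ge0 // /nrm lerDr.
    rewrite expr2 mulr_suml; apply: ler_sum => j _; rewrite cnX expr2 ler_wpM2l ?cn_ge0 //.
    by rewrite (bigD1 j) //= lerDl sumr_ge0 // => i _; exact: cn_ge0.
  rewrite -(prod_1cnX f 1 1) expr2; have : nrm n z <= \prod_(j < n) (1 + cn (zl (a j) (f j))) ^+ 1.
    apply: (le_trans (nrm_le_prod _ _)); apply: ler_prod => j _.
    by rewrite addr_ge0 ?cn_ge0 //= /z zline_zl // expr1.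
  by move=> h'; rewrite ler_pM ?nrm_ge0.
(* [Re w] is bounded above because [Re (z_j^2) <= a_j^2 <= 1]; large imaginary parts only decrease
   it. *)
have hm : Num.max 1 (expR (Rez w)) <= expR n%:R.
  rewrite ge_max -{1}(@expR0 R) !ler_expR ler0n /= /w RezCM Rez_sum.
  apply: (@le_trans _ _ (2^-1 * de * \sum_(j < n) 1)).
    rewrite ler_wpM2l ?mulr_ge0 //; apply: ler_sum => j _.
    rewrite RezX2 /z zline_zl // Rez_zl; apply: (@le_trans _ _ (a j ^+ 2)).
      by rewrite gerBl sqr_ge0.
    by rewrite -real_normK ?num_real // expr_le1 // a1.
  by rewrite sumr_const card_ord ler_piMl // mulr_ile1 // invf_le1 // ler1n.
have hb : cn (cexp w - 1) <= 4 * (de * \prod_(j < n) (1 + cn (zl (a j) (f j))) ^+ 2) * expR n%:R.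
  by apply: (le_trans (cn_cexpB1 _)); apply: ler_pM => //; rewrite ?ler_wpM2l ?mulr_ge0 ?cn_ge0.
rewrite -prod_1cnX; move: (h f) hb (P0 m) (P0 2%N) (cn_ge0 (gx n s x z)) (cn_ge0 (cexp w - 1)) (cn_ge0 (H z)).
rewrite -/z; move: (cn (gx _ _ _ _)) (cn (_ - 1)) (cn (H _)) (\prod_(j < n) _) (\prod_(j < n) _) => g e hh P2 P1 h1 h2 P20 P10 g0 e0 hh0.
rewrite (_ : de * g * _ = g * (4 * (de * P2) * expR n%:R) * (C * P1)); last by ring.
exact: (ler_pM (mulr_ge0 g0 e0) hh0 (ler_wpM2l g0 h2) h1).
Qed.
End Regularity.

(** * Boundary condition *)

Section BoundaryCondition.
Variable R : realType.
Variables (tau : R) (n : nat) (a : nat -> R).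
Hypotheses (tau0 : 0 < tau) (tau1 : tau < 1) (n1 : (1 <= n)%N).
Hypotheses (a0 : - (1 - tau) < a 0%N) (aS : forall j, (j.+1 < n)%N -> a j < a j.+1)
  (an : a n.-1 < 0) (tS : forall j, (j.+1 < n)%N -> tau * a j < a j.+1).
Variables (p q : R).
Hypotheses (pq1 : p + q = 1) (pE : p = tau * q).

Lemma a_le1 j : (j < n)%N -> `|a j| <= 1.
Proof.
move=> jn; have h1 := contour_neg n1 aS an jn; have h2 := contour_mono aS (leq0n j) jn.
rewrite ltr0_norm //; move: a0 tau0 => *; lra.
Qed.

Definition swapn (k j : nat) : nat := if j == k then k.+1 else if j == k.+1 then k else j.

Lemma swapnK k j : swapn k (swapn k j) = j.
Proof.
rewrite /swapn; case: (eqVneq j k) => [->|jk]; first by rewrite eqxx ifN // -addn1 -[X in _ == X]addn0 eqn_add2l.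
case: (eqVneq j k.+1) => [->|jk1]; first by rewrite eqxx.
by rewrite (negbTE jk) (negbTE jk1).
Qed.

Lemma involn_swap k : (k.+1 < n)%N -> involn n (swapn k).
Proof.
move=> kn j jn; split; last exact: swapnK.
by rewrite /swapn; case: eqP => // _; case: eqP => // _; exact: ltnW.
Qed.

(** A set of ordered pairs invariant under the transposition of [k] and [k+1], which reverses only
    the omitted pair. *)
Definition offpair (k A B : nat) : bool := (A < B)%N && ~~ ((A == k) && (B == k.+1)).

Lemma offpair_swap k A B : offpair k (swapn k A) (swapn k B) = offpair k A B.
Proof.
rewrite /offpair /swapn.
by case: (eqVneq A k) => ?; case: (eqVneq A k.+1) => ?; case: (eqVneq B k) => ?;
  case: (eqVneq B k.+1) => ?; subst; rewrite ?eqxx; lia.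
Qed.

Definition Hrest k (z : nat -> R[i]) : R[i] :=
  (\prod_(j < n) (Gmain tau (z j) * (z j + (1 - tau)%:C)^-1)) *
  \prod_(B < n) \prod_(A < n | offpair k A B) ((z B - z A) / (z B - tau%:C * z A)).

Lemma hg_offpair k z : (k.+1 < n)%N -> hg tau (Gmain tau) (1 - tau) n z =
  Hrest k z * ((z k.+1 - z k) / (z k.+1 - tau%:C * z k)).
Proof.
move=> kn; rewrite /hg /Hrest -mulrA; congr (_ * _); rewrite /pairf.
pose F (B A : nat) := (z B - z A) / (z B - tau%:C * z A).
have E (B : 'I_n) : \prod_(A < n | (A < B)%N) F B A =
    (\prod_(A < n | offpair k A B) F B A) * (if B == Ordinal kn then F k.+1 k else 1).
  case: (eqVneq B (Ordinal kn)) => [->|Bk].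
    rewrite (bigD1 (Ordinal (ltnW kn))) //= mulrC; congr (_ * _).
    by apply: eq_bigl => A; rewrite /offpair /= eqxx andbT.
  rewrite mulr1; apply: eq_bigl => A; rewrite /offpair.
  suff -> : (B == k.+1 :> nat) = false by rewrite andbF andbT.
  by apply: contraNF Bk => /eqP h; apply/eqP; exact: val_inj.
rewrite (eq_bigr _ (fun B _ => E B)) big_split /=; congr (_ * _).
by rewrite (bigD1 (Ordinal kn)) //= eqxx big1 ?mulr1 // => B /negbTE ->.
Qed.

Lemma Hrest_swap k z : (k.+1 < n)%N -> Hrest k (fun j => z (swapn k j)) = Hrest k z.
Proof.
move=> kn; have sk := involn_swap kn; rewrite /Hrest; congr (_ * _).
  by rewrite (big_involn _ (fun j => Gmain tau (z j) * (z j + (1 - tau)%:C)^-1) sk).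
under eq_bigr do rewrite big_mkcond; under [RHS]eq_bigr do rewrite big_mkcond.
pose F B A := if offpair k A B then (z B - z A) / (z B - tau%:C * z A) else 1.
rewrite -(big_involn _ (fun B => \prod_(A < n) F B A) sk); apply: eq_bigr => B _.
rewrite -(big_involn _ (fun A => F (swapn k B) A) sk); apply: eq_bigr => A _.
by rewrite /F offpair_swap.
Qed.

(** The domain is a disjunction because [perm_transfer] asks for one class on both positions of the
    contours, before and after the exchange. *)
Lemma tcl_Hrest k (c : R) : (k.+1 < n)%N -> tcl n
  (fun z => (forall j, (j < n)%N -> Rez (z j) = a j) \/ (forall j, (j < n)%N -> Rez (z j) = a (swapn k j)))
  (fun z => (c%:C * z k.+1 + (- c)%:C * z k + 0) * Hrest k z).
Proof.
move=> kn; have sk := involn_swap kn.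
have mono := contour_mono aS.
have rng j : (j < n)%N -> a 0%N <= a j <= a n.-1.
  by move=> jn; rewrite !mono //= ?prednK // -ltnS prednK.
have Dr z j : (j < n)%N -> (forall j, (j < n)%N -> Rez (z j) = a j) \/ (forall j, (j < n)%N -> Rez (z j) = a (swapn k j)) ->
    a 0%N <= Rez (z j) <= a n.-1.
  by move=> jn [H|H]; rewrite H //; apply: rng => //; have [] := sk j jn.
apply: tclM; first exact: tcl_lin2 _ (ltnW kn).
apply: tclM.
  apply: tcl_prod => j _; apply: tclM.
    have sG : sc (a 0%N) (a n.-1) (Gmain tau).
      apply: scM; last exact: sc_cst.
      apply: (sc_ext (h1 := fun z => ((-1)%:C * z + 0)^-1 * (-1)%:C)).
        by move=> z; rewrite N1C mulN1r addr0 invrN mulrN1 opprK.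
      apply: scM; last exact: sc_cst.
      apply: (@sc_inv R _ _ _ _ (- a n.-1)) => [|z /andP[_ zh]]; first by rewrite oppr_gt0.
      by rewrite addr0 RezCM mulN1r lerN2.
    apply: (tcl_sc sG (ltn_ord j)) => z Dz; exact: Dr.
  have e0 : 0 < a 0%N + (1 - tau) by rewrite -ltrBlDr sub0r.
  have := @tcl_inv2 _ n (fun z => (forall j, (j < n)%N -> Rez (z j) = a j) \/ (forall j, (j < n)%N -> Rez (z j) = a (swapn k j)))
    1 0 (1 - tau)%:C j j _ (ltn_ord j) (ltn_ord j) e0.
  have -> : (fun z : nat -> R[i] => (1%:C * z j + 0%:C * z j + (1 - tau)%:C)^-1) = (fun z => (z j + (1 - tau)%:C)^-1).
    by apply/funext => z; rewrite mul1r mul0r addr0.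
  apply => z Dz; rewrite mul1r mul0r addr0 RezD RezC lerD2r.
  by have /andP[] := Dr z j (ltn_ord j) Dz.
apply: tcl_prod => B _; apply: tcl_prod => A AB; apply: tclM.
  have := @tcl_lin2 _ n (fun z => (forall j, (j < n)%N -> Rez (z j) = a j) \/ (forall j, (j < n)%N -> Rez (z j) = a (swapn k j)))
     1 (-1) 0 B A (ltn_ord B) (ltn_ord A).
  by congr tcl; apply/funext => z; rewrite mul1r CN mulN1r addr0.
have h1 : 0 < a B - tau * a A by rewrite subr_gt0 (contour_tau aS tS) //; case/andP: AB.
have h2 : 0 < a (swapn k B) - tau * a (swapn k A).
  rewrite subr_gt0 (contour_tau aS tS) //; last by have [] := sk B (ltn_ord B).
  by move: AB; rewrite -(offpair_swap k A B) => /andP[].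
have e0 : 0 < Num.min (a B - tau * a A) (a (swapn k B) - tau * a (swapn k A)) by rewrite lt_min h1.
have := @tcl_inv2 _ n (fun z => (forall j, (j < n)%N -> Rez (z j) = a j) \/ (forall j, (j < n)%N -> Rez (z j) = a (swapn k j)))
  1 (- tau) 0 B A _ (ltn_ord B) (ltn_ord A) e0.
have -> : (fun z : nat -> R[i] => (1%:C * z B + (- tau)%:C * z A + 0)^-1) = (fun z => (z B - tau%:C * z A)^-1).
  by apply/funext => z; rewrite mul1r CN mulNr addr0.
apply => z; rewrite mul1r addr0 CN mulNr RezB RezCM.
by move=> [H|H]; rewrite !H // ge_min lexx ?orbT.
Qed.

Definition bdir (k : nat) (lambda : R) (j : nat) : R :=
  (if j == k then lambda * p else 0) + (if j == k.+1 then - (lambda * q) else 0).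

(* [p z_k - q z_(k+1)] cancels the denominator [z_(k+1) - tau z_k]; what remains is antisymmetric under the swap. *)
Lemma boundary_zero k s (y : nat -> R) : (k.+1 < n)%N -> 0 < s -> y k = y k.+1 ->
  gint n s y a (fun z => hg tau (Gmain tau) (1 - tau) n z * dotz n (bdir k 1) z) = 0.
Proof.
move=> kn s0 yk; have sk := involn_swap kn.
(* By [p = tau q], [p z_k - q z_(k+1) = - q (z_(k+1) - tau z_k)]; after cancellation the numerator
   [z_(k+1) - z_k] remains with the coefficient [- q]. *)
pose h (z : nat -> R[i]) := ((- q)%:C * z k.+1 + (- - q)%:C * z k + 0) * Hrest k z.
have E (t : RT R n) : hg tau (Gmain tau) (1 - tau) n (zc a t) * dotz n (bdir k 1) (zc a t) = h (zc a t).
  rewrite (hg_offpair _ kn) /bdir dotz2 ?(ltnW kn) // !mul1r /h addr0.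
  have zn : zc a t k.+1 - tau%:C * zc a t k != 0.
    apply: Re_gt0_neq0; rewrite RezB RezCM !zc_zl ?(ltnW kn) // !Rez_zl subr_gt0.
    exact: tS.
  move: (Hrest k _) zn; move: (zc a t k) (zc a t k.+1) => u v r zn.
  rewrite pE CM !CN opprK; field; exact: zn.
have -> : gint n s y a (fun z => hg tau (Gmain tau) (1 - tau) n z * dotz n (bdir k 1) z) = gint n s y a h.
  by apply: eq_cintg => t; rewrite E.
have e2 : 1 ^+ 2 = 1 :> R by rewrite expr1n.
have T := perm_transfer y s0 e2 sk (tcl_Hrest (- q) kn) (a := a) (a2 := a).
have zE (t : RT R n) : (fun j => 1%:C * zc a t (swapn k j)) = (fun j => zc a t (swapn k j)).
  by apply/funext => j; rewrite mul1r.
have {T} T : gint n s y a h = cintg (lebn R n) (fun t => - (gx n s y (zc a t) * h (zc a t))).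
  rewrite T; first last.
  - move=> t; right => j jn; have [h1 _] := sk j jn.
    by rewrite mul1r zc_zl // Rez_zl.
  - by move=> t; left => j jn; rewrite zc_zl // Rez_zl.
  apply: eq_cintg => t; rewrite zE Hrest_swap // !mul1r.
  have -> : gx n s y (fun j => zc a t (swapn k j)) = gx n s y (zc a t).
    rewrite /gx -(big_involn _ (fun j => gss s (zc a t j) * cexp ((y j)%:C * zc a t j)) sk).
    have ys j : y (swapn k j) = y j.
      by rewrite /swapn; case: eqP => [->|_]; rewrite ?yk //; case: eqP => [->|_].
    by apply: eq_bigr => j _; rewrite ys.
  have -> : swapn k k.+1 = k by rewrite /swapn ifN ?eqxx // -addn1 -[X in _ == X]addn0 eqn_add2l.
  have -> : swapn k k = k.+1 by rewrite /swapn eqxx.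
  rewrite /h !CN; move: (Hrest k _) (gx _ _ _ _) (zc a t k) (zc a t k.+1) => *; ring.
have ph : cintegrable (lebn R n) (fun t => gx n s y (zc a t) * h (zc a t)).
  have := gint_integrable y s0 (pbdM (pbd_main tau0 n1 a0 aS an tS) (pbd_dotz n a (bdir k 1))).
  by congr cintegrable; apply/funext => t; rewrite E.
have := T; rewrite cintgN // -/(gint n s y a h) => /eqP; rewrite -addr_eq0 -mulr2n mulrn_eq0 /=.
by move=> /eqP.
Qed.

Lemma p_ge0 : 0 <= p.
Proof. by rewrite pE mulr_ge0 ?(ltW tau0) //; apply: ltW; have := pq1; rewrite pE; have := tau0; nra. Qed.

Lemma q_gt0 : 0 < q.
Proof. have := pq1; rewrite pE; have := tau0; nra. Qed.

Lemma xn_bdir k la : (k.+1 < n)%N -> 0 <= la -> xn n (bdir k la) <= la.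
Proof.
move=> kn l0; have kn' := ltnW kn.
have p0 := mulr_ge0 l0 p_ge0; have q0 := mulr_ge0 l0 (ltW q_gt0).
apply: (@le_trans _ _ (\sum_(j < n) ((if j == k :> nat then la * p else 0) + (if j == k.+1 :> nat then la * q else 0)))).
  apply: ler_sum => j _; rewrite /bdir; apply: (le_trans (ler_normD _ _)); rewrite lerD //.
    by case: ifP => _; rewrite ?normr0 ?ger0_norm.
  by case: ifP => _; rewrite ?normr0 ?normrN ?ger0_norm.
rewrite big_split /=.
have S (i : nat) (c : R) : (i < n)%N -> \sum_(j < n) (if j == i :> nat then c else 0) = c.
  move=> ni; rewrite (bigD1 (Ordinal ni)) //= eqxx big1 ?addr0 // => j ji.
  rewrite ifF //; apply: contraNF ji => /eqP h; apply/eqP; exact: val_inj.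
by rewrite !S // -mulrDr pq1 mulr1.
Qed.

Let H0 := hg tau (Gmain tau) (1 - tau) n.
Let KU : R := tau ^+ (n * n.-1)./2 * (2 * pi)^-1 ^+ n.
Local Notation U := (Uf tau n a).

Lemma KU_ge0 : 0 <= KU.
Proof.
apply: mulr_ge0; first by rewrite exprn_ge0 // ltW.
by rewrite exprn_ge0 // invr_ge0 mulr_ge0 ?pi_ge0.
Qed.

Lemma U_gint s x : 0 < s -> U s x = KU%:C * gint n s x a H0.
Proof. exact: UfE. Qed.

Lemma pbdH0 : pbd n a H0.
Proof. exact: pbd_main. Qed.

(** The second-order remainder gives [la^2]. The first-order term vanishes at the nearby point [y]
    with [y_k = y_(k+1)], so its Lipschitz bound gives [la |x_k - x_(k+1)|]. *)
Lemma push_bound k de T : (k.+1 < n)%N -> 0 < de -> exists C : R, 0 <= C /\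
  forall s x la, de <= s <= T -> 0 <= la ->
  cn (U s (fun j => x j + bdir k la j) - U s x) <=
    C * (la ^+ 2 + la * `|x k - x k.+1|) * expR (3 * (xn n x + la)).
Proof.
move=> kn d0; have kn' := ltnW kn; have pH := pbdH0.
have pHl := pbdM pH (pbd_dotz n a (bdir k 1)).
have [C2 [C20 h2]] := gint_second a_le1 T pH d0.
have [C1 [C10 h1]] := gint_lip a_le1 T pHl d0.
exists (KU * (C2 + C1)); split; first by rewrite mulr_ge0 ?KU_ge0 // addr_ge0.
move=> s x la sT l0; have s0 : 0 < s by case/andP: sT => h _; exact: lt_le_trans h.
rewrite !U_gint // -mulrBr cnM cnR (ger0_norm KU_ge0).
move: KU KU_ge0 => K K0; rewrite -2!mulrA ler_wpM2l // mulrA.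
set d := `|x k - x k.+1|.
pose B := gint n s x a (fun z => H0 z * dotz n (bdir k 1) z).
have EB : gint n s x a (fun z => H0 z * dotz n (bdir k la) z) = la%:C * B.
  rewrite /B /gint -cintgZ; last exact: (gint_integrable x s0 pHl).
  apply: eq_cintg => t; rewrite (_ : bdir k la = fun j => la * bdir k 1 j); last first.
    by apply/funext => j; rewrite /bdir mulrDr; case: eqP => _; case: eqP => _; ring.
  by rewrite dotzZ; ring.
pose v (j : nat) : R := if j == k then x k - x k.+1 else 0.
pose y j := x j - v j.
have xy : x = fun j => y j + v j by apply/funext => j; rewrite /y subrK.
have yk : y k = y k.+1.
  by rewrite /y /v eqxx ifN ?subr0 ?subKr // -addn1 -[X in _ == X]addn0 eqn_add2l.
have xv : xn n v = d.
  rewrite /xn (bigD1 (Ordinal kn')) //= /v eqxx big1 ?addr0 // => j jk.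
  rewrite ifF ?normr0 //; apply: contraNF jk => /eqP h; apply/eqP; exact: val_inj.
have dx : d <= xn n x.
  rewrite /xn (bigD1 (Ordinal kn')) //= (bigD1 (Ordinal kn)) //=; last first.
    by rewrite -val_eqE /= -addn1 -[X in _ == X]addn0 eqn_add2l.
  by rewrite addrA; apply: ler_wpDr; [exact: sumr_ge0|exact: ler_normB].
have xny : xn n y <= xn n x + d.
  rewrite -xv (_ : xn n v = xn n (fun j => - v j)); first exact: (xnD n x (fun j => - v j)).
  by rewrite /xn; apply: eq_bigr => j _; rewrite normrN.
have hB : cn B <= C1 * (d * expR (3 * xn n x)).
  have := h1 s y v sT; rewrite -xy -/B (boundary_zero kn s0 yk) subr0 xv => /le_trans; apply.
  rewrite ler_wpM2l // ler_wpM2l ?normr_ge0 // ler_expR; lra.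
have h3 := h2 s x (bdir k la) sT; rewrite EB in h3.
have xb := xn_bdir kn l0; have xb0 := xn_ge0 n (bdir k la); have xx0 := xn_ge0 n x.
rewrite (_ : gint _ _ _ _ _ - _ = (gint n s (fun j => x j + bdir k la j) a H0 - gint n s x a H0 - la%:C * B) + la%:C * B); last by rewrite subrK.
have d00 : 0 <= d by exact: normr_ge0.
apply: (le_trans (cnD _ _)); apply: (@le_trans _ _ (C2 * (la ^+ 2 * expR (3 * (xn n x + la))) +
   C1 * (la * d * expR (3 * (xn n x + la))))).
  apply: lerD.
    apply: (le_trans h3); rewrite ler_wpM2l // ler_pM ?sqr_ge0 ?expR_ge0 //.
      by rewrite lerXn2r // nnegrE.
    rewrite ler_expR; lra.
  rewrite cnM cnR (ger0_norm l0); apply: (@le_trans _ _ (la * (C1 * (d * expR (3 * xn n x))))).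
    by rewrite ler_wpM2l.
  rewrite mulrCA ler_wpM2l // -mulrA ler_wpM2l // ler_wpM2l // ler_expR; lra.
have e0 := expR_ge0 (3 * (xn n x + la)); move: (expR _) e0 => E e0.
have i1 : 0 <= C1 * (la ^+ 2 * E) by rewrite !mulr_ge0 ?sqr_ge0.
have i2 : 0 <= C2 * (la * d * E) by rewrite mulr_ge0 // mulr_ge0 // mulr_ge0.
rewrite mulrDl !mulrDr mulrDl; lra.
Qed.

Definition lamk (x : nat -> R) k : R := if (k.+1 < n)%N then Num.max 0 (x k.+1 - x k) else 0.

(* Resolves the first [K] overlaps [x k.+1 - x k > 0] simultaneously, all of them measured in the original [x]. *)
Definition prho K (x : nat -> R) (j : nat) : R :=
  x j + p * (if (j < K)%N then lamk x j else 0)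
      - q * (if j is j'.+1 then (if (j' < K)%N then lamk x j' else 0) else 0).

Definition lamt (x : nat -> R) : R := \sum_(k < n) lamk x k.

Lemma lamk_ge0 x k : 0 <= lamk x k.
Proof. by rewrite /lamk; case: ifP => // _; rewrite le_max lexx. Qed.

Lemma lamk_le x k : (k < n)%N -> lamk x k <= lamt x.
Proof.
move=> kn; rewrite /lamt (bigD1 (Ordinal kn)) //= lerDl.
by apply: sumr_ge0 => j _; exact: lamk_ge0.
Qed.

Lemma lamt_ge0 x : 0 <= lamt x.
Proof. by apply: sumr_ge0 => j _; exact: lamk_ge0. Qed.

Lemma sum_shift_le (f : nat -> R) : (forall k, 0 <= f k) ->
  \sum_(j < n) (if j : nat is j'.+1 then f j' else 0) <= \sum_(j < n) f j.
Proof.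
case: (n) => [|m] f0; first by rewrite !big_ord0.
by rewrite big_ord_recl /= add0r big_ord_recr /= lerDl.
Qed.

Lemma lamt_xn x : lamt x <= 2 * xn n x.
Proof.
have E k : lamk x k <= `|x k| + (if (k.+1 < n)%N then `|x k.+1| else 0).
  rewrite /lamk; case: ifP => _; last by rewrite addr0.
  rewrite ge_max addr_ge0 //=; apply: (le_trans (ler_norm _)).
  by rewrite distrC; exact: ler_normB.
apply: (@le_trans _ _ (\sum_(j < n) (`|x j| + (if (j.+1 < n)%N then `|x j.+1| else 0)))).
  by apply: ler_sum => j _; exact: E.
rewrite big_split /= mulr_natl mulr2n lerD2l.
rewrite /xn; case: (n) => [|m]; first by rewrite !big_ord0.
rewrite big_ord_recr /= ltnn addr0 [leRHS]big_ord_recl /=.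
by apply: ler_wpDl => //; apply: ler_sum => j _; case: ifP.
Qed.

Lemma prho_xn K x : xn n (prho K x) <= xn n x + lamt x.
Proof.
have q0 := ltW q_gt0; have p0 := p_ge0.
apply: (@le_trans _ _ (\sum_(j < n) (`|x j| + (p * lamk x j + q * (if j : nat is j'.+1 then lamk x j' else 0))))).
  apply: ler_sum => j _; rewrite /prho -addrA; apply: (le_trans (ler_normD _ _)); rewrite lerD2l.
  apply: (le_trans (ler_normB _ _)); rewrite lerD // normrM ger0_norm // ler_wpM2l //.
    by case: ifP => _; rewrite ?normr0 ?lamk_ge0 // ger0_norm ?lamk_ge0.
  case: (nat_of_ord j) => [|j']; first by rewrite normr0.
  by case: ifP => _; rewrite ?normr0 ?lamk_ge0 // ger0_norm ?lamk_ge0.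
rewrite big_split /= lerD2l big_split /= -!mulr_sumr.
have h : \sum_(j < n) (if j : nat is j'.+1 then lamk x j' else 0) <= lamt x.
  by apply: sum_shift_le => k; exact: lamk_ge0.
apply: (@le_trans _ _ (p * lamt x + q * lamt x)); first by rewrite lerD2l ler_wpM2l.
by rewrite -mulrDl pq1 mul1r.
Qed.

Lemma prhoS K x : (K.+1 < n)%N -> prho K.+1 x = fun j => prho K x j + bdir K (lamk x K) j.
Proof.
move=> Kn; apply/funext => j; rewrite /prho /bdir.
have A i : (if (i < K.+1)%N then lamk x i else 0) =
    (if (i < K)%N then lamk x i else 0) + (if i == K then lamk x K else 0).
  by rewrite ltnS; case: ltngtP => [_|_|->]; rewrite ?addr0 ?add0r.
rewrite A (_ : (match j with 0%N => 0 | j'.+1 => if (j' < K.+1)%N then lamk x j' else 0 end) =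
   (if j is j'.+1 then (if (j' < K)%N then lamk x j' else 0) else 0) + (if j == K.+1 then lamk x K else 0)); last first.
  by case: (j) => [|j']; rewrite ?addr0 // A.
have G (b1 b2 : bool) (u v w r : R) : r + p * (u + (if b1 then w else 0)) - q * (v + (if b2 then w else 0)) =
    r + p * u - q * v + ((if b1 then w * p else 0) + (if b2 then - (w * q) else 0)).
  by case: b1; case: b2; ring.
exact: G.
Qed.

(** The pushes are inserted one at a time. Earlier ones may have changed the gap at [K], but where
    there is an overlap to resolve it is still at most [2 lamt], so [push_bound] is quadratic in
    [lamt] at each stage. *)
Lemma rho_bound_U K de T : (K <= n)%N -> 0 < de -> exists C : R, 0 <= C /\
  forall s x, de <= s <= T ->
  cn (U s (prho K x) - U s x) <= C * (lamt x ^+ 2 * expR (15 * xn n x)).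
Proof.
move=> Kn d0; elim: K Kn => [_|K IH Kn].
  exists 0; split => // s x sT; rewrite (_ : prho 0 x = x) ?subrr ?cn0 ?mul0r //.
  by apply/funext => j; rewrite /prho /= mulr0 addr0; case: j => [|j]; rewrite mulr0 subr0.
have [C [C0 hC]] := IH (ltnW Kn).
have [Kn'|Kn'] := ltnP K.+1 n; last first.
  exists C; split => // s x sT; rewrite (_ : prho K.+1 x = prho K x); first exact: hC.
  have l0 : lamk x K = 0 by rewrite /lamk ltnNge Kn'.
  apply/funext => j; rewrite /prho; congr (_ + p * _ - q * _).
    by rewrite ltnS leq_eqVlt; case: eqP => [->|_] //=; rewrite l0 ltnn.
  by case: j => // j; rewrite ltnS leq_eqVlt; case: eqP => [->|_] //=; rewrite l0 ltnn.
have [C1 [C10 hC1]] := push_bound T Kn' d0.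
exists (3 * C1 + C); split; first by rewrite addr_ge0 ?mulr_ge0.
move=> s x sT; rewrite prhoS //.
set y := prho K x; set la := lamk x K.
have l0 : 0 <= la by exact: lamk_ge0.
have lt0 := lamt_ge0 x; have lx := lamt_xn x; have yx := prho_xn K x.
have lle : la <= lamt x by apply: lamk_le; exact: ltnW.
rewrite (_ : U s _ - U s x = (U s (fun j => y j + bdir K la j) - U s y) + (U s y - U s x)); last by rewrite addrA subrK.
apply: (le_trans (cnD _ _)); rewrite mulrDl; apply: lerD; last exact: hC.
apply: (le_trans (hC1 s y la sT l0)).
have hd : la * `|y K - y K.+1| <= 2 * lamt x ^+ 2.
  case: (eqVneq la 0) => [->|la0]; first by rewrite mul0r mulr_ge0 // sqr_ge0.
  have laE : la = x K.+1 - x K.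
    have : la != 0 by []; rewrite /la /lamk Kn'; case: (leP 0 (x K.+1 - x K)) => // h _.
    by move: la0; rewrite /la /lamk Kn'; case: (leP 0 (x K.+1 - x K)) h => //; rewrite ?eqxx // => h1 h2; lra.
  have yd : `|y K - y K.+1| <= 2 * lamt x.
    have yE : y K - y K.+1 = - (la + q * (if K is j'.+1 then (if (j' < K)%N then lamk x j' else 0) else 0)).
      rewrite /y /prho ltnn (ltnNge K.+1 K) leqnSn /= !mulr0 laE; ring.
    have pv : 0 <= (if K is j'.+1 then (if (j' < K)%N then lamk x j' else 0) else 0) <= lamt x.
      case: (K) Kn => [|K'] Kn; first by rewrite lexx.
      by rewrite ltnSn lamk_ge0 /= lamk_le // (leq_trans _ Kn) // ltnW.
    case/andP: pv => pv0 pv1; rewrite yE normrN ger0_norm; last by rewrite addr_ge0 // mulr_ge0 // ltW // q_gt0.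
    rewrite mulr_natl mulr2n lerD //; apply: le_trans pv1.
    by rewrite ler_piMl // -pq1 lerDr p_ge0.
  by rewrite expr2 mulrCA; apply: ler_pM.
have hs : la ^+ 2 <= lamt x ^+ 2 by rewrite lerXn2r // nnegrE.
(* The constants: [la^2 + 2 lamt^2 <= 3 lamt^2], and [3 (xn y + la) <= 15 xn x] because
   [xn y <= 3 xn x] and [la <= 2 xn x]. *)
rewrite (_ : 3 * C1 * _ = C1 * (3 * lamt x ^+ 2) * expR (15 * xn n x)); last by ring.
apply: ler_pM; rewrite ?mulr_ge0 ?addr_ge0 ?sqr_ge0 ?expR_ge0 ?mulr_ge0 //.
  rewrite ler_wpM2l //; lra.
rewrite ler_expR; rewrite -/y in yx; lra.
Qed.
End BoundaryCondition.

(** * Gaussian averages *)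

Section ParameterIntegrals.
Context {d1 d2} {T1 : measurableType d1} {T2 : measurableType d2} {R : realType}.
Variable m2 : {sigma_finite_measure set T2 -> \bar R}.

Lemma measurable_Rintegral_param (f : T1 * T2 -> R) : measurable_fun setT f ->
  measurable_fun setT (fun x => Rintegral m2 setT (fun y => f (x, y))).
Proof.
move=> mf; apply: measurableT_comp; first exact: fine_measurable.
rewrite (_ : (fun x => _) = (fun x => (\int[m2]_y ((EFin \o f)^\+ (x, y)) - \int[m2]_y ((EFin \o f)^\- (x, y)))%E)); last first.
  apply/funext => x; rewrite integralE; congr (_ - _)%E; apply: eq_integral => y _; by rewrite ?funeposE ?funenegE.
have mF : measurable_fun setT (EFin \o f) by exact/measurable_EFinP.
apply: emeasurable_funB.
  apply: (measurable_fun_fubini_tonelli_F (m2 := m2)) => //; exact: measurable_funepos.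
apply: (measurable_fun_fubini_tonelli_F (m2 := m2)) => //; exact: measurable_funeneg.
Qed.

Lemma cmeas_cintg_param (f : T1 * T2 -> R[i]) : cmeas f ->
  cmeas (fun x => cintg m2 (fun y => f (x, y))).
Proof.
case=> h1 h2; split.
  exact: (measurable_Rintegral_param h1).
exact: (measurable_Rintegral_param h2).
Qed.

End ParameterIntegrals.

Section NormalLaw.
Variable R : realType.
Local Notation leb := [the {sigma_finite_measure set (measurableTypeR R) -> \bar R} of @lebesgue_measure R].

Definition gaussm (h : R) : {sigma_finite_measure set (measurableTypeR R) -> \bar R} :=
  [the {sigma_finite_measure set (measurableTypeR R) -> \bar R} of normal_prob 0 (Num.sqrt h)].

Lemma gaussmT h : gaussm h setT = 1%E.
Proof. exact: (@probability_setT _ _ _ (normal_prob 0 (Num.sqrt h))). Qed.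

(** Change of variables by the Radon-Nikodym derivative, which agrees almost everywhere with the
    density since both have the same integrals over measurable sets. *)
Lemma ge0_integral_gaussm h (f : measurableTypeR R -> \bar R) : measurable_fun setT f -> (forall y, 0 <= f y)%E ->
  (\int[gaussm h]_y f y = \int[leb]_y (f y * (normal_pdf 0 (Num.sqrt h) y)%:E))%E.
Proof.
move=> mf f0; have dom := @normal_prob_dominates R 0 (Num.sqrt h).
rewrite -(Radon_Nikodym_SigmaFinite.change_of_variables dom f0 measurableT mf).
apply: ae_eq_integral => //.
- apply: emeasurable_funM => //; apply: (measurable_int leb).
  exact: Radon_Nikodym_SigmaFinite.f_integrable.
- apply: emeasurable_funM => //; apply/measurable_EFinP; exact: measurable_normal_pdf.
- apply: ae_eqe_mul2l; apply: integral_ae_eq => //.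
  + exact: Radon_Nikodym_SigmaFinite.f_integrable.
  + apply/measurable_EFinP; exact: measurable_normal_pdf.
  + by move=> E _ mE; rewrite -Radon_Nikodym_SigmaFinite.f_integral.
Qed.

Lemma rintegrable_gaussm h (f : measurableTypeR R -> R) : measurable_fun setT f ->
  rintegrable leb (fun y => f y * normal_pdf 0 (Num.sqrt h) y) -> rintegrable (gaussm h) f.
Proof.
move=> mf /integrableP[_ jf]; apply/integrableP; split; first exact/measurable_EFinP.
rewrite ge0_integral_gaussm //; last first.
  by apply: measurableT_comp => //; exact/measurable_EFinP.
apply: le_lt_trans jf; apply: ge0_le_integral => //.
- by move=> y _; rewrite mule_ge0 // lee_fin normal_pdf_ge0.
- apply: emeasurable_funM; last by apply/measurable_EFinP; exact: measurable_normal_pdf.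
  by apply: measurableT_comp => //; exact/measurable_EFinP.
- apply: measurableT_comp => //; apply/measurable_EFinP; apply: measurable_funM => //; exact: measurable_normal_pdf.
by move=> y _ /=; rewrite normrM (ger0_norm (normal_pdf_ge0 _ _ _)) EFinM.
Qed.

Lemma Rintegral_gaussm h (f : measurableTypeR R -> R) : measurable_fun setT f ->
  Rintegral (gaussm h) setT f = Rintegral leb setT (fun y => f y * normal_pdf 0 (Num.sqrt h) y).
Proof.
move=> mf; rewrite /Rintegral; congr fine.
have mF : measurable_fun setT (EFin \o f) by exact/measurable_EFinP.
rewrite integralE [RHS]integralE; congr (_ - _)%E.
  rewrite ge0_integral_gaussm //; last exact: measurable_funepos.
  apply: eq_integral => y _; rewrite !funeposE /=; have p0 := normal_pdf_ge0 0 (Num.sqrt h) y.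
  by rewrite -!EFin_max -!EFinM maxr_pMl // mul0r.
rewrite ge0_integral_gaussm //; last exact: measurable_funeneg.
apply: eq_integral => y _; rewrite !funenegE /=; have p0 := normal_pdf_ge0 0 (Num.sqrt h) y.
by rewrite -EFin_max -EFinM maxr_pMl // mul0r mulNr EFin_max.
Qed.

Lemma normal_pdf_gk (h y : R) : 0 < h -> normal_pdf 0 (Num.sqrt h) y =
  (Num.sqrt (pi / (2 * h)^-1))^-1 * gk (2 * h)^-1 y.
Proof.
move=> h0; have := @gk_shift_normal R (2 * h)^-1 0 y; rewrite invr_gt0 mulr_gt0 // => /(_ isT).
rewrite expr0n !mul0r expR0 mulr1 mul1r => ->.
rewrite mulrA mulVf ?mul1r; last by rewrite gt_eqF // sqrtr_gt0 divr_gt0 ?pi_gt0 // invr_gt0 mulr_gt0.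
congr (normal_pdf _ (Num.sqrt _) _); by field; rewrite gt_eqF.
Qed.

Lemma rintegrable_gaussm_exp (h c : R) : 0 < h -> rintegrable (gaussm h) (fun y => expR (c * `|y|)).
Proof.
move=> h0; have k0 : 0 < (2 * h)^-1 by rewrite invr_gt0 mulr_gt0.
have m1 : measurable_fun (setT : set (measurableTypeR R)) (fun y : R => expR (c * `|y|)).
  apply: measurableT_comp => //; apply: measurable_funM => //; exact: measurableT_comp.
apply: rintegrable_gaussm => //.
pose K := (Num.sqrt (pi / (2 * h)^-1))^-1 : R.
have K0 : 0 <= K by rewrite invr_ge0.
apply: (rintegrable_le (mu := leb) (W := fun y => K * (gk (2 * h)^-1 y * expR (c * y) + gk (2 * h)^-1 y * expR ((- c) * y)))).
- apply: measurable_funM => //; exact: measurable_normal_pdf.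
- move=> y; rewrite ger0_norm; last by rewrite mulr_ge0 ?expR_ge0 ?normal_pdf_ge0.
  rewrite normal_pdf_gk // mulrCA -/K ler_wpM2l // mulrC -mulrDr ler_wpM2l ?gk_ge0 //.
  case: (ler0P (y : R)) => y0; last by rewrite lerDl expR_ge0.
  by rewrite mulrN mulNr lerDr expR_ge0.
- by apply: rintegrableZ; apply: rintegrableD; exact: rintegrable_gk_exp.
Qed.

Lemma cintg_gaussm h (f : measurableTypeR R -> R[i]) : cmeas f ->
  cintg (gaussm h) f = cintg leb (fun y => (normal_pdf 0 (Num.sqrt h) y)%:C * f y).
Proof.
move=> [mf1 mf2]; apply: complex_ext; rewrite ?Rez_cintg ?Imz_cintg Rintegral_gaussm //.
  by apply: eq_Rintegral => y _; rewrite RezCM mulrC.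
by apply: eq_Rintegral => y _; rewrite ImzCM mulrC.
Qed.

Lemma cmeas_cexpl (z : R[i]) : cmeas (fun y : measurableTypeR R => cexp (z * y%:C)).
Proof. by apply: cmeas_cexp; apply: cmeasM; [exact: cmeas_cst|exact: cmeas_real]. Qed.

Lemma cintegrable_gaussm_cexp h (z : R[i]) : 0 < h -> cintegrable (gaussm h) (fun y => cexp (z * y%:C)).
Proof.
move=> h0; apply: (cintegrable_le (mu := gaussm h) (W := fun y => expR (`|Rez z| * `|y|))).
- exact: cmeas_cexpl.
- by move=> y; rewrite cn_cexp mulrC RezCM ler_expR -normrM mulrC ler_norm.
- exact: rintegrable_gaussm_exp.
Qed.

Lemma cintg_gaussm_cexp h (z : R[i]) : 0 < h ->
  cintg (gaussm h) (fun y => cexp (z * y%:C)) = cexp ((2^-1 * h)%:C * z ^+ 2).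
Proof.
move=> h0; have k0 : 0 < (2 * h)^-1 by rewrite invr_gt0 mulr_gt0.
rewrite cintg_gaussm; last exact: cmeas_cexpl.
pose K := (Num.sqrt (pi / (2 * h)^-1))^-1 : R.
have jg : cintegrable leb (fun y : measurableTypeR R => (gk (2 * h)^-1 y)%:C * cexp (z * y%:C)).
  apply: (cintegrable_le (mu := leb) (W := fun y => gk (2 * h)^-1 y * expR (Rez z * y))).
  - by apply: cmeasM; [apply: cmeas_real; exact: measurable_gk|exact: cmeas_cexpl].
  - by move=> y; rewrite cnM cnR ger0_norm ?gk_ge0 // cn_cexp (mulrC z) RezCM (mulrC (y : R)).
  - exact: rintegrable_gk_exp.
transitivity (K%:C * cintg leb (fun y : measurableTypeR R => (gk (2 * h)^-1 y)%:C * cexp (z * y%:C))).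
  rewrite -cintgZ //; apply: eq_cintg => y; rewrite normal_pdf_gk // CM -/K; ring.
rewrite (cintg_gk_cexp z k0) mulrA -CM mulVf ?mul1r; last first.
  by rewrite gt_eqF // sqrtr_gt0 divr_gt0 // pi_gt0.
congr (cexp _); rewrite mulrC; congr (real_complex R _ * _); by field; rewrite gt_eqF.
Qed.

End NormalLaw.

Section GaussianAverage.
Variable R : realType.
Variables (n : nat) (a : nat -> R).
Local Notation leb := [the {sigma_finite_measure set (measurableTypeR R) -> \bar R} of @lebesgue_measure R].

(** The increment enters through [cexp (z_j xi_j)], whose Gaussian mean [exp (h z_j^2 / 2)] turns
    [gss s] into [gss (s + h)]. *)
Lemma gint_heat s h x H : pbd n a H -> 0 < s -> 0 < h ->
  cintg (pwm (gaussm h) n) (fun xi : RT R n => gint n s (fun j => x j + coord xi j) a H) =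
  gint n (s + h) x a H.
Proof.
move=> pH s0 h0.
pose F (u : RT R n * RT R n) := (gx n s x (zc a u.2) * H (zc a u.2)) * \prod_(j < n) cexp (zc a u.2 j * (coord u.1 j)%:C).
have FE (xi t : RT R n) : gx n s (fun j => x j + coord xi j) (zc a t) * H (zc a t) = F (xi, t).
  rewrite /F gx_shift /= mulrAC; congr (_ * _).
  rewrite /dotz cexp_sum; apply: eq_bigr => j _; by rewrite mulrC.
transitivity (cintg (pwm (gaussm h) n) (fun xi : RT R n => cintg (lebn R n) (fun t => F (xi, t)))).
  by apply: eq_cintg => xi; apply: eq_cintg => t; rewrite FE.
have mF : cmeas F.
  apply: cmeasM.
    apply: (cmeas_comp (f := fun t : RT R n => gx n s x (zc a t) * H (zc a t)) (h := snd)).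
      exact: cmeas_gxH.
    exact: measurable_snd.
  apply: cmeas_prod => j _; apply: cmeas_cexp; apply: cmeasM.
    apply: (cmeas_comp (f := fun t : RT R n => zc a t j) (h := snd)); first exact: cmeas_zc.
    exact: measurable_snd.
  apply: cmeas_real.
  apply: (measurableT_comp (f := fun t : RT R n => coord t j)); last exact: measurable_fst.
  exact: (measurable_coord (T := measurableTypeR R)).
have jg := gint_integrable x s0 pH.
have jF : cintegrable (pwm (gaussm h) n \x lebn R n)%E F.
  apply: (cintegrable_le (mu := (pwm (gaussm h) n \x lebn R n)%E) (W := fun u =>
    (\prod_(j < n) expR (`|a j| * `|coord u.1 j|)) * cn (gx n s x (zc a u.2) * H (zc a u.2)))) => //.
    move=> [xi t]; rewrite /F /= cnM mulrC ler_wpM2r ?cn_ge0 // cn_prod.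
    apply: ler_prod => j _; rewrite cn_ge0 cn_cexp mulrC RezCM zc_zl // Rez_zl ler_expR.
    by rewrite -normrM mulrC ler_norm.
  apply: (rintegrable_prod (m1 := pwm (gaussm h) n) (m2 := lebn R n)
      (f := fun xi => \prod_(j < n) expR (`|a j| * `|coord xi j|))
      (g := fun t => cn (gx n s x (zc a t) * H (zc a t)))); last by case: jg.
    apply: (rintegrable_pw (m := gaussm h) (W := fun j y => expR (`|a j| * `|y|))) => j _.
    exact: rintegrable_gaussm_exp.
rewrite cintg_fubini1 // -cintg_fubini2 //; apply: eq_cintg => t.
rewrite /F /= cintgZ; last first.
  apply: (@cintegrable_pw _ _ _ (gaussm h) n (fun j y => cexp (zc a t j * y%:C))) => j _.
  exact: cintegrable_gaussm_cexp.
rewrite (@cintg_pw _ _ _ (gaussm h) n (fun j y => cexp (zc a t j * y%:C))); last first.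
  by move=> j _; exact: cintegrable_gaussm_cexp.
rewrite mulrAC; congr (_ * _); rewrite /gx -big_split /=; apply: eq_bigr => j _.
by rewrite cintg_gaussm_cexp // gssD mulrAC.
Qed.

Lemma cmeas_gint_param d (T : measurableType d) s H (X : T -> nat -> R) : pbd n a H ->
  (forall j, (j < n)%N -> measurable_fun setT (fun w => X w j)) ->
  cmeas (fun w => gint n s (X w) a H).
Proof.
move=> pH mX.
apply: (cmeas_cintg_param (lebn R n) (f := fun u : T * RT R n => gx n s (X u.1) (zc a u.2) * H (zc a u.2))).
have mz j : cmeas (fun u : T * RT R n => zc a u.2 j).
  apply: (cmeas_comp (f := fun t : RT R n => zc a t j) (h := snd)); first exact: cmeas_zc.
  exact: measurable_snd.
apply: cmeasM; last first.
  by case: pH => mH _; apply: (cmeas_comp mH); exact: measurable_snd.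
apply: cmeas_prod => j _; apply: cmeasM.
  apply: cmeas_cexp; apply: cmeasM; [exact: cmeas_cst|exact: cmeasX].
apply: cmeas_cexp; apply: cmeasM => //; apply: cmeas_real.
apply: (measurableT_comp (f := fun w => X w j)); [exact: mX|exact: measurable_fst].
Qed.

End GaussianAverage.

(** * Joint law of independent increments *)

Section MakePower.
Context {dT} {T : measurableType dT}.

Fixpoint mkpw (n : nat) (f : nat -> T) : pw T n :=
  match n return pw T n with
  | 0 => tt
  | n'.+1 => (f 0%N, mkpw n' (fun j => f j.+1))
  end.

Lemma coord_mkpw n f j : (j < n)%N -> coord (mkpw n f) j = f j.
Proof. by elim: n f j => // n IH f [|j] //= jn; rewrite IH. Qed.

Lemma measurable_mkpw d (O : measurableType d) n (Y : nat -> O -> T) :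
  (forall j, (j < n)%N -> measurable_fun setT (Y j)) ->
  measurable_fun setT (fun w => mkpw n (Y^~ w)).
Proof.
elim: n Y => [|n IH] Y mY /=; first exact: measurable_cst.
apply: measurable_fun_pair; first exact: mY.
by apply: (IH (fun j => Y j.+1)) => j jn; exact: mY.
Qed.

Context {R : realType}.
Variable m : {sigma_finite_measure set T -> \bar R}.

Lemma pwmT n : m setT = 1%E -> pwm m n setT = 1%E.
Proof.
move=> m1; elim: n => [|n IH] /=; first by rewrite /diracm /= diracT.
transitivity (m setT * pwm m n setT)%E; last by rewrite m1 IH mule1.
by rewrite -setXTT; exact: (product_measure1E m (pwm m n) measurableT measurableT).
Qed.

End MakePower.

Definition pushforward_measure {d1 d2} {T1 : measurableType d1} {T2 : measurableType d2}
  {R : realType} (m : {measure set T1 -> \bar R}) (f : T1 -> T2) (mf : measurable_fun setT f) :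
  {measure set T2 -> \bar R} :=
  measure_function_pushforward__canonical__measure_function_Measure m mf.

Section ProductLaw.
Context {d} {O : measurableType d} {R : realType} (P : probability O R).

(** Restricted to [D], divided by [c] and pushed forward by the pair, [P] becomes a measure that
    agrees with the product on rectangles, hence everywhere. *)
Lemma law_pair {d1 d2} {T1 : measurableType d1} {T2 : measurableType d2}
  (m1 : {sigma_finite_measure set T1 -> \bar R}) (m2 : {sigma_finite_measure set T2 -> \bar R})
  (D : set O) (c : R) (Y1 : O -> T1) (Y2 : O -> T2) :
  measurable D -> 0 <= c -> measurable_fun setT Y1 -> measurable_fun setT Y2 ->
  m1 setT = 1%E -> m2 setT = 1%E ->
  (forall A B, measurable A -> measurable B ->
     P (D `&` Y1 @^-1` A `&` Y2 @^-1` B) = (c%:E * m1 A * m2 B)%E) ->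
  forall S, measurable S -> P (D `&` (fun w => (Y1 w, Y2 w)) @^-1` S) = (c%:E * (m1 \x m2) S)%E.
Proof.
move=> mD c0 mY1 mY2 m1T m2T h S mS.
have mY : measurable_fun setT (fun w => (Y1 w, Y2 w)) by exact: measurable_fun_pair.
have mYS (S' : set (T1 * T2)) : measurable S' -> measurable ((fun w => (Y1 w, Y2 w)) @^-1` S').
  by move=> mS'; rewrite -[X in measurable X]setTI; exact: mY.
have PD : P D = c%:E.
  have := h setT setT measurableT measurableT; rewrite !preimage_setT !setIT m1T m2T !mule1; exact.
(* For [c = 0] no normalization is possible, but then [D] is a null set. *)
move: c0; rewrite le_eqVlt => /orP[/eqP c0|c0].
  rewrite -c0 mul0e; apply/eqP; rewrite eq_le measure_ge0 andbT.
  rewrite (_ : 0%E = P D); last by rewrite PD -c0.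
  by rewrite le_measure ?inE //; apply: measurableI => //; exact: mYS.
have ci : 0 <= c^-1 by rewrite invr_ge0 ltW.
pose Q := mscale (NngNum ci) (pushforward_measure (mrestr P mD) mY).
have QE S' : Q S' = (c^-1%:E * P (D `&` (fun w => (Y1 w, Y2 w)) @^-1` S'))%E.
  by rewrite /Q /mscale /= /pushforward /mrestr setIC.
rewrite (@product_measure_unique _ _ _ _ _ m1 m2 Q) //.
  apply: (etrans _ (congr1 (fun z => c%:E * z)%E (esym (QE S)))).
  by rewrite muleA -EFinM divff ?gt_eqF // mul1e.
move=> A B mA mB; apply: (etrans (QE _)).
have -> : D `&` (fun w => (Y1 w, Y2 w)) @^-1` (A `*` B) = D `&` Y1 @^-1` A `&` Y2 @^-1` B.
  by apply/seteqP; split => w /=; tauto.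
by rewrite h // !muleA -EFinM mulVf ?gt_eqF // mul1e.
Qed.

Lemma law_pw {dT} {T : measurableType dT} (m : {sigma_finite_measure set T -> \bar R}) n
  (D : set O) (c : R) (Y : nat -> O -> T) :
  m setT = 1%E -> measurable D -> 0 <= c -> (forall j, (j < n)%N -> measurable_fun setT (Y j)) ->
  (forall A : nat -> set T, (forall i, measurable (A i)) ->
     P (D `&` [set w | forall i, (i < n)%N -> A i (Y i w)]) = (c * \prod_(i < n) fine (m (A i)))%:E) ->
  forall S, measurable S -> P (D `&` (fun w => mkpw n (Y^~ w)) @^-1` S) = (c%:E * pwm m n S)%E.
Proof.
move=> mT; elim: n D c Y => [|n IH] D c Y mD c0 mY h S mS.
  have := h (fun=> setT) (fun=> measurableT); rewrite big_ord0 mulr1.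
  have -> : [set w | forall i, (i < 0)%N -> [set: T] (Y i w)] = setT by apply/seteqP.
  rewrite setIT => PD; rewrite /= diracE.
  case: (boolP (tt \in S)) => St /=.
    rewrite mule1 -PD; congr (P _); apply/seteqP; split => w /=; first by case.
    by move=> Dw; split => //; move: St; rewrite inE.
  rewrite mule0 (_ : D `&` _ = set0) ?measure0 //; apply/seteqP; split => w //= -[_ Sw].
  by move: St; rewrite notin_setE.
have mfin A : measurable A -> m A \is a fin_num.
  move=> mA; rewrite ge0_fin_numE //; apply: (@le_lt_trans _ _ (m setT)); last by rewrite mT ltry.
  by rewrite le_measure ?inE.
apply: (law_pair (m1 := m) (m2 := pwm m n) (Y1 := Y 0%N) (Y2 := fun w => mkpw n (fun j => Y j.+1 w))) => //.
- exact: mY.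
- by apply: (measurable_mkpw (Y := fun j => Y j.+1)) => j jn; exact: mY.
- exact: pwmT.
move=> A B mA mB.
have mYA : measurable (Y 0%N @^-1` A) by rewrite -[X in measurable X]setTI; exact: mY.
rewrite (_ : c%:E * m A = (c * fine (m A))%:E)%E; last by rewrite EFinM fineK // mfin.
apply: (IH (D `&` Y 0%N @^-1` A) (c * fine (m A)) (fun j => Y j.+1)) => //.
- exact: measurableI.
- by apply: mulr_ge0 => //; exact: fine_ge0.
- by move=> j jn; exact: mY.
move=> A' mA'; pose A2 i := if i is i'.+1 then A' i' else A.
have := h A2; rewrite big_ord_recl mulrA => <-; last by case.
congr (P _); apply/seteqP; split => w /=.
  by move=> [[Dw Aw] h']; split => // -[|i] //=; exact: h'.
by move=> [Dw h']; split; [split => //; exact: (h' 0%N)|move=> i; exact: (h' i.+1)].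
Qed.

(* [D] and [c] carry the coordinates already treated through the induction. *)
Lemma law_pw2 {dT} {T : measurableType dT} (m : {sigma_finite_measure set T -> \bar R}) n N
  (D : set O) (c : R) (Y : nat -> nat -> O -> T) :
  m setT = 1%E -> measurable D -> 0 <= c ->
  (forall i j, (i < N)%N -> (j < n)%N -> measurable_fun setT (Y i j)) ->
  (forall A : nat -> nat -> set T, (forall i j, measurable (A i j)) ->
     P (D `&` [set w | forall i j, (i < N)%N -> (j < n)%N -> A i j (Y i j w)]) =
     (c * \prod_(i < N) \prod_(j < n) fine (m (A i j)))%:E) ->
  forall S, measurable S ->
    P (D `&` (fun w => mkpw N (fun i => mkpw n (fun j => Y i j w))) @^-1` S) =
    (c%:E * pwm (pwm m n) N S)%E.
Proof.
move=> mT; elim: N D c Y => [|N IH] D c Y mD c0 mY h S mS.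
  apply: (law_pw (m := pwm m n) (n := 0) (Y := fun i w => mkpw n (fun j => Y i j w))) => //.
    exact: pwmT.
  move=> A mA; rewrite big_ord0; have := h (fun _ _ => setT) (fun _ _ => measurableT).
  by rewrite big_ord0 => <-; congr (P (_ `&` _)); apply/seteqP.
have pwfin A : measurable A -> pwm m n A \is a fin_num.
  move=> mA; rewrite ge0_fin_numE //; apply: (@le_lt_trans _ _ (pwm m n setT)); last by rewrite pwmT // ltry.
  by rewrite le_measure ?inE.
have mrow i : (i < N.+1)%N -> measurable_fun setT (fun w => mkpw n (fun j => Y i j w)).
  by move=> iN; apply: (measurable_mkpw (Y := Y i)) => j jn; exact: mY.
apply: (law_pair (m1 := pwm m n) (m2 := pwm (pwm m n) N)
   (Y1 := fun w => mkpw n (fun j => Y 0%N j w)) (Y2 := fun w => mkpw N (fun i => mkpw n (fun j => Y i.+1 j w)))) => //.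
- exact: mrow.
- by apply: (measurable_mkpw (Y := fun i w => mkpw n (fun j => Y i.+1 j w))) => i iN; exact: mrow.
- exact: pwmT.
- by apply: pwmT; exact: pwmT.
move=> A B mA mB.
have mrA : measurable ((fun w => mkpw n (fun j => Y 0%N j w)) @^-1` A).
  by rewrite -[X in measurable X]setTI; exact: mrow.
rewrite (_ : c%:E * pwm m n A = (c * fine (pwm m n A))%:E)%E; last by rewrite EFinM fineK // pwfin.
apply: (IH _ (c * fine (pwm m n A)) (fun i => Y i.+1)) => //.
- exact: measurableI.
- by apply: mulr_ge0 => //; exact: fine_ge0.
- by move=> i j iN jn; exact: mY.
move=> A' mA'.
set D' := [set w | forall i j, (i < N)%N -> (j < n)%N -> A' i j (Y i.+1 j w)].
set c' := \prod_(i < N) \prod_(j < n) fine (m (A' i j)).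
have c'0 : 0 <= c' by apply: prodr_ge0 => i _; apply: prodr_ge0 => j _; exact: fine_ge0.
have mD' : measurable D'.
  have -> : D' = \bigcap_(i in [set i | (i < N)%N]) \bigcap_(j in [set j | (j < n)%N]) (Y i.+1 j @^-1` A' i j).
    by apply/seteqP; split => w /= h1 i; [move=> iN j jn; exact: h1|move=> j iN jn; exact: (h1 i iN j jn)].
  apply: bigcap_measurableType => i iN; apply: bigcap_measurableType => j jn.
  by rewrite -[X in measurable X]setTI; exact: mY.
have := law_pw (m := m) (n := n) (D := D `&` D') (c := c * c') (Y := Y 0%N) mT.
move=> /(_ (measurableI _ _ mD mD') (mulr_ge0 c0 c'0)) H.
have {H} := H (fun j jn => mY 0%N j isT jn) _ A mA.
rewrite [D `&` _ `&` D']setIAC => ->; last first.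
  move=> A0 mA0; pose A2 i := if i is i'.+1 then A' i' else A0.
  have := h A2; rewrite big_ord_recl /= -/c' mulrAC -mulrA => <-; last by case.
  rewrite -setIA; congr (P (_ `&` _)); apply/seteqP; split => w /=.
    by move=> [h1 h2] [|i] j iN jn /=; [exact: h2|exact: h1].
  by move=> h1; split => [i j iN jn|i iN]; [exact: (h1 i.+1)|exact: (h1 0%N)].
by rewrite mulrAC [in RHS]EFinM fineK // pwfin.
Qed.

Lemma Rintegral_law {dT} {T : measurableType dT} (m : {sigma_finite_measure set T -> \bar R})
  (Y : O -> T) : measurable_fun setT Y ->
  (forall S, measurable S -> P (Y @^-1` S) = m S) ->
  forall f : T -> R, rintegrable m f ->
  P.-integrable setT (EFin \o (f \o Y)) /\ Rintegral P setT (f \o Y) = Rintegral m setT f.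
Proof.
move=> mY h f jf.
have eqm : (\int[m]_t (f t)%:E = \int[pushforward P Y]_t (f t)%:E)%E.
  by apply: (eq_measure_integral (pushforward_measure P mY)) => S mS _; rewrite [RHS]h.
have mf := measurable_int _ jf.
have jf' : P.-integrable setT ((EFin \o f) \o Y).
  apply/integrableP; split; first exact: measurableT_comp.
  have /integrableP[_] := jf.
  rewrite (eq_measure_integral (pushforward_measure P mY)) => [|S mS _]; last by rewrite [RHS]h.
  rewrite ge0_integral_pushforward //; exact: measurableT_comp.
split => //; rewrite /Rintegral eqm; congr fine.
by rewrite integral_pushforward.
Qed.

End ProductLaw.

(** * Euler scheme *)

Section ProductWalk.
Variable R : realType.
Variables (n : nat) (h : R).
Hypothesis h0 : 0 < h.
Local Notation RTn := (RT R n).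
Local Notation mN N := (pwm (pwm (gaussm h) n) N).

Definition wc N (w : pw RTn N) (i j : nat) : R := coord (coord w i) j.

Definition tot N (w : nat -> nat -> R) : R := \sum_(i < N) xn n (w i).

Lemma tot_ge0 N w : 0 <= tot N w.
Proof. by apply: sumr_ge0 => i _; exact: xn_ge0. Qed.

Lemma tot_recl N w : tot N.+1 w = xn n (w 0%N) + tot N (fun i => w i.+1).
Proof. by rewrite /tot big_ord_recl. Qed.

Lemma tot_mono i N w : (i <= N)%N -> tot i w <= tot N w.
Proof.
move=> /subnKC <-; rewrite /tot big_split_ord /= lerDl.
by apply: sumr_ge0 => j _; exact: xn_ge0.
Qed.

Lemma measurable_wc N i j : measurable_fun setT (fun w : pw RTn N => wc w i j).
Proof.
apply: (measurableT_comp (f := fun t : RTn => coord t j)).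
  exact: (measurable_coord (T := measurableTypeR R)).
exact: (measurable_coord (T := RTn)).
Qed.

Lemma measurable_coordR j : measurable_fun setT (fun t : RTn => coord t j : R).
Proof. exact: (measurable_coord (T := measurableTypeR R)). Qed.

Lemma mNT N : mN N setT = 1%E.
Proof. by apply: pwmT; apply: pwmT; exact: gaussmT. Qed.

Lemma expb_prod (c : R) N w : expR (c * tot N w) = \prod_(i < N) \prod_(j < n) expR (c * `|w i j|).
Proof.
rewrite /tot mulr_sumr expR_sum; apply: eq_bigr => i _.
by rewrite /xn mulr_sumr expR_sum.
Qed.

Lemma rintegrable_expb (c C : R) N (f : pw RTn N -> R) : measurable_fun setT f ->
  (forall w, `|f w| <= C * expR (c * tot N (wc w))) -> rintegrable (mN N) f.
Proof.
move=> mf fb; apply: (rintegrable_le (mu := mN N) mf fb); apply: rintegrableZ.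
have jr : rintegrable (pwm (gaussm h) n) (fun t : RTn => \prod_(j < n) expR (c * `|coord t j|)).
  by apply: (rintegrable_pw (m := gaussm h) (W := fun j y => expR (c * `|y|))) => j _; exact: rintegrable_gaussm_exp.
have := rintegrable_pw (m := pwm (gaussm h) n) (n := N) (fun i _ => jr).
by congr (rintegrable _ _); apply/funext => w; rewrite expb_prod.
Qed.

Lemma rintegrable_expb1 (c C : R) (f : RTn -> R) : measurable_fun setT f ->
  (forall t, `|f t| <= C * expR (c * xn n (coord t))) -> rintegrable (pwm (gaussm h) n) f.
Proof.
move=> mf fb; apply: (rintegrable_le (mu := pwm (gaussm h) n) mf fb); apply: rintegrableZ.
have := rintegrable_pw (m := gaussm h) (n := n) (W := fun j y => expR (c * `|y|)) (fun j _ => rintegrable_gaussm_exp c h0).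
by congr (rintegrable _ _); apply/funext => t; rewrite /xn mulr_sumr expR_sum.
Qed.

Lemma Rintegral_mN_rec N (f : pw RTn N.+1 -> R) : rintegrable (mN N.+1) f ->
  Rintegral (mN N.+1) setT f =
  Rintegral (pwm (gaussm h) n) setT (fun xi => Rintegral (mN N) setT (fun w => f (xi, w))).
Proof. by move=> jf; rewrite (@Rintegral_fubini1 _ _ _ _ _ (pwm (gaussm h) n) (mN N)). Qed.

Lemma rintegrable_mN_rec N (f : pw RTn N.+1 -> R) : rintegrable (mN N.+1) f ->
  rintegrable (pwm (gaussm h) n) (fun xi => Rintegral (mN N) setT (fun w => f (xi, w))).
Proof. by move=> jf; apply: (integrable_fubini_Rintegral (m1 := pwm (gaussm h) n) (m2 := mN N)). Qed.

Lemma Rintegral_prob d (T : measurableType d) (mu : {sigma_finite_measure set T -> \bar R}) (c : R) :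
  mu setT = 1%E -> rintegrable mu (fun=> c) /\ Rintegral mu setT (fun=> c) = c.
Proof.
move=> muT; split; last by rewrite /Rintegral integral_cst //= [X in (_ * X)%E]muT mule1.
apply/integrableP; split; first exact: measurable_cst.
by rewrite integral_cst //= [X in (_ * X)%E]muT mule1 ltry.
Qed.

Lemma le_rint d (T : measurableType d) (mu : {sigma_finite_measure set T -> \bar R}) (f g : T -> R) :
  rintegrable mu f -> rintegrable mu g -> (forall x, f x <= g x) ->
  Rintegral mu setT f <= Rintegral mu setT g.
Proof. by move=> jf jg fg; apply: le_Rintegral => // x _. Qed.

Lemma abs_rint d (T : measurableType d) (mu : {sigma_finite_measure set T -> \bar R}) (f g : T -> R) :
  rintegrable mu f -> rintegrable mu g -> (forall x, `|f x| <= g x) ->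
  `|Rintegral mu setT f| <= Rintegral mu setT g.
Proof.
move=> jf jg fg; apply: (le_trans (le_normr_Rintegral _ jf)) => //.
by apply: le_rint => //; exact: integrable_norm.
Qed.

Lemma subr_rint d (T : measurableType d) (mu : {sigma_finite_measure set T -> \bar R}) (f g : T -> R) :
  rintegrable mu f -> rintegrable mu g ->
  Rintegral mu setT f - Rintegral mu setT g = Rintegral mu setT (fun x => f x - g x).
Proof. by move=> jf jg; rewrite RintegralB. Qed.

Section Chain.
Variables (p q tau : R).
Hypotheses (tau0 : 0 < tau) (pq1 : p + q = 1) (pE : p = tau * q).
Local Notation rho := (prho n p q n).

(** The push precedes the increment in each step: on a starting point in the chamber the first push
    is trivial, and the overlap created by the last increment is left unresolved. *)
Fixpoint chain N (x : nat -> R) (w : nat -> nat -> R) : nat -> R :=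
  if N is N'.+1 then chain N' (fun j => rho x j + w 0%N j) (fun i => w i.+1) else x.

Lemma chainSr N x w : chain N.+1 x w = fun j => rho (chain N x w) j + w N j.
Proof. by elim: N x w => [|N IH] x w //; rewrite [LHS]IH. Qed.

Lemma rho_xn3 x : xn n (rho x) <= 3 * xn n x.
Proof. have h1 := prho_xn n tau0 pq1 pE n x; have h2 := lamt_xn n x; lra. Qed.

(** The factor [3^N] is harmless, because this bound serves only integrability for fixed [N]. The
    bound uniform in the grid is [chain_xn_bound]. *)
Lemma chain_xn N x w : xn n (chain N x w) <= 3 ^+ N * (xn n x + tot N w).
Proof.
elim: N x w => [|N IH] x w; first by rewrite /tot big_ord0 expr0 mul1r addr0.
apply: (le_trans (IH _ _)); rewrite exprSr -mulrA ler_wpM2l ?exprn_ge0 // tot_recl.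
have h1 := rho_xn3 x; have h2 := xnD n (rho x) (w 0%N); have h3 := tot_ge0 N (fun i => w i.+1).
have h4 := xn_ge0 n (w 0%N); lra.
Qed.

Lemma measurable_lamk d (T : measurableType d) (X : T -> nat -> R) k :
  (forall j, measurable_fun setT (fun w => X w j)) -> measurable_fun setT (fun w => lamk n (X w) k).
Proof.
move=> mX; rewrite /lamk; case: (k.+1 < n)%N => //.
by apply: measurable_maxr => //; exact: measurable_funB.
Qed.

Lemma measurable_lamt d (T : measurableType d) (X : T -> nat -> R) :
  (forall j, measurable_fun setT (fun w => X w j)) -> measurable_fun setT (fun w => lamt n (X w)).
Proof. by move=> mX; apply: measurable_sum => k; exact: measurable_lamk. Qed.

Lemma measurable_xn d (T : measurableType d) (X : T -> nat -> R) :
  (forall j, measurable_fun setT (fun w => X w j)) -> measurable_fun setT (fun w => xn n (X w)).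
Proof. by move=> mX; apply: measurable_sum => k; exact: measurableT_comp. Qed.

Lemma measurable_rho d (T : measurableType d) (X : T -> nat -> R) j :
  (forall j, measurable_fun setT (fun w => X w j)) -> measurable_fun setT (fun w => rho (X w) j).
Proof.
move=> mX; rewrite /prho; apply: measurable_funB.
  apply: measurable_funD => //; apply: measurable_funM => //.
  by case: (j < n)%N => //; exact: measurable_lamk.
apply: measurable_funM => //; case: j => [|j] //.
by case: (j < n)%N => //; exact: measurable_lamk.
Qed.

Lemma measurable_chain d (T : measurableType d) N (X : T -> nat -> R) (W : T -> nat -> nat -> R) :
  (forall j, measurable_fun setT (fun w => X w j)) ->
  (forall i j, measurable_fun setT (fun w => W w i j)) ->
  forall j, measurable_fun setT (fun w => chain N (X w) (W w) j).
Proof.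
elim: N X W => [|N IH] X W mX mW j /=; first exact: mX.
apply: (IH (fun w j => rho (X w) j + W w 0%N j) (fun w i => W w i.+1)) => // k.
by apply: measurable_funD => //; exact: measurable_rho.
Qed.

Variable C : R.
Hypothesis C0 : 0 <= C.

Definition err (x : nat -> R) : R := C * (lamt n x ^+ 2 * expR (15 * xn n x)).

Lemma err_ge0 x : 0 <= err x.
Proof. by rewrite /err mulr_ge0 // mulr_ge0 ?sqr_ge0 ?expR_ge0. Qed.

(** From [lamt <= 2 xn] and [xn^2 <= exp (2 xn)]; the 17 is 15 + 2. *)
Lemma err_le x : err x <= 4 * C * expR (17 * xn n x).
Proof.
rewrite /err (_ : 17 * xn n x = 2 * xn n x + 15 * xn n x); last by ring.
rewrite expRD (mulrC 4 C) -(mulrA C) ler_wpM2l // [leRHS]mulrA ler_wpM2r ?expR_ge0 //.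
apply: (@le_trans _ _ (4 * xn n x ^+ 2)).
  rewrite (_ : 4 * _ = (2 * xn n x) ^+ 2); last by ring.
  by rewrite lerXn2r ?nnegrE ?lamt_ge0 ?lamt_xn // mulr_ge0 ?xn_ge0.
rewrite ler_wpM2l // mulr2n mulrDl mul1r expRD -expr2 lerXn2r ?nnegrE ?xn_ge0 ?expR_ge0 //.
by apply: le_trans (expR_ge1Dx _); rewrite lerDr.
Qed.

Definition Serr N (x : nat -> R) (w : nat -> nat -> R) : R := \sum_(i < N) err (chain i x w).

Lemma SerrS N x w : Serr N.+1 x w = err x + Serr N (fun j => rho x j + w 0%N j) (fun i => w i.+1).
Proof. by rewrite /Serr big_ord_recl. Qed.

Lemma Serr_ge0 N x w : 0 <= Serr N x w.
Proof. by apply: sumr_ge0 => i _; exact: err_ge0. Qed.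

Lemma measurable_Serr d (T : measurableType d) N (X : T -> nat -> R) (W : T -> nat -> nat -> R) :
  (forall j, measurable_fun setT (fun w => X w j)) ->
  (forall i j, measurable_fun setT (fun w => W w i j)) ->
  measurable_fun setT (fun w => Serr N (X w) (W w)).
Proof.
move=> mX mW; apply: measurable_sum => i; rewrite /err.
have mc := measurable_chain i mX mW.
apply: measurable_funM => //; apply: measurable_funM.
  by apply: measurable_funX; exact: measurable_lamt.
by apply: measurableT_comp => //; apply: measurable_funM => //; exact: measurable_xn.
Qed.

Lemma Serr_le N x w : Serr N x w <= (N%:R * (4 * C) * expR (17 * 3 ^+ N * xn n x)) * expR (17 * 3 ^+ N * tot N w).
Proof.
rewrite -mulrA -expRD -mulrDr -mulrA mulr_natl -[X in _ *+ X]card_ord -sumr_const.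
apply: ler_sum => i _; apply: (le_trans (err_le _)).
have xt : 0 <= xn n x + tot N w by rewrite addr_ge0 ?xn_ge0 ?tot_ge0.
rewrite ler_wpM2l ?mulr_ge0 // ler_expR -mulrA ler_wpM2l //.
apply: (le_trans (chain_xn _ _ _)); apply: (@le_trans _ _ (3 ^+ i * (xn n x + tot N w))).
  by rewrite ler_wpM2l ?exprn_ge0 // lerD2l tot_mono // ltnW.
rewrite ler_wpM2r // ler_eXn2l //; first exact: ltnW.
by rewrite ltr1n.
Qed.

Lemma rintegrable_Serr N x : rintegrable (mN N) (fun w => Serr N x (wc w)).
Proof.
apply: rintegrable_expb; last by move=> w; rewrite ger0_norm ?Serr_ge0 //; exact: Serr_le.
apply: (@measurable_Serr _ _ N (fun _ => x) (fun w => wc w)) => [j|i j]; [exact: measurable_cst|exact: measurable_wc].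
Qed.

(** [u] stands for the real or the imaginary part of the right-hand side; what matters is its
    behaviour under Gaussian averages and under pushes. *)
Variables (u : R -> (nat -> R) -> R) (de T : R).
Hypothesis heat : forall s x, 0 < s ->
  Rintegral (pwm (gaussm h) n) setT (fun xi : RTn => u s (fun j => x j + coord xi j)) = u (s + h) x.
Hypothesis push : forall s x, de <= s <= T -> `|u s (rho x) - u s x| <= err x.
Hypothesis mu_ : forall s d (O : measurableType d) (X : O -> nat -> R),
  (forall j, measurable_fun setT (fun w => X w j)) -> measurable_fun setT (fun w => u s (X w)).
Variable Cu : R.
Hypothesis Cu0 : 0 <= Cu.
Hypothesis growth : forall s x, de <= s <= T -> `|u s x| <= Cu * expR (xn n x).
Hypothesis de0 : 0 < de.

Lemma rintegrable_uchain N s x : de <= s <= T -> rintegrable (mN N) (fun w => u s (chain N x (wc w))).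
Proof.
move=> sT; apply: (@rintegrable_expb (3 ^+ N) (Cu * expR (3 ^+ N * xn n x))).
  apply: mu_ => j; apply: (@measurable_chain _ _ N (fun _ => x) (fun w => wc w)) => [k|i k]; [exact: measurable_cst|exact: measurable_wc].
move=> w; apply: (le_trans (growth _ sT)); rewrite -mulrA -expRD -mulrDr ler_wpM2l // ler_expR.
exact: chain_xn.
Qed.

(** Given the first increment, the induction hypothesis compares with [u (s + N h)]. Averaging over
    that increment gives [u (s + N h + h)] at the pushed point, and [push] removes the push at the
    cost [err x]. *)
Lemma chain_rate N s x : de <= s -> s + N%:R * h <= T ->
  `|Rintegral (mN N) setT (fun w => u s (chain N x (wc w))) - u (s + N%:R * h) x| <=
  Rintegral (mN N) setT (fun w => Serr N x (wc w)).
Proof.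
move=> ds; elim: N x => [|N IH] x sT.
  rewrite mul0r addr0 (_ : Rintegral _ _ _ = u s x); last by rewrite [LHS]Rintegral_unit.
  by rewrite subrr normr0 [leRHS]Rintegral_unit Serr_ge0.
have NT : s + N%:R * h + h <= T by move: sT; rewrite -addn1 natrD mulrDl mul1r addrA.
have sT' : de <= s <= T.
  by rewrite ds /=; apply: le_trans NT; rewrite -addrA lerDl addr_ge0 ?mulr_ge0 // ltW.
have NT' : s + N%:R * h <= T by apply: le_trans NT; rewrite lerDl ltW.
have dN : de <= s + N%:R * h by apply: (le_trans ds); rewrite lerDl mulr_ge0 // ltW.
pose y (xi : RTn) j := rho x j + coord xi j.
have ju := @rintegrable_uchain N.+1 s x sT'.
have jS := rintegrable_Serr N.+1 x.
rewrite (Rintegral_mN_rec ju) (Rintegral_mN_rec jS).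
have jg := rintegrable_mN_rec ju; have je := rintegrable_mN_rec jS.
pose e (xi : RTn) := Rintegral (mN N) setT (fun w => Serr N (y xi) (wc w)).
have eE xi : Rintegral (mN N) setT (fun w => Serr N.+1 x (wc ((xi, w) : pw RTn N.+1))) = err x + e xi.
  have [j1 j2] := Rintegral_prob (err x) (mNT N).
  transitivity (Rintegral (mN N) setT (fun w => err x + Serr N (y xi) (wc w))).
    by apply: eq_Rintegral => w _; rewrite SerrS.
  by rewrite RintegralD // ?j2 //; exact: rintegrable_Serr.
have pT : pwm (gaussm h) n setT = 1%E by apply: pwmT; exact: gaussmT.
have [j1 j2] := Rintegral_prob (err x) pT.
have je' : rintegrable (pwm (gaussm h) n) e.
  move: je; rewrite (_ : (fun xi => _) = (fun xi => err x + e xi)); last by apply/funext => xi; exact: eE.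
  move=> /rintegrableD /(_ (rintegrableZ (-1) j1)); congr (rintegrable _ _).
  by apply/funext => xi; ring.
rewrite (_ : (fun xi => Rintegral (mN N) setT (fun w => Serr N.+1 x (wc ((xi, w) : pw RTn N.+1)))) = (fun xi => err x + e xi)); last first.
  by apply/funext => xi; exact: eE.
rewrite RintegralD // j2.
have -> : s + N.+1%:R * h = s + N%:R * h + h by rewrite -addn1 natrD mulrDl mul1r addrA.
set s' := s + N%:R * h.
have s'0 : 0 < s' by exact: lt_le_trans dN.
have ji : rintegrable (pwm (gaussm h) n) (fun xi : RTn => u s' (y xi)).
  apply: (@rintegrable_expb1 1 (Cu * expR (xn n (rho x)))).
    apply: mu_ => j; apply: measurable_funD => //; exact: measurable_coordR.
  move=> xi; apply: (le_trans (growth _ _)); first by rewrite dN.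
  rewrite -mulrA -expRD mul1r ler_wpM2l // ler_expR; exact: xnD.
have s'T : de <= s' + h <= T by rewrite NT andbT (le_trans dN) // lerDl ltW.
have := push x s'T; rewrite -(heat (rho x) s'0) => pb.
have ib : `|Rintegral (pwm (gaussm h) n) setT (fun xi => Rintegral (mN N) setT (fun w => u s (chain N.+1 x (wc ((xi, w) : pw RTn N.+1)))))
    - Rintegral (pwm (gaussm h) n) setT (fun xi : RTn => u s' (y xi))| <= Rintegral (pwm (gaussm h) n) setT e.
  rewrite subr_rint //; apply: abs_rint => //.
    by have := rintegrableD jg (rintegrableZ (-1) ji); congr (rintegrable _ _); apply/funext => xi; ring.
  by move=> xi; have := IH (y xi) NT'.
move: pb ib; rewrite /y; set A := Rintegral _ _ _; set B := Rintegral _ _ _; set D := Rintegral _ _ _ => pb ib.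
rewrite (_ : B - u (s' + h) x = (A - u (s' + h) x) + (B - A)); last by ring.
exact: (le_trans (ler_normD _ _) (lerD pb ib)).
Qed.

End Chain.

End ProductWalk.

(** * Exponential maximal inequality *)

Section ExponentialMaximal.
Variable R : realType.
Variables (n : nat) (h : R).
Hypothesis h0 : 0 < h.
Local Notation RTn := (RT R n).
Local Notation mN N := (pwm (pwm (gaussm h) n) N).

(** The product of the [2 cosh (c b_j)]: comparable with [exp (c xn b)], and moreover an
    eigenfunction of Gaussian averaging with eigenvalue [KE >= 1], so a submartingale along the
    walk. *)
Definition fexp (c : R) (b : nat -> R) : R := \prod_(j < n) (expR (c * b j) + expR (- (c * b j))).

Lemma exprn_prod (v : R) : v ^+ n = \prod_(j < n) v.
Proof. by rewrite prodr_const card_ord. Qed.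

Lemma sqr_expb (K c x y : R) : K ^+ 2 * expR (2 * c * x) * expR (2 * c * y) = (K * expR (c * (x + y))) ^+ 2.
Proof.
rewrite [RHS]exprMn -mulrA -expRD; congr (_ * _).
rewrite -expRM_natl; congr expR; ring.
Qed.

Lemma fexp_ge0 c b : 0 <= fexp c b.
Proof. by apply: prodr_ge0 => j _; rewrite addr_ge0 ?expR_ge0. Qed.

Lemma expR_xn_fexp c b : 0 <= c -> expR (c * xn n b) <= fexp c b.
Proof.
move=> c0; rewrite /xn mulr_sumr expR_sum; apply: ler_prod => j _; rewrite expR_ge0 /=.
by case: (ler0P (b j)) => _; rewrite ?mulrN ?lerDl ?lerDr ?expR_ge0.
Qed.

Lemma fexp_le c b : 0 <= c -> fexp c b <= 2 ^+ n * expR (c * xn n b).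
Proof.
move=> c0; rewrite /xn mulr_sumr expR_sum exprn_prod -big_split /=.
apply: ler_prod => j _; rewrite addr_ge0 ?expR_ge0 //= mulr_natl mulr2n.
have h1 : c * b j <= c * `|b j| by rewrite ler_wpM2l // ler_norm.
have h2 : - (c * b j) <= c * `|b j| by rewrite -mulrN ler_wpM2l // -normrN ler_norm.
by rewrite lerD // ler_expR.
Qed.

Lemma fexp_sqr c b : fexp c b ^+ 2 <= 2 ^+ n * fexp (2 * c) b.
Proof.
rewrite /fexp -prodrXl exprn_prod -big_split /=.
apply: ler_prod => j _; rewrite sqr_ge0 /=.
have -> : expR (2 * c * b j) = expR (c * b j) ^+ 2.
  by rewrite -mulrA mulr_natl mulr2n expRD -expr2.
have -> : expR (- (2 * c * b j)) = expR (- (c * b j)) ^+ 2.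
  by rewrite -mulrA mulr_natl mulr2n opprD expRD -expr2.
move: (expR _) (expR _) => u v; rewrite -subr_ge0 (_ : _ - _ = (u - v) ^+ 2) ?sqr_ge0 //; ring.
Qed.

Lemma measurable_fexp d (T : measurableType d) c (X : T -> nat -> R) :
  (forall j, measurable_fun setT (fun w => X w j)) -> measurable_fun setT (fun w => fexp c (X w)).
Proof.
move=> mX; apply: measurable_prod => j _; apply: measurable_funD; apply: measurableT_comp => //.
  exact: measurable_funM.
by apply: measurableT_comp => //; exact: measurable_funM.
Qed.

Lemma Rintegral_gaussm_expR (c : R) : Rintegral (gaussm h) setT (fun y => expR (c * y)) = expR (2^-1 * h * c ^+ 2) /\
  rintegrable (gaussm h) (fun y => expR (c * y)).
Proof.
have cE (y : R) : cexp (c%:C * y%:C) = (expR (c * y))%:C by rewrite -CM cexpR.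
split.
  have := congr1 (@complex.Re R) (cintg_gaussm_cexp c%:C h0); rewrite Rez_cintg.
  rewrite -rmorphXn -CM cexpR RezC => <-; apply: eq_Rintegral => y _; by rewrite cE RezC.
have := cintegrable_Re (cintegrable_gaussm_cexp c%:C h0).
by congr (rintegrable _ _); apply/funext => y; rewrite cE RezC.
Qed.

Definition KE c : R := expR (2^-1 * h * c ^+ 2) ^+ n.

Lemma KE_ge1 c : 1 <= KE c.
Proof.
rewrite /KE exprn_ege1 // -expR0 ler_expR; apply: mulr_ge0; last exact: sqr_ge0.
by rewrite mulr_ge0 // ltW.
Qed.

Lemma Rintegral_fexp c b :
  Rintegral (pwm (gaussm h) n) setT (fun xi : RTn => fexp c (fun j => b j + coord xi j)) = KE c * fexp c b.
Proof.
pose W j (y : R) := expR (c * b j) * expR (c * y) + expR (- (c * b j)) * expR (- c * y).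
have jW j : rintegrable (gaussm h) (W j).
  by apply: rintegrableD; apply: rintegrableZ; case: (Rintegral_gaussm_expR c) (Rintegral_gaussm_expR (- c)) => _ ? [].
transitivity (Rintegral (pwm (gaussm h) n) setT (fun xi : RTn => \prod_(j < n) W j (coord xi j))).
  apply: eq_Rintegral => xi _; apply: eq_bigr => j _.
  by rewrite /W -!expRD; congr (expR _ + expR _); ring.
rewrite (@Rintegral_pw _ _ _ (gaussm h) n W) // /fexp /KE exprn_prod -big_split /=.
apply: eq_bigr => j _; have [i1 j1] := Rintegral_gaussm_expR c; have [i2 j2] := Rintegral_gaussm_expR (- c).
rewrite /W RintegralD ?RintegralZl //; try exact: rintegrableZ.
rewrite i1 i2 sqrrN; ring.
Qed.

Fixpoint pos N (b : nat -> R) (w : nat -> nat -> R) : nat -> R :=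
  if N is N'.+1 then pos N' (fun j => b j + w 0%N j) (fun i => w i.+1) else b.

Lemma posE N b w j : pos N b w j = b j + \sum_(i < N) w i j.
Proof.
elim: N b w => [|N IH] b w; first by rewrite big_ord0 addr0.
by rewrite /= IH big_ord_recl addrA.
Qed.

Lemma pos_xn N b w : xn n (pos N b w) <= xn n b + tot n N w.
Proof.
elim: N b w => [|N IH] b w; first by rewrite /tot big_ord0 addr0.
apply: (le_trans (IH _ _)); rewrite tot_recl addrA lerD2r; exact: xnD.
Qed.

Variable c : R.
Hypothesis c0 : 0 <= c.

(** The running maximum of [fexp], with [m] the maximum so far; in this form it can be integrated
    one increment at a time. *)
Fixpoint amax N (m : R) (b : nat -> R) (w : nat -> nat -> R) : R :=
  if N is N'.+1 then
    amax N' (Num.max m (fexp c (fun j => b j + w 0%N j))) (fun j => b j + w 0%N j) (fun i => w i.+1)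
  else m.

Lemma amax_ge N m b w : m <= amax N m b w.
Proof.
elim: N m b w => [|N IH] m b w //=; apply: le_trans (IH _ _ _); by rewrite le_max lexx.
Qed.

Lemma amax_ub N m b w i : (i < N)%N -> fexp c (pos i.+1 b w) <= amax N m b w.
Proof.
elim: N m b w i => [|N IH] m b w [|i] //= iN; last exact: IH.
by apply: le_trans (amax_ge _ _ _ _); rewrite le_max lexx orbT.
Qed.

Lemma amax_lub N m b w V : m <= V -> (forall i, (i < N)%N -> fexp c (pos i.+1 b w) <= V) -> amax N m b w <= V.
Proof.
elim: N m b w => [|N IH] m b w mV hV //=; apply: IH => [|i iN]; last exact: (hV i.+1).
by rewrite ge_max mV /=; exact: (hV 0%N).
Qed.

Lemma amax_bound N m b w : 0 <= m -> amax N m b w <= (m + 2 ^+ n) * expR (c * (xn n b + tot n N w)).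
Proof.
move=> m0; have t0 := tot_ge0 n N w; have b0 := xn_ge0 n b.
have p2 : 0 <= 2 ^+ n :> R by rewrite exprn_ge0.
apply: amax_lub => [|i iN].
  apply: (@le_trans _ _ (m + 2 ^+ n)); first by rewrite lerDl.
  by rewrite ler_peMr ?addr_ge0 // -expR0 ler_expR mulr_ge0 // addr_ge0.
apply: (le_trans (fexp_le _ c0)); apply: ler_pM; rewrite ?expR_ge0 ?lerDr //.
rewrite ler_expR ler_wpM2l //; apply: (le_trans (pos_xn _ _ _)); rewrite lerD2l.
exact: tot_mono.
Qed.

Lemma measurable_pos d (T : measurableType d) N (X : T -> nat -> R) (W : T -> nat -> nat -> R) :
  (forall j, measurable_fun setT (fun w => X w j)) ->
  (forall i j, measurable_fun setT (fun w => W w i j)) ->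
  forall j, measurable_fun setT (fun w => pos N (X w) (W w) j).
Proof.
elim: N X W => [|N IH] X W mX mW j //=.
by apply: (IH (fun w j => X w j + W w 0%N j) (fun w i => W w i.+1)) => // k; exact: measurable_funD.
Qed.

Lemma measurable_amax d (T : measurableType d) N (M : T -> R) (X : T -> nat -> R) (W : T -> nat -> nat -> R) :
  measurable_fun setT M -> (forall j, measurable_fun setT (fun w => X w j)) ->
  (forall i j, measurable_fun setT (fun w => W w i j)) ->
  measurable_fun setT (fun w => amax N (M w) (X w) (W w)).
Proof.
elim: N M X W => [|N IH] M X W mM mX mW //=.
have mX' k : measurable_fun setT (fun w => X w k + W w 0%N k) by exact: measurable_funD.
apply: (IH _ (fun w j => X w j + W w 0%N j) (fun w i => W w i.+1)) => //.
by apply: measurable_maxr => //; apply: measurable_fexp.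
Qed.

Definition wdoob N m b w : R := 2 * amax N m b w * fexp c (pos N b w) - amax N m b w ^+ 2.

Lemma fexp_pos_le N b w : fexp c (pos N b w) <= 2 ^+ n * expR (c * (xn n b + tot n N w)).
Proof.
apply: (le_trans (fexp_le _ c0)); rewrite ler_wpM2l ?exprn_ge0 // ler_expR ler_wpM2l //.
exact: pos_xn.
Qed.

Lemma rintegrable_amax2 N m b : 0 <= m -> rintegrable (mN N) (fun w => amax N m b (wc w) ^+ 2).
Proof.
move=> m0; apply: (@rintegrable_expb _ _ _ h0 (2 * c) ((m + 2 ^+ n) ^+ 2 * expR (2 * c * xn n b))).
  apply: measurable_funX; apply: (@measurable_amax _ _ N (fun=> m) (fun=> b) (fun w => wc w)) => [|j|i j].
  - exact: measurable_cst.
  - exact: measurable_cst.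
  - exact: measurable_wc.
move=> w; rewrite ger0_norm ?sqr_ge0 // sqr_expb.
have h1 := amax_ge N m b (wc w).
rewrite lerXn2r ?nnegrE ?(le_trans m0) //; last exact: amax_bound.
by apply: le_trans (amax_bound _ _ _ m0).
Qed.

Lemma rintegrable_fexp2 N b : rintegrable (mN N) (fun w => fexp c (pos N b (wc w)) ^+ 2).
Proof.
apply: (@rintegrable_expb _ _ _ h0 (2 * c) ((2 ^+ n) ^+ 2 * expR (2 * c * xn n b))).
  apply: measurable_funX; apply: measurable_fexp => j.
  apply: (@measurable_pos _ _ N (fun=> b) (fun w => wc w)) => [k|i k]; [exact: measurable_cst|exact: measurable_wc].
move=> w; rewrite ger0_norm ?sqr_ge0 // sqr_expb.
by rewrite lerXn2r ?nnegrE ?fexp_ge0 //; last exact: fexp_pos_le.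
Qed.

Lemma wdoob_le N m b w : wdoob N m b w <= 2 * fexp c (pos N b w) ^+ 2 - 2^-1 * amax N m b w ^+ 2.
Proof.
rewrite /wdoob; move: (amax _ _ _ _) (fexp _ _) => u v.
rewrite -subr_ge0 (_ : _ - _ = 2^-1 * (u - 2 * v) ^+ 2); last by field.
by rewrite mulr_ge0 // sqr_ge0.
Qed.

Lemma rintegrable_wdoob N m b : 0 <= m -> rintegrable (mN N) (fun w => wdoob N m b (wc w)).
Proof.
move=> m0; have j1 := rintegrable_amax2 N b m0; have j2 := rintegrable_fexp2 N b.
apply: (rintegrable_le (mu := mN N) (W := fun w => 2 * amax N m b (wc w) ^+ 2 + fexp c (pos N b (wc w)) ^+ 2)).
- apply: measurable_funB; last by have := measurable_int _ j1; move/measurable_EFinP.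
  apply: measurable_funM; first apply: measurable_funM => //.
    apply: (@measurable_amax _ _ N (fun=> m) (fun=> b) (fun w => wc w)) => [|j|i j];
      [exact: measurable_cst|exact: measurable_cst|exact: measurable_wc].
  apply: measurable_fexp => j.
  apply: (@measurable_pos _ _ N (fun=> b) (fun w => wc w)) => [k|i k]; [exact: measurable_cst|exact: measurable_wc].
- move=> w; rewrite /wdoob; move: (amax _ _ _ _) (fexp _ _) => u v.
  have h1 := sqr_ge0 (u - v); have h2 := sqr_ge0 (u + v).
  by rewrite ler_norml; apply/andP; split; nra.
- by apply: rintegrableD => //; exact: rintegrableZ.
Qed.

(* Raising the maximum from [m] to [s] only increases [2 m s - m^2], and [fexp] is a submartingale along the walk. *)
Lemma wdoob_sub N m b : 0 <= m ->
  2 * m * fexp c b - m ^+ 2 <= Rintegral (mN N) setT (fun w => wdoob N m b (wc w)).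
Proof.
elim: N m b => [|N IH] m b m0; first by rewrite [leRHS]Rintegral_unit.
have jw := rintegrable_wdoob N.+1 b m0.
rewrite (Rintegral_mN_rec jw); have jr := rintegrable_mN_rec jw.
pose b' (xi : RTn) j := b j + coord xi j.
have pT : pwm (gaussm h) n setT = 1%E by apply: pwmT; exact: gaussmT.
have [j1 j2] := Rintegral_prob (- m ^+ 2) pT.
have jf : rintegrable (pwm (gaussm h) n) (fun xi : RTn => fexp c (b' xi)).
  apply: (@rintegrable_expb1 _ _ _ h0 c (2 ^+ n * expR (c * xn n b))).
    by apply: measurable_fexp => j; apply: measurable_funD => //; exact: measurable_coordR.
  move=> xi; rewrite ger0_norm ?fexp_ge0 //; apply: (le_trans (fexp_le _ c0)).
  rewrite -mulrA -expRD -mulrDr ler_wpM2l ?exprn_ge0 // ler_expR ler_wpM2l //; exact: xnD.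
have jg : rintegrable (pwm (gaussm h) n) (fun xi : RTn => 2 * m * fexp c (b' xi) + - m ^+ 2).
  by apply: rintegrableD => //; exact: rintegrableZ.
apply: (@le_trans _ _ (Rintegral (pwm (gaussm h) n) setT (fun xi : RTn => 2 * m * fexp c (b' xi) + - m ^+ 2))).
  rewrite RintegralD ?RintegralZl //; last exact: rintegrableZ.
  rewrite j2 lerD2r ler_wpM2l ?mulr_ge0 // Rintegral_fexp ler_peMl ?fexp_ge0 //; exact: KE_ge1.
apply: le_rint => // xi.
have m'0 : 0 <= Num.max m (fexp c (b' xi)) by rewrite le_max m0.
apply: le_trans (IH (Num.max m (fexp c (b' xi))) (b' xi) m'0).
case: (leP m (fexp c (b' xi))) => ms //; move: (fexp _ _) ms => v ms.
have := sqr_ge0 (v - m); nra.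
Qed.

(** For the initial maximum [m = f = fexp c b] the value [2 m f - m^2 = f^2] is nonnegative, so by
    [wdoob_sub] the mean of [wdoob] is too. Pathwise [wdoob] is at most twice the squared final
    value minus half the squared maximum; the constant is 2 divided by one half. *)
Lemma amax_doob N b : Rintegral (mN N) setT (fun w => amax N (fexp c b) b (wc w) ^+ 2) <=
  4 * Rintegral (mN N) setT (fun w => fexp c (pos N b (wc w)) ^+ 2).
Proof.
have f0 := fexp_ge0 c b.
have j1 := rintegrable_amax2 N b f0; have j2 := rintegrable_fexp2 N b.
have h1 := wdoob_sub N b f0.
have j3 : rintegrable (mN N) (fun w => 2 * fexp c (pos N b (wc w)) ^+ 2 + - 2^-1 * amax N (fexp c b) b (wc w) ^+ 2).
  by apply: rintegrableD; exact: rintegrableZ.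
have h2 : Rintegral (mN N) setT (fun w => wdoob N (fexp c b) b (wc w)) <=
    Rintegral (mN N) setT (fun w => 2 * fexp c (pos N b (wc w)) ^+ 2 + - 2^-1 * amax N (fexp c b) b (wc w) ^+ 2).
  apply: le_rint => // [|w]; first exact: rintegrable_wdoob.
  by apply: (le_trans (wdoob_le _ _ _ _)); rewrite mulNr.
have E3 : Rintegral (mN N) setT (fun w => 2 * fexp c (pos N b (wc w)) ^+ 2 + - 2^-1 * amax N (fexp c b) b (wc w) ^+ 2) =
    2 * Rintegral (mN N) setT (fun w => fexp c (pos N b (wc w)) ^+ 2) +
    - 2^-1 * Rintegral (mN N) setT (fun w => amax N (fexp c b) b (wc w) ^+ 2).
  by rewrite RintegralD ?RintegralZl //; exact: rintegrableZ.
rewrite E3 in h2.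
have h3 := sqr_ge0 (fexp c b); rewrite expr2 in h3; move: h1 h2; rewrite expr2.
move: (Rintegral _ _ _) (Rintegral _ _ _) (Rintegral _ _ _) => u v w; nra.
Qed.

End ExponentialMaximal.

Section ExponentialMoment.
Variable R : realType.
Variables (n : nat) (h c : R).
Hypotheses (h0 : 0 < h) (c0 : 0 <= c).
Local Notation RTn := (RT R n).
Local Notation mN N := (pwm (pwm (gaussm h) n) N).

Lemma rintegrable_fexp_pos N b : rintegrable (mN N) (fun w => fexp n c (pos N b (wc w))).
Proof.
apply: (@rintegrable_expb _ _ _ h0 c (2 ^+ n * expR (c * xn n b))).
  apply: measurable_fexp => j.
  apply: (@measurable_pos _ _ _ N (fun=> b) (fun w => wc w)) => [k|i k]; [exact: measurable_cst|exact: measurable_wc].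
move=> w; rewrite ger0_norm ?fexp_ge0 // -mulrA -expRD -mulrDr; exact: fexp_pos_le.
Qed.

Lemma Rintegral_fexp_pos N b : Rintegral (mN N) setT (fun w => fexp n c (pos N b (wc w))) =
  KE n h c ^+ N * fexp n c b.
Proof.
elim: N b => [|N IH] b; first by rewrite [LHS]Rintegral_unit expr0 mul1r.
rewrite (Rintegral_mN_rec (rintegrable_fexp_pos N.+1 b)).
pose b' (xi : RTn) j := b j + coord xi j.
transitivity (Rintegral (pwm (gaussm h) n) setT (fun xi : RTn => KE n h c ^+ N * fexp n c (b' xi))).
  by apply: eq_Rintegral => xi _; rewrite -IH.
rewrite RintegralZl //; first by rewrite Rintegral_fexp // mulrA exprSr.
apply: (@rintegrable_expb1 _ _ _ h0 c (2 ^+ n * expR (c * xn n b))).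
  by apply: measurable_fexp => j; apply: measurable_funD => //; exact: measurable_coordR.
move=> xi; rewrite ger0_norm ?fexp_ge0 //; apply: (le_trans (fexp_le _ _ c0)).
rewrite -mulrA -expRD -mulrDr ler_wpM2l ?exprn_ge0 // ler_expR ler_wpM2l //; exact: xnD.
Qed.

End ExponentialMoment.

(** The square of [fexp] is dominated by [fexp] at [2 c], whose mean along the walk is known
    exactly. The result depends on the number of steps only through the total time [N h]. *)
Lemma amax_moment (R : realType) n (h c : R) N b : 0 < h -> 0 <= c ->
  Rintegral (pwm (pwm (gaussm h) n) N) setT (fun w => amax n c N (fexp n c b) b (wc w) ^+ 2) <=
  4 * 2 ^+ n * (expR (2 * (N%:R * h) * c ^+ 2) ^+ n * fexp n (2 * c) b).
Proof.
move=> h0 c0; apply: (le_trans (amax_doob _ h0 c0 N b)); rewrite -(mulrA 4) ler_wpM2l //.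
have c20 : 0 <= 2 * c by exact: mulr_ge0.
have -> : expR (2 * (N%:R * h) * c ^+ 2) ^+ n = KE n h (2 * c) ^+ N.
  rewrite /KE -exprM mulnC exprM; congr (_ ^+ n); rewrite -expRM_natl; congr expR.
  by rewrite -mulr_natl; field.
rewrite -(Rintegral_fexp_pos n h0 c20 N b) -RintegralZl //; last exact: rintegrable_fexp_pos.
apply: le_rint => // [||w].
- exact: rintegrable_fexp2.
- by apply: rintegrableZ; exact: rintegrable_fexp_pos.
- exact: fexp_sqr.
Qed.

(** * Local times and pathwise comparison *)

Section LocalTime.
Variable R : realType.
Implicit Types (s t e : R) (y : R -> R).
Local Notation leb := (@lebesgue_measure R).

Lemma continuous_half_measurable y s t : 0 <= s -> {within `[0, +oo[%classic, continuous y} ->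
  measurable_fun `[s, t]%classic y.
Proof.
move=> s0 cy; apply: subspace_continuous_measurable_fun => //.
apply: (continuous_subspaceW _ cy) => r /=; rewrite !in_itv /= => /andP[h _].
by rewrite andbT (le_trans s0).
Qed.

Lemma measurable_occupation y t e : {within `[0, +oo[%classic, continuous y} ->
  measurable_fun `[0, t]%classic (fun s => \1_(`[0, e[%classic) (y s) : R).
Proof.
move=> cy; apply: (measurable_comp (F := setT)) => //; exact: continuous_half_measurable.
Qed.

Lemma integrable_occupation y t e : {within `[0, +oo[%classic, continuous y} ->
  leb.-integrable `[0, t]%classic (EFin \o (fun s => \1_(`[0, e[%classic) (y s) : R)).
Proof.
move=> cy; apply: (@le_integrable _ _ _ _ _ _ _ (EFin \o cst 1)) => //.
- by apply/measurable_EFinP; exact: measurable_occupation.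
- by move=> s _ /=; rewrite lee_fin normr1 ger0_norm ?indic_ge0 // indicE; case: (_ \in _).
- apply/integrableP; split; first by apply/measurable_EFinP; exact: measurable_cst.
  rewrite (eq_integral (cst 1%E)) ?integral_cst //=; last by move=> ? _; rewrite normr1.
  rewrite mul1e lebesgue_measure_itv /=; by case: ifP => _; rewrite ?ltry.
Qed.

Lemma occupation_split y s t e : 0 <= s <= t -> {within `[0, +oo[%classic, continuous y} ->
  Rintegral leb `[0, t]%classic (fun s => \1_(`[0, e[%classic) (y s)) =
  Rintegral leb `[0, s]%classic (fun s => \1_(`[0, e[%classic) (y s)) +
  Rintegral leb `]s, t]%classic (fun s => \1_(`[0, e[%classic) (y s)).
Proof.
move=> /andP[s0 st] cy.
have E : `[0, t]%classic = `[0, s]%classic `|` `]s, t]%classic.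
  by rewrite -itv_bndbnd_setU // bnd_simp.
rewrite E Rintegral_setU //; first by rewrite -E; exact: integrable_occupation.
by apply/disj_setPS => r [] /=; rewrite !in_itv /= => /andP[_ h1] /andP[h2 _]; move: (lt_le_trans h2 h1); rewrite ltxx.
Qed.

Lemma local_time0 y L : right_local_time_at0 y 0 L -> L = 0.
Proof.
move=> h; have : (0 : R) @[e --> (0:R)^'+] --> L.
  apply: cvg_trans h; apply: near_eq_cvg; near=> e.
  by rewrite set_itv1 Rintegral_set1 mulr0.
move=> h1; exact: (cvg_unique (@Rhausdorff R) h1 (cvg_cst _)).
Unshelve. all: by end_near.
Qed.

Lemma local_time_mono y s t L L' : 0 <= s <= t -> {within `[0, +oo[%classic, continuous y} ->
  right_local_time_at0 y s L -> right_local_time_at0 y t L' -> L <= L'.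
Proof.
move=> st cy h h'; apply: (ler_cvg_to h h'); near=> e.
rewrite ler_wpM2l //; first by rewrite invr_ge0; near: e; exact: nbhs_right_ge.
rewrite (occupation_split _ st cy) lerDl; apply: Rintegral_ge0 => // r _.
Unshelve. all: by end_near.
Qed.

(** While the path is at least [eps], the occupation time of [[0, e[] with [e <= eps] does not grow.
    With [local_time0] and [local_time_mono] this is all that the comparison uses about local
    times. *)
Lemma local_time_flat y s t eps L L' : 0 <= s <= t -> {within `[0, +oo[%classic, continuous y} ->
  0 < eps -> (forall r, s < r <= t -> eps <= y r) ->
  right_local_time_at0 y s L -> right_local_time_at0 y t L' -> L' = L.
Proof.
move=> st cy e0 far h h'; apply: (cvg_unique (@Rhausdorff R) h'); apply: cvg_trans h.
apply: near_eq_cvg; near=> e; congr (_ * _).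
rewrite (occupation_split _ st cy) [X in _ = _ + X](_ : _ = 0) ?addr0 //.
rewrite /Rintegral integral0_eq // => r; rewrite /= in_itv /= => rs; congr (_%:E).
rewrite indicE memNset // /= in_itv /= => /andP[_ /(le_lt_trans (far r rs))].
apply/negP; rewrite -leNgt; near: e; exact: nbhs_right_le.
Unshelve. all: by end_near.
Qed.

End LocalTime.

(** * Barrier and maximum principle *)

Section MaximumPrinciple.
Variable R : realType.
Variables (p q : R).
Hypotheses (p0 : 0 <= p) (q0 : 0 <= q) (pq1 : p + q = 1) (pq : p < q).

(* [bar k = (k+1)/(q-p)] solves [bar k = 1 + q bar (k-1) + p bar (k+1)] with [bar (-1) = 0] *)
Definition bar (k : nat) : R := k.+1%:R / (q - p).

Definition prevn (f : nat -> R) (k : nat) : R := if k is k'.+1 then f k' else 0.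

Lemma bar_ge0 k : 0 <= bar k.
Proof. by rewrite /bar divr_ge0 // subr_ge0 ltW. Qed.

Lemma bar_mono k l : (k <= l)%N -> bar k <= bar l.
Proof. by move=> kl; rewrite /bar ler_wpM2r ?invr_ge0 ?subr_ge0 ?(ltW pq) // ler_nat. Qed.

Lemma bar_ge1 k : 1 <= bar k.
Proof.
rewrite /bar ler_pdivlMr ?subr_gt0 // mul1r.
apply: (@le_trans _ _ 1); first by move: p0 pq1; lra.
by rewrite ler1n.
Qed.

Lemma bar_rec k : q * prevn bar k + p * bar k.+1 = bar k - 1.
Proof.
have qp : q - p != 0 by rewrite gt_eqF // subr_gt0.
have -> : prevn bar k = k%:R / (q - p) by case: k => [|k] /=; rewrite ?mul0r.
rewrite /bar (_ : k.+2%:R = k%:R + 2 :> R); last by rewrite -natrD addn2.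
rewrite -[k.+1%:R]natr1; apply: (@mulIf _ (q - p)) => //.
rewrite mulrBl mulrDl mul1r !mulrA !divfK //; move: (k%:R : R) => kk.
have -> : q = 1 - p by rewrite -pq1 addrC addKr. 
ring.
Qed.

Lemma prevn_le f g k : (forall i, f i <= g i) -> prevn f k <= prevn g k.
Proof. by case: k => [|k] h /=. Qed.

(** Suppose the maximal value [M] of [D / bar] is positive. At a maximizer the inequality and the
    recursion for [bar] give [M bar_k <= eps + M (bar_k - 1)], that is [M <= eps]. The time index
    may change freely, as the barrier does not depend on it. *)
Lemma max_principle n N (D : nat -> nat -> R) (eps : R) : 0 <= eps ->
  (forall k i, (n <= k.+1)%N -> D k i = 0) ->
  (forall k i, (k.+1 < n)%N -> (i <= N)%N -> exists i', (i' <= N)%N /\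
     D k i <= Num.max 0 (eps + q * prevn (D^~ i') k + p * D k.+1 i')) ->
  forall k i, (i <= N)%N -> D k i <= eps * bar k.
Proof.
move=> e0 Dn Dr k0 i0 i0N.
have [kn|kn] := ltnP k0.+1 n; last by rewrite Dn // mulr_ge0 // bar_ge0.
pose F (u : 'I_n * 'I_N.+1) := D u.1 u.2 / bar u.1.
have b0 k : 0 < bar k by apply: lt_le_trans (bar_ge1 k).
pose u0 : 'I_n * 'I_N.+1 := (Ordinal (ltnW kn), Ordinal (i0N : (i0 < N.+1)%N)).
case: (arg_maxP F (i0 := u0) (P := xpredT) isT) => -[k i] _ Fm.
set M := F (k, i).
have DM k' i' : (i' <= N)%N -> D k' i' <= Num.max 0 M * bar k'.
  move=> i'N; have [k'n|k'n] := ltnP k' n; last first.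
    rewrite Dn; last exact: leqW.
    by rewrite mulr_ge0 ?bar_ge0 // le_max lexx.
  have := Fm (Ordinal k'n, Ordinal (i'N : (i' < N.+1)%N)) isT.
  rewrite /F /= ler_pdivrMr // => h; apply: (le_trans h).
  by rewrite ler_wpM2r ?bar_ge0 // le_max lexx orbT.
suff Me : Num.max 0 M <= eps by apply: (le_trans (DM _ _ i0N)); rewrite ler_wpM2r ?bar_ge0.
rewrite ge_max e0 /=; have [M0|M0] := leP M 0; first exact: le_trans M0 e0.
have Mm : Num.max 0 M = M by apply/max_idPr; exact: ltW.
have kn' : (k.+1 < n)%N.
  rewrite ltnNge; apply: contraTN M0 => h; rewrite -leNgt /M /F /= Dn // mul0r //.
have [i' [i'N]] := Dr k i kn' (ltn_ord i).
have DE : D k i = M * bar k by rewrite /M /F /= divfK // gt_eqF.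
have Dpos : 0 < D k i by rewrite DE mulr_gt0.
rewrite le_max leNgt Dpos /= DE => h.
have h1 : prevn (D^~ i') k <= M * prevn bar k.
  case: (k : nat) => [|k'] /=; first by rewrite mulr0.
  by rewrite -Mm; exact: DM.
have h2 : D k.+1 i' <= M * bar k.+1 by rewrite -Mm; exact: DM.
have h3 : q * prevn (D^~ i') k + p * D k.+1 i' <= M * (bar k - 1).
  rewrite -bar_rec mulrDr; apply: lerD.
    by rewrite mulrCA ler_wpM2l.
  by rewrite mulrCA ler_wpM2l.
move: h h3; rewrite mulrBr mulr1; move: (_ * prevn (D^~ i') k) (p * _) (M * bar k) => u v w; lra.
Qed.

End MaximumPrinciple.

(** * The scheme and the reflected paths on one grid *)

Section PathComparison.
Variable R : realType.
Variables (n : nat) (p q : R).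
Hypotheses (p0 : 0 <= p) (q0 : 0 <= q) (pq1 : p + q = 1) (pq : p < q).
Variables (x : nat -> R) (B X L : nat -> R -> R) (tg : nat -> R).
Hypothesis xW : weyl_minus n x.
Hypotheses (tg0 : tg 0%N = 0) (tgS : forall i, tg i <= tg i.+1).
Hypothesis B0 : forall j, (j < n)%N -> B j 0 = 0.

Definition ell (k : nat) (s : R) : R := if (k.+1 < n)%N then L k s else 0.
Definition incr (i j : nat) : R := B j (tg i.+1) - B j (tg i).
Local Notation Y i := (chain n p q i x incr).
Local Notation lam k i := (lamk n (Y i) k).
Local Notation barq := (bar p q).

(* The discrete counterpart of the local time [L k] at time [tg i]. *)
Definition push (k i : nat) : R := \sum_(l < i) lam k l.

Lemma tg_mono i l : (i <= l)%N -> tg i <= tg l.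
Proof. exact: (homo_leq le_refl le_trans tgS). Qed.

Lemma tg_ge0 i : 0 <= tg i.
Proof. by rewrite -tg0; exact: tg_mono. Qed.

Lemma pushS k i : push k i.+1 = push k i + lam k i.
Proof. by rewrite /push big_ord_recr. Qed.

Lemma push_mono k i l : (i <= l)%N -> push k i <= push k l.
Proof.
apply: (homo_leq le_refl le_trans) => m; by rewrite pushS lerDl lamk_ge0.
Qed.

Lemma push_ge0 k i : 0 <= push k i.
Proof. by apply: sumr_ge0 => l _; exact: lamk_ge0. Qed.

Lemma push_out k i : (n <= k.+1)%N -> push k i = 0.
Proof. by move=> nk; apply: big1 => l _; rewrite /lamk ltnNge nk. Qed.

Lemma prevn_if (f : nat -> R) j : (j < n)%N ->
  (if j is j'.+1 then (if (j' < n)%N then f j' else 0) else 0) = prevn f j.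
Proof. by case: j => [|j] //= jn; rewrite (ltnW jn). Qed.

Lemma chain_push j i : (j < n)%N -> Y i j = x j + B j (tg i) + p * push j i - q * prevn (push^~ i) j.
Proof.
move=> jn; elim: i => [|i IH].
  rewrite /= tg0 B0 // /push big_ord0 mulr0 (_ : prevn _ j = 0) ?mulr0; first by ring.
  by case: (j) => //= j'; rewrite big_ord0.
rewrite chainSr /prho jn prevn_if // IH pushS (_ : prevn (push^~ i.+1) j = prevn (push^~ i) j + prevn (fun k => lam k i) j).
  rewrite /incr; ring.
by case: (j) => [|j'] /=; rewrite ?addr0 ?pushS.
Qed.

(** The difference of the equations for [k] and [k+1], solved for [push k] by [p + q = 1]. The
    neighbouring pushes appear with the weights [q] and [p], as in the recursion for the barrier. *)
Lemma gap_push k i : (k.+1 < n)%N ->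
  push k i = (Y i k - Y i k.+1) - (x k - x k.+1) - (B k (tg i) - B k.+1 (tg i)) +
    q * prevn (push^~ i) k + p * push k.+1 i.
Proof.
move=> kn; rewrite !chain_push // ?(ltnW kn) //= -[in LHS](mul1r (push k i)) -pq1; ring.
Qed.

Section Step.
Variables (N : nat) (eta : R).
Hypothesis eta0 : 0 < eta.
Hypothesis incr_eta : forall i j, (i < N)%N -> (j < n)%N -> `|incr i j| <= eta.

(** A push closes its own overlap; the neighbouring pushes reopen it by [q lam_(k-1) + p lam_(k+1)]
    and the increments by at most [2 eta]. The profile [2 eta bar] is stationary for this
    recursion. *)
Lemma lam_bound k i : (i <= N)%N -> lam k i <= 2 * eta * barq k.
Proof.
have e0 : 0 <= 2 * eta by rewrite mulr_ge0 // ltW.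
elim: i k => [|i IH] k iN; rewrite {1}/lamk; (case: ifP => kn; last exact: (mulr_ge0 e0 (bar_ge0 pq k)));
  rewrite ge_max (mulr_ge0 e0 (bar_ge0 pq k)) andTb.
  by rewrite /= (le_trans _ (mulr_ge0 e0 (bar_ge0 pq k))) // subr_le0 xW.
rewrite chainSr /prho kn (ltnW kn) (prevn_if (fun k => lam k i) (ltnW kn)) /=.
have h1 := incr_eta iN kn; have h2 := incr_eta iN (ltnW kn).
have h3 : Y i k.+1 - Y i k <= lam k i by rewrite /lamk kn le_max lexx orbT.
have h4 := IH k.+1 (ltnW iN).
have h5 : prevn (fun k => lam k i) k <= 2 * eta * prevn barq k.
  by case: (k) => [|k'] /=; rewrite ?mulr0 // IH // ltnW.
have h6 : q * prevn (fun k => lam k i) k + p * lam k.+1 i <= 2 * eta * (barq k - 1).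
  rewrite -(bar_rec pq1 pq) mulrDr; apply: lerD.
    by rewrite mulrCA ler_wpM2l.
  by rewrite mulrCA ler_wpM2l.
move: h1 h2 => /ler_normlP[a1 a2] /ler_normlP[b1 b2].
have h7 : (if (k < n)%N then lam k i else 0) = lam k i by rewrite (ltnW kn).
have h8 : lam k i = p * lam k i + q * lam k i by rewrite -mulrDl pq1 mul1r.
move: h3 h6 h8 a2 b1; rewrite mulrBr mulr1.
move: (lam k i) (lam k.+1 i) (prevn _ k) (2 * eta * barq k) (Y i k) (Y i k.+1) (incr i k) (incr i k.+1) => *; nra.
Qed.

(** At a genuine push the gap term of [gap_push] cancels, and the total push is expressed by the
    driving paths and the neighbouring pushes. The bound is the same for every grid. *)
Lemma push_bound_max (S : R) k i : 0 <= S -> (forall i j, (i <= N)%N -> (j < n)%N -> `|B j (tg i)| <= S) ->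
  (i <= N)%N -> push k i <= 2 * S * barq k.
Proof.
move=> S0 hS; elim: i k => [|i IH] k iN.
  by rewrite /push big_ord0 mulr_ge0 ?bar_ge0 // mulr_ge0.
have [kn|kn] := ltnP k.+1 n; last by rewrite push_out // mulr_ge0 ?bar_ge0 // mulr_ge0.
have iN' := ltnW iN.
rewrite pushS {1}/lamk kn; case: (leP 0 (Y i k.+1 - Y i k)) => _; last by rewrite addr0 IH.
rewrite [push k i](gap_push i kn).
have h1 : prevn (push^~ i) k <= 2 * S * prevn barq k.
  by case: (k) => [|k'] /=; rewrite ?mulr0 // IH.
have h2 : q * prevn (push^~ i) k + p * push k.+1 i <= 2 * S * (barq k - 1).
  rewrite -(bar_rec pq1 pq) mulrDr; apply: lerD.
    by rewrite mulrCA ler_wpM2l.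
  by rewrite mulrCA ler_wpM2l // IH.
have /ler_normlP[a1 a2] := hS i k iN' (ltnW kn); have /ler_normlP[b1 b2] := hS i k.+1 iN' kn.
have h3 := xW kn; move: h2; rewrite mulrBr mulr1; lra.
Qed.

Hypothesis Leq : forall j s, (j < n)%N -> 0 <= s -> X j s = x j + B j s + p * ell j s - q * prevn (ell^~ s) j.
Hypothesis XW : forall s, 0 <= s -> weyl_minus n (X^~ s).
Hypothesis L0 : forall k, (k.+1 < n)%N -> L k 0 = 0.
Hypothesis Lmono : forall k s s', (k.+1 < n)%N -> 0 <= s <= s' -> L k s <= L k s'.
Hypothesis Lflat : forall k s s' e, (k.+1 < n)%N -> 0 <= s <= s' -> 0 < e ->
  (forall r, s < r <= s' -> e <= X k r - X k.+1 r) -> L k s' = L k s.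

Lemma gap_ell k s : (k.+1 < n)%N -> 0 <= s ->
  ell k s = (X k s - X k.+1 s) - (x k - x k.+1) - (B k s - B k.+1 s) +
    q * prevn (ell^~ s) k + p * ell k.+1 s.
Proof.
move=> kn s0; rewrite !Leq // ?(ltnW kn) //= -[in LHS](mul1r (ell k s)) -pq1; ring.
Qed.

(** At a genuine push the gap of the scheme cancels from its equation, whereas the gap of [X] is
    nonnegative; so the inequality at [tg i] for the neighbours gives it for the new push, and
    monotonicity of [L] carries it to the next grid point. *)
Lemma push_le k i : push k i <= ell k (tg i).
Proof.
elim: i k => [|i IH] k.
  by rewrite /push big_ord0 /ell; case: ifP => kn //; rewrite tg0 L0.
have [kn|kn] := ltnP k.+1 n; last by rewrite push_out // /ell ltnNge kn.
have mn : ell k (tg i) <= ell k (tg i.+1) by rewrite /ell kn Lmono // tg_ge0 tgS.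
rewrite pushS {1}/lamk kn; case: (leP 0 (Y i k.+1 - Y i k)) => _; last by rewrite addr0 (le_trans (IH k)).
apply: le_trans mn; rewrite [push k i](gap_push i kn) [ell k _](gap_ell kn (tg_ge0 i)).
have h1 : prevn (push^~ i) k <= prevn (ell^~ (tg i)) k by exact: prevn_le.
have h2 := XW (tg_ge0 i) kn.
have h3 : q * prevn (push^~ i) k <= q * prevn (ell^~ (tg i)) k by rewrite ler_wpM2l.
have h4 : p * push k.+1 i <= p * ell k.+1 (tg i) by rewrite ler_wpM2l.
lra.
Qed.

Hypothesis X_eta : forall i j r, (i < N)%N -> (j < n)%N -> tg i <= r <= tg i.+1 -> `|X j r - X j (tg i.+1)| <= eta.

(* The last grid cell in which the gap [X k - X k.+1] comes below [eta]. *)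
Lemma last_contact k i : (k.+1 < n)%N -> (i <= N)%N -> ell k (tg i) = 0 \/
  exists l, [/\ (l < i)%N, X k (tg l.+1) - X k.+1 (tg l.+1) <= 3 * eta & ell k (tg i) = ell k (tg l.+1)].
Proof.
move=> kn; elim: i => [|i IH] iN; first by left; rewrite /ell kn tg0 L0.
(* At a contact the gap is at most [eta]; moving both paths to the right end of the cell adds at
   most [2 eta]. *)
have [[r [ri rk]]|far] := pselect (exists r, tg i <= r <= tg i.+1 /\ X k r - X k.+1 r <= eta).
  right; exists i; split => //.
  have /ler_normlP[a1 a2] := X_eta iN (ltnW kn) ri; have /ler_normlP[b1 b2] := X_eta iN kn ri; lra.
have E : ell k (tg i.+1) = ell k (tg i).
  rewrite /ell kn; apply: (Lflat (e := eta)) => //; first by rewrite tg_ge0 tgS.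
  move=> r /andP[r1 r2]; rewrite leNgt; apply/negP => /ltW h; apply: far.
  by exists r; rewrite (ltW r1) r2.
rewrite E; have [->|[l [li h1 h2]]] := IH (ltnW iN); first by left.
by right; exists l; split => //; exact: ltnW.
Qed.

(** Since the last contact [ell k] has not grown, so the difference may be estimated there: the gap
    of [X] is at most [3 eta] and that of the scheme at least [- 2 eta bar n]. This is the situation
    of [max_principle], with the contact as the new time index. *)
Lemma push_close k i : (i <= N)%N -> ell k (tg i) - push k i <= (3 * eta + 2 * eta * barq n) * barq k.
Proof.
pose D k i := ell k (tg i) - push k i.
have e0 := ltW eta0; have bn := bar_ge0 pq n.
apply: (@max_principle _ p q p0 q0 pq1 pq n N D).
- by rewrite addr_ge0 // ?(mulr_ge0 _ bn) ?mulr_ge0.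
- by move=> k' i' kn; rewrite /D push_out // /ell ltnNge kn subr0.
move=> {}k {}i kn iN; have [E|[l [li h1 h2]]] := last_contact kn iN.
  exists i; split => //; rewrite le_max /D E sub0r oppr_le0 push_ge0 //.
exists l.+1; split; first exact: leq_trans iN.
rewrite le_max; apply/orP; right; rewrite /D h2.
have h3 := push_mono k li; have l0 := tg_ge0 l.+1.
rewrite [ell k _](gap_ell kn l0).
have h4 := gap_push l.+1 kn.
have h5 : - (2 * eta * barq n) <= Y l.+1 k - Y l.+1 k.+1.
  have := lam_bound k (leq_trans li iN); rewrite {1}/lamk kn ge_max => /andP[_ h6].
  have : 2 * eta * barq k <= 2 * eta * barq n by rewrite ler_wpM2l ?mulr_ge0 ?(ltW eta0) // bar_mono // ltnW // ltnW.
  lra.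
have -> : prevn (fun k0 => ell k0 (tg l.+1) - push k0 l.+1) k = prevn (ell^~ (tg l.+1)) k - prevn (push^~ l.+1) k.
  by case: (k) => [|k'] /=; rewrite ?subr0.
rewrite !mulrBr; lra.
Qed.

Lemma path_close j : (j < n)%N -> `|X j (tg N) - Y N j| <= (3 * eta + 2 * eta * barq n) * barq n.
Proof.
move=> jn; rewrite chain_push // Leq ?tg_ge0 //.
have e0 : 0 <= 3 * eta + 2 * eta * barq n by rewrite addr_ge0 // ?(mulr_ge0 _ (bar_ge0 pq n)) ?mulr_ge0 // ltW.
pose D k := ell k (tg N) - push k N.
have D0 k : 0 <= D k by rewrite subr_ge0 push_le.
have D1 k : (k <= n)%N -> D k <= (3 * eta + 2 * eta * barq n) * barq n.
  by move=> kn; apply: (le_trans (push_close _ (leqnn N))); rewrite ler_wpM2l // bar_mono.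
have P0 : 0 <= prevn D j by case: (j) => /=.
have P1 : prevn D j <= (3 * eta + 2 * eta * barq n) * barq n.
  by case: (j) jn => [|k] kn /=; [rewrite mulr_ge0 ?bar_ge0|rewrite D1 // ltnW // ltnW].
have PE : prevn D j = prevn (ell^~ (tg N)) j - prevn (push^~ N) j.
  by case: (j) => [|k'] /=; rewrite ?subr0.
rewrite (_ : _ - _ = p * D j - q * prevn D j); last by rewrite PE /D; ring.
have b0 : 0 <= (3 * eta + 2 * eta * barq n) * barq n by rewrite mulr_ge0 ?bar_ge0.
have a1 := D0 j; have a2 := D1 j (ltnW jn).
move: P0 P1 a1 a2 b0; move: (prevn D j) (D j) ((_ + _) * _) => u v b *.
have c1 : 0 <= p * v by exact: mulr_ge0.
have c2 : 0 <= q * u by exact: mulr_ge0.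
have c3 : p * v <= p * b by rewrite ler_wpM2l.
have c4 : q * u <= q * b by rewrite ler_wpM2l.
have c5 : b = p * b + q * b by rewrite -mulrDl pq1 mul1r.
have c6 : 0 <= p * b by exact: mulr_ge0.
have c7 : 0 <= q * b by exact: mulr_ge0.
by rewrite ler_norml; apply/andP; split; lra.
Qed.

End Step.

Section Growth.
Variables (N : nat) (S : R).
Hypothesis S0 : 0 <= S.
Hypothesis hS : forall i j, (i <= N)%N -> (j < n)%N -> `|B j (tg i)| <= S.

Lemma chain_xn_bound i : (i <= N)%N -> xn n (Y i) <= xn n x + n%:R * (1 + 2 * barq n) * S.
Proof.
move=> iN; apply: (@le_trans _ _ (\sum_(j < n) (`|x j| + (1 + 2 * barq n) * S))); last first.
  by rewrite big_split /= sumr_const card_ord -[(1 + _) * S *+ n]mulr_natl mulrA.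
apply: ler_sum => j _; rewrite chain_push //.
have P (k : nat) : (k <= n)%N -> 0 <= push k i <= 2 * S * barq n.
  move=> kn; rewrite push_ge0 /=; apply: (le_trans (push_bound_max _ S0 hS iN)).
  by rewrite ler_wpM2l ?mulr_ge0 // bar_mono.
have /andP[a1 a2] := P j (ltnW (ltn_ord j)).
have /andP[b1 b2] : 0 <= prevn (push^~ i) j <= 2 * S * barq n.
  case: (j : nat) (ltn_ord j) => [|k] kn /=; first by rewrite lexx mulr_ge0 ?bar_ge0 // mulr_ge0.
  by apply: P; apply: ltnW; exact: ltnW.
have h := hS iN (ltn_ord j).
rewrite (_ : _ - _ = x j + (B j (tg i) + (p * push j i - q * prevn (push^~ i) j))); last by ring.
apply: (le_trans (ler_normD _ _)); rewrite lerD2l mulrDl mul1r.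
apply: (le_trans (ler_normD _ _)); apply: lerD => //.
move: a1 a2 b1 b2; rewrite (mulrAC 2); move: (prevn _ j) (push j i) (2 * barq n * S) => u v b *.
have c1 : 0 <= p * v by exact: mulr_ge0.
have c2 : 0 <= q * u by exact: mulr_ge0.
have c3 : p * v <= p * b by rewrite ler_wpM2l.
have c4 : q * u <= q * b by rewrite ler_wpM2l.
have c5 : b = p * b + q * b by rewrite -mulrDl pq1 mul1r.
by rewrite ler_norml; apply/andP; split; lra.
Qed.

Lemma sum_lamt : \sum_(i < N) lamt n (Y i) <= 2 * n%:R * barq n * S.
Proof.
rewrite /lamt exchange_big /=.
apply: (@le_trans _ _ (\sum_(k < n) 2 * S * barq n)); last first.
  by rewrite sumr_const card_ord -mulr_natl le_eqVlt; apply/orP; left; apply/eqP; ring.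
apply: ler_sum => k _; apply: (le_trans (push_bound_max _ S0 hS (leqnn N))).
by rewrite ler_wpM2l ?mulr_ge0 // bar_mono // ltnW.
Qed.

Lemma lamt_le_max i : (i < N)%N -> lamt n (Y i) <= 2 * n%:R * barq n * S.
Proof.
move=> iN; apply: le_trans sum_lamt; rewrite (bigD1 (Ordinal iN)) //= lerDl.
by apply: sumr_ge0 => l _; exact: lamt_ge0.
Qed.

(** A sum of squares is at most the maximum times the sum. By [sum_lamt] the sum is bounded on every
    grid, so smallness comes from the maximum [La]. *)
Lemma Serr_bound C La : 0 <= C -> 0 <= La -> (forall i, (i < N)%N -> lamt n (Y i) <= La) ->
  Serr n p q C N x incr <= C * expR (15 * (xn n x + n%:R * (1 + 2 * barq n) * S)) * (La * (2 * n%:R * barq n * S)).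
Proof.
move=> C0 La0 hLa; set E := expR _.
apply: (@le_trans _ _ (\sum_(i < N) C * E * (La * lamt n (Y i)))).
  apply: ler_sum => i _; rewrite /err -(mulrA C) ler_wpM2l // mulrC.
  apply: ler_pM; rewrite ?expR_ge0 ?sqr_ge0 //.
    by rewrite ler_expR ler_wpM2l // chain_xn_bound // ltnW.
  by rewrite expr2 ler_wpM2r ?lamt_ge0 // hLa.
rewrite -mulr_sumr ler_wpM2l ?mulr_ge0 ?expR_ge0 // -mulr_sumr ler_wpM2l //; exact: sum_lamt.
Qed.

End Growth.

End PathComparison.

Section UniformContinuity.
Variable R : realType.

Lemma heine_half (f : R -> R) (t eta : R) : {within `[0, +oo[%classic, continuous f} -> 0 < eta ->
  exists2 de : R, 0 < de & forall r r', 0 <= r <= t -> 0 <= r' <= t -> `|r - r'| <= de -> `|f r - f r'| <= eta.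
Proof.
move=> cf e0.
pose P (de r : R) := 0 <= r <= t -> forall r', 0 <= r' <= t -> `|r - r'| <= de -> `|f r - f r'| <= eta.
have /compact_near_coveringP cpt := @segment_compact R 0 t.
have H : \forall de \near (0:R)^'+, `[0, t]%classic `<=` P de.
  apply: (cpt R (0:R)^'+ P _) => x; rewrite /= in_itv /= => /andP[x0 xt].
  have /subspace_continuousP/(_ x) := cf; rewrite /= in_itv /= x0 => /(_ isT).
  move=> /cvgrPdist_le/(_ (eta / 2)); rewrite divr_gt0 // => /(_ isT).
  rewrite near_withinE => -[e /= eps0 he].
  have he' r : 0 <= r -> `|x - r| < e -> `|f x - f r| <= eta / 2.
    by move=> r0 xr; apply: he => //=; rewrite in_itv /= r0.
  exists ([set r | `|x - r| < e / 2], [set de | 0 < de < e / 2]).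
    split => /=; last first.
      near=> de; apply/andP; split; near: de; [exact: nbhs_right_gt|apply: nbhs_right_lt; exact: divr_gt0].
    by exists (e / 2); rewrite /= ?divr_gt0.
  move=> [r de] /= [xr /andP[d0 de2]] r0t r' r'0t rr'.
  have h1 : `|f x - f r| <= eta / 2 by apply: he'; [case/andP: r0t|apply: (lt_le_trans xr); lra].
  have h2 : `|f x - f r'| <= eta / 2.
    apply: he'; first by case/andP: r'0t.
    rewrite -(subrK r x) -addrA; apply: (le_lt_trans (ler_normD _ _)); lra.
  rewrite (_ : f r - f r' = (f x - f r') - (f x - f r)); last by ring.
  apply: (le_trans (ler_normB _ _)); lra.
have [de [d0 hd]] : exists de : R, 0 < de /\ `[0, t]%classic `<=` P de.
  have F : ProperFilter (0:R)^'+ by exact: at_right_proper_filter.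
  by apply: (@filter_ex _ (0:R)^'+); near=> de; split; near: de; [exact: nbhs_right_gt|exact: H].
exists de => // r r' r0t; exact: hd.
Unshelve. all: by end_near.
Qed.

Lemma bounded_half (f : R -> R) (t : R) : {within `[0, +oo[%classic, continuous f} -> 0 <= t ->
  exists2 S : R, 0 <= S & forall r, 0 <= r <= t -> `|f r| <= S.
Proof.
move=> cf t0.
have cf' : {within `[0, t], continuous f}.
  by apply: (continuous_subspaceW _ cf) => r /=; rewrite !in_itv /= => /andP[-> _].
have [c1 _ h1] := EVT_max t0 cf'; have [c2 _ h2] := EVT_min t0 cf'.
exists (`|f c1| + `|f c2|); first by rewrite addr_ge0.
move=> r rt; have a1 := h1 r rt; have a2 := h2 r rt.
have b1 := ler_norm (f c1); have b2 := ler_norm (- f c2); rewrite normrN in b2.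
have b3 := normr_ge0 (f c1); have b4 := normr_ge0 (f c2).
by rewrite ler_norml; apply/andP; split; lra.
Qed.

Lemma heine_halfs n (f : nat -> R -> R) (t eta : R) :
  (forall j, (j < n)%N -> {within `[0, +oo[%classic, continuous (f j)}) -> 0 < eta ->
  exists2 de : R, 0 < de & forall j, (j < n)%N ->
    forall r r', 0 <= r <= t -> 0 <= r' <= t -> `|r - r'| <= de -> `|f j r - f j r'| <= eta.
Proof.
elim: n => [|n IH] cf e0; first by exists 1.
have [d1 d10 h1] := IH (fun j jn => cf j (ltnW jn)) e0.
have [d2 d20 h2] := heine_half t (cf n (ltnSn n)) e0.
exists (Num.min d1 d2); first by rewrite lt_min d10.
move=> j; rewrite ltnS leq_eqVlt => /orP[/eqP ->|jn] r r' rt rt'; rewrite le_min => /andP[a b]; [exact: h2|exact: h1].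
Qed.

Lemma bounded_halfs n (f : nat -> R -> R) (t : R) :
  (forall j, (j < n)%N -> {within `[0, +oo[%classic, continuous (f j)}) -> 0 <= t ->
  exists2 S : R, 0 <= S & forall j, (j < n)%N -> forall r, 0 <= r <= t -> `|f j r| <= S.
Proof.
elim: n => [|n IH] cf t0; first by exists 0.
have [S1 S10 h1] := IH (fun j jn => cf j (ltnW jn)) t0.
have [S2 S20 h2] := bounded_half (cf n (ltnSn n)) t0.
exists (S1 + S2); first by rewrite addr_ge0.
move=> j; rewrite ltnS leq_eqVlt => /orP[/eqP ->|jn] r rt.
  by apply: (le_trans (h2 r rt)); rewrite lerDr.
by apply: (le_trans (h1 j jn r rt)); rewrite lerDl.
Qed.

End UniformContinuity.

(** * Refinement along dyadic grids *)

Section DyadicLimit.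
Variable R : realType.
Variables (n : nat) (p q : R).
Hypotheses (p0 : 0 <= p) (q0 : 0 <= q) (pq1 : p + q = 1) (pq : p < q).
Variables (x : nat -> R) (B X L : nat -> R -> R) (t : R).
Hypotheses (t0 : 0 < t) (xW : weyl_minus n x).
Hypothesis B0 : forall j, (j < n)%N -> B j 0 = 0.
Hypothesis cB : forall j, (j < n)%N -> {within `[0, +oo[%classic, continuous (B j)}.
Hypothesis cX : forall j, (j < n)%N -> {within `[0, +oo[%classic, continuous (X j)}.
Hypothesis XW : forall s, 0 <= s -> weyl_minus n (X^~ s).
Hypothesis lt : forall k s, (k.+1 < n)%N -> 0 <= s ->
  right_local_time_at0 (fun s => X k s - X k.+1 s) s (L k s).
Hypothesis Leq : forall j s, (j < n)%N -> 0 <= s -> X j s = x j + B j s + p * ell n L j s - q * prevn ((ell n L)^~ s) j.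

(** Dyadic grids are nested, which makes running maxima over them monotone in [k]. *)
Definition dyad (t : R) (k i : nat) : R := i%:R * (t / 2 ^+ k).

Lemma dyad0 s k : dyad s k 0 = 0. Proof. by rewrite /dyad mul0r. Qed.

Lemma dyad_top s k : dyad s k (2 ^ k) = s.
Proof. by rewrite /dyad natrX mulrCA divff ?mulr1 // expf_neq0. Qed.

Lemma dyad_dist s k i : dyad s k i.+1 - dyad s k i = s / 2 ^+ k.
Proof. by rewrite /dyad -mulrBl -natrB // subSnn mul1r. Qed.

Lemma dyadS k i : dyad t k i <= dyad t k i.+1.
Proof. by rewrite -subr_ge0 dyad_dist divr_ge0 ?exprn_ge0 // ltW. Qed.

Lemma dyad_le k i : (i <= 2 ^ k)%N -> 0 <= dyad t k i <= t.
Proof.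
move=> ik; have d0 : 0 <= t / 2 ^+ k by rewrite divr_ge0 ?exprn_ge0 // ltW.
rewrite /dyad mulr_ge0 //= -[leRHS](dyad_top t k) /dyad ler_wpM2r // ler_nat //.
Qed.

Lemma dyad_succ s k i : dyad s k.+1 i.*2 = dyad s k i.
Proof.
rewrite /dyad -muln2 natrM exprSr invfM; field.
by rewrite expf_neq0.
Qed.

Lemma dyad_mesh (de : R) : 0 < de -> exists k0, forall k, (k0 <= k)%N -> t / 2 ^+ k <= de.
Proof.
move=> d0; have := cvg_geometric t (z := 2^-1 : R); rewrite gtr0_norm // invf_lt1 // ltr1n => /(_ isT).
move=> /cvgrPdist_le/(_ de d0) [k0 _ h]; exists k0 => k kk0.
have := h k kk0; rewrite /= sub0r normrN ger0_norm; last by rewrite mulr_ge0 ?exprn_ge0 // ltW.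
by rewrite exprVn.
Qed.

Lemma gap_cont k : (k.+1 < n)%N -> {within `[0, +oo[%classic, continuous (fun s => X k s - X k.+1 s)}.
Proof.
move=> kn s; apply: cvgB; [exact: (cX (ltnW kn))|exact: (cX kn)].
Qed.

Lemma L_zero k : (k.+1 < n)%N -> L k 0 = 0.
Proof. by move=> kn; exact: (local_time0 (lt kn (lexx 0))). Qed.

Lemma L_mono k s s' : (k.+1 < n)%N -> 0 <= s <= s' -> L k s <= L k s'.
Proof.
move=> kn ss'; have /andP[s0 s1] := ss'.
exact: (local_time_mono ss' (gap_cont kn) (lt kn s0) (lt kn (le_trans s0 s1))).
Qed.

Lemma L_flat k s s' e : (k.+1 < n)%N -> 0 <= s <= s' -> 0 < e ->
  (forall r, s < r <= s' -> e <= X k r - X k.+1 r) -> L k s' = L k s.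
Proof.
move=> kn ss' e0 far; have /andP[s0 s1] := ss'.
exact: (local_time_flat ss' (gap_cont kn) e0 far (lt kn s0) (lt kn (le_trans s0 s1))).
Qed.

Local Notation w k := (incr B (dyad t k)).
Local Notation Y k i := (chain n p q i x (w k)).

Lemma dyad_fine (eta : R) : 0 < eta -> exists k0, forall k, (k0 <= k)%N ->
  (forall i j, (i < 2 ^ k)%N -> (j < n)%N -> `|w k i j| <= eta) /\
  (forall i j r, (i < 2 ^ k)%N -> (j < n)%N -> dyad t k i <= r <= dyad t k i.+1 ->
     `|X j r - X j (dyad t k i.+1)| <= eta).
Proof.
move=> e0; have [d1 d10 h1] := heine_halfs t cB e0; have [d2 d20 h2] := heine_halfs t cX e0.
have d0 : 0 < Num.min d1 d2 by rewrite lt_min d10.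
have [k0 hk] := dyad_mesh d0; exists k0 => k /hk; rewrite le_min => /andP[a1 a2]; split.
  move=> i j ik jn; apply: h1 => //; try exact: dyad_le; try exact: dyad_le (ltnW ik).
  by rewrite dyad_dist ger0_norm // divr_ge0 ?exprn_ge0 // ltW.
move=> i j r ik jn ri; have /andP[b1 b2] := dyad_le (ltnW ik); have /andP[b3 b4] := dyad_le ik.
case/andP: (ri) => r1 r2; apply: h2 => //; first by rewrite (le_trans b1) //= (le_trans r2).
  by rewrite b3.
apply: le_trans a2; rewrite -(dyad_dist t k i) distrC ger0_norm ?subr_ge0 //; lra.
Qed.

Lemma dyad_bounded : exists2 S : R, 0 <= S &
  forall k i j, (i <= 2 ^ k)%N -> (j < n)%N -> `|B j (dyad t k i)| <= S.
Proof.
have [S S0 h] := bounded_halfs cB (ltW t0); exists S => // k i j ik jn.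
by apply: h => //; exact: dyad_le.
Qed.

Lemma dyad_cvg_X j : (j < n)%N -> (fun k => Y k (2 ^ k)%N j) @ \oo --> X j t.
Proof.
move=> jn; apply/cvgrPdist_le => e e0.
(* The constant of [path_close]: the distance is at most [c eta]. *)
pose c := (3 + 2 * bar p q n) * bar p q n.
have b1 := bar_ge1 p0 pq1 pq n.
have c0 : 0 < c by rewrite /c; move: b1; move: (bar p q n) => b b1; nra.
have eta0 : 0 < e / c by rewrite divr_gt0.
have [k0 hk] := dyad_fine eta0; exists k0 => // k /hk [h1 h2] /=.
have := path_close p0 q0 pq1 pq xW (dyad0 t k) (dyadS k) B0 eta0 h1 Leq XW L_zero L_mono L_flat h2 jn.
rewrite dyad_top => /le_trans; apply.
rewrite (_ : (3 * (e / c) + 2 * (e / c) * bar p q n) * bar p q n = (e / c) * c); last by rewrite /c; ring.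
by rewrite divfK // gt_eqF.
Qed.

Lemma dyad_cvg_Serr C : 0 <= C -> (fun k => Serr n p q C (2 ^ k) x (w k)) @ \oo --> (0 : R).
Proof.
move=> C0; have [S S0 hS] := dyad_bounded; apply/cvgrPdist_le => e e0.
have bn := bar_ge0 pq n.
pose E := C * expR (15 * (xn n x + n%:R * (1 + 2 * bar p q n) * S)) * ((n%:R * (2 * bar p q n)) * (2 * n%:R * bar p q n * S)) + 1.
have E0 : 0 < E.
  rewrite /E; move: bn; move: (bar p q n) => b b0; apply: ltr_wpDl => //.
  by rewrite !mulr_ge0 ?expR_ge0.
have eta0 : 0 < e / E by rewrite divr_gt0.
have [k0 hk] := dyad_fine eta0; exists k0 => // k /hk [h1 h2] /=.
rewrite sub0r normrN ger0_norm; last exact: Serr_ge0.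
pose La := n%:R * (2 * (e / E) * bar p q n).
have La0 : 0 <= La by apply: mulr_ge0 => //; apply: mulr_ge0 => //; apply: mulr_ge0 => //; exact: ltW.
have hLa i : (i < 2 ^ k)%N -> lamt n (Y k i) <= La.
  move=> ik; rewrite /La mulr_natl -[X in _ *+ X]card_ord -sumr_const; apply: ler_sum => l _.
  apply: (le_trans (lam_bound p0 q0 pq1 pq xW eta0 h1 l (ltnW ik))).
  by apply: ler_wpM2l; [apply: mulr_ge0 => //; exact: ltW|exact: bar_mono (ltnW (ltn_ord l))].
have := Serr_bound p0 q0 pq1 pq xW (dyad0 t k) B0 S0 (hS k) C0 La0 hLa.
move=> /le_trans; apply; rewrite /La.
apply: (@le_trans _ _ ((e / E) * E)); last by rewrite divfK // gt_eqF.
move: eta0; move: (e / E) => h h0.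
rewrite /E (mulrDr h) (mulr1 h); apply: ler_wpDr; first exact: ltW.
by rewrite le_eqVlt; apply/orP; left; apply/eqP; ring.
Qed.

End DyadicLimit.

(** * Passage to the limit *)

Section AlmostEverywhereDominated.
Context {d} {T : measurableType d} {R : realType} (mu : {measure set T -> \bar R}).

Lemma rint_dominated_ae_full (f : nat -> T -> R) (f0 : T -> R) (g : T -> \bar R) :
  (forall k, measurable_fun setT (f k)) -> measurable_fun setT f0 ->
  {ae mu, forall w, f ^~ w @ \oo --> f0 w} -> mu.-integrable setT g ->
  {ae mu, forall w k, (`|f k w|%:E <= g w)%E} ->
  mu.-integrable setT (EFin \o f0) /\
  (fun k => Rintegral mu setT (f k)) @ \oo --> Rintegral mu setT f0.
Proof.
move=> mf mf0 fc jg fg.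
have H1 k : measurable_fun setT (EFin \o f k) by exact/measurable_EFinP.
have H2 : measurable_fun setT (EFin \o f0) by exact/measurable_EFinP.
have H3 : {ae mu, forall w, setT w -> (EFin \o f k) w @[k --> \oo] --> (EFin \o f0) w}.
  by apply: filterS fc => w h _; apply: cvg_EFin; [exact: nearW|exact: h].
have H4 : {ae mu, forall w k, setT w -> (`|(EFin \o f k) w| <= g w)%E}.
  by apply: filterS fg => w h k _; exact: h.
have [i0 _ H] := dominated_convergence measurableT H1 H2 H3 jg H4.
split => //; apply: fine_cvg; rewrite fineK //; exact: integrable_fin_num.
Qed.

Lemma rint_dominated_ae (f : nat -> T -> R) (f0 : T -> R) (g : T -> \bar R) :
  (forall k, measurable_fun setT (f k)) -> measurable_fun setT f0 ->
  {ae mu, forall w, f ^~ w @ \oo --> f0 w} -> mu.-integrable setT g ->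
  {ae mu, forall w k, (`|f k w|%:E <= g w)%E} ->
  (fun k => Rintegral mu setT (f k)) @ \oo --> Rintegral mu setT f0.
Proof. by move=> mf mf0 fc jg fg; case: (rint_dominated_ae_full mf mf0 fc jg fg). Qed.

(** Monotone convergence. The supremum is kept extended-valued, since finiteness is obtained only
    almost everywhere. *)
Lemma monotone_sup_integrable (g : nat -> T -> R) (K : R) :
  (forall k, measurable_fun setT (g k)) -> (forall k w, 0 <= g k w) ->
  (forall w, nondecreasing_seq (g ^~ w)) ->
  (forall k, (\int[mu]_w (g k w)%:E <= K%:E)%E) ->
  mu.-integrable setT (fun w => ereal_sup (range (fun k => (g k w)%:E))).
Proof.
move=> mg g0 gm gK.
have gm' w : nondecreasing_seq (fun k => (g k w)%:E) by move=> k l kl; rewrite lee_fin gm.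
have gc w : (fun k => (g k w)%:E) @ \oo --> ereal_sup (range (fun k => (g k w)%:E)).
  exact: ereal_nondecreasing_cvgn.
have mG k : measurable_fun setT (fun w => (g k w)%:E) by exact/measurable_EFinP.
apply/integrableP; split; first by apply: (emeasurable_fun_cvg (fun k w => (g k w)%:E)).
rewrite (_ : (fun w => _) = (fun w => limn (fun k => (g k w)%:E))); last first.
  apply/funext => w; rewrite (cvg_lim _ (gc w)) // gee0_abs //.
  by apply: (@le_trans _ _ (g 0%N w)%:E); [rewrite lee_fin|apply: ereal_sup_ubound; exists 0%N].
rewrite monotone_convergence //; last by move=> k w _; rewrite lee_fin.
apply: (@le_lt_trans _ _ K%:E); last exact: ltry.
apply: lime_le; last by apply: nearW => k; exact: gK.
apply: ereal_nondecreasing_is_cvgn => k l kl; apply: ge0_le_integral => //.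
- by move=> w _; rewrite lee_fin.
- by move=> w _; rewrite lee_fin gm.
Qed.

End AlmostEverywhereDominated.

Lemma gaussmE (R : realType) (h : R) A : gaussm h A = normal_prob 0 (Num.sqrt h) A.
Proof. by []. Qed.

Section Extensionality.
Variable R : realType.

Lemma coord_mkpw_out n (f : nat -> measurableTypeR R) j : (n <= j)%N -> coord (mkpw n f) j = 0 :> R.
Proof. by elim: n f j => [|n IH] f [|j] //= nj; rewrite IH. Qed.

Lemma wc_mkpw n N (f : nat -> nat -> R) i : (i < N)%N ->
  wc (mkpw N (fun i => mkpw n (f i : nat -> measurableTypeR R)) : pw (RT R n) N) i = fun j => if (j < n)%N then f i j else 0.
Proof.
move=> iN; apply/funext => j; rewrite /wc coord_mkpw //; case: ltnP => jn; first by rewrite coord_mkpw.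
exact: coord_mkpw_out.
Qed.

Lemma chain_ext n (p q : R) N x w w' : (forall i, (i < N)%N -> w i = w' i) ->
  chain n p q N x w = chain n p q N x w'.
Proof.
elim: N x w w' => [|N IH] x w w' h //=; rewrite (h 0%N) //.
by apply: IH => i iN; exact: h.
Qed.

Lemma Serr_ext n (p q C : R) N x w w' : (forall i, (i < N)%N -> w i = w' i) ->
  Serr n p q C N x w = Serr n p q C N x w'.
Proof.
move=> h; apply: eq_bigr => i _; congr (err _ _ _); apply: chain_ext => l li.
by apply: h; exact: ltn_trans (ltn_ord i).
Qed.

Lemma amax_ext n (c : R) N m b w w' : (forall i, (i < N)%N -> w i = w' i) ->
  amax n c N m b w = amax n c N m b w'.
Proof.
elim: N m b w w' => [|N IH] m b w w' h //=; rewrite (h 0%N) //.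
by apply: IH => i iN; exact: h.
Qed.

Lemma pos_incr (B : nat -> R -> R) tg N j : pos N (fun=> 0) (incr B tg) j = B j (tg N) - B j (tg 0%N).
Proof.
rewrite posE add0r; elim: N => [|N IH]; first by rewrite big_ord0 subrr.
by rewrite big_ord_recr /= IH /incr; ring.
Qed.

End Extensionality.

(** * Brownian increments on the dyadic grids: law and maximal function *)

Section Increments.
Context {d} {Omega : measurableType d} {R : realType} (P : probability Omega R).
Variables (n : nat) (B : nat -> R -> Omega -> R) (t : R).
Hypotheses (t0 : 0 < t) (BM : indep_std_BMs P n B).

(** Set to 0 beyond [n] to agree with the default coordinates of the product space, so that
    [wc_bvec] is an equality of functions. *)
Definition bpath (w : Omega) (j : nat) (s : R) : R := if (j < n)%N then B j s w else 0.
Definition binc (k : nat) (w : Omega) : nat -> nat -> R := incr (bpath w) (dyad t k).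
Local Notation h k := (t / 2 ^+ k).
Local Notation law k := (pwm (pwm (gaussm (h k)) n) (2 ^ k)).

Definition bvec k (w : Omega) : pw (RT R n) (2 ^ k) :=
  mkpw (2 ^ k) (fun i => mkpw n (fun j => B j (dyad t k i.+1) w - B j (dyad t k i) w : measurableTypeR R)).

Lemma mesh_gt0 k : 0 < h k. Proof. by rewrite divr_gt0 ?exprn_gt0. Qed.

Lemma dyad_ge0 k i : 0 <= dyad t k i.
Proof. by rewrite /dyad mulr_ge0 // ltW // mesh_gt0. Qed.

Lemma measurable_B j s : (j < n)%N -> 0 <= s -> measurable_fun setT (B j s).
Proof. by case: BM => mB _ _; exact: mB. Qed.

Lemma wc_bvec k w i : (i < 2 ^ k)%N -> wc (bvec k w) i = binc k w i.
Proof.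
move=> ik; rewrite /bvec wc_mkpw //; apply/funext => j.
by rewrite /binc /incr /bpath; case: ifP => _; rewrite ?subrr.
Qed.

Lemma measurable_binc k i j : measurable_fun setT (fun w => binc k w i j).
Proof.
rewrite /binc /incr /bpath; case: (ltnP j n) => jn; last exact: measurable_cst.
by apply: measurable_funB; apply: measurable_B => //; exact: dyad_ge0.
Qed.

Lemma bvec_law k : measurable_fun setT (bvec k) /\
  forall S, measurable S -> P (bvec k @^-1` S) = law k S.
Proof.
have mD i j : (j < n)%N -> measurable_fun setT (fun w => B j (dyad t k i.+1) w - B j (dyad t k i) w).
  by move=> jn; apply: measurable_funB; apply: measurable_B => //; exact: dyad_ge0.
split.
  apply: (measurable_mkpw (T := RT R n) (n := 2 ^ k) (Y := fun i w => mkpw n (fun j => B j (dyad t k i.+1) w - B j (dyad t k i) w : measurableTypeR R))) => i ik.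
  apply: (measurable_mkpw (T := measurableTypeR R) (n := n) (Y := fun j w => B j (dyad t k i.+1) w - B j (dyad t k i) w)) => j jn.
  exact: mD.
move=> S mS; case: BM => _ _ indep.
have := @law_pw2 _ _ _ P _ (measurableTypeR R) (gaussm (h k)) n (2 ^ k) setT 1
  (fun i j w => B j (dyad t k i.+1) w - B j (dyad t k i) w) (gaussmT _) measurableT ler01.
move=> H; have {H} := H (fun i j _ jn => mD i j jn).
move=> H; rewrite -[LHS](congr1 P (setTI _)) -[RHS]mul1e; apply: H => // A mA; rewrite setTI mul1r.
have tS i : (i < 2 ^ k)%N -> dyad t k i < dyad t k i.+1.
  by move=> _; rewrite -subr_gt0 dyad_dist mesh_gt0.
apply: (etrans (indep (2 ^ k)%N (dyad t k) A (dyad0 t k) tS mA)).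
apply: (congr1 EFin); apply: eq_bigr => i _; apply: eq_bigr => j _.
by rewrite gaussmE dyad_dist.
Qed.

Lemma expect_law k (f : pw (RT R n) (2 ^ k) -> R) (g : Omega -> R) : rintegrable (law k) f ->
  (forall w, g w = f (bvec k w)) ->
  P.-integrable setT (EFin \o g) /\ Rintegral P setT g = Rintegral (law k) setT f.
Proof.
move=> jf gE; have [mv lv] := bvec_law k; have := Rintegral_law mv lv jf.
by rewrite (_ : f \o bvec k = g) //; apply/funext => w; rewrite gE.
Qed.

Section Maximal.
Variable c : R.
Hypothesis c0 : 0 < c.

Definition bmax k w : R := amax n c (2 ^ k) (fexp n c (fun=> 0)) (fun=> 0) (binc k w).

Lemma bmax_ge1 k w : 1 <= bmax k w.
Proof.
apply: le_trans (amax_ge _ _ _ _ _ _); apply: le_trans (expR_xn_fexp _ _ (ltW c0)).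
by rewrite -expR0 ler_expR mulr_ge0 ?(ltW c0) // xn_ge0.
Qed.

Lemma bmax_mono w : nondecreasing_seq (bmax ^~ w).
Proof.
apply/nondecreasing_seqP => k; apply: amax_lub; first exact: amax_ge.
move=> i ik.
(* Point [i+1] of grid [k] is point [2 (i+1)] of grid [k+1]. *)
have -> : pos i.+1 (fun=> 0) (binc k w) = pos (i.+1).*2 (fun=> 0) (binc k.+1 w).
  by apply/funext => j; rewrite !pos_incr dyad_succ !dyad0.
rewrite doubleS; apply: amax_ub; rewrite expnS mul2n -doubleS.
by rewrite leq_double.
Qed.

Lemma measurable_bmax k : measurable_fun setT (bmax k).
Proof.
apply: (@measurable_amax _ _ _ _ _ _ (fun=> fexp n c (fun=> 0)) (fun=> fun=> 0) (binc k)) => [|j|i j].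
- exact: measurable_cst.
- exact: measurable_cst.
- exact: measurable_binc.
Qed.

Lemma bmax_bound k w i j : (forall j, (j < n)%N -> B j 0 w = 0) -> (i <= 2 ^ k)%N -> (j < n)%N ->
  `|bpath w j (dyad t k i)| <= ln (bmax k w) / c.
Proof.
move=> B0 ik jn; have A1 := bmax_ge1 k w; have A0 : 0 < bmax k w by exact: lt_le_trans A1.
case: i ik => [|i] ik.
  rewrite dyad0 /bpath jn B0 // normr0 divr_ge0 ?(ltW c0) // ln_ge0 //.
rewrite ler_pdivlMr // mulrC -ler_expR lnK ?posrE //.
have := @amax_ub R n c (2 ^ k) (fexp n c (fun=> 0)) (fun=> 0) (binc k w) i ik.
apply: le_trans; apply: le_trans (expR_xn_fexp _ _ (ltW c0)).
rewrite ler_expR ler_wpM2l ?(ltW c0) // /xn (bigD1 (Ordinal jn)) // (pos_incr (bpath w) (dyad t k) i.+1 j) dyad0.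
rewrite [X in _ - X](_ : _ = 0) ?subr0; last by rewrite /bpath jn B0.
by rewrite lerDl; apply: sumr_ge0.
Qed.

(** The moment bound depends on the grid only through [2^k (t / 2^k) = t], so the supremum over all
    grids is integrable. It is the majorant for both limits in [heat_expect]. *)
Lemma bmax_integrable : P.-integrable setT (fun w => ereal_sup (range (fun k => (bmax k w ^+ 2)%:E))).
Proof.
apply: (@monotone_sup_integrable _ _ _ _ _ (4 * 2 ^+ n * (expR (2 * t * (c ^+ 2)) ^+ n * fexp n (2 * c) (fun=> 0)))).
- by move=> k; apply: measurable_funX; exact: measurable_bmax.
- by move=> k w; exact: sqr_ge0.
- move=> w k l kl; have h1 := bmax_mono w kl; have h2 := bmax_ge1 k w; have h3 := bmax_ge1 l w.
  by rewrite lerXn2r // nnegrE (le_trans ler01).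
move=> k; have jf := rintegrable_amax2 n (mesh_gt0 k) (ltW c0) (2 ^ k) (fun=> 0) (fexp_ge0 n c (fun=> 0)).
have [jg E] := expect_law (g := fun w => bmax k w ^+ 2) jf (fun w => congr1 (fun z => z ^+ 2)
  (amax_ext n c (fexp n c (fun=> 0)) (fun=> 0) (fun i ik => esym (wc_bvec w ik)))).
rewrite -(@fineK _ (integral _ _ _)); last exact: integrable_fin_num.
rewrite lee_fin [leLHS]E.
have := amax_moment n (2 ^ k) (fun=> 0) (mesh_gt0 k) (ltW c0).
by rewrite (_ : (2 ^ k)%:R * h k = t) // -[RHS](dyad_top t k).
Qed.

End Maximal.

End Increments.

(* Positivity arguments need real integrands, so the evolution is run separately for both parts of [U]. *)
Definition prt (R : realType) (b : bool) (z : R[i]) : R := if b then Rez z else Imz z.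

Section RealParts.
Variable R : realType.
Implicit Types (z : R[i]).

Lemma prtB b z z' : prt b (z - z') = prt b z - prt b z'.
Proof. by case: b; rewrite /prt ?RezB ?ImzB. Qed.

Lemma prtM b (k : R) z : prt b (k%:C * z) = k * prt b z.
Proof. by case: b; rewrite /prt ?RezCM ?ImzCM. Qed.

Lemma prt_le b z : `|prt b z| <= cn z.
Proof. by case: b; [exact: Rez_le_cn|exact: Imz_le_cn]. Qed.

Lemma prt_cmeas b d (T : measurableType d) (f : T -> R[i]) : cmeas f -> measurable_fun setT (fun w => prt b (f w)).
Proof. by case=> h1 h2; case: b. Qed.

Lemma prt_cintg b d (T : measurableType d) (mu : {measure set T -> \bar R}) (f : T -> R[i]) :
  prt b (cintg mu f) = Rintegral mu setT (fun x => prt b (f x)).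
Proof. by case: b; rewrite /prt ?Rez_cintg ?Imz_cintg. Qed.

End RealParts.

Definition Uscale (R : realType) (tau : R) n : R := tau ^+ (n * n.-1)./2 * (2 * pi)^-1 ^+ n.

(** Chosen so that [Serr] is dominated by a multiple of [bmax^2]: [Serr_bound] has the exponent
    [15 n (1 + 2 bar n) S], and the additional 2 absorbs the factor [S^2]. *)
Definition Arate (R : realType) (p q : R) n : R := 15 * (n%:R * (1 + 2 * bar p q n)) + 2.

(** * Expectation of the right-hand side at a positive time along the process *)

Section HeatExpectation.
Context {d} {Omega : measurableType d} {R : realType} (P : probability Omega R).
Variables (p q tau : R) (n : nat) (a x : nat -> R) (t : R) (B X L : nat -> R -> Omega -> R).
Hypotheses (tau0 : 0 < tau) (tau1 : tau < 1) (n1 : (1 <= n)%N).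
Hypotheses (a0 : - (1 - tau) < a 0%N) (aS : forall j, (j.+1 < n)%N -> a j < a j.+1)
  (an : a n.-1 < 0) (tS : forall j, (j.+1 < n)%N -> tau * a j < a j.+1).
Hypotheses (pq1 : p + q = 1) (pE : p = tau * q).
Hypotheses (xW : weyl_minus n x) (t0 : 0 < t).
Hypotheses (BM : indep_std_BMs P n B) (sol : solves_system P n p q x B X L).

Let p0 : 0 <= p := p_ge0 tau0 pq1 pE.
Let q0 : 0 <= q := ltW (q_gt0 tau0 pq1 pE).

Lemma p_lt_q : p < q.
Proof. by rewrite pE gtr_pMl // (q_gt0 tau0 pq1 pE). Qed.

Let Hm := hg tau (Gmain tau) (1 - tau) n.
Local Notation K := (Uscale tau n).
Let pH : pbd n a Hm := pbdH0 tau0 n1 a0 aS an tS.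
Let a1 j (jn : (j < n)%N) : `|a j| <= 1 := a_le1 tau0 n1 a0 aS an jn.

Definition ureal (b : bool) (s : R) (y : nat -> R) : R := K * prt b (gint n s y a Hm).

Lemma ureal_Uf b s y : 0 < s -> ureal b s y = prt b (Uf tau n a s y).
Proof. by move=> s0; rewrite (U_gint tau0 n1 a0 aS an tS) // prtM. Qed.

Lemma K_ge0 : 0 <= K.
Proof. by rewrite /Uscale mulr_ge0 ?exprn_ge0 ?invr_ge0 ?mulr_ge0 ?pi_ge0 // ltW. Qed.

Lemma ureal_growth b de T : 0 < de -> exists2 C, 0 <= C &
  forall s y, de <= s <= T -> `|ureal b s y| <= C * expR (xn n y).
Proof.
move=> d0; have [C [C0 h]] := gint_growth a1 T pH d0; exists (K * C); first by rewrite mulr_ge0 // K_ge0.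
move=> s y sT; rewrite /ureal normrM (ger0_norm K_ge0) -(mulrA K) ler_wpM2l ?K_ge0 //.
exact: le_trans (prt_le _ _) (h s y sT).
Qed.

Lemma measurable_ureal b s d' (O : measurableType d') (Z : O -> nat -> R) :
  (forall j, (j < n)%N -> measurable_fun setT (fun w => Z w j)) -> measurable_fun setT (fun w => ureal b s (Z w)).
Proof. by move=> mZ; apply: measurable_funM => //; apply: prt_cmeas; exact: cmeas_gint_param. Qed.

Lemma ureal_heat b h s y : 0 < h -> 0 < s ->
  Rintegral (pwm (gaussm h) n) setT (fun xi : RT R n => ureal b s (fun j => y j + coord xi j)) = ureal b (s + h) y.
Proof.
move=> h0 s0; rewrite /ureal -(gint_heat y pH s0 h0) prt_cintg RintegralZl //.
have [C [C0 hC]] := gint_growth a1 s pH s0.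
apply: (@rintegrable_expb1 _ _ _ h0 1 (C * expR (xn n y))).
  by apply: prt_cmeas; apply: (@cmeas_gint_param _ _ _ _ _ _ _ (fun (xi : RT R n) j => y j + coord xi j)) => // j _;
    apply: measurable_funD => //; exact: measurable_coordR.
move=> xi; apply: (le_trans (prt_le _ _)); apply: (le_trans (hC s _ _)); first by rewrite lexx.
by rewrite -mulrA -expRD mul1r ler_wpM2l // ler_expR; exact: xnD.
Qed.

Lemma ureal_cvg b s (y : nat -> nat -> R) (z : nat -> R) : 0 < s ->
  (forall j, (j < n)%N -> (fun k => y k j) @ \oo --> z j) ->
  (fun k => ureal b s (y k)) @ \oo --> ureal b s z.
Proof.
move=> s0 yz; have [C [C0 hC]] := gint_lip a1 s pH s0.
have dz : (fun k => xn n (fun j => y k j - z j)) @ \oo --> (0 : R).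
  rewrite (_ : 0 = \sum_(j < n) (0 : R)); last by rewrite big1.
  apply: cvg_big => [|j _]; first exact: add_continuous.
  rewrite -(normr0 R) -(subrr (z j)); apply: cvg_norm; apply: cvgB; [exact: yz|exact: cvg_cst].
apply/cvgrPdist_le => e e0.
pose C' := K * (C * expR (xn n z + 1)) + 1.
have C'0 : 0 < C' by rewrite ltr_wpDl // mulr_ge0 ?K_ge0 // mulr_ge0 ?expR_ge0.
have m0 : 0 < Num.min 1 (e / C') by rewrite lt_min ltr01 divr_gt0.
move/cvgrPdist_le/(_ _ m0) : dz; apply: filterS => k; rewrite sub0r normrN ger0_norm ?xn_ge0 // le_min => /andP[d1 d2].
rewrite distrC /ureal -mulrBr -prtB normrM (ger0_norm K_ge0).
have := hC s z (fun j => y k j - z j); rewrite lexx => /(_ isT).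
rewrite (_ : (fun j => z j + (y k j - z j)) = y k); last by apply/funext => j; rewrite addrC subrK.
move=> h; apply: (@le_trans _ _ (K * (C * ((e / C') * expR (xn n z + 1))))).
  rewrite ler_wpM2l ?K_ge0 //; apply: (le_trans (prt_le _ _)); apply: (le_trans h).
  rewrite ler_wpM2l //; apply: ler_pM; rewrite ?xn_ge0 ?expR_ge0 // ler_expR lerD2l //.
apply: (@le_trans _ _ ((e / C') * C')); last by rewrite divfK // gt_eqF.
have ec : 0 <= e / C' by rewrite ltW // divr_gt0.
rewrite {2}/C' (mulrDr (e / C')) (mulr1 (e / C')); apply: ler_wpDr => //.
by rewrite le_eqVlt; apply/orP; left; apply/eqP; ring.
Qed.

Lemma good_paths : {ae P, forall w,
  [/\ forall j, (j < n)%N -> B j 0 w = 0,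
      forall j, (j < n)%N -> {within `[0, +oo[%classic, continuous (bpath n B w j)},
      forall j, (j < n)%N -> {within `[0, +oo[%classic, continuous (X j ^~ w)},
      forall s, 0 <= s -> weyl_minus n (fun j => X j s w) &
      (forall k s, (k.+1 < n)%N -> 0 <= s ->
        right_local_time_at0 (fun s => X k s w - X k.+1 s w) s (L k s w)) /\
      (forall j s, (j < n)%N -> 0 <= s -> X j s w = x j + bpath n B w j s +
         p * ell n (fun k s => L k s w) j s - q * prevn ((ell n (fun k s => L k s w))^~ s) j)]}.
Proof.
case: BM => _ hB _; case: sol => _ hX; apply: filterS2 hB hX => w hB [cX hX].
have bE j : (j < n)%N -> bpath n B w j = B j ^~ w by move=> jn; apply/funext => s; rewrite /bpath jn.
split.
- by move=> j /hB[].
- by move=> j jn; rewrite bE //; have [] := hB j jn.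
- exact: cX.
- by move=> s s0; have [] := hX s s0.
split; first by move=> k s kn s0; have [_ h _] := hX s s0; exact: h.
move=> j s jn s0; have [_ _ h] := hX s s0; rewrite (h j jn) bE //; congr (_ + p * _ - q * _).
by case: (j) jn => [|j'] //= jn; rewrite /ell jn.
Qed.

Local Notation c := (Arate p q n).

Lemma c_gt0 : 0 < c.
Proof.
have b0 := bar_ge0 p_lt_q n; rewrite /Arate; apply: ltr_wpDl => //.
by rewrite mulr_ge0 // mulr_ge0 // addr_ge0 // mulr_ge0.
Qed.

Local Notation Y k w := (chain n p q (2 ^ k) x (binc n B t k w)).

Lemma expR_bmax (A r : R) : 1 <= A -> r <= 2 * c -> expR (r * (ln A / c)) <= A ^+ 2.
Proof.
move=> A1 rc; have A0 : 0 < A by exact: lt_le_trans A1.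
have c0 := c_gt0; have l0 : 0 <= ln A / c by rewrite divr_ge0 ?ln_ge0 // ltW.
apply: (@le_trans _ _ (expR (2 * c * (ln A / c)))); first by rewrite ler_expR ler_wpM2r.
rewrite (_ : 2 * c * (ln A / c) = ln A + ln A); last by field; rewrite gt_eqF.
by rewrite expRD lnK ?posrE.
Qed.

Lemma dominated_ureal b de : 0 < de -> exists2 C, 0 <= C &
  {ae P, forall w k, `|ureal b de (Y k w)| <= C * bmax n B t c k w ^+ 2}.
Proof.
move=> d0; have [C C0 hC] := ureal_growth b de d0.
exists (C * expR (xn n x)); first by rewrite mulr_ge0 ?expR_ge0.
apply: filterS good_paths => w [B0 cB cX XW _] k.
apply: (le_trans (hC de _ _)); first by rewrite lexx.
have c0 := c_gt0; have b0 := bar_ge0 p_lt_q n.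
have A1 := bmax_ge1 n B t c0 k w.
pose S := ln (bmax n B t c k w) / c.
have S0 : 0 <= S by rewrite divr_ge0 ?ln_ge0 // ltW.
have hS i j : (i <= 2 ^ k)%N -> (j < n)%N -> `|bpath n B w j (dyad t k i)| <= S.
  by move=> ik jn; apply: bmax_bound.
have B0' j : (j < n)%N -> bpath n B w j 0 = 0 by move=> jn; rewrite /bpath jn B0.
have := chain_xn_bound p0 q0 pq1 p_lt_q xW (dyad0 t k) B0' S0 hS (leqnn _).
rewrite -/(binc n B t k w) => hx.
have h1 : n%:R * (1 + 2 * bar p q n) <= 2 * c.
  have : 0 <= n%:R * (1 + 2 * bar p q n) by rewrite mulr_ge0 // addr_ge0 // mulr_ge0.
  rewrite /Arate; move: (_ * (1 + _)) => v; lra.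
rewrite -mulrA ler_wpM2l //; apply: (@le_trans _ _ (expR (xn n x) * expR (n%:R * (1 + 2 * bar p q n) * S))).
  by rewrite -expRD ler_expR.
by rewrite ler_wpM2l ?expR_ge0 // expR_bmax.
Qed.

Lemma dominated_Serr C : 0 <= C -> exists2 C', 0 <= C' &
  {ae P, forall w k, Serr n p q C (2 ^ k) x (binc n B t k w) <= C' * bmax n B t c k w ^+ 2}.
Proof.
move=> C0; have b0 := bar_ge0 p_lt_q n; have nb0 : 0 <= 2 * n%:R * bar p q n by rewrite mulr_ge0 // mulr_ge0.
exists (C * expR (15 * xn n x) * (2 * n%:R * bar p q n) ^+ 2).
  by rewrite mulr_ge0 ?sqr_ge0 // mulr_ge0 ?expR_ge0.
apply: filterS good_paths => w [B0 cB cX XW _] k.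
have c0 := c_gt0; have A1 := bmax_ge1 n B t c0 k w.
pose S := ln (bmax n B t c k w) / c.
have S0 : 0 <= S by rewrite divr_ge0 ?ln_ge0 // ltW.
have hS i j : (i <= 2 ^ k)%N -> (j < n)%N -> `|bpath n B w j (dyad t k i)| <= S.
  by move=> ik jn; apply: bmax_bound.
have B0' j : (j < n)%N -> bpath n B w j 0 = 0 by move=> jn; rewrite /bpath jn B0.
have La0 : 0 <= 2 * n%:R * bar p q n * S by exact: mulr_ge0.
have := Serr_bound p0 q0 pq1 p_lt_q xW (dyad0 t k) B0' S0 hS C0 La0
  (fun i ik => lamt_le_max p0 q0 pq1 p_lt_q xW (dyad0 t k) B0' S0 hS ik).
rewrite -/(binc n B t k w) => /le_trans; apply.
have S2 : S ^+ 2 <= expR (2 * S).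
  rewrite mulr_natl mulr2n expRD -expr2 lerXn2r ?nnegrE ?expR_ge0 //.
  by apply: le_trans (expR_ge1Dx S); rewrite lerDr.
have EA : expR (15 * (n%:R * (1 + 2 * bar p q n) * S)) * S ^+ 2 <= bmax n B t c k w ^+ 2.
  apply: (@le_trans _ _ (expR (c * S))); last by apply: expR_bmax => //; move: c0; lra.
  have -> : c * S = 15 * (n%:R * (1 + 2 * bar p q n) * S) + 2 * S by rewrite /Arate; ring.
  by rewrite expRD ler_wpM2l ?expR_ge0.
rewrite (mulrDr 15) expRD; have E20 := expR_ge0 (15 * xn n x).
move: EA E20; move: (expR (15 * (_ * S))) (expR (15 * xn n x)) (bmax _ _ _ _ _ _ ^+ 2) => E1 E2 A2 EA E20.
apply: (@le_trans _ _ (C * E2 * (2 * n%:R * bar p q n) ^+ 2 * (E1 * S ^+ 2))).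
  by rewrite le_eqVlt; apply/orP; left; apply/eqP; ring.
by rewrite ler_wpM2l // mulr_ge0 ?sqr_ge0 // mulr_ge0.
Qed.

Lemma heat_expect b de : 0 < de ->
  Rintegral P setT (fun w => ureal b de (fun j => X j t w)) = ureal b (de + t) x.
Proof.
move=> d0; have [C [C0 hC]] := rho_bound_U tau0 tau1 n1 a0 aS an tS pq1 pE (de + t) (leqnn n) d0.
have [Cg Cg0 hg] := ureal_growth b (de + t) d0.
have [K1 K10 dom1] := dominated_ureal b d0.
have [K2 K20 dom2] := dominated_Serr C0.
pose G w := ereal_sup (range (fun k => (bmax n B t c k w ^+ 2)%:E)).
have iG : P.-integrable setT G by exact: bmax_integrable c_gt0.
have GE k w : ((bmax n B t c k w ^+ 2)%:E <= G w)%E by apply: ereal_sup_ubound; exists k.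
have mY k j : measurable_fun setT (fun w => Y k w j).
  apply: (@measurable_chain _ _ _ _ _ _ (2 ^ k) (fun=> x) (binc n B t k)) => [l|i l]; first exact: measurable_cst.
  exact: (measurable_binc t0 BM).
have mS k : measurable_fun setT (fun w => Serr n p q C (2 ^ k) x (binc n B t k w)).
  apply: (@measurable_Serr _ _ _ _ _ _ _ (2 ^ k) (fun=> x) (binc n B t k)) => [l|i l]; first exact: measurable_cst.
  exact: (measurable_binc t0 BM).
have c1 : (fun k => Rintegral P setT (fun w => ureal b de (Y k w))) @ \oo -->
    Rintegral P setT (fun w => ureal b de (fun j => X j t w)).
  apply: (@rint_dominated_ae _ _ _ _ _ _ (fun w => K1%:E * G w)%E).
  - by move=> k; apply: measurable_ureal => j _; exact: mY.
  - by apply: measurable_ureal => j jn; case: sol => mX _; apply: mX => //; exact: ltW.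
  - apply: filterS good_paths => w [B0 cB cX XW [Lt Le]]; apply: ureal_cvg => // j jn.
    by apply: (dyad_cvg_X p0 q0 pq1 p_lt_q t0 xW _ cB cX XW Lt Le) => // i in_; rewrite /bpath in_ B0.
  - exact: integrableZl.
  - apply: filterS dom1 => w h k; apply: (@le_trans _ _ (K1 * bmax n B t c k w ^+ 2)%:E).
      by rewrite lee_fin.
    by rewrite EFinM lee_wpmul2l ?lee_fin.
have c2 : (fun k => Rintegral P setT (fun w => Serr n p q C (2 ^ k) x (binc n B t k w))) @ \oo --> (0 : R).
  have -> : 0 = Rintegral P setT (fun=> 0) :> R by rewrite /Rintegral integral0.
  apply: (@rint_dominated_ae _ _ _ _ _ _ (fun w => K2%:E * G w)%E) => //.
  - apply: filterS good_paths => w [B0 cB cX XW [Lt Le]].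
    by apply: (dyad_cvg_Serr p0 q0 pq1 p_lt_q t0 xW _ cB cX) => // i in_; rewrite /bpath in_ B0.
  - exact: integrableZl.
  - apply: filterS dom2 => w h k; rewrite ger0_norm; last exact: Serr_ge0.
    apply: (@le_trans _ _ (K2 * bmax n B t c k w ^+ 2)%:E); first by rewrite lee_fin.
    by rewrite EFinM lee_wpmul2l ?lee_fin.
(* [chain_rate] is a statement about the product measure; [expect_law] carries it to the Brownian
   increments. *)
have rate k : `|Rintegral P setT (fun w => ureal b de (Y k w)) - ureal b (de + t) x| <=
    Rintegral P setT (fun w => Serr n p q C (2 ^ k) x (binc n B t k w)).
  have h0 := mesh_gt0 t0 k.
  have ht : (2 ^ k)%:R * (t / 2 ^+ k) = t by exact: (dyad_top t k).
  have push s y : de <= s <= de + t -> `|ureal b s (prho n p q n y) - ureal b s y| <= err n C y.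
    move=> sT; have s0 : 0 < s by case/andP: sT => h _; exact: lt_le_trans h.
    by rewrite !ureal_Uf // -prtB; apply: (le_trans (prt_le _ _)); exact: hC.
  have mu s d' (O : measurableType d') (Z : O -> nat -> R) : (forall j, measurable_fun setT (fun w => Z w j)) ->
      measurable_fun setT (fun w => ureal b s (Z w)) by move=> mZ; exact: measurable_ureal.
  have dd : de <= de <= de + t by rewrite lexx lerDl ltW.
  have dT : de + (2 ^ k)%:R * (t / 2 ^+ k) <= de + t by rewrite ht.
  have := chain_rate h0 tau0 pq1 pE C0 (fun s y s0 => ureal_heat b y h0 s0) push mu Cg0 hg d0 x (lexx de) dT.
  have jS := rintegrable_Serr n h0 tau0 pq1 pE C0 (2 ^ k) x.
  have ju := rintegrable_uchain h0 tau0 pq1 pE mu Cg0 hg (2 ^ k) x dd.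
  have eY w : Y k w = chain n p q (2 ^ k) x (wc (bvec n B t k w)).
    by apply: chain_ext => i ik; rewrite wc_bvec.
  have eS w : Serr n p q C (2 ^ k) x (binc n B t k w) = Serr n p q C (2 ^ k) x (wc (bvec n B t k w)).
    by apply: Serr_ext => i ik; rewrite wc_bvec.
  have [_ E1] := expect_law t0 BM (g := fun w => ureal b de (Y k w)) ju (fun w => congr1 (ureal b de) (eY w)).
  have [_ E2] := expect_law t0 BM (g := fun w => Serr n p q C (2 ^ k) x (binc n B t k w)) jS eS.
  by rewrite -E1 -E2 ht.
apply/eqP; rewrite -subr_eq0 -normr_le0.
have c3 : (fun k => `|Rintegral P setT (fun w => ureal b de (Y k w)) - ureal b (de + t) x|) @ \oo -->
    `|Rintegral P setT (fun w => ureal b de (fun j => X j t w)) - ureal b (de + t) x|.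
  by apply: cvg_norm; apply: cvgB => //; exact: cvg_cst.
exact: (ler_cvg_to c3 c2 (nearW _ rate)).
Qed.

End HeatExpectation.

(** * The initial function as a product over the particles *)

Section StepProfile.
Variables (R : realType) (tau : R).
Hypotheses (tau0 : 0 < tau) (tau1 : tau < 1).
Local Notation leb := (@lebesgue_measure R).

(** In the chamber the coordinates above [u] are the first ones, so the product is [tau] to their
    number. Written as a telescoping sum it is linear in indicators of half-lines, which integrate
    to the positive parts of the coordinates. *)
Lemma prod_theta n (y : nat -> R) u : weyl_minus n y ->
  \prod_(j < n) tau ^+ theta (y j - u) - 1 = \sum_(k < n) (tau ^+ k.+1 - tau ^+ k) * ((u < y k)%R)%:R.
Proof.
elim: n => [|n IH] yW; first by rewrite !big_ord0 subrr.
have yW' : weyl_minus n y by move=> j jn; apply: yW; exact: ltnW.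
rewrite !big_ord_recr /= -(IH yW') /theta subr_gt0.
case: (ltP u (y n)) => uy; last by rewrite expr0 !mulr1 mulr0 addr0.
have -> : \prod_(j < n) tau ^+ (if 0 < y j - u then 1%N else 0%N) = tau ^+ n.
  rewrite -[X in _ ^+ X]card_ord -prodr_const; apply: eq_bigr => j _.
  have yj : y n <= y j.
    have mono : forall m, (j + m <= n)%N -> y (j + m)%N <= y j.
      elim=> [|m IHm] jm; first by rewrite addn0.
      apply: (le_trans _ (IHm _)); rewrite addnS in jm *; last exact: ltnW.
      exact: yW.
    by have := mono (n - j)%N; rewrite subnKC ?leqnn; [exact|exact: ltnW].
  by rewrite subr_gt0 (lt_le_trans uy yj) expr1.
rewrite expr1 mulr1 exprSr; ring.
Qed.

Lemma half_line_indic (y : R) :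
  leb.-integrable `[0, +oo[%classic (EFin \o (fun u : R => ((u < y)%R)%:R)) /\
  Rintegral leb `[0, +oo[%classic (fun u => ((u < y)%R)%:R) = Num.max 0 y.
Proof.
have iE u : ((u < y)%R)%:R = \1_(`]-oo, y[%classic) u :> R.
  by rewrite indicE; congr (_%:R); rewrite mem_setE.
have E : (\int[leb]_(u in `[0%R, +oo[) (\1_(`]-oo, y[%classic) u)%:E = (Num.max 0 y)%:E)%E.
  rewrite integral_indic //.
  have -> : `]-oo, y[%classic `&` `[0, +oo[%classic = `[0, y[%classic.
    by apply/seteqP; split => u /=; rewrite !in_itv /= ?andbT; [move=> [-> ->]|move=> /andP[-> ->]].
  apply: (etrans (lebesgue_measure_itv _)); rewrite /= lte_fin; case: (ltP 0 y) => y0 /=; last by [].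
  by rewrite oppr0 adde0.
split.
  apply/integrableP; split.
    apply/measurable_EFinP; rewrite (_ : (fun u => _) = \1_(`]-oo, y[%classic)); last by apply/funext.
    exact: measurable_indic.
  apply: (@le_lt_trans _ _ (Num.max 0 y)%:E); last exact: ltry.
  rewrite -E le_eqVlt; apply/orP; left; apply/eqP; apply: eq_integral => u _.
  by rewrite /= -iE normr_nat.
rewrite (_ : (fun u => _) = \1_(`]-oo, y[%classic)); last by apply/funext.
by rewrite /Rintegral E.
Qed.

Lemma step_profile n (c y : nat -> R) :
  leb.-integrable `[0, +oo[%classic (EFin \o (fun u : R => \sum_(k < n) c k * ((u < y k)%R)%:R)) /\
  Rintegral leb `[0, +oo[%classic (fun u => \sum_(k < n) c k * ((u < y k)%R)%:R) = \sum_(k < n) c k * Num.max 0 (y k).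
Proof.
elim: n => [|n [IH1 IH2]].
  rewrite big_ord0; split.
    rewrite (_ : _ \o _ = cst 0%E); first exact: integrable0.
    by apply/funext => u; rewrite /= big_ord0.
  by rewrite /Rintegral integral0_eq // => u _; rewrite big_ord0.
have [j1 j2] := half_line_indic (y n).
have j3 : leb.-integrable `[0, +oo[%classic (EFin \o (fun u : R => c n * ((u < y n)%R)%:R)).
  rewrite (_ : _ \o _ = (fun u => (c n)%:E * (((u < y n)%R)%:R)%:E)%E); last by apply/funext => u; rewrite /= EFinM.
  exact: integrableZl.
have fE : (fun u : R => \sum_(k < n.+1) c k * ((u < y k)%R)%:R) = (fun u => \sum_(k < n) c k * ((u < y k)%R)%:R + c n * ((u < y n)%R)%:R).
  by apply/funext => u; rewrite big_ord_recr.
rewrite fE; split.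
  rewrite (_ : _ \o _ = ((EFin \o (fun u : R => \sum_(k < n) c k * ((u < y k)%R)%:R)%R) \+ (EFin \o (fun u : R => c n * ((u < y n)%R)%:R)%R))%E) //.
  exact: integrableD.
by rewrite RintegralD // IH2 RintegralZl // j2 big_ord_recr.
Qed.

Definition phi_lim j (y : R) : R := expR (- ((1 - tau) * tau ^+ j * Num.max 0 y)).

Lemma Fn_weyl n y : weyl_minus n y -> Fn tau n y = \prod_(j < n) phi_lim j (y j).
Proof.
move=> yW; rewrite /Fn -expR_sum; congr expR.
have [_ E] := step_profile n (fun k => tau ^+ k.+1 - tau ^+ k) y.
transitivity (Rintegral leb `[0, +oo[%classic (fun u => \sum_(k < n) (tau ^+ k.+1 - tau ^+ k) * ((u < y k)%R)%:R)).
  by apply: eq_Rintegral => u _; exact: prod_theta.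
rewrite E; apply: eq_bigr => k _; rewrite exprS; ring.
Qed.

Lemma measurable_Fn d (T : measurableType d) n (X : T -> nat -> R) :
  (forall j, (j < n)%N -> measurable_fun setT (fun w => X w j)) -> measurable_fun setT (fun w => Fn tau n (X w)).
Proof.
move=> mX; apply: measurableT_comp => //.
pose f (z : T * measurableTypeR R) : R :=
  \1_(`[0, +oo[%classic) (z.2 : R) * (\prod_(j < n) tau ^+ theta (X z.1 j - z.2) - 1).
have mth : measurable_fun setT (fun v : R => tau ^+ theta v).
  rewrite (_ : (fun v => _) = (fun v => 1 + (tau - 1) * \1_(`]0, +oo[%classic) v)); last first.
    apply/funext => v; rewrite /theta indicE mem_setE in_itv /= andbT.
    by case: ifP => _; rewrite ?expr1 ?mulr1 ?mulr0 ?addr0 // addrC subrK.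
  by apply: measurable_funD => //; apply: measurable_funM => //; exact: measurable_indic.
have mf : measurable_fun setT f.
  apply: measurable_funM.
    apply: (measurableT_comp (f := \1_(`[0, +oo[%classic) : R -> R)); last exact: measurable_snd.
    exact: measurable_indic.
  apply: measurable_funB => //; apply: measurable_prod => j _.
  apply: (measurableT_comp mth); apply: measurable_funB; last exact: measurable_snd.
  by apply: (measurableT_comp (f := fun w => X w j)); [exact: mX|exact: measurable_fst].
have := measurable_Rintegral_param [the {sigma_finite_measure set (measurableTypeR R) -> \bar R} of leb] mf.
congr (measurable_fun _ _); apply/funext => w.
rewrite [RHS]/Rintegral integral_mkcond; congr fine; apply: eq_integral => u _.
by rewrite /f patchE indicE /=; case: ifP => _; rewrite ?mul1r ?mul0r.
Qed.

Lemma phi_main_cvg (s : nat -> R) j y : s @ \oo --> (0 : R) ->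
  (fun m => phi_main tau (s m) j y) @ \oo --> phi_lim j y.
Proof.
move=> s0; rewrite /phi_main /phi_lim; case: (leP 0 y) => y0; last first.
  by rewrite mulr0 oppr0 expR0; exact: cvg_cst.
have -> : expR (- ((1 - tau) * tau ^+ j * y)) = expR (2^-1 * 0 * ((1 - tau) * tau ^+ j) ^+ 2 - (1 - tau) * tau ^+ j * y).
  by congr expR; ring.
apply: continuous_cvg; first exact: continuous_expR.
apply: cvgB; last exact: cvg_cst.
by apply: cvgMr_tmp; apply: cvgMl_tmp.
Qed.

End StepProfile.

(** * The limit of vanishing initial time *)

Section InitialLimit.
Context {d} {Omega : measurableType d} {R : realType} (P : probability Omega R).
Variables (p q tau : R) (n : nat) (a x : nat -> R) (t : R) (B X L : nat -> R -> Omega -> R).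
Hypotheses (tau0 : 0 < tau) (tau1 : tau < 1) (n1 : (1 <= n)%N).
Hypotheses (a0 : - (1 - tau) < a 0%N) (aS : forall j, (j.+1 < n)%N -> a j < a j.+1)
  (an : a n.-1 < 0) (tS : forall j, (j.+1 < n)%N -> tau * a j < a j.+1).
Hypotheses (pq1 : p + q = 1) (pE : p = tau * q).
Hypotheses (xW : weyl_minus n x) (t0 : 0 < t).
Hypotheses (BM : indep_std_BMs P n B) (sol : solves_system P n p q x B X L).
Local Notation u := (ureal tau n a).

(** The imaginary part tends to 0 because the products of [phi_main] are real. *)
Definition limF (b : bool) (y : nat -> R) : R := if b then Fn tau n y else 0.

Lemma expect_Fn b : P.-integrable setT (fun w => (limF b (fun j => X j t w))%:E) /\
  Rintegral P setT (fun w => limF b (fun j => X j t w)) = prt b (Uf tau n a t x).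
Proof.
have [C [k1 [C0 k11 hU]]] := U_initial tau0 tau1 n1 a0 aS an tS.
(* Times [s m = (ka m)^(-2)] tending to 0 within the range of [U_initial]; they take the place of
   [delta]. *)
pose ka (m : nat) : R := k1 + m%:R; pose s m : R := (ka m ^+ 2)^-1.
have kak m : k1 <= ka m by rewrite lerDl.
have ka1 m : 1 <= ka m by rewrite (le_trans k11) // lerDl.
have ka0 m : 0 < ka m by exact: lt_le_trans (ka1 m).
have ska m : s m * ka m ^+ 2 = 1 by rewrite mulVf // expf_neq0 // gt_eqF.
have s0 m : 0 < s m by rewrite invr_gt0 exprn_gt0.
have kav : (fun m => (ka m)^-1) @ \oo --> (0 : R).
  apply: (squeeze_cvgr (f := fun=> 0) (h := @harmonic R)); [|exact: cvg_cst|exact: cvg_harmonic].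
  apply: nearW => m; rewrite invr_ge0 (ltW (ka0 m)) /= lef_pV2 ?posrE // -natr1 addrC /ka lerD2r //.
have sk m : s m <= (ka m)^-1.
  by rewrite /s lef_pV2 ?posrE ?exprn_gt0 // expr2 ler_peMl // ltW.
have sv : s @ \oo --> (0 : R).
  apply: (squeeze_cvgr (f := fun=> 0) (h := fun m => (ka m)^-1)) => //; last exact: cvg_cst.
  by apply: nearW => m; rewrite (ltW (s0 m)) sk.
have uc y : weyl_minus n y -> (fun m => u b (s m) y) @ \oo --> limF b y.
  move=> yW; pose M m : R := if b then \prod_(j < n) phi_main tau (s m) j (y j) else 0.
  have Mc : M @ \oo --> limF b y.
    rewrite /M /limF; case: (b); last exact: cvg_cst.
    rewrite (Fn_weyl _ yW); apply: cvg_big => [|j _]; first exact: mul_continuous.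
    exact: phi_main_cvg.
  have Dc : (fun m => u b (s m) y - M m) @ \oo --> (0 : R).
    apply/norm_cvg0P; apply: (squeeze_cvgr (f := fun=> 0) (h := fun m => C * (ka m)^-1)).
    - apply: nearW => m; rewrite normr_ge0 /=.
      have [_ h] := hU (ka m) (s m) y (kak m) (ska m) yW.
      rewrite (ureal_Uf tau0 n1 a0 aS an tS) // (_ : M m = prt b (\prod_(j < n) phi_main tau (s m) j (y j))%:C).
        by rewrite -prtB; exact: le_trans (prt_le _ _) h.
      by rewrite /M /prt; case: (b); rewrite ?RezC ?ImzC.
    - exact: cvg_cst.
    - by rewrite -[X in _ --> X](mulr0 C); apply: cvgM; [exact: cvg_cst|exact: kav].
  rewrite -[limF b y]add0r (_ : (fun m => _) = (fun m => (u b (s m) y - M m) + M m)); last first.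
    by apply/funext => m; rewrite subrK.
  exact: cvgD.
have mX j : (j < n)%N -> measurable_fun setT (fun w => X j t w).
  by move=> jn; case: sol => mX _; apply: mX => //; exact: ltW.
have mu m : measurable_fun setT (fun w => u b (s m) (fun j => X j t w)).
  by apply: measurable_ureal.
have mF : measurable_fun setT (fun w => limF b (fun j => X j t w)).
  by rewrite /limF; case: (b) => //; exact: (measurable_Fn _ (X := fun w j => X j t w)).
have ae1 : {ae P, forall w, (fun m => u b (s m) (fun j => X j t w)) @ \oo --> limF b (fun j => X j t w)}.
  by apply: filterS (good_paths BM sol) => w [_ _ _ XW _]; apply: uc; exact: XW (ltW t0).
have ae2 : {ae P, forall w m, (`|u b (s m) (fun j => X j t w)|%:E <= C%:E)%E}.
  apply: filterS (good_paths BM sol) => w [_ _ _ XW _] m; rewrite lee_fin.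
  rewrite (ureal_Uf tau0 n1 a0 aS an tS) //; apply: (le_trans (prt_le _ _)).
  have [h _] := hU (ka m) (s m) (fun j => X j t w) (kak m) (ska m) (XW t (ltW t0)).
  exact: h.
have iC : P.-integrable setT (fun=> C%:E) by apply: finite_measure_integrable_cst.
have [jF cF] := rint_dominated_ae_full mu mF ae1 iC ae2.
split => //; apply: (cvg_unique (@Rhausdorff R) cF).
(* [heat_expect] with [s m] as the positive time; continuity in time then replaces [t + s m] by
   [t]. *)
have -> : (fun m => Rintegral P setT (fun w => u b (s m) (fun j => X j t w))) = (fun m => u b (t + s m) x).
  apply/funext => m; rewrite addrC.
  exact: (heat_expect tau0 tau1 n1 a0 aS an tS pq1 pE xW t0 BM sol).
rewrite -(ureal_Uf tau0 n1 a0 aS an tS) //.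
have [C' [C'0 hC']] := gint_time (a_le1 tau0 n1 a0 aS an) (pbdH0 tau0 n1 a0 aS an tS) t0.
have K0 := K_ge0 n tau0.
have Dc : (fun m => u b (t + s m) x - u b t x) @ \oo --> (0 : R).
  apply/norm_cvg0P; apply: (squeeze_cvgr (f := fun=> 0) (h := fun m => Uscale tau n * C' * expR (xn n x) * s m)).
  - apply: nearW => m; rewrite normr_ge0 /= /ureal -mulrBr -prtB normrM (ger0_norm K0).
    have sm1 : 0 <= s m <= 1.
      by rewrite (ltW (s0 m)) (le_trans (sk m)) // invf_le1 ?ka0.
    rewrite (_ : Uscale tau n * C' * expR (xn n x) * s m = Uscale tau n * (C' * (s m * expR (xn n x)))); last by ring.
    by rewrite ler_wpM2l //; apply: le_trans (prt_le _ _) (hC' x (s m) sm1).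
  - exact: cvg_cst.
  - by rewrite -[X in _ --> X](mulr0 (Uscale tau n * C' * expR (xn n x))); apply: cvgM; [exact: cvg_cst|exact: sv].
rewrite -[u b t x]add0r (_ : (fun m => _) = (fun m => (u b (t + s m) x - u b t x) + u b t x)); last first.
  by apply/funext => m; rewrite subrK.
by apply: cvgD => //; exact: cvg_cst.
Qed.

End InitialLimit.

Theorem theorem3 (R : realType) (p q : R) (n : nat) (x : nat -> R) (t : R)
    (a : nat -> R)
    (d : measure_display) (Omega : measurableType d) (P : probability Omega R)
    (B X L : nat -> R -> Omega -> R) :
  p + q = 1 -> 0 < p / q -> p / q < 1 -> (1 <= n)%N ->
  weyl_minus n x -> 0 < t ->
  (* contours C_j = a_j + i R *)
  - (1 - p / q) < a 0%N -> (forall j, (j.+1 < n)%N -> a j < a j.+1) ->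
  a n.-1 < 0 -> (forall j, (j.+1 < n)%N -> p / q * a j < a j.+1) ->
  (* x(t) is the process started at x, driven by independent standard BMs *)
  indep_std_BMs P n B -> solves_system P n p q x B X L ->
  let tau := p / q in
  let rhs := (tau ^+ (n * n.-1)./2)%:C *
             contour_iter n a (integrand n tau t x) in
  (\int[P]_w (Fn tau n (fun j => X j t w))%:E)%E = (complex.Re rhs)%:E
  /\ complex.Im rhs = 0.
Proof.
move=> pq1 tau0 tau1 n1 xW t0 a0 aS an tS BM sol tau rhs.
have q_neq0 : q != 0 by apply: contraTneq tau0 => ->; rewrite invr0 mulr0 ltxx.
have pE : p = tau * q by rewrite /tau divfK.
(* The real part gives the value of the expectation, the imaginary part the vanishing of
   [complex.Im rhs]. *)
have E b := expect_Fn tau0 tau1 n1 a0 aS an tS pq1 pE xW t0 BM sol b.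
have [jF EF] := E true; have [_ E0] := E false; split; last first.
  rewrite -[LHS]/(prt false (Uf tau n a t x)) -E0 /limF.
  by rewrite /Rintegral integral0.
rewrite -[complex.Re rhs]/(prt true (Uf tau n a t x)) -EF /Rintegral fineK //.
exact: integrable_fin_num jF.
Qed.
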